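(* Let $M$ be a compact, connected, smooth Riemannian manifold and $T:M\to M$. Suppose either that $(J,T)$ is a mixing repeller, in which case put $X=J$, or that $T$ is an Axiom A diffeomorphism such that $(\Omega(T),T)$ is mixing, in which case put $X=\Omega(T)$. Let $m$ be the unique $T$-invariant probability measure of maximal entropy on $X$. Then there exists a constant $c>0$ such that for any $T$-invariant Borel probability measure $\mu$ on $X$ and any Lipschitz function $f:X\to\mathbb{R}$ with Lipschitz constant $L$ we have $$\left|\int f\, d\mu-\int f\, dm\right|\le c\,L\,\bigl(h_m(T)-h_\mu(T)\bigr)^{1/2}.$$
   Context: Repeller: $T:M\to M$ is a $C^1$ map and $J\subset M$ is a compact set with $T^{-1}J=J$ such that (i) $T$ is expanding on $J$: after a smooth modification of the Riemannian metric there is $\theta_0>1$ with $\|D_xT^k(v)\|\ge\theta_0^k\|v\|$ for all $x\in J$, $v\in T_xM$, $k\in\mathbb{N}$; and (ii) $J$ is maximal: there is an open neighborhood $V$ of $J$ with $J=\{x\in V: T^n(x)\in V\text{ for all }n\ge0\}$. Non-wandering set: $\Omega(T)$ is the set of $x\in M$ such that for every neighborhood $U$ of $x$, $U\cap\bigcup_{k\ge1}T^{-k}U\ne\emptyset$. The set $\Omega=\Omega(T)$ is hyperbolic if there is $\theta_0>1$ such that for each $x\in\Omega$ the tangent space $T_xM$ is a direct sum of two ($DT$-invariant) subspaces $W^s(x)$ and $W^u(x)$ such that, after a smooth change of the Riemannian metric, $\|D_xT^{-k}(v)\|\le\theta_0^{-k}\|v\|$ for $v\in W^u(x)$, $k\in\mathbb{N}$,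 and $\|D_xT^{k}(v)\|\le\theta_0^{-k}\|v\|$ for $v\in W^s(x)$, $k\in\mathbb{N}$. Axiom A diffeomorphism: a diffeomorphism $T:M\to M$ such that $\Omega(T)$ is hyperbolic and $\Omega(T)$ is the closure of the set of periodic points of $T$. Mixing means that the restriction $T|_X$ is topologically mixing. Lipschitz is with respect to the Riemannian distance. $h_\mu(T)$ is the Kolmogorov–Sinai entropy. *)

(* Defs.v *)
From HB Require Import structures.
From mathcomp Require Import all_boot all_order all_algebra.
From mathcomp Require Import all_classical all_reals all_analysis.

Set Implicit Arguments.
Unset Strict Implicit.
Unset Printing Implicit Defensive.

Import Order.TTheory GRing.Theory Num.Theory.
Import numFieldNormedType.Exports.

Local Open Scope classical_set_scope.
Local Open Scope ring_scope.

(* [U] is meant to be open; values of [f] outside [U] are then irrelevant. *)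
Fixpoint Ck_on (R : realType) (V W : normedModType R) (k : nat) (U : set V)
    (f : V -> W) : Prop :=
  match k with
  | 0%N => forall x, U x -> {for x, continuous f}
  | k'.+1 => (forall x, U x -> differentiable f x) /\
             (forall v, Ck_on k' U (fun x => 'd f x v))
  end.

Definition smooth_on (R : realType) (V W : normedModType R) (U : set V)
    (f : V -> W) : Prop :=
  forall k, Ck_on k U f.

(* A homeomorphism between open subsets of [M] and of R^n; [cinv] is only
   meaningful on [ccod]. *)
Record chart (R : realType) (n : nat) (M : ptopologicalType) := Chart {
  cdom : set M;
  cmap : M -> 'rV[R]_n;
  cinv : 'rV[R]_n -> M;
  cdom_open : open cdom;
  ccod_open : open (cmap @` cdom);
  cmapK : forall x, cdom x -> cinv (cmap x) = x;
  cmap_continuous : forall x, cdom x -> {for x, continuous cmap};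
  cinv_continuous : forall y, (cmap @` cdom) y -> {for y, continuous cinv} }.

Definition ccod (R : realType) (n : nat) (M : ptopologicalType)
    (c : chart R n M) : set 'rV[R]_n := cmap c @` cdom c.

(* A preferred chart is singled out at each point, so that the tangent space
   at [x] is R^n, read in the chart [chart_at x]. *)
Record smoothAtlas (R : realType) (n : nat) (M : ptopologicalType) :=
  SmoothAtlas {
    charts : set (chart R n M);
    chart_at : M -> chart R n M;
    chart_at_charts : forall x, charts (chart_at x);
    chart_at_dom : forall x, cdom (chart_at x) x;
    charts_compat : forall c c', charts c -> charts c' ->
      smooth_on (cmap c @` (cdom c `&` cdom c')) (cmap c' \o cinv c) }.

Section Manifold.
Context (R : realType) (n : nat) (M : ptopologicalType).
Variable A : smoothAtlas R n M.

Definition Ck_map (k : nat) (T : M -> M) : Prop :=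
  continuous T /\
  forall c c', charts A c -> charts A c' ->
    Ck_on k (cmap c @` (cdom c `&` T @^-1` cdom c')) (cmap c' \o T \o cinv c).

Definition tangent_map (T : M -> M) (x : M) (v : 'rV[R]_n) : 'rV[R]_n :=
  'd (cmap (chart_at A (T x)) \o T \o cinv (chart_at A x))
     (cmap (chart_at A x) x) v.

(* The tangent vector at [cinv c y] whose coordinates in [c] are [v]. *)
Definition tangent_of_chart (c : chart R n M) (y v : 'rV[R]_n) : 'rV[R]_n :=
  'd (cmap (chart_at A (cinv c y)) \o cinv c) y v.

Definition form (S : 'M[R]_n) (v w : 'rV[R]_n) : R :=
  (v *m S *m w^T) ord0 ord0.

Record riemannianMetric := RiemannianMetric {
  gram : M -> 'M[R]_n;
  gram_sym : forall x, (gram x)^T = gram x;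
  gram_pos : forall x v, v != 0 -> 0 < form (gram x) v v;
  gram_smooth : forall c v w, charts A c ->
    smooth_on (ccod c) (fun y : 'rV[R]_n =>
      form (gram (cinv c y)) (tangent_of_chart c y v)
        (tangent_of_chart c y w) : R) }.

Definition riem_norm (g : riemannianMetric) (x : M) (v : 'rV[R]_n) : R :=
  Num.sqrt (form (gram g x) v v).

Definition C1_curve (gamma : R -> M) : Prop :=
  continuous gamma /\
  forall c, charts A c -> Ck_on 1 (gamma @^-1` cdom c) (cmap c \o gamma).

Definition velocity (gamma : R -> M) (t : R) : 'rV[R]_n :=
  derive1 (cmap (chart_at A (gamma t)) \o gamma) t.

(* [piecewise_C1_length g x y l]: some piecewise C^1 curve from [x] to [y] has
   length [l].  A C^1 curve on a compact interval is, up to reparametrization,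
   the restriction to [0, 1] of a C^1 curve defined on the whole line. *)
Inductive piecewise_C1_length (g : riemannianMetric) : M -> M -> R -> Prop :=
| C1_piece (gamma : R -> M) : C1_curve gamma ->
    piecewise_C1_length g (gamma 0) (gamma 1)
      (\int[lebesgue_measure]_(t in `[0, 1])
         riem_norm g (gamma t) (velocity gamma t))
| C1_concat (x y z : M) (l l' : R) :
    piecewise_C1_length g x y l -> piecewise_C1_length g y z l' ->
    piecewise_C1_length g x z (l + l').

Definition riem_dist (g : riemannianMetric) (x y : M) : R :=
  inf [set l | piecewise_C1_length g x y l].

Definition lipschitz_with (g : riemannianMetric) (X : set M) (L : R)
    (f : M -> R) : Prop :=
  forall x y, X x -> X y -> `|f x - f y| <= L * riem_dist g x y.

Definition top_mixing (T : M -> M) (X : set M) : Prop :=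
  forall U V : set M, open U -> open V ->
    X `&` U !=set0 -> X `&` V !=set0 ->
    exists N : nat, forall k, (N <= k)%N ->
      X `&` U `&` iter k T @^-1` V !=set0.

Definition expanding (T : M -> M) (J : set M) : Prop :=
  exists g : riemannianMetric, exists2 theta : R, 1 < theta &
    forall x v k, J x ->
      theta ^+ k * riem_norm g x v <=
        riem_norm g (iter k T x) (tangent_map (iter k T) x v).

Definition repeller (T : M -> M) (J : set M) : Prop :=
  [/\ Ck_map 1 T, compact J, T @^-1` J = J, expanding T J &
      exists V : set M, [/\ open V, J `<=` V &
        J = [set x | V x /\ forall k, V (iter k T x)]]].

Definition nonwandering (T : M -> M) : set M :=
  [set x | forall U, nbhs x U ->
    U `&` \bigcup_(k in [set k | (1 <= k)%N]) (iter k T @^-1` U) !=set0].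

Definition periodic_points (T : M -> M) : set M :=
  [set x | exists2 k, (1 <= k)%N & iter k T x = x].

(* [S] is the inverse of [T]. *)
Definition hyperbolic (T S : M -> M) (X : set M) : Prop :=
  exists2 theta : R, 1 < theta &
  exists Ws Wu : M -> {vspace 'rV[R]_n},
    [/\ forall x, X x -> directv (Ws x + Wu x)%VS /\ (Ws x + Wu x = fullv)%VS,
        forall x, X x ->
          tangent_map T x @` [set v | v \in Ws x] = [set v | v \in Ws (T x)],
        forall x, X x ->
          tangent_map T x @` [set v | v \in Wu x] = [set v | v \in Wu (T x)] &
        exists g : riemannianMetric,
          (forall x v k, X x -> v \in Wu x ->
             riem_norm g (iter k S x) (tangent_map (iter k S) x v)
               <= theta ^- k * riem_norm g x v) /\
          (forall x v k, X x -> v \in Ws x ->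
             riem_norm g (iter k T x) (tangent_map (iter k T) x v)
               <= theta ^- k * riem_norm g x v)].

Definition axiomA (T : M -> M) : Prop :=
  exists S : M -> M,
    [/\ cancel T S, cancel S T, Ck_map 1 T & Ck_map 1 S] /\
    hyperbolic T S (nonwandering T) /\
    nonwandering T = closure (periodic_points T).

End Manifold.

Definition borel (M : ptopologicalType) := g_sigma_algebraType (@open M).

Section Entropy.
Context (R : realType) (M : ptopologicalType).
Implicit Types (T : M -> M) (X : set M) (mu : probability (borel M) R).

(* Borel probability measures on a Borel set [X] are identified with those
   on [M] giving full mass to [X]. *)
Definition invariant_on T X mu : Prop :=
  mu X = 1%E /\
  forall B : set (borel M), measurable B -> mu (T @^-1` B) = mu B.

Definition fin_partition (k : nat) (P : 'I_k -> set (borel M)) : Prop :=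
  [/\ forall i, measurable (P i), trivIset setT P & \bigcup_i P i = setT].

(* The atoms of the join of P, T^-1 P, ..., T^-(N-1) P. *)
Definition join_cell T (k : nat) (P : 'I_k -> set (borel M)) (N : nat)
    (w : {ffun 'I_N -> 'I_k}) : set (borel M) :=
  \bigcap_(j in [set: 'I_N]) (iter j T @^-1` P (w j)).

Definition join_entropy T mu (k : nat) (P : 'I_k -> set (borel M)) (N : nat)
    : R :=
  - \sum_(w : {ffun 'I_N -> 'I_k})
      fine (mu (join_cell T P w)) * ln (fine (mu (join_cell T P w))).

Definition partition_entropy T mu (k : nat) (P : 'I_k -> set (borel M)) : R :=
  limn (fun N => join_entropy T mu P N / N%:R).

Definition ks_entropy T mu : \bar R :=
  ereal_sup [set h | exists (k : nat) (P : 'I_k -> set (borel M)),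
    fin_partition P /\ h = (partition_entropy T mu P)%:E].

Definition maximal_entropy T X mu : Prop :=
  invariant_on T X mu /\
  forall nu, invariant_on T X nu -> (ks_entropy T nu <= ks_entropy T mu)%E.

Definition unique_maximal_entropy T X mu : Prop :=
  maximal_entropy T X mu /\
  forall nu, maximal_entropy T X nu ->
    forall B : set (borel M), measurable B -> nu B = mu B.

End Entropy.

(* Main.v *)
(* Both kinds of systems are expansive and have periodic shadowing for a metric
   [dist] built from finitely many charts, so that Birkhoff sums of [f] along
   orbit segments that stay close differ by at most a constant times [L]. Bowen's
   coding replaces orbit segments of length [N] by paths in a finite graph; with
   [Z_N(f)] the sum of [exp] of the Birkhoff sums of [f] over these paths,
   [h_mu + \int f dmu <= lim (log Z_N(f)) / N]. Applied to [(mu, f)] and to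
   [(m, - f)], this bounds [h_mu + h_m + \int f dmu - \int f dm] by the growth rate
   of [Z_N(f) Z_N(- f)], a sum over pairs of loops. Two loops may be exchanged
   between consecutive common visits to a base point; averaging over these
   exchanges turns [exp (S f(u) - S f(v))] into a product of hyperbolic cosines
   of oscillations, each at most [L] times the gap between two visits. The number
   of loops grows at most like [exp (N h_m)], since separated loops carry an
   invariant measure of the corresponding entropy, and the gaps have exponential
   tails; the renewal equation then yields the rate [2 h_m + C L ^ 2]. Hence
   [h_mu + t \delta <= h_m + C t ^ 2 L ^ 2] for small [t], and choosing
   [t = sqrt (h_m - h_mu) / L] gives the theorem. *)
Require Import Defs.
From HB Require Import structures.
From mathcomp Require Import all_boot all_order all_algebra.
From mathcomp Require Import all_classical all_reals all_analysis.
From mathcomp Require Import ring lra zify.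

Set Implicit Arguments.
Unset Strict Implicit.
Unset Printing Implicit Defensive.

Import Order.TTheory GRing.Theory Num.Theory.
Import numFieldNormedType.Exports.

Local Open Scope classical_set_scope.
Local Open Scope ring_scope.

(** * Charts and the chart metric *)

(** The linear term in [t] cancels because the difference of the Birkhoff sums of two loops changes
    sign when the loops are exchanged; this is why [m] is tested against [- f]. The renewal argument
    needs the number of loops of length [N] at the base point to be at most [exp (N h_m)], with no
    constant in front. Loops at one vertex concatenate freely, so it is enough that distinct loops
    of equal length give separated orbit segments. Pseudo-orbits on a finite net lack this property,
    since many of them follow the same orbit. Bowen's labels restore it: they are functions of the
    orbit, and two orbits that stay close and have equal labels at both ends have equal labels in
    between. A repeller is not invertible, and gluing joins a past to a future, so the coding uses
    two-sided orbits, indexed by [int]. The exponential moments are controlled only for [t L <= t0];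
    when [sqrt (h_m - h_mu)] exceeds [t0], the choice is [t = t0 / L] instead, which costs the term
    [sqrt h_m / t0] in the constant. *)

Section rowvec.
Context {R : realType}.

Lemma coord_le_norm (m n : nat) (v : 'M[R]_(m, n)) i j : `|v i j| <= `|v|.
Proof.
rewrite [leRHS]/Num.norm /= mx_normrE.
by apply: (le_bigmax _ (fun k : 'I_m * 'I_n => `|v k.1 k.2|) (i, j)).
Qed.

Lemma norm_le_coord (m n : nat) (v : 'M[R]_(m, n)) (c : R) : 0 <= c ->
  (forall i j, `|v i j| <= c) -> `|v| <= c.
Proof.
move=> c0 h; rewrite [leLHS]/Num.norm /= mx_normrE.
by apply/bigmax_leP; split => // -[i j] _ /=.
Qed.

Lemma row_expand (n : nat) (v : 'rV[R]_n) : v = \sum_i v 0 i *: delta_mx 0 i.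
Proof. exact: row_sum_delta. Qed.

Definition opbound (n m : nat) (f : 'rV[R]_n -> 'rV[R]_m) : R :=
  \sum_i `|f (delta_mx 0 i)|.

Lemma opbound_ge0 (n m : nat) (f : 'rV[R]_n -> 'rV[R]_m) : 0 <= opbound f.
Proof. by apply: sumr_ge0. Qed.

Lemma le_opbound (n m : nat) (f : 'rV[R]_n -> 'rV[R]_m) (v : 'rV[R]_n) :
  linear f -> `|f v| <= opbound f * `|v|.
Proof.
move=> lf; pose F : {linear 'rV[R]_n -> 'rV[R]_m} :=
  HB.pack f (GRing.isLinear.Build R _ _ _ f lf).
rewrite -[f]/(F : _ -> _) {1}(row_expand v) linear_sum /=.
apply: le_trans (ler_norm_sum _ _ _) _; rewrite mulr_suml; apply: ler_sum => i _.
rewrite -[f (_ *: _)]/(F _) linearZ normrZ mulrC ler_wpM2l //.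
exact: coord_le_norm.
Qed.

Lemma diff_is_linear (V W : normedModType R) (f : V -> W) x :
  linear ('d f x : V -> W).
Proof. exact: linearP. Qed.

Lemma lin_sub (n m : nat) (f g : 'rV[R]_n -> 'rV[R]_m) :
  linear f -> linear g -> linear (fun z => f z - g z).
Proof.
by move=> lf lg a x y; rewrite (lf a x y) (lg a x y) scalerBr opprD addrACA.
Qed.

Lemma half_add (a b e t : R) : a <= e / 2 * t -> b <= e / 2 * t -> a + b <= e * t.
Proof. by lra. Qed.

Lemma half_bound (a b c o e t : R) : b <= e / 2 * t -> c <= o * t -> 0 <= e ->
  0 <= t -> a <= b + c -> a <= (o + e) * t.
Proof. by nra. Qed.

Lemma segment_within (f : R -> R) (a b : R) :
  (forall x, x \in `[a, b] -> {for x, continuous f}) ->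
  {within `[a, b], continuous f}.
Proof.
move=> h; apply: continuous_in_subspaceT => x; rewrite inE /= => xab.
by apply: h.
Qed.

(** The norm is the largest coordinate, so the one-dimensional mean value theorem, applied to each
    coordinate along the segment from [v] to [u], suffices; the intermediate point may depend on the
    coordinate. *)
Lemma mean_value_ball (n m : nat) (f : 'rV[R]_n -> 'rV[R]_m)
    (L : 'rV[R]_n -> 'rV[R]_m) (p u v : 'rV[R]_n) (r eta : R) : 0 <= eta ->
  (forall w, `|w - p| < r -> differentiable f w) ->
  (forall w z, `|w - p| < r -> `|'d f w z - L z| <= eta * `|z|) ->
  `|u - p| < r -> `|v - p| < r ->
  `|f u - f v - L (u - v)| <= eta * `|u - v|.
Proof.
move=> eta0 df hL up vp; apply: norm_le_coord; first by rewrite mulr_ge0.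
move=> i j; rewrite ord1 {i}.
pose g (s : R) := v + s *: (u - v).
have gin (s : R) : s \in `[0, 1] -> `|g s - p| < r.
  rewrite in_itv /= => /andP[s0 s1].
  have -> : g s - p = (1 - s) *: (v - p) + s *: (u - p).
    by rewrite /g; apply/rowP => k; rewrite !mxE; ring.
  apply: le_lt_trans (ler_normD _ _) _; rewrite !normrZ.
  rewrite (ger0_norm s0) ger0_norm ?subr_ge0//.
  have [s00|s00] := eqVneq s 0; first by rewrite s00 subr0 mul0r addr0 mul1r.
  apply: (@lt_le_trans _ _ ((1 - s) * r + s * r)).
    by apply: ler_ltD; [apply: ler_wpM2l; [rewrite subr_ge0|exact: ltW]|
      rewrite ltr_pM2l // lt_def s00].
  by rewrite -mulrDl subrK mul1r.
pose c (w : 'rV[R]_m) : R := w 0 j.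
have gd (s : R) : is_diff s g (fun h : R => h *: (u - v)).
  rewrite /g.
  have H := @is_diffD R R 'rV[R]_n (cst v) (fun s => s *: (u - v)) _ _ s
     (is_diff_cst _ _) (is_diff_scalel _ _).
  by apply: is_diff_eq; rewrite ?add0r.
have gc (s : R) : differentiable g s by case: (gd s).
have der (s : R) : s \in `[0, 1] -> is_derive s 1 (c \o f \o g) (('d f (g s) (u - v)) 0 j).
  move=> s01.
  have dfg : differentiable (f \o g) s.
    by apply: differentiable_comp => //; apply: df; exact: gin.
  have dc : differentiable (c \o (f \o g)) s.
    by apply: differentiable_comp => //; exact: differentiable_coord.
  have -> : c \o f \o g = c \o (f \o g) by [].
  apply: DeriveDef; first exact: diff_derivable.
  rewrite deriveE // diff_comp //; last exact: differentiable_coord.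
  rewrite /= diff_comp //=; last by apply: df; exact: gin.
  rewrite diff_val scale1r.
  have clin : linear (c : _ -> R^o) by move=> a x y; rewrite /c !mxE.
  pose C : {linear 'rV[R]_m -> R^o} :=
    HB.pack (c : _ -> R^o) (GRing.isLinear.Build _ _ _ _ _ clin).
  rewrite (_ : (c : _ -> R) = C) // diff_lin //.
  exact: coord_continuous.
pose h : R -> R := c \o f \o g.
pose dh (s : R) : R := ('d f (g s) (u - v)) 0 j.
have derh (x : R) : x \in `]0, 1[ -> is_derive x 1 h (dh x).
  by move=> x01; apply: der; move: x01; rewrite !in_itv /= => /andP[/ltW -> /ltW ->].
have ch : {within `[0, 1], continuous h}.
  apply: segment_within => x x01; apply: differentiable_continuous.
  by apply/derivable1_diffP; have [] := der _ x01.
have [s s01] := MVT_segment ler01 derh ch.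
have g1 : g 1 = u by rewrite /g scale1r addrC subrK.
have g0 : g 0 = v by rewrite /g scale0r addr0.
rewrite /h /dh /= g1 g0 subr0 mulr1 => E.
rewrite !mxE -/(c (f u)) -/(c (f v)) E.
have := hL (g s) (u - v) (gin _ s01); apply: le_trans.
by have := coord_le_norm ('d f (g s) (u - v) - L (u - v)) 0 j; rewrite !mxE.
Qed.

Lemma ball_norm_nbhs (n : nat) (p : 'rV[R]_n) (A : set 'rV[R]_n) :
  nbhs p A -> exists2 r, 0 < r & forall w, `|w - p| < r -> A w.
Proof.
move=> /nbhs_ballP[r /= r0 H]; exists r => // w wr; apply: H.
by rewrite -ball_normE /= distrC.
Qed.

(** [Ck_on] gives continuity of the differential only for each fixed vector; testing it on the basis
    vectors makes it uniform in [z]. Dividing by [n.+1] rather than [n] covers [n = 0]. *)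
Lemma C1_diff_near (n m : nat) (U : set 'rV[R]_n) (f : 'rV[R]_n -> 'rV[R]_m) p eta :
  open U -> Ck_on 1 U f -> U p -> 0 < eta ->
  exists2 r, 0 < r & forall w, `|w - p| < r ->
    U w /\ forall z, `|'d f w z - 'd f p z| <= eta * `|z|.
Proof.
move=> oU [df cf] Up eta0.
have H : \forall w \near p, forall i : 'I_n,
    `|'d f w (delta_mx 0 i) - 'd f p (delta_mx 0 i)| <= eta / n.+1%:R.
  have FF : Filter (nbhs p) by apply: nbhs_filter.
  apply: (@filter_forall _ _ _ _ FF) => i.
  have := cf (delta_mx 0 i) p Up.
  move=> /cvgrPdist_le /(_ (eta / n.+1%:R)) Hi.
  have := Hi (divr_gt0 eta0 (ltr0Sn _ _)).
  apply: filterS => w /= Hw; by rewrite distrC.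
have [r r0 Hr] := ball_norm_nbhs (filterI (open_nbhs_nbhs (conj oU Up)) H).
exists r => // w wr; have [Uw Hw] := Hr _ wr; split => // z.
have lin : linear (fun z => 'd f w z - 'd f p z).
  exact: (lin_sub (diff_is_linear f w) (diff_is_linear f p)).
apply: le_trans (le_opbound z lin) _; apply: ler_wpM2r => //.
rewrite /opbound; apply: (@le_trans _ _ (\sum_(i < n) (eta / n.+1%:R))).
  exact: ler_sum.
rewrite sumr_const card_ord -[leLHS]mulr_natr mulrAC ler_pdivrMr ?ltr0n //.
by rewrite ler_pM2l // ler_nat.
Qed.

(* The slope bound holds with the base point of the differential moving
   together with the two points, which is what a compactness argument needs. *)
Lemma C1_uniform_near (n m : nat) (U : set 'rV[R]_n) (f : 'rV[R]_n -> 'rV[R]_m) p eta :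
  open U -> Ck_on 1 U f -> U p -> 0 < eta ->
  exists2 r, 0 < r & exists2 B, 0 < B & forall q u v,
    `|q - p| < r -> `|u - q| < r -> `|v - q| < r ->
    [/\ U u, `|f u - f v - 'd f q (u - v)| <= eta * `|u - v| &
        forall z, `|'d f q z| <= B * `|z| ].
Proof.
move=> oU cf Up eta0.
have e2 : 0 < eta / 2 by rewrite divr_gt0.
have [D DE] : exists D : 'rV[R]_n -> 'rV[R]_n -> 'rV[R]_m,
    D = (fun w z => 'd f w z) by eexists.
have MV := @mean_value_ball n m f.
have [r r0 Hr] := C1_diff_near oU cf Up e2.
have DO z : `|D p z| <= opbound (D p) * `|z|.
  by rewrite DE; apply: le_opbound; exact: diff_is_linear.
have {}Hr w : `|w - p| < r -> U w /\ forall z, `|D w z - D p z| <= eta / 2 * `|z|.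
  by rewrite DE; exact: Hr.
have {}MV (L : 'rV[R]_n -> 'rV[R]_m) (u v : 'rV[R]_n) :
    (forall w z, `|w - p| < r -> `|D w z - L z| <= eta * `|z|) ->
    `|u - p| < r -> `|v - p| < r ->
    `|f u - f v - L (u - v)| <= eta * `|u - v|.
  rewrite DE => HL; apply: MV => //; first exact: ltW.
  by move=> w /Hr[Uw _]; exact: cf.1.
exists (r / 2); first by rewrite divr_gt0.
exists (opbound (D p) + eta); first by rewrite ltr_wpDl // opbound_ge0.
move=> q u v qp uq vq.
suff : [/\ U u, `|f u - f v - D q (u - v)| <= eta * `|u - v| &
        forall z, `|D q z| <= (opbound (D p) + eta) * `|z| ] by rewrite DE.
clear DE cf.
have lt_r (x : 'rV[R]_n) : `|x - q| < r / 2 -> `|x - p| < r.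
  move=> xq; apply: le_lt_trans (ler_distD q _ _) _; lra.
have qr : `|q - p| < r by lra.
split.
- exact: (Hr _ (lt_r _ uq)).1.
- apply: MV; [move=> w z wp|exact: lt_r|exact: lt_r].
  have h1 := (Hr _ wp).2 z; have h2 := (Hr _ qr).2 z.
  have -> : D w z - D q z = (D w z - D p z) - (D q z - D p z).
    by rewrite opprB addrA subrK.
  apply: le_trans (ler_normB _ _) _.
  exact: half_add h1 h2.
- move=> z; have h := (Hr _ qr).2 z.
  apply: half_bound h (DO z) _ _ _ => //; first exact: ltW.
  by have := ler_distD (D p z) (D q z) 0; rewrite !subr0.
Qed.

End rowvec.

Section atlas.
Context {R : realType} {n : nat} {M : ptopologicalType}.
Variable A : smoothAtlas R n M.
Hypothesis M_hausdorff : hausdorff_space M.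
Hypothesis M_compact : compact [set: M].

(** The form in which compactness enters the uniform estimates in charts. Monotonicity of [P] in [d]
    is not assumed, so the local hypothesis asks for all small [d]; the parameter is sent to 0 from
    the right. *)
Lemma compact_uniform (P : R -> M -> Prop) :
  (forall x0 : M, exists2 d0, 0 < d0 &
     \forall x \near x0, forall d, 0 < d -> d < d0 -> P d x) ->
  exists2 d, 0 < d & forall x, P d x.
Proof.
move=> H.
have H1 : forall x, [set: M] x -> \forall x' \near x & i \near (0 : R)^'+, P i x'.
  move=> x0 _; have [d0 d0p Hd] := H x0.
  near=> x i => /=; have [i0 id] : 0 < i /\ i < d0.
    by split; near: i; [exact: nbhs_right_gt|exact: nbhs_right_lt].
  by move: i0 id; apply: (near Hd x).
have PF : ProperFilter ((0 : R)^'+) by apply: at_right_proper_filter.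
have H2 := (compact_near_coveringP setT).1 M_compact R (0^'+) P _ H1.
have [d [d0 Pd]] := @filter_ex _ _ PF _ (filterI (nbhs_right_gt (0 : R)) (H2 _)).
by exists d => // x; exact: Pd.
Unshelve. all: by end_near. Qed.

Lemma chart_image_open (c : chart R n M) (W : set M) :
  open W -> open (cmap c @` (cdom c `&` W)).
Proof.
move=> oW.
have -> : cmap c @` (cdom c `&` W) = ccod c `&` cinv c @^-1` W.
  apply/seteqP; split=> [_ [x [cx Wx] <-]|_ [[x cx <-]]] /=.
    by split; [exists x|rewrite /= cmapK].
  by rewrite cmapK // => Wx; exists x.
rewrite openE => y [cy Wy]; rewrite /interior.
apply: filterI; first by apply: open_nbhs_nbhs; split => //; exact: ccod_open.
by apply: (cinv_continuous cy); apply: open_nbhs_nbhs.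
Qed.

Local Notation ch a := (chart_at A a).

(** The factor 4 leaves room for concentric balls: those of radius [rad a] cover [M], those of
    radius [2 * rad a] carry the bumps, and closed ones of radius below [4 * rad a] are compact. *)
Lemma chart_radius (a : M) : {r : R | 0 < r &
  forall w, `|w - cmap (ch a) a| < 4 * r -> ccod (ch a) w}.
Proof.
apply: cid2.
have : nbhs (cmap (ch a) a) (ccod (ch a)).
  apply: open_nbhs_nbhs; split; first exact: ccod_open.
  by exists a => //; exact: chart_at_dom.
move=> /ball_norm_nbhs[r r0 H]; exists (r / 4); first by rewrite divr_gt0.
by move=> w wr; apply: H; apply: lt_le_trans wr _; rewrite mulrC divfK.
Qed.

Definition rad a := s2val (chart_radius a).
Lemma rad_gt0 a : 0 < rad a. Proof. exact: s2valP (chart_radius a). Qed.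
Lemma rad_cod a w : `|w - cmap (ch a) a| < 4 * rad a -> ccod (ch a) w.
Proof. exact: (s2valP' (chart_radius a)). Qed.

Definition inU (a : M) (r : R) : set M :=
  [set x | cdom (ch a) x /\ `|cmap (ch a) x - cmap (ch a) a| < r * rad a].
Definition inK (a : M) (r : R) : set M :=
  [set x | cdom (ch a) x /\ `|cmap (ch a) x - cmap (ch a) a| <= r * rad a].

Lemma inU_le a r r' : r <= r' -> inU a r `<=` inU a r'.
Proof.
move=> rr x [cx xr]; split => //; apply: lt_le_trans xr _.
by rewrite ler_wpM2r // ltW // rad_gt0.
Qed.

Lemma inUK a r : inU a r `<=` inK a r.
Proof. by move=> x [cx xr]; split => //; exact: ltW. Qed.

Lemma inKU a r r' : r < r' -> inK a r `<=` inU a r'.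
Proof.
move=> rr x [cx xr]; split => //; apply: le_lt_trans xr _.
by rewrite ltr_pM2r // rad_gt0.
Qed.

Lemma inU_open a r : open (inU a r).
Proof.
rewrite openE => x [cx xr]; rewrite /interior; apply: filterI.
  by apply: open_nbhs_nbhs; split => //; exact: cdom_open.
have /cvgr_dist_lt := cmap_continuous cx.
move=> /(_ (r * rad a - `|cmap (ch a) x - cmap (ch a) a|)).
rewrite subr_gt0 => /(_ xr); apply: filterS => y /= h.
rewrite distrC in h.
have := ler_distD (cmap (ch a) x) (cmap (ch a) y) (cmap (ch a) a); lra.
Qed.

(** The set is the image under [cinv] of a compact ball of R^n inside [ccod]; in a Hausdorff space
    such an image is closed, although the chart domain is only open. *)
Lemma inK_closed a r : r < 4 -> closed (inK a r).
Proof.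
move=> r4; apply: compact_closed => //.
pose B : set 'rV[R]_n := [set w | `|w - cmap (ch a) a| <= r * rad a].
have Bcod w : B w -> ccod (ch a) w.
  by move=> Bw; apply: rad_cod; apply: le_lt_trans Bw _; rewrite ltr_pM2r // rad_gt0.
have -> : inK a r = cinv (ch a) @` B.
  apply/seteqP; split=> [x [cx xr]|_ [w Bw <-]].
    by exists (cmap (ch a) x) => //; rewrite cmapK.
  have [y cy yw] := Bcod _ Bw; rewrite /inK /= -yw cmapK //; split => //.
  by rewrite yw.
apply: continuous_compact.
  apply: continuous_in_subspaceT => w; rewrite inE => /Bcod Bw.
  exact: cinv_continuous.
apply: bounded_closed_compact.
  exists (`|cmap (ch a) a| + r * rad a); split; first exact: num_real.
  move=> z zr w Bw; apply: ltW; apply: le_lt_trans zr.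
  have := ler_distD (cmap (ch a) a) w 0; rewrite !subr0 => h.
  by rewrite (le_trans h) // addrC lerD2l.
have -> : B = closed_ball_ Num.norm (cmap (ch a) a) (r * rad a).
  by apply/seteqP; split=> w; rewrite /B /closed_ball_ /= distrC.
exact: closed_closed_ball_.
Qed.

Lemma finite_atlas : exists s : seq M, forall x, exists2 a, a \in s & inU a 1 x.
Proof.
have := M_compact; rewrite compact_cover => /(_ _ setT (fun a => inU a 1)) [].
- by move=> a _; exact: inU_open.
- move=> x _; exists x => //; split; first exact: chart_at_dom.
  by rewrite subrr normr0 mul1r rad_gt0.
- move=> D _ cov; exists (finmap.enum_fset D) => x.
  by have [a aD ax] := cov x I; exists a.
Qed.

Definition ats : seq M := projT1 (cid finite_atlas).
Lemma ats_cover x : exists a, a \in ats /\ inU a 1 x.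
Proof. by have [a as_ ax] := projT2 (cid finite_atlas) x; exists a. Qed.

Definition idx x := projT1 (cid (ats_cover x)).
Lemma idx_in x : idx x \in ats. Proof. by case: (projT2 (cid (ats_cover x))). Qed.
Lemma idxU x : inU (idx x) 1 x. Proof. by case: (projT2 (cid (ats_cover x))). Qed.

Definition bump a x : R :=
  if `[< cdom (ch a) x >] then Num.max 0 (2 * rad a - `|cmap (ch a) x - cmap (ch a) a|)
  else 0.

Lemma bump_out a x : ~ inU a 2 x -> bump a x = 0.
Proof.
move=> nU; rewrite /bump; case: asboolP => // cx.
apply/max_idPl; rewrite subr_le0 leNgt; apply/negP => h; apply: nU; split => //.
Qed.

Lemma bump_in a x : cdom (ch a) x ->
  bump a x = Num.max 0 (2 * rad a - `|cmap (ch a) x - cmap (ch a) a|).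
Proof. by rewrite /bump => cx; rewrite asboolT. Qed.

Lemma bump_gt0 a x : 0 < bump a x -> inU a 2 x.
Proof. by move=> b0; apply: contrapT => /bump_out E; rewrite E ltxx in b0. Qed.

Lemma bump_inU a x : inU a 1 x -> rad a < bump a x.
Proof.
move=> [cx xr]; rewrite bump_in //; rewrite lt_max; apply/orP; right; lra.
Qed.

Lemma bump_continuous a : continuous (bump a).
Proof.
move=> x; have [cx|ncx] := pselect (cdom (ch a) x).
  have H : {for x, continuous (fun y => Num.max 0
      (2 * rad a - `|cmap (ch a) y - cmap (ch a) a|))}.
    apply: (@continuous_max _ _ (cst 0) (fun y => 2 * rad a -
      `|cmap (ch a) y - cmap (ch a) a|)); first exact: cvg_cst.
    apply: cvgB; first exact: cvg_cst.
    by apply: cvg_norm; apply: cvgB; [exact: cmap_continuous|exact: cvg_cst].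
  rewrite /prop_for /continuous_at bump_in //.
  apply: cvg_trans H; apply: near_eq_cvg.
  have : \forall y \near x, cdom (ch a) y.
    by apply: open_nbhs_nbhs; split => //; exact: cdom_open.
  by apply: filterS => y cy; rewrite bump_in.
have nK : ~ inK a 2 x by move=> [].
rewrite /continuous_at bump_out; last by move=> /inUK.
apply: cvg_near_cst; have : \forall y \near x, (~` inK a 2) y.
  apply: open_nbhs_nbhs; split => //; apply: closed_openC; apply: inK_closed.
  by rewrite ltr_nat.
by apply: filterS => y nKy; rewrite bump_out // => /inUK.
Qed.

(* Urysohn-type embedding: the coordinates weighted by the bumps separate
   points, and give a metric compatible with the topology. *)
Definition bcoord a x : 'rV[R]_n := bump a x *: cmap (ch a) x.

Lemma bcoord_continuous a : continuous (bcoord a).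
Proof.
move=> x; have [cx|ncx] := pselect (cdom (ch a) x).
  by apply: cvgZ; [exact: bump_continuous|exact: cmap_continuous].
have nK : ~ inK a 2 x by move=> [].
rewrite /continuous_at {2}/bcoord bump_out ?scale0r; last by move=> /inUK.
apply: cvg_near_cst; have : \forall y \near x, (~` inK a 2) y.
  apply: open_nbhs_nbhs; split => //; apply: closed_openC; apply: inK_closed.
  by rewrite ltr_nat.
by apply: filterS => y nKy; rewrite /bcoord bump_out ?scale0r // => /inUK.
Qed.

Definition dist x y : R :=
  \sum_(a <- ats) (`|bump a x - bump a y| + `|bcoord a x - bcoord a y|).

Lemma dist_ge0 x y : 0 <= dist x y.
Proof. by apply: sumr_ge0 => a _; apply: addr_ge0. Qed.

Lemma distxx x : dist x x = 0.
Proof. by apply: big1 => a _; rewrite !subrr !normr0 addr0. Qed.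

Lemma distC x y : dist x y = dist y x.
Proof. by apply: eq_bigr => a _; rewrite distrC [X in _ + X]distrC. Qed.

Lemma dist_tri y x z : dist x z <= dist x y + dist y z.
Proof.
rewrite /dist -big_split /=; apply: ler_sum => a _.
by rewrite addrACA; apply: lerD; exact: ler_distD.
Qed.

Lemma dist_bump a x y : a \in ats -> `|bump a x - bump a y| <= dist x y.
Proof.
move=> aA; rewrite /dist (big_rem a aA) /= -addrA lerDl.
by rewrite addr_ge0 // sumr_ge0 // => b _; apply: addr_ge0.
Qed.

Lemma dist_bcoord a x y : a \in ats -> `|bcoord a x - bcoord a y| <= dist x y.
Proof.
move=> aA; rewrite /dist (big_rem a aA) /= addrAC lerDr.
by rewrite addr_ge0 // sumr_ge0 // => b _; apply: addr_ge0.
Qed.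

(** Some bump is positive at [x], hence at [y], which puts both points in one chart domain; dividing
    the weighted coordinates by the common bump value gives equal coordinates. *)
Lemma dist0_eq x y : dist x y = 0 -> x = y.
Proof.
move=> d0; have aA := idx_in x; have xU := idxU x.
move: aA xU; set a := idx x => aA xU.
have := dist_bump x y aA; rewrite d0 normr_le0 subr_eq0 => /eqP bE.
have := dist_bcoord x y aA; rewrite d0 normr_le0 subr_eq0 => /eqP cE.
have b0 : 0 < bump a x by apply: lt_trans (bump_inU xU); exact: rad_gt0.
have [cy _] : inU a 2 y by apply: bump_gt0; rewrite -bE.
move: cE; rewrite /bcoord -bE => /(scalerI (lt0r_neq0 b0)) E.
by case: xU => cx _; rewrite -(cmapK cx) -(cmapK cy) E.
Qed.

Lemma dist_continuous x : continuous (dist x).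
Proof.
apply: continuous_big => [|a _ y]; first exact: add_continuous.
apply: cvgD.
  by apply: cvg_norm; apply: cvgB; [exact: cvg_cst|exact: bump_continuous].
by apply: cvg_norm; apply: cvgB; [exact: cvg_cst|exact: bcoord_continuous].
Qed.

Lemma dist_near x e : 0 < e -> \forall y \near x, dist x y < e.
Proof.
move=> e0; have /cvgr_dist_lt/(_ _ e0) := @dist_continuous x x.
by apply: filterS => y; rewrite distxx sub0r normrN ger0_norm // dist_ge0.
Qed.

(** The complement of an open neighbourhood is compact, so [dist x] has a positive minimum on it. *)
Lemma nbhs_dist x (O : set M) : nbhs x O ->
  exists2 e, 0 < e & forall y, dist x y < e -> O y.
Proof.
rewrite nbhsE => -[V [oV Vx] VO].
have [[z0 nz0]|H] := pselect (exists z, ~ V z); last first.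
  by exists 1 => // y _; apply: VO; apply: contrapT => nV; apply: H; exists y.
have cC : compact (~` V).
  apply: (subclosed_compact _ M_compact) => //; exact: open_closedC.
have [|z nz zmin] := compact_EVT_min (f := dist x) (ex_intro _ z0 nz0) cC.
  by apply: continuous_subspaceT; exact: dist_continuous.
rewrite inE in nz.
exists (dist x z).
  rewrite lt_def dist_ge0 andbT; apply/eqP => /dist0_eq E; apply: nz.
  by rewrite -E.
move=> y; apply: contraPP => nO; apply/negP; rewrite -leNgt; apply: zmin.
by rewrite inE => Vy; apply: nO; exact: VO.
Qed.

End atlas.

Opaque diff.

Lemma near_mem (T : Type) (I : choiceType) (s : seq I) (F : set_system T)
    (P : I -> T -> Prop) : Filter F ->
  (forall i, i \in s -> \forall x \near F, P i x) ->
  \forall x \near F, forall i, i \in s -> P i x.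
Proof.
move=> FF; elim: s => [_|i s IH H].
  by apply: nearW => x j; rewrite in_nil.
have H1 : \forall x \near F, P i x by apply: H; rewrite mem_head.
have H2 : \forall x \near F, forall j, j \in s -> P j x.
  by apply: IH => j js; apply: H; rewrite in_cons js orbT.
by apply: filterS2 H1 H2 => x h1 h2 j; rewrite in_cons => /orP[/eqP ->|/h2].
Qed.

Lemma diff_near_eq (R : realType) (V W : normedModType R) (f g : V -> W) x :
  (\forall y \near x, f y = g y) -> differentiable f x ->
  differentiable g x /\ ('d g x = 'd f x :> (V -> W)).
Proof.
move=> fg df; have [cf /eqaddoP of_] := (diff_locallyP x f).1 df.
have E : g \o shift x = cst (g x) + 'd f x +o_ 0 id.
  apply/eqaddoP => eps e0; have := of_ _ e0.
  have H : \forall h \near (0 : V), f (h + x) = g (h + x).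
    have := fg; rewrite (near_shift 0 x) /=; apply: filterS => h.
    by rewrite /= subr0.
  apply: filterS2 H => h; rewrite /= !fctE /= => ->.
  by rewrite (nbhs_singleton fg).
have dE := diff_unique cf E; split; last exact: dE.
by apply/diff_locallyP; rewrite dE.
Qed.

Lemma diff_comp_at (R : realType) (U V W : normedModType R) (f : U -> V)
    (g : V -> W) x y : f x = y -> differentiable f x -> differentiable g y ->
  differentiable (g \o f) x /\ forall v, 'd (g \o f) x v = 'd g y ('d f x v).
Proof.
move=> <- df dg; split; first exact: differentiable_comp.
by move=> v; rewrite diff_comp.
Qed.

Lemma diff_eq_at (R : realType) (V W : normedModType R) (f g : V -> W) x :
  (\forall y \near x, f y = g y) -> differentiable f x ->
  differentiable g x /\ forall v, 'd g x v = 'd f x v.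
Proof.
move=> fg df; have [h1 h2] := diff_near_eq fg df; split; first exact: h1.
by move=> v; rewrite h2.
Qed.

Lemma continuous_near_eq (U V : topologicalType) (f g : U -> V) p :
  (\forall u \near p, f u = g u) -> {for p, continuous f} -> {for p, continuous g}.
Proof.
move=> E; rewrite /prop_for /continuous_at -(nbhs_singleton E).
by apply: cvg_trans; apply: near_eq_cvg.
Qed.

(** [Ck_on 1] asks for continuity of the differential at a fixed vector, but in a chain rule the
    vector moves together with the base point. Both variations are handled here, with the linear
    maps close in operator norm. *)
Lemma cvg_linear_family (R : realType) (U : topologicalType) (m k l : nat) (p : U)
    (F : U -> 'rV[R]_m) (D : U -> 'rV[R]_k)
    (L : 'rV[R]_m -> 'rV[R]_k -> 'rV[R]_l) :
  {for p, continuous F} -> {for p, continuous D} -> linear (L (F p)) ->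
  (forall eta, 0 < eta -> exists2 r, 0 < r & forall w, `|w - F p| < r ->
     forall z, `|L w z - L (F p) z| <= eta * `|z|) ->
  {for p, continuous (fun u => L (F u) (D u))}.
Proof.
move=> cF cD lL near_L; have FF : Filter (nbhs p) by apply: nbhs_filter.
apply/(@cvgrPdist_le _ _ _ _ FF) => eps eps0.
have B0 := opbound_ge0 (L (F p)).
set B := opbound _ in B0.
have eta0 : 0 < eps / 2 / (`|D p| + 1) by rewrite !divr_gt0 // ltr_wpDl.
have d0 : 0 < Num.min 1 (eps / 2 / (B + 1)).
  by rewrite lt_min ltr01 /= !divr_gt0 // ltr_wpDl.
have [r r0 Hr] := near_L _ eta0.
have h1 := @cvgr_dist_lt _ _ _ _ FF _ _ cF _ r0.
have h2 := @cvgr_dist_lt _ _ _ _ FF _ _ cD _ d0.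
apply: filterS2 h1 h2 => u /= h1; rewrite lt_min => /andP[h2 h3].
have E : L (F p) (D p) - L (F u) (D u) =
    L (F p) (D p - D u) - (L (F u) (D u) - L (F p) (D u)).
  have -> : L (F p) (D p - D u) = L (F p) (D p) - L (F p) (D u).
    have := lL (-1) (D u) (D p); rewrite !scaleN1r (addrC (- D u)) => ->.
    by rewrite addrC.
  by rewrite opprB addrA subrK.
rewrite E; apply: le_trans (ler_normB _ _) _.
have l1 := le_opbound (D p - D u) lL.
have l2 : `|L (F u) (D u) - L (F p) (D u)| <= eps / 2 / (`|D p| + 1) * `|D u|.
  by apply: Hr; rewrite distrC.
have l3 : `|D u| <= `|D p| + 1.
  have := ler_distD (D p) (D u) 0; rewrite !subr0 distrC; lra.
have k1 : B * `|D p - D u| <= eps / 2.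
  apply: (@le_trans _ _ (B * (eps / 2 / (B + 1)))); first by apply: ler_wpM2l => //; lra.
  rewrite mulrA ler_pdivrMr ?ltr_wpDl // mulrC; nra.
have k2 : eps / 2 / (`|D p| + 1) * `|D u| <= eps / 2.
  rewrite mulrAC ler_pdivrMr; last by rewrite ltr_wpDl.
  by rewrite ler_pM2l // divr_gt0.
by rewrite [leRHS]splitr; apply: lerD; [exact: le_trans l1 k1|exact: le_trans l2 k2].
Qed.

Lemma half_dist (R : realType) (n : nat) (a b c : 'rV[R]_n) (e t : R) :
  `|a - c| <= e / 2 * t -> `|b - c| <= e / 2 * t -> `|a - b| <= e * t.
Proof.
move=> h1 h2; have := half_add h1 h2; apply: le_trans.
by rewrite (distrC b) ler_distD.
Qed.

Section charts_dyn.
Context {R : realType} {n : nat} {M : ptopologicalType}.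
Variable A : smoothAtlas R n M.
Hypothesis M_hausdorff : hausdorff_space M.
Hypothesis M_compact : compact [set: M].

Local Notation ch a := (chart_at A a).
Local Notation dist := (dist A M_compact).
Local Notation ats := (ats A M_compact).
Local Notation inU := (inU A).
Local Notation inK := (inK A).

(** A Lebesgue number for the given neighbourhoods: half of each radius is kept for the distance
    between [x] and [y]. *)
Lemma dist_uniform (P : M -> M -> Prop) :
  (forall x0 : M, exists2 O : set M, nbhs x0 O & forall x y, O x -> O y -> P x y) ->
  exists2 e, 0 < e & forall x y, dist x y < e -> P x y.
Proof.
move=> H; apply: (compact_uniform M_compact
  (P := fun e x => forall y, dist x y < e -> P x y)).
move=> x0; have [W nW HW] := H x0; have [e1 e10 He1] := nbhs_dist A M_hausdorff M_compact nW.
have e2 : 0 < e1 / 2 by rewrite divr_gt0.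
exists (e1 / 2) => //.
have := dist_near A M_hausdorff M_compact x0 e2.
apply: filterS => x xx0 d d0 dd y xy; apply: HW.
- by apply: He1; lra.
- by apply: He1; have := dist_tri A M_compact x x0 y; lra.
Qed.

(** The condition [inU a 1 x] is not closed in [x]. Near [x0] the charts are therefore sorted by the
    closed condition [inK a 1 x0]: where it fails, it fails nearby, and the chart need not be
    considered. *)
Lemma chart_close eta : 0 < eta -> exists2 e, 0 < e & forall x y, dist x y < e ->
  forall a, a \in ats -> inU a 1 x ->
    inU a 2 y /\ `|cmap (ch a) x - cmap (ch a) y| < eta.
Proof.
move=> eta0.
apply: (dist_uniform (P := fun x y => forall a, a \in ats -> inU a 1 x ->
    inU a 2 y /\ `|cmap (ch a) x - cmap (ch a) y| < eta)) => x0.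
exists [set y | forall a, a \in ats ->
    (inK a 1 x0 -> inU a 2 y /\ `|cmap (ch a) x0 - cmap (ch a) y| < eta / 2) /\
    (~ inK a 1 x0 -> ~ inK a 1 y)].
  apply: near_mem => a _; have [Kx|nKx] := pselect (inK a 1 x0).
    have U2 : \forall y \near x0, inU a 2 y.
      apply: open_nbhs_nbhs; split; first exact: inU_open.
      by apply: inKU Kx; rewrite ltr1n.
    have cc : \forall y \near x0, `|cmap (ch a) x0 - cmap (ch a) y| < eta / 2.
      apply: cvgr_dist_lt; last by rewrite divr_gt0.
      by apply: cmap_continuous; case: Kx.
    by apply: filterS2 U2 cc => y.
  have : \forall y \near x0, (~` inK a 1) y.
    apply: open_nbhs_nbhs; split => //; apply: closed_openC.
    by apply: inK_closed => //; rewrite ltr1n.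
  by apply: filterS => y.
move=> x y Hx Hy a aA Ux.
have K0 : inK a 1 x0.
  by apply: contrapT => nK; apply: ((Hx a aA).2 nK); exact: inUK.
have [_ h1] := (Hx a aA).1 K0; have [U2 h2] := (Hy a aA).1 K0; split => //.
have := ler_distD (cmap (ch a) x0) (cmap (ch a) x) (cmap (ch a) y).
by rewrite (distrC (cmap (ch a) x) (cmap (ch a) x0)); lra.
Qed.

Lemma chart_inv_close e : 0 < e -> exists2 eta, 0 < eta & forall x a u,
  a \in ats -> inU a 1 x -> `|u - cmap (ch a) x| < eta ->
  ccod (ch a) u /\ dist (cinv (ch a) u) x < e.
Proof.
move=> e0.
apply: (compact_uniform M_compact (P := fun eta x => forall a u,
  a \in ats -> inU a 1 x -> `|u - cmap (ch a) x| < eta ->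
  ccod (ch a) u /\ dist (cinv (ch a) u) x < e)) => x0.
have e2 : 0 < e / 2 by rewrite divr_gt0.
have H : exists2 d0, 0 < d0 & forall a, a \in ats -> inK a 1 x0 ->
    forall u, `|u - cmap (ch a) x0| < d0 ->
      ccod (ch a) u /\ dist x0 (cinv (ch a) u) < e / 2.
  elim: (ats) => [|a s [d d0 IH]]; first by exists 1.
  have [[cx Kx]|nK] := pselect (inK a 1 x0); last first.
    by exists d => // b; rewrite in_cons => /orP[/eqP -> //|bs]; exact: IH.
  have : \forall u \near cmap (ch a) x0, ccod (ch a) u /\ dist x0 (cinv (ch a) u) < e / 2.
    apply: filterI.
      by apply: open_nbhs_nbhs; split; [exact: ccod_open|exists x0].
    have cc : {for cmap (ch a) x0, continuous (cinv (ch a))}.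
      by apply: cinv_continuous; exists x0.
    move: cc; rewrite /prop_for /continuous_at cmapK // => cc.
    exact: (cc _ (dist_near A M_hausdorff M_compact x0 e2)).
  move=> /ball_norm_nbhs[r r0 Hr]; exists (Num.min d r).
    by rewrite lt_min d0 r0.
  move=> b; rewrite in_cons => /orP[/eqP -> _ u|bs Kb u]; rewrite lt_min => /andP[h1 h2].
    exact: Hr.
  exact: IH.
have [d0 d00 Hd] := H; exists (d0 / 2); first by rewrite divr_gt0.
have H1 : \forall x \near x0, forall a, a \in ats ->
    (inK a 1 x0 -> `|cmap (ch a) x0 - cmap (ch a) x| < d0 / 2) /\
    (~ inK a 1 x0 -> ~ inK a 1 x).
  apply: near_mem => a _; have [Kx|nKx] := pselect (inK a 1 x0).
    have cc : \forall y \near x0, `|cmap (ch a) x0 - cmap (ch a) y| < d0 / 2.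
      apply: cvgr_dist_lt; last by rewrite divr_gt0.
      by apply: cmap_continuous; case: Kx.
    by apply: filterS cc => y.
  have : \forall y \near x0, (~` inK a 1) y.
    apply: open_nbhs_nbhs; split => //; apply: closed_openC.
    by apply: inK_closed => //; rewrite ltr1n.
  by apply: filterS => y.
have H2 := dist_near A M_hausdorff M_compact x0 e2.
apply: filterS2 H1 H2 => x Hx x0x d dp dlt a u aA Ux ux.
have K0 : inK a 1 x0.
  by apply: contrapT => nK; apply: ((Hx a aA).2 nK); exact: inUK.
have h1 := (Hx a aA).1 K0.
have [|cu du] := Hd a aA K0 u.
  have := ler_distD (cmap (ch a) x) u (cmap (ch a) x0).
  by rewrite (distrC (cmap (ch a) x) (cmap (ch a) x0)); lra.
split => //; have := dist_tri A M_compact x0 (cinv (ch a) u) x.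
by rewrite (distC A M_compact (cinv (ch a) u) x0); lra.
Qed.

Definition chmap (G : M -> M) a b := cmap (ch b) \o G \o cinv (ch a).

Definition dmap (G : M -> M) a b x (v : 'rV[R]_n) : 'rV[R]_n :=
  'd (chmap G a b) (cmap (ch a) x) v.

Lemma dmapE G a b x v : dmap G a b x v = 'd (chmap G a b) (cmap (ch a) x) v.
Proof. by []. Qed.

Lemma dmap_linear G a b x : linear (dmap G a b x).
Proof. exact: diff_is_linear. Qed.

Lemma Ck_map_diff (G : M -> M) (c c' : chart R n M) x : Ck_map A 1 G ->
  charts A c -> charts A c' -> cdom c x -> cdom c' (G x) ->
  differentiable (cmap c' \o G \o cinv c) (cmap c x).
Proof.
by move=> [_ CG] hc hc' cx cGx; have [+ _] := CG c c' hc hc'; apply; exists x.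
Qed.

Lemma chart_near (G : M -> M) (c c' : chart R n M) x : continuous G ->
  cdom c x -> cdom c' (G x) ->
  \forall u \near cmap c x, cdom c (cinv c u) /\ cdom c' (G (cinv c u)).
Proof.
move=> cG cx cGx.
have cc : {for cmap c x, continuous (cinv c)} by apply: cinv_continuous; exists x.
have : \forall y \near x, cdom c y /\ cdom c' (G y).
  apply: filterI; first by apply: open_nbhs_nbhs; split => //; exact: cdom_open.
  by apply: cG; apply: open_nbhs_nbhs; split => //; exact: cdom_open.
by move=> H; move: cc; rewrite /prop_for /continuous_at cmapK // => cc; exact: (cc _ H).
Qed.

Lemma diff_chart_comp (G H : M -> M) (c c' c'' : chart R n M) x :
  Ck_map A 1 G -> Ck_map A 1 H -> charts A c -> charts A c' -> charts A c'' ->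
  cdom c x -> cdom c' (G x) -> cdom c'' (H (G x)) ->
  differentiable (cmap c'' \o (H \o G) \o cinv c) (cmap c x) /\
  forall v, 'd (cmap c'' \o (H \o G) \o cinv c) (cmap c x) v =
    'd (cmap c'' \o H \o cinv c') (cmap c' (G x))
      ('d (cmap c' \o G \o cinv c) (cmap c x) v).
Proof.
move=> CG CH hc hc' hc'' cx cGx cHx.
have dG := Ck_map_diff CG hc hc' cx cGx.
have dH := Ck_map_diff CH hc' hc'' cGx cHx.
have E0 : (cmap c' \o G \o cinv c) (cmap c x) = cmap c' (G x) by rewrite /= cmapK.
have [dC dCv] := diff_comp_at E0 dG dH.
have near_eq : \forall u \near cmap c x,
   ((cmap c'' \o H \o cinv c') \o (cmap c' \o G \o cinv c)) u =
   (cmap c'' \o (H \o G) \o cinv c) u.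
  have := chart_near CG.1 cx cGx; apply: filterS => u [_ cu] /=.
  by rewrite cmapK.
have [dE dEv] := diff_eq_at near_eq dC.
split; first exact: dE.
by move=> v; exact: etrans (dEv v) (dCv v).
Qed.

Lemma dmap_comp (G H : M -> M) a b c x v : Ck_map A 1 G -> Ck_map A 1 H ->
  cdom (ch a) x -> cdom (ch b) (G x) -> cdom (ch c) (H (G x)) ->
  dmap (H \o G) a c x v = dmap H b c (G x) (dmap G a b x v).
Proof.
move=> CG CH ca cb cc; rewrite /dmap /chmap.
have hc y : charts A (ch y) by exact: chart_at_charts.
by have [_] := diff_chart_comp CG CH (hc a) (hc b) (hc c) ca cb cc; apply.
Qed.

Lemma Ck_map_comp (G H : M -> M) : Ck_map A 1 G -> Ck_map A 1 H -> Ck_map A 1 (H \o G).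
Proof.
move=> CG CH; split.
  by move=> x; apply: continuous_comp; [exact: CG.1|exact: CH.1].
move=> c c' hc hc'; split.
  move=> _ [x [cx cHx] <-].
  by have [] := @diff_chart_comp G H c (ch (G x)) c' x CG CH hc
    (chart_at_charts _ _) hc' cx (chart_at_dom _ _) cHx.
move=> v _ [x [cx cHx] <-].
pose b := ch (G x).
have hb : charts A b by exact: chart_at_charts.
have cb : cdom b (G x) by exact: chart_at_dom.
pose FG := cmap b \o G \o cinv c; pose FH := cmap c' \o H \o cinv b.
have [DG DGE] : exists D : 'rV[R]_n -> 'rV[R]_n, D = (fun u => 'd FG u v) by eexists.
have [DH DHE] : exists D : 'rV[R]_n -> 'rV[R]_n -> 'rV[R]_n,
  D = (fun w z => 'd FH w z) by eexists.
have E : \forall u \near cmap c x,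
    DH (FG u) (DG u) = 'd (cmap c' \o (H \o G) \o cinv c) u v.
  have h1 := chart_near CG.1 cx cb.
  have h2 : \forall u \near cmap c x, cdom c (cinv c u) /\ cdom c' (H (G (cinv c u))).
    apply: (@chart_near (H \o G)) => //.
    by move=> y; apply: continuous_comp; [exact: CG.1|exact: CH.1].
  have h3 : \forall u \near cmap c x, ccod c u.
    by apply: open_nbhs_nbhs; split; [exact: ccod_open|exists x].
  apply: filterS3 h1 h2 h3 => u [c1 c2] [_ c3] [y cy yu].
  rewrite -yu cmapK // in c2 c3 *.
  have -> : FG (cmap c y) = cmap b (G y) by rewrite /FG /= cmapK.
  have [_ dEv] := diff_chart_comp CG CH hc hb hc' cy c2 c3.
  by rewrite DHE DGE; exact: esym (dEv v).
have E0 : FG (cmap c x) = cmap b (G x) by rewrite /FG /= cmapK.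
have cDG : {for cmap c x, continuous DG}.
  by rewrite DGE; have [_ CG1] := CG; have [_ +] := CG1 c b hc hb; apply; exists x.
have cFG : {for cmap c x, continuous FG}.
  by apply: differentiable_continuous; exact: Ck_map_diff.
have near_DH eta : 0 < eta -> exists2 r, 0 < r & forall w,
    `|w - FG (cmap c x)| < r -> forall z, `|DH w z - DH (FG (cmap c x)) z| <= eta * `|z|.
  move=> eta0; have [_ CH1] := CH.
  have oU : open (cmap b @` (cdom b `&` H @^-1` cdom c')).
    apply: chart_image_open; apply: open_comp; last exact: cdom_open.
    by move=> y _; exact: CH.1.
  have Up : (cmap b @` (cdom b `&` H @^-1` cdom c')) (cmap b (G x)) by exists (G x).
  have [r r0 Hr] := C1_diff_near oU (CH1 b c' hb hc') Up eta0.
  exists r => // w; rewrite E0 DHE => /Hr[_]; exact.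
have lDH : linear (DH (FG (cmap c x))) by rewrite DHE; exact: diff_is_linear.
exact: continuous_near_eq E (cvg_linear_family cFG cDG lDH near_DH).
Qed.

Lemma Ck_map_id : Ck_map A 1 id.
Proof.
split; first by move=> x; exact: cvg_id.
by move=> c c' hc hc'; have := charts_compat hc hc' 1%N.
Qed.

Lemma Ck_map_iter (G : M -> M) k : Ck_map A 1 G -> Ck_map A 1 (iter k G).
Proof.
move=> CG; elim: k => [|k IH]; first exact: Ck_map_id.
have -> : iter k.+1 G = G \o iter k G by apply/funext.
exact: Ck_map_comp.
Qed.

(** The single parameter [d] is a radius and, through [d^-1], also a bound for the differentials; in
    this way one application of [compact_uniform] yields both. *)
Lemma C1_map_uniform (G : M -> M) eta : Ck_map A 1 G -> 0 < eta ->
  exists2 d, 0 < d & forall x a b, a \in ats -> b \in ats ->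
    inU a 2 x -> inU b 2 (G x) -> forall u v,
    `|u - cmap (ch a) x| < d -> `|v - cmap (ch a) x| < d ->
    [/\ ccod (ch a) u /\ cdom (ch b) (G (cinv (ch a) u)),
       `|chmap G a b u - chmap G a b v - dmap G a b x (u - v)| <= eta * `|u - v| &
       forall z, `|dmap G a b x z| <= d^-1 * `|z| ].
Proof.
move=> CG eta0.
apply: (compact_uniform M_compact (P := fun d x => forall a b,
    a \in ats -> b \in ats ->
    inU a 2 x -> inU b 2 (G x) -> forall u v,
    `|u - cmap (ch a) x| < d -> `|v - cmap (ch a) x| < d ->
    [/\ ccod (ch a) u /\ cdom (ch b) (G (cinv (ch a) u)),
       `|chmap G a b u - chmap G a b v - dmap G a b x (u - v)| <= eta * `|u - v| &
       forall z, `|dmap G a b x z| <= d^-1 * `|z| ])) => x0.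
pose Q a b d x := forall u v,
    `|u - cmap (ch a) x| < d -> `|v - cmap (ch a) x| < d ->
    [/\ ccod (ch a) u /\ cdom (ch b) (G (cinv (ch a) u)),
       `|chmap G a b u - chmap G a b v - dmap G a b x (u - v)| <= eta * `|u - v| &
       forall z, `|dmap G a b x z| <= d^-1 * `|z| ].
have H a b : exists2 d0, 0 < d0 & \forall x \near x0, forall d, 0 < d -> d < d0 ->
    inU a 2 x -> inU b 2 (G x) -> Q a b d x.
  have [[Kx KG]|nK] := pselect (inK a 2 x0 /\ inK b 2 (G x0)); last first.
    exists 1 => //.
    have [nK1|nK2] : ~ inK a 2 x0 \/ ~ inK b 2 (G x0).
    - by have [h|h] := pselect (inK a 2 x0); [right => h'; apply: nK|left].
    - have : \forall y \near x0, (~` inK a 2) y.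
        apply: open_nbhs_nbhs; split => //; apply: closed_openC.
        by apply: inK_closed => //; rewrite ltr_nat.
      by apply: filterS => y nKy d _ _ /inUK.
    have : \forall y \near x0, (~` inK b 2) (G y).
      apply: CG.1; apply: open_nbhs_nbhs; split => //; apply: closed_openC.
      by apply: inK_closed => //; rewrite ltr_nat.
    by apply: filterS => y nKy d _ _ _ /inUK.
  have oU : open (cmap (ch a) @` (cdom (ch a) `&` G @^-1` cdom (ch b))).
    apply: chart_image_open; apply: open_comp; last exact: cdom_open.
    by move=> y _; exact: CG.1.
  have Up : (cmap (ch a) @` (cdom (ch a) `&` G @^-1` cdom (ch b))) (cmap (ch a) x0).
    by exists x0 => //; split; [exact: Kx.1|exact: KG.1].
  have hc y : charts A (ch y) by exact: chart_at_charts.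
  have [r r0 [B B0 HB]] := C1_uniform_near oU (CG.2 _ _ (hc a) (hc b)) Up eta0.
  exists (Num.min r B^-1); first by rewrite lt_min r0 invr_gt0.
  have cc : \forall y \near x0, `|cmap (ch a) x0 - cmap (ch a) y| < r.
    by apply: cvgr_dist_lt => //; apply: cmap_continuous; case: Kx.
  apply: filterS cc => y; rewrite distrC => yr d d0.
  rewrite lt_min => /andP[dr dB] _ _ u v ud vd.
  have [[z [cz cGz] zu] e1 e2] := HB _ _ _ yr (lt_trans ud dr) (lt_trans vd dr).
  split; [|exact: e1|].
    by rewrite -zu cmapK //; split => //; exists z.
  move=> w; apply: le_trans (e2 w) _; apply: ler_wpM2r => //.
  by rewrite -[B]invrK lef_pV2 ?posrE ?invr_gt0 // ltW.
have {H}H : exists2 d0, 0 < d0 & forall a b, a \in ats -> b \in ats ->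
   \forall x \near x0, forall d, 0 < d -> d < d0 ->
    inU a 2 x -> inU b 2 (G x) -> Q a b d x.
  have H1 a (s : seq M) : exists2 d0, 0 < d0 & forall b, b \in s ->
     \forall x \near x0, forall d, 0 < d -> d < d0 ->
      inU a 2 x -> inU b 2 (G x) -> Q a b d x.
    elim: s => [|b s [d1 d10 IH]]; first by exists 1.
    have [d2 d20 H2] := H a b; exists (Num.min d1 d2); first by rewrite lt_min d10.
    move=> c; rewrite in_cons => /orP[/eqP ->|/IH].
      apply: filterS H2 => x Hx d dp; rewrite lt_min => /andP[_]; exact: Hx.
    by apply: filterS => x Hx d dp; rewrite lt_min => /andP[+ _]; exact: Hx.
  suff : forall s t : seq M, exists2 d0, 0 < d0 & forall a b, a \in s -> b \in t ->
     \forall x \near x0, forall d, 0 < d -> d < d0 ->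
      inU a 2 x -> inU b 2 (G x) -> Q a b d x by apply.
  move=> s t; elim: s => [|a s [d1 d10 IH1]]; first by exists 1.
  have [d2 d20 H2] := H1 a t.
  exists (Num.min d1 d2); first by rewrite lt_min d10.
  move=> c b; rewrite in_cons => /orP[/eqP -> bt|cs bt].
    apply: filterS (H2 b bt) => x Hx d dp; rewrite lt_min => /andP[_]; exact: Hx.
  by apply: filterS (IH1 c b cs bt) => x Hx d dp; rewrite lt_min => /andP[+ _]; exact: Hx.
have [d0 d00 Hd] := H; exists d0 => //.
have : \forall x \near x0, forall a, a \in ats -> forall b, b \in ats ->
    forall d, 0 < d -> d < d0 -> inU a 2 x -> inU b 2 (G x) -> Q a b d x.
  by apply: near_mem => a aA; apply: near_mem => b bA; exact: Hd.
apply: filterS => x Hx d dp dd a b aA bA Ua Ub; exact: Hx.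
Qed.

Lemma dmap_uniform (G : M -> M) eta : Ck_map A 1 G -> 0 < eta ->
  exists2 e, 0 < e & forall x y, dist x y < e -> forall a b, a \in ats -> b \in ats ->
    inU a 1 x -> inU b 1 (G x) ->
    [/\ inU a 2 y, inU b 2 (G y) &
     forall w, `|dmap G a b x w - dmap G a b y w| <= eta * `|w|].
Proof.
move=> CG eta0.
apply: (dist_uniform (P := fun x y => forall a b, a \in ats -> b \in ats ->
    inU a 1 x -> inU b 1 (G x) ->
    [/\ inU a 2 y, inU b 2 (G y) &
     forall w, `|dmap G a b x w - dmap G a b y w| <= eta * `|w|])) => x0.
pose good a b y := [/\ inU a 2 y, inU b 2 (G y) &
     forall w, `|dmap G a b y w - dmap G a b x0 w| <= eta / 2 * `|w|].
exists [set y | forall a, a \in ats -> forall b, b \in ats ->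
    (inK a 1 x0 /\ inK b 1 (G x0) -> good a b y) /\
    (~ (inK a 1 x0 /\ inK b 1 (G x0)) -> ~ (inK a 1 y /\ inK b 1 (G y)))].
  apply: near_mem => a aA; apply: near_mem => b bA.
  have [[Kx KG]|nK] := pselect (inK a 1 x0 /\ inK b 1 (G x0)); last first.
    have : \forall y \near x0, ~ (inK a 1 y /\ inK b 1 (G y)).
      have [nK1|nK2] : ~ inK a 1 x0 \/ ~ inK b 1 (G x0).
      - by have [h|h] := pselect (inK a 1 x0); [right => h'; apply: nK|left].
      - have : \forall y \near x0, (~` inK a 1) y.
          apply: open_nbhs_nbhs; split => //; apply: closed_openC.
          by apply: inK_closed => //; rewrite ltr1n.
        by apply: filterS => y nKy [].
      have : \forall y \near x0, (~` inK b 1) (G y).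
        apply: CG.1; apply: open_nbhs_nbhs; split => //; apply: closed_openC.
        by apply: inK_closed => //; rewrite ltr1n.
      by apply: filterS => y nKy [].
    by apply: filterS => y.
  have oU : open (cmap (ch a) @` (cdom (ch a) `&` G @^-1` cdom (ch b))).
    apply: chart_image_open; apply: open_comp; last exact: cdom_open.
    by move=> y _; exact: CG.1.
  have Up : (cmap (ch a) @` (cdom (ch a) `&` G @^-1` cdom (ch b))) (cmap (ch a) x0).
    by exists x0 => //; split; [exact: Kx.1|exact: KG.1].
  have hc y : charts A (ch y) by exact: chart_at_charts.
  have e2 : 0 < eta / 2 by rewrite divr_gt0.
  have [r r0 Hr] := C1_diff_near oU (CG.2 _ _ (hc a) (hc b)) Up e2.
  have cc : \forall y \near x0, `|cmap (ch a) x0 - cmap (ch a) y| < r.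
    by apply: cvgr_dist_lt => //; apply: cmap_continuous; case: Kx.
  have U2 : \forall y \near x0, inU a 2 y.
    apply: open_nbhs_nbhs; split; first exact: inU_open.
    by apply: inKU Kx; rewrite ltr1n.
  have V2 : \forall y \near x0, inU b 2 (G y).
    apply: CG.1; apply: open_nbhs_nbhs; split; first exact: inU_open.
    by apply: inKU KG; rewrite ltr1n.
  apply: filterS3 cc U2 V2 => y; rewrite distrC => yr U2 V2; split; last by move=> nK; case: nK.
  move=> _.
  by split => // w; exact: (Hr _ yr).2.
move=> x y Hx Hy a b aA bA Ux UGx.
have [K0|nK] := pselect (inK a 1 x0 /\ inK b 1 (G x0)); last first.
  by case: ((Hx a aA b bA).2 nK); split; exact: inUK.
have [_ _ h1] := (Hx a aA b bA).1 K0; have [U2 V2 h2] := (Hy a aA b bA).1 K0.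
split; [exact: U2|exact: V2|move=> w].
exact: half_dist (h1 w) (h2 w).
Qed.

End charts_dyn.

(** * Quadratic forms and comparison of norms *)

Lemma formE (R : realType) (n : nat) (S : 'M[R]_n) (v w : 'rV[R]_n) :
  Defs.form S v w = \sum_i \sum_j v 0 i * S i j * w 0 j.
Proof.
rewrite /Defs.form !mxE exchange_big /=; apply: eq_bigr => j _.
by rewrite !mxE mulr_suml.
Qed.

Lemma form_bilinear (R : realType) (n : nat) (S : 'M[R]_n)
    (f : 'rV[R]_n -> 'rV[R]_n) (v w : 'rV[R]_n) : linear f ->
  Defs.form S (f v) (f w) =
  Defs.form (\matrix_(i, j) Defs.form S (f (delta_mx 0 i)) (f (delta_mx 0 j))) v w.
Proof.
move=> lf; pose F : {linear 'rV[R]_n -> 'rV[R]_n} :=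
  HB.pack f (GRing.isLinear.Build R _ _ _ f lf).
rewrite [RHS]formE.
have E (u : 'rV[R]_n) : f u = \sum_i u 0 i *: f (delta_mx 0 i).
  rewrite -[f]/(F : _ -> _) {1}(row_expand u) linear_sum /=.
  by apply: eq_bigr => i _; rewrite -[f (_ *: _)]/(F _) linearZ.
rewrite (E v) (E w) /Defs.form.
rewrite mulmx_suml mulmx_suml summxE; apply: eq_bigr => i _.
rewrite linear_sum mulmx_sumr summxE; apply: eq_bigr => j _.
rewrite linearZ /= -scalemxAl -scalemxAl -scalemxAr !mxE.
by rewrite mulrA [in RHS]mulrAC.
Qed.

Lemma form_bound (R : realType) (n : nat) (S : 'M[R]_n) (e : R) (v : 'rV[R]_n) :
  (forall i j, `|S i j| <= e) -> `|Defs.form S v v| <= (n%:R ^+ 2 * e) * `|v| ^+ 2.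
Proof.
move=> Se; rewrite formE; apply: le_trans (ler_norm_sum _ _ _) _.
apply: (@le_trans _ _ (\sum_(i < n) \sum_(j < n) (e * `|v| ^+ 2))).
  apply: ler_sum => i _; apply: le_trans (ler_norm_sum _ _ _) _.
  apply: ler_sum => j _; rewrite !normrM mulrAC mulrC expr2.
  apply: ler_pM; rewrite ?mulr_ge0 //.
  by apply: ler_pM => //; exact: coord_le_norm.
rewrite !sumr_const card_ord -mulrnA -[leLHS]mulr_natr natrM.
by rewrite le_eqVlt; apply/orP; left; apply/eqP; ring.
Qed.

Lemma form_sub (R : realType) (n : nat) (S S' : 'M[R]_n) (v : 'rV[R]_n) :
  Defs.form S v v - Defs.form S' v v = Defs.form (S - S') v v.
Proof. by rewrite /Defs.form mulmxBr mulmxBl !mxE. Qed.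

Lemma form_continuous (R : realType) (n : nat) (S : 'M[R]_n) :
  continuous (fun v : 'rV[R]_n => Defs.form S v v).
Proof.
have -> : (fun v : 'rV[R]_n => Defs.form S v v) =
    (fun v : 'rV[R]_n => \sum_i \sum_j v 0 i * S i j * v 0 j).
  by apply/funext => v; exact: formE.
apply: continuous_big => [|i _]; first exact: add_continuous.
apply: continuous_big => [|j _ v]; first exact: add_continuous.
have FF : Filter (nbhs v) by apply: nbhs_filter.
apply: (@cvgM _ _ _ FF); last exact: coord_continuous.
by apply: (@cvgM _ _ _ FF); [exact: coord_continuous|exact: cvg_cst].
Qed.

(** The constant is the minimum over the compact unit sphere, which is empty exactly when
    [n = 0]. *)
Lemma form_lower (R : realType) (n : nat) (S : 'M[R]_n) :
  (forall v, v != 0 -> 0 < Defs.form S v v) ->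
  exists2 m, 0 < m & forall v, m * `|v| ^+ 2 <= Defs.form S v v.
Proof.
move=> pS; pose Sp := [set v : 'rV[R]_n | `|v| = 1].
have [[v0 v01]|H] := pselect (exists v : 'rV[R]_n, v != 0); last first.
  exists 1 => // v; have -> : v = 0.
    by apply/eqP; apply: contrapT => /negP nv; apply: H; exists v.
  by rewrite normr0 expr0n /= mulr0 /Defs.form !mul0mx mxE.
have cS : compact Sp.
  apply: bounded_closed_compact.
    exists 1; split; first exact: num_real.
    by move=> z z1 w; rewrite /Sp /= => ->; exact: ltW.
  have -> : Sp = (fun w : 'rV[R]_n => `|w|) @^-1` [set 1] by [].
  apply: preimage_closed; last exact: closed_eq.
  by move=> w _; exact: norm_continuous.
have Sn (v : 'rV[R]_n) : v != 0 -> Sp (`|v|^-1 *: v).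
  move=> v0'; rewrite /Sp /= normrZ normfV normr_id mulVf //.
  by rewrite normr_eq0.
have [|z + zmin] := compact_EVT_min (f := fun v => Defs.form S v v) (ex_intro _ _ (Sn _ v01)) cS.
  by apply: continuous_subspaceT; exact: form_continuous.
rewrite inE => Sz.
exists (Defs.form S z z).
  by apply: pS; apply/eqP => z0; move: Sz; rewrite /Sp /= z0 normr0 => /eqP; rewrite eq_sym oner_eq0.
move=> v; have [->|v0'] := eqVneq v 0.
  by rewrite normr0 expr0n /= mulr0 /Defs.form !mul0mx mxE.
have := zmin (`|v|^-1 *: v); rewrite inE => /(_ (Sn _ v0')).
have -> : Defs.form S (`|v|^-1 *: v) (`|v|^-1 *: v) = (`|v| ^+ 2)^-1 * Defs.form S v v.
  rewrite /Defs.form -!scalemxAl linearZ /= -scalemxAr !mxE mulrA.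
  by rewrite -invfM -expr2.
have n0 : 0 < `|v| ^+ 2 by rewrite exprn_gt0 // normr_gt0.
by rewrite mulrC ler_pdivlMr.
Qed.

Section metric.
Context {R : realType} {n : nat} {M : ptopologicalType}.
Variable A : smoothAtlas R n M.
Hypothesis M_hausdorff : hausdorff_space M.
Hypothesis M_compact : compact [set: M].

Local Notation ch a := (chart_at A a).
Local Notation dist := (dist A M_compact).
Local Notation ats := (ats A M_compact).
Local Notation inU := (inU A).
Local Notation inK := (inK A).
Local Notation dmap := (dmap A).
Local Notation loc := (idx A M_compact).

Lemma dmap_id a x v : cdom (ch a) x -> dmap id a a x v = v.
Proof.
move=> cx; rewrite dmapE /chmap.
have E : \forall u \near cmap (ch a) x, id u = (cmap (ch a) \o id \o cinv (ch a)) u.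
  have : \forall u \near cmap (ch a) x, ccod (ch a) u.
    by apply: open_nbhs_nbhs; split; [exact: ccod_open|exists x].
  by apply: filterS => _ [y cy <-] /=; rewrite cmapK.
have did := is_diff_id (cmap (ch a) x).
have [|_ dE] := diff_eq_at E; first exact: ex_diff.
by apply: etrans (dE v) _; rewrite diff_val.
Qed.

Lemma dmap_inv (G H : M -> M) a b x v : Ck_map A 1 G -> Ck_map A 1 H ->
  cdom (ch a) x -> cdom (ch b) (G x) -> H (G x) = x -> H \o G = id ->
  dmap H b a (G x) (dmap G a b x v) = v.
Proof.
move=> CG CH ca cb HG HGid; have ca' : cdom (ch a) (H (G x)) by rewrite HG.
by rewrite -(dmap_comp v CG CH ca cb ca') HGid dmap_id.
Qed.

Lemma dmap_idK a b x v : cdom (ch a) x -> cdom (ch b) x ->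
  dmap id b a x (dmap id a b x v) = v.
Proof.
move=> ca cb; exact: (@dmap_inv id id a b x v (Ck_map_id A) (Ck_map_id A)).
Qed.

Lemma tocE a x v : cdom (ch a) x ->
  tangent_of_chart A (ch a) (cmap (ch a) x) v = dmap id a x x v.
Proof. by move=> ca; rewrite /tangent_of_chart cmapK. Qed.

(** [gram h x] is read in the chart preferred at [x], which need not vary continuously with [x]. In
    a fixed chart of the finite atlas the Gram matrix [Gm a x] is continuous, so its bounds are
    locally uniform, hence uniform. *)
Lemma riem_norm_equiv (h : riemannianMetric A) : exists2 C, 1 <= C &
  forall x a v, a \in ats -> inU a 2 x ->
   riem_norm h x (dmap id a x x v) <= C * `|v| /\
   `|v| <= C * riem_norm h x (dmap id a x x v).
Proof.
pose Gm a x : 'M[R]_n := \matrix_(i, j) Defs.form (gram h x)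
   (dmap id a x x (delta_mx 0 i)) (dmap id a x x (delta_mx 0 j)).
have GmE a x v w : Defs.form (gram h x) (dmap id a x x v) (dmap id a x x w) = Defs.form (Gm a x) v w.
  by apply: form_bilinear; exact: dmap_linear.
have GmI a x i j : Gm a x i j = Defs.form (gram h x)
    (dmap id a x x (delta_mx 0 i)) (dmap id a x x (delta_mx 0 j)) by rewrite mxE.
have [Gm' Gm'E] : exists G, G = Gm by eexists.
rewrite -Gm'E in GmE GmI; move: Gm' {Gm'E Gm} GmE GmI => Gm GmE GmI.
have [d d0 Hd] : exists2 d : R, 0 < d & forall x a v, a \in ats -> inU a 2 x ->
    d * `|v| ^+ 2 <= Defs.form (Gm a x) v v /\ Defs.form (Gm a x) v v <= d^-1 * `|v| ^+ 2.
  apply: (compact_uniform M_compact (P := fun d x => forall a v, a \in ats -> inU a 2 x ->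
    d * `|v| ^+ 2 <= Defs.form (Gm a x) v v /\ Defs.form (Gm a x) v v <= d^-1 * `|v| ^+ 2)) => x0.
  have H a : exists2 d0, 0 < d0 & \forall x \near x0, forall d, 0 < d -> d < d0 ->
      inU a 2 x -> forall v,
      d * `|v| ^+ 2 <= Defs.form (Gm a x) v v /\ Defs.form (Gm a x) v v <= d^-1 * `|v| ^+ 2.
    have [[ca Kx]|nK] := pselect (inK a 2 x0); last first.
      exists 1 => //; have : \forall y \near x0, (~` inK a 2) y.
        apply: open_nbhs_nbhs; split => //; apply: closed_openC.
        by apply: inK_closed => //; rewrite ltr_nat.
      by apply: filterS => y nKy d _ _ /inUK.
    have [m m0 Hm] : exists2 m, 0 < m & forall v, m * `|v| ^+ 2 <= Defs.form (Gm a x0) v v.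
      apply: form_lower => v v0; rewrite -GmE; apply: gram_pos.
      apply/eqP => E; move/eqP: v0; apply.
      rewrite -(dmap_idK v ca (chart_at_dom A x0)) E.
      by have := dmap_linear A id x0 a x0 (-1) 0 0; rewrite scaler0 addr0 scaleN1r addNr.
    have n0 : 0 < m / 2 / (n%:R ^+ 2 + 1) by rewrite !divr_gt0 // ltr_wpDl.
    have near_Gm : \forall x \near x0, forall i j,
       `|Gm a x i j - Gm a x0 i j| <= m / 2 / (n%:R ^+ 2 + 1).
      apply: filter_forall => i; apply: filter_forall => j.
      have := @gram_smooth _ _ _ _ h (ch a) (delta_mx 0 i) (delta_mx 0 j)
        (chart_at_charts _ _) 0%N (cmap (ch a) x0).
      have c0 : ccod (ch a) (cmap (ch a) x0) by exists x0.
      move=> /(_ c0) H0.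
      have H1 := continuous_comp (cmap_continuous ca) H0.
      have H2 := @cvgr_dist_le _ _ _ _ (nbhs_filter x0) _ _ H1 _ n0.
      have H3 : \forall y \near x0, cdom (ch a) y.
        by apply: open_nbhs_nbhs; split => //; exact: cdom_open.
      apply: filterS2 H3 H2 => y cy /=; rewrite !cmapK // !tocE // distrC.
      by rewrite !GmI.
    pose B := opbound (fun v : 'rV[R]_n => v *m Gm a x0).
    pose K := n%:R ^+ 2 * (\sum_i \sum_j `|Gm a x0 i j|) + m.
    have K0 : 0 < K.
      by rewrite ltr_wpDl // mulr_ge0 // ?exprn_ge0 // sumr_ge0 // => i _; apply: sumr_ge0.
    exists (Num.min (m / 2) K^-1); first by rewrite lt_min invr_gt0 K0 divr_gt0.
    apply: filterS near_Gm => x Hx d d0; rewrite lt_min => /andP[dm dK] _ v.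
    have v2 : 0 <= `|v| ^+ 2 by rewrite exprn_ge0.
    have l1 : `|Defs.form (Gm a x) v v - Defs.form (Gm a x0) v v| <= m / 2 * `|v| ^+ 2.
      rewrite form_sub; apply: le_trans (form_bound (e := m / 2 / (n%:R ^+ 2 + 1)) _ _) _.
        by move=> i j; rewrite !mxE; exact: Hx.
      apply: ler_wpM2r => //; rewrite mulrCA ger_pMr ?divr_gt0 //.
      by rewrite ler_pdivrMr ?ltr_wpDl // mul1r lerDl.
    have l2 : `|Defs.form (Gm a x0) v v| <= (K - m) * `|v| ^+ 2.
      rewrite /K addrK; apply: form_bound => i j.
      rewrite (bigD1 i) //= (bigD1 j) //= -addrA lerDl.
      by rewrite addr_ge0 // ?sumr_ge0 // => k _; apply: sumr_ge0.
    have l3 := Hm v.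
    have dK' : K < d^-1 by rewrite -[K]invrK ltf_pV2 ?posrE ?invr_gt0.
    move: l1 l2 l3; move: (Defs.form _ _ _) (Defs.form _ _ _) => f1 f0.
    move=> /ler_normlP[a1 a2] /ler_normlP[a3 a4] a5.
    by move: v2; move: (`|v| ^+ 2) a1 a2 a3 a4 a5 => t *; split; nra.
  suff [d0 d00 Hd] : exists2 d0, 0 < d0 & forall a, a \in ats -> \forall x \near x0,
      forall d, 0 < d -> d < d0 -> inU a 2 x -> forall v,
      d * `|v| ^+ 2 <= Defs.form (Gm a x) v v /\ Defs.form (Gm a x) v v <= d^-1 * `|v| ^+ 2.
    exists d0 => //; have := near_mem (nbhs_filter x0) Hd.
    by apply: filterS => x Hx d dp dd a v aA Ux; exact: Hx.
  elim: (ats) => [|a s [d1 d10 IH]]; first by exists 1.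
  have [d2 d20 H2] := H a; exists (Num.min d1 d2); first by rewrite lt_min d10.
  move=> c; rewrite in_cons => /orP[/eqP ->|/IH].
    apply: filterS H2 => x Hx d dp; rewrite lt_min => /andP[_]; exact: Hx.
  by apply: filterS => x Hx d dp; rewrite lt_min => /andP[+ _]; exact: Hx.
(* Chosen so that [C >= 1] and [C ^+ 2 >= d^-1]; the square appears because norms are square roots
   of forms. *)
pose C := 1 + d^-1 + 1.
have di : 0 < d^-1 by rewrite invr_gt0.
have C1 : 1 <= C by rewrite /C; lra.
have C0 : 0 <= C by lra.
exists C => // x a v aA Ux; have [h1 h2] := Hd x a v aA Ux.
have C2 : d^-1 <= C ^+ 2 by rewrite /C; nra.
rewrite /riem_norm GmE.
have f0 : 0 <= Defs.form (Gm a x) v v by apply: le_trans h1; rewrite mulr_ge0 ?exprn_ge0 // ltW.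
split.
  rewrite -[leRHS]ger0_norm ?mulr_ge0 // -sqrtr_sqr ler_sqrt ?exprn_ge0 ?mulr_ge0 //.
  by rewrite exprMn; apply: le_trans h2 _; apply: ler_wpM2r => //; rewrite exprn_ge0.
rewrite -[leLHS]normr_id -sqrtr_sqr -[C]ger0_norm // -sqrtr_sqr -sqrtrM ?exprn_ge0 //.
rewrite ler_sqrt ?mulr_ge0 ?exprn_ge0 //.
have : `|v| ^+ 2 <= d^-1 * Defs.form (Gm a x) v v by rewrite ler_pdivlMl.
move=> /le_trans; apply; exact: ler_wpM2r.
Qed.

End metric.

(** * Hyperbolicity in charts *)

Lemma bernoulli_le (R : realType) (d : R) k : 0 <= d -> 1 + d *+ k <= (1 + d) ^+ k.
Proof.
move=> d0; elim: k => [|k IH]; first by rewrite mulr0n addr0 expr0.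
rewrite exprS mulrS; have k0 : 0 <= d *+ k by rewrite mulrn_wge0.
by move: (d *+ k) k0 IH => t t0 IH; nra.
Qed.

Lemma pow_unbounded (R : realType) (th K : R) : 1 < th ->
  exists k0 : nat, forall k, (k0 <= k)%N -> K <= th ^+ k.
Proof.
move=> th1; pose d := th - 1; have d0 : 0 < d by rewrite subr_gt0.
exists (Num.bound (K / d)) => k hk.
have -> : th = 1 + d by rewrite addrC subrK.
apply: le_trans (bernoulli_le k (ltW d0)).
have : K / d < k%:R.
  apply: le_lt_trans (ler_norm _) _; apply: lt_le_trans (archi_boundP (normr_ge0 _)) _.
  rewrite ler_nat; apply: leq_trans hk.
  by rewrite /Num.bound normr_id.
rewrite ltr_pdivrMr // => /ltW; rewrite -[d *+ k]mulr_natl; lra.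
Qed.

Section hyperbolic_data.
Context {R : realType} {n : nat} {M : ptopologicalType}.
Variable A : smoothAtlas R n M.
Hypothesis M_hausdorff : hausdorff_space M.
Hypothesis M_compact : compact [set: M].

Local Notation ch a := (chart_at A a).
Local Notation dist := (dist A M_compact).
Local Notation ats := (ats A M_compact).
Local Notation inU := (inU A).
Local Notation dmap := (dmap A).
Local Notation loc := (idx A M_compact).

(** [P] projects to the stable and [Q] to the unstable space. Backward contraction on the unstable
    space is written as forward expansion, which makes sense for non-invertible [T]; a repeller has
    [P = 0] and [Q] the identity. *)
Definition hypdata (T : M -> M) (X : set M) (h : riemannianMetric A) (th : R)
    (P Q : M -> 'rV[R]_n -> 'rV[R]_n) : Prop :=
  [/\ 1 < th,
      forall x, linear (P x) /\ linear (Q x),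
      forall x v, X x -> P x v + Q x v = v /\ P x (P x v) = P x v,
      forall x v k, X x ->
        riem_norm h (iter k T x) (tangent_map A (iter k T) x (P x v)) <=
          th ^- k * riem_norm h x (P x v) /\
        th ^+ k * riem_norm h x (Q x v) <=
          riem_norm h (iter k T x) (tangent_map A (iter k T) x (Q x v)) &
      forall x v, X x -> tangent_map A T x (P x v) = P (T x) (tangent_map A T x v)].

Lemma loc_dom x : cdom (ch (loc x)) x.
Proof. by have [] := idxU A M_compact x. Qed.

Lemma locU1 x : inU (loc x) 1 x. Proof. exact: idxU. Qed.

Lemma locU2 x : inU (loc x) 2 x.
Proof. by apply: inU_le (locU1 x); rewrite ler1n. Qed.

Lemma dmap_bound (G : M -> M) : Ck_map A 1 G -> exists2 B, 1 <= B &
  forall x a b v, a \in ats -> b \in ats -> inU a 2 x -> inU b 2 (G x) ->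
    `|dmap G a b x v| <= B * `|v|.
Proof.
move=> CG; have [d d0 Hd] := C1_map_uniform M_hausdorff M_compact CG ltr01.
exists (1 + d^-1); first by rewrite lerDl invr_ge0 ltW.
move=> x a b v aA bA Ux UGx.
have cd : `|cmap (ch a) x - cmap (ch a) x| < d by rewrite subrr normr0.
have [_ _ Hz] := Hd x a b aA bA Ux UGx _ _ cd cd.
apply: le_trans (Hz v) _; apply: ler_wpM2r => //; first by rewrite lerDr.
Qed.

Section splitting.
Variables (T : M -> M) (X : set M) (h : riemannianMetric A) (th : R).
Variables (P Q : M -> 'rV[R]_n -> 'rV[R]_n).
Hypothesis CT : Ck_map A 1 T.
Hypothesis TX : forall x, X x -> X (T x).
Hypothesis hd : hypdata T X h th P Q.

Lemma iter_stable k x : X x -> X (iter k T x).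
Proof. by move=> Xx; elim: k => //= k; exact: TX. Qed.

(** [P] and [Q] act in the chart preferred at [x]; [Pc] and [Qc] are the same projections read in
    the chart [loc x] of the finite atlas, where estimates can be uniform. *)
Definition Pc x v := dmap id x (loc x) x (P x (dmap id (loc x) x x v)).
Definition Qc x v := dmap id x (loc x) x (Q x (dmap id (loc x) x x v)).
Definition Dk k x := dmap (iter k T) (loc x) (loc (iter k T x)) x.

Lemma lin_comp (f g : 'rV[R]_n -> 'rV[R]_n) : linear f -> linear g ->
  linear (fun v => f (g v)).
Proof. by move=> lf lg a u v; rewrite lg lf. Qed.

Lemma Pc_linear x : linear (Pc x).
Proof.
have [_ /(_ x)[lP lQ] _ _ _] := hd.
apply: lin_comp; [exact: dmap_linear|apply: lin_comp => //; exact: dmap_linear].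
Qed.

Lemma Qc_linear x : linear (Qc x).
Proof.
have [_ /(_ x)[lP lQ] _ _ _] := hd.
apply: lin_comp; [exact: dmap_linear|apply: lin_comp => //; exact: dmap_linear].
Qed.

Lemma Dk_linear k x : linear (Dk k x). Proof. exact: dmap_linear. Qed.

Lemma linD (f : 'rV[R]_n -> 'rV[R]_n) u v : linear f -> f (u + v) = f u + f v.
Proof. by move=> lf; have := lf 1 u v; rewrite !scale1r. Qed.

Lemma linB (f : 'rV[R]_n -> 'rV[R]_n) u v : linear f -> f (u - v) = f u - f v.
Proof.
by move=> lf; have := lf (-1) v u; rewrite !scaleN1r (addrC (- v)) => ->; rewrite addrC.
Qed.

Lemma PcQc x v : X x -> Pc x v + Qc x v = v.
Proof.
move=> Xx; have [_ _ /(_ x (dmap id (loc x) x x v) Xx)[E _] _ _] := hd.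
rewrite /Pc /Qc -linD; last exact: dmap_linear.
by rewrite E dmap_idK //; [exact: loc_dom|exact: chart_at_dom].
Qed.

Lemma toP x v : dmap id (loc x) x x (Pc x v) = P x (dmap id (loc x) x x v).
Proof. by rewrite /Pc dmap_idK //; [exact: chart_at_dom|exact: loc_dom]. Qed.

Lemma toQ x v : dmap id (loc x) x x (Qc x v) = Q x (dmap id (loc x) x x v).
Proof. by rewrite /Qc dmap_idK //; [exact: chart_at_dom|exact: loc_dom]. Qed.

Lemma tm_to k x v : tangent_map A (iter k T) x (dmap id (loc x) x x v) =
  dmap id (loc (iter k T x)) (iter k T x) (iter k T x) (Dk k x v).
Proof.
have CI := Ck_map_id A; have Ck := Ck_map_iter k CT.
have lx := loc_dom x; have ly := loc_dom (iter k T x).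
have cx := chart_at_dom A x; have cy := chart_at_dom A (iter k T x).
have E1 := dmap_comp v CI Ck lx cx cy.
have E2 := dmap_comp v Ck CI lx ly cy.
by rewrite -[LHS]E1 -E2.
Qed.

Lemma DkP k x v : X x -> Dk k x (Pc x v) = Pc (iter k T x) (Dk k x v).
Proof.
move=> Xx; have Ck := Ck_map_iter k CT.
have invk : forall w, tangent_map A (iter k T) x (P x w) =
    P (iter k T x) (tangent_map A (iter k T) x w).
  elim: k Ck => [|k IH] Ck w.
    have E u : tangent_map A (iter 0 T) x u = u by exact: (dmap_id u (chart_at_dom A x)).
    by rewrite !E.
  have Ck' := Ck_map_iter k CT.
  have E u : tangent_map A (iter k.+1 T) x u =
      tangent_map A T (iter k T x) (tangent_map A (iter k T) x u).
    exact: (dmap_comp u Ck' CT (chart_at_dom A _) (chart_at_dom A _) (chart_at_dom A _)).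
  have [_ _ _ _ Hinv] := hd.
  by rewrite !E IH // Hinv //; exact: iter_stable.
have := invk (dmap id (loc x) x x v); rewrite -toP !tm_to -toP => E.
have := congr1 (dmap id (iter k T x) (loc (iter k T x)) (iter k T x)) E.
by rewrite !dmap_idK //; (exact: chart_at_dom || exact: loc_dom).
Qed.

Lemma DkQ k x v : X x -> Dk k x (Qc x v) = Qc (iter k T x) (Dk k x v).
Proof.
move=> Xx; have Xy := iter_stable k Xx.
have := PcQc (Dk k x v) Xy; have l := Dk_linear k x.
rewrite -{3}(PcQc v Xx) linD // DkP // => /addrI ->.
by [].
Qed.

(** The data contain no bound on the angle between the two spaces. If [Qc x v] were large compared
    with [v], then after [k0] steps its growth, against the decay of the stable part, would make the
    image of [v] larger than the bound [B] on the derivative permits. *)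
Lemma hyp_coord : exists2 C, 1 <= C & forall x v k, X x ->
  [/\ `|Dk k x (Pc x v)| <= C * th ^- k * `|Pc x v|,
      th ^+ k * `|Qc x v| <= C * `|Dk k x (Qc x v)|,
      `|Pc x v| <= C * `|v| & `|Qc x v| <= C * `|v| ].
Proof.
have [th1 _ _ Hk _] := hd.
have th0 : 0 < th by apply: lt_trans th1.
have [C0 C01 HC0] := riem_norm_equiv M_hausdorff M_compact h.
have C00 : 0 <= C0 by apply: le_trans C01.
pose C := C0 ^+ 2.
have C1 : 1 <= C by rewrite /C exprn_ege1.
have E1 x v k : X x -> `|Dk k x (Pc x v)| <= C * th ^- k * `|Pc x v|.
  move=> Xx; set y := iter k T x.
  have [_ h1] := HC0 y (loc y) (Dk k x (Pc x v)) (idx_in A M_compact y) (locU2 y).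
  have [h2 _] := HC0 x (loc x) (Pc x v) (idx_in A M_compact x) (locU2 x).
  have [h3 _] := Hk x (dmap id (loc x) x x v) k Xx.
  rewrite -/(Dk k x) -tm_to toP in h1; rewrite toP in h2.
  have tk : 0 <= th ^- k by rewrite invr_ge0 exprn_ge0 // ltW.
  apply: le_trans h1 _; rewrite /C expr2 -!mulrA; apply: ler_wpM2l => //.
  apply: le_trans h3 _; rewrite mulrCA; apply: ler_wpM2l => //.
have E2 x v k : X x -> th ^+ k * `|Qc x v| <= C * `|Dk k x (Qc x v)|.
  move=> Xx; set y := iter k T x.
  have [h1 _] := HC0 y (loc y) (Dk k x (Qc x v)) (idx_in A M_compact y) (locU2 y).
  have [_ h2] := HC0 x (loc x) (Qc x v) (idx_in A M_compact x) (locU2 x).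
  have [_ h3] := Hk x (dmap id (loc x) x x v) k Xx.
  rewrite -tm_to toQ in h1; rewrite toQ in h2.
  have tk : 0 <= th ^+ k by rewrite exprn_ge0 // ltW.
  apply: (@le_trans _ _ (th ^+ k * (C0 * riem_norm h x (Q x (dmap id (loc x) x x v))))).
    by apply: ler_wpM2l.
  rewrite mulrCA /C expr2 -mulrA; apply: ler_wpM2l => //.
  exact: le_trans h3 h1.
(* After [k0] steps the unstable part has grown by the factor [4 * C] and the stable part has shrunk
   by the same factor. *)
have [k0 Hk0] := pow_unbounded (4 * C ^+ 2) th1.
have {}Hk0 := Hk0 k0 (leqnn _).
have [B B1 HB] := dmap_bound (Ck_map_iter k0 CT).
pose K := C + C * B + 4.
have E3 x v : X x -> `|Qc x v| <= (C * B + 2) * `|v|.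
  move=> Xx; have Xy := iter_stable k0 Xx.
  have h1 := E1 x v k0 Xx; have h2 := E2 x v k0 Xx.
  have h3 : `|Dk k0 x v| <= B * `|v|.
    by apply: HB; (exact: idx_in || exact: locU2).
  have h4 : `|Dk k0 x (Qc x v)| <= `|Dk k0 x v| + `|Dk k0 x (Pc x v)|.
    rewrite -{2}(PcQc v Xx) linD; last exact: Dk_linear.
    have := ler_normB (Dk k0 x (Pc x v) + Dk k0 x (Qc x v)) (Dk k0 x (Pc x v)).
    by rewrite addrC addKr => h4.
  have h5 : `|Pc x v| <= `|v| + `|Qc x v|.
    by have := ler_normB v (Qc x v); rewrite -{1}(PcQc v Xx) addrK.
  have h6 : `|Qc x v| <= `|v| + `|Pc x v|.
    by have := ler_normB v (Pc x v); rewrite -{1}(PcQc v Xx) addrC addKr.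
  have tk : th ^- k0 * (4 * C ^+ 2) <= 1.
    by rewrite mulrC ler_pdivrMr ?exprn_gt0 // mul1r.
  have tk0 : 0 <= th ^- k0 by rewrite invr_ge0 exprn_ge0 // ltW.
  have a1 : `|Dk k0 x (Pc x v)| * (4 * C) <= `|Pc x v|.
    have := ler_wpM2r (_ : 0 <= 4 * C) h1; rewrite mulr_ge0 ?(le_trans _ C1) //.
    move=> /(_ isT) /le_trans; apply.
    have -> : C * th ^- k0 * `|Pc x v| * (4 * C) =
       (th ^- k0 * (4 * C ^+ 2)) * `|Pc x v| by ring.
    by rewrite ler_piMl.
  have a2 : (4 * C ^+ 2) * `|Qc x v| <= C * `|Dk k0 x (Qc x v)|.
    by apply: le_trans h2; apply: ler_wpM2r.
  have : 0 <= `|v| by []. have : 0 <= `|Qc x v| by []. have : 0 <= `|Pc x v| by [].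
  have : 0 <= `|Dk k0 x (Pc x v)| by []. have : 0 <= `|Dk k0 x v| by [].
  move: (`|v|) (`|Qc x v|) (`|Pc x v|) (`|Dk k0 x (Pc x v)|) (`|Dk k0 x v|)
    (`|Dk k0 x (Qc x v)|) h3 h4 h5 h6 a1 a2.
  clear - B1 C1 => v q p dp dv dq h3 h4 h5 h6 a1 a2 dv0 dp0 p0 q0 v0.
  have b1 : 4 * C * q <= dq by nra.
  have b2 : 4 * dp <= p by nra.
  have b3 : C * B * v >= B * v by nra.
  nra.
exists K; first by rewrite /K; nra.
move=> x v k Xx.
have CK : C <= K by rewrite /K; nra.
have tk0 : 0 <= th ^- k by rewrite invr_ge0 exprn_ge0 // ltW.
split.
- apply: le_trans (E1 x v k Xx) _; apply: ler_wpM2r => //; exact: ler_wpM2r.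
- by apply: le_trans (E2 x v k Xx) _; apply: ler_wpM2r.
- have := ler_normB v (Qc x v); rewrite -{1}(PcQc v Xx) addrK.
  have := E3 x v Xx; have : 0 <= `|v| by [].
  move: (`|v|) (`|Qc x v|) (`|Pc x v|) => a b c a0 h1 h2; rewrite /K; nra.
- have := E3 x v Xx; have : 0 <= `|v| by [].
  move: (`|v|) (`|Qc x v|) => a b a0 h1; rewrite /K; nra.
Qed.

End splitting.
End hyperbolic_data.

(** Once [s j <= u j] holds, it persists and [u] at least doubles at every step, so [u] is
    controlled from the end [m]. As long as it fails, [s] at least halves, so [s] is controlled from
    the start. *)
Lemma cone_sequences (R : realType) (s u : nat -> R) m :
  (forall j, 0 <= s j /\ 0 <= u j) ->
  (forall j, (j < m)%N -> s j.+1 <= s j / 4 + u j / 8 /\ 4 * u j - s j / 8 <= u j.+1) ->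
  forall j, (j <= m)%N ->
    s j + u j <= 2 * (2^-1 ^+ j * s 0%N + 2^-1 ^+ (m - j) * u m).
Proof.
move=> pos step j jm.
have grow i : (i <= m)%N -> s (m - i)%N <= u (m - i)%N -> u (m - i)%N <= 2^-1 ^+ i * u m.
  elim: i => [|i IH] im; first by rewrite subn0 expr0 mul1r.
  have E : (m - i = (m - i.+1).+1)%N by lia.
  have [|a b] := step (m - i.+1)%N; first by lia.
  rewrite -E in a b; have [p0 q0] := pos (m - i.+1)%N => su.
  have {}IH := IH (ltnW im) ltac:(lra).
  rewrite exprS -mulrA; lra.
have shrink : u j < s j -> s j <= 2^-1 ^+ j * s 0%N.
  elim: j jm => [|j IH] jm; first by rewrite expr0 mul1r.
  have [a b] := step j jm; have [p0 q0] := pos j => us.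
  have us' : u j < s j by rewrite ltNge; apply/negP => ?; lra.
  have {}IH := IH (ltnW jm) us'.
  rewrite exprS -mulrA; lra.
have [p0 _] := pos 0%N; have [_ q0] := pos m.
have e1 : 0 <= 2^-1 ^+ j * s 0%N by rewrite mulr_ge0 // exprn_ge0.
have e2 : 0 <= 2^-1 ^+ (m - j) * u m by rewrite mulr_ge0 // exprn_ge0.
have [su|us] := leP (s j) (u j); last by have := shrink us; lra.
have := grow (m - j)%N (leq_subr _ _); rewrite subKn // => /(_ su); lra.
Qed.

Section expansivity.
Context {R : realType} {n : nat} {M : ptopologicalType}.
Variable A : smoothAtlas R n M.
Hypothesis M_hausdorff : hausdorff_space M.
Hypothesis M_compact : compact [set: M].

Local Notation ch a := (chart_at A a).
Local Notation dist := (dist A M_compact).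
Local Notation ats := (ats A M_compact).
Local Notation inU := (inU A).
Local Notation dmap := (dmap A).
Local Notation loc := (idx A M_compact).

Variables (T : M -> M) (X : set M) (h : riemannianMetric A) (th : R).
Variables (P Q : M -> 'rV[R]_n -> 'rV[R]_n).
Hypothesis CT : Ck_map A 1 T.
Hypothesis TX : forall x, X x -> X (T x).
Hypothesis hd : hypdata T X h th P Q.

Local Notation Pc := (Pc A M_compact P).
Local Notation Qc := (Qc A M_compact Q).
Local Notation Dk := (Dk A M_compact T).

Lemma loc_in x : loc x \in ats. Proof. exact: idx_in. Qed.

(** A stable vector at [x], carried to a nearby [y], keeps a bounded image for [k] steps, because
    the derivatives of [iter k T] at [x] and [y] are close. An unstable component at [y] would have
    grown by [th ^+ k], so it is small. The number [k] is fixed before [e]. *)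
Lemma splitting_continuous tau : 0 < tau -> exists2 e, 0 < e &
  forall x y v, X x -> X y -> dist x y < e ->
    `|Qc y (dmap id (loc x) (loc y) x (Pc x v))| <= tau * `|Pc x v|.
Proof.
move=> tau0; have [C C1 HC] := hyp_coord M_hausdorff M_compact CT TX hd.
have [th1 _ _ _ _] := hd; have th0 : 0 < th by apply: lt_trans th1.
have [B B1 HB] := dmap_bound M_hausdorff M_compact (Ck_map_id A).
have [k Hk] := pow_unbounded (C * (B * C + B + C * C * B) / tau) th1.
have {}Hk := Hk k (leqnn k).
have [e e0 He] := dmap_uniform M_hausdorff M_compact (Ck_map_iter k CT) ltr01.
exists e => // x y v Xx Xy xy; set v' := Pc x v.
have yx : dist y x < e by rewrite distC.
have [U2 V2 Hw] := He y x yx (loc y) (loc (iter k T y)) (loc_in _) (loc_in _)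
  (locU1 _ _ _) (locU1 _ _ _).
set a := loc y in U2 V2 Hw *; set b := loc (iter k T y) in V2 Hw *.
set w := dmap id (loc x) a x v'.
have lx := loc_dom A M_compact x.
have lTx := loc_dom A M_compact (iter k T x).
have wB : `|w| <= B * `|v'|.
  by apply: HB; [exact: loc_in|exact: loc_in|exact: locU2|exact: U2].
have d1 : `|dmap (iter k T) a b x w| <= B * C * th ^- k * `|v'|.
  have -> : dmap (iter k T) a b x w = dmap (iter k T) (loc x) b x v'.
    exact/esym/(dmap_comp v' (Ck_map_id A) (Ck_map_iter k CT) lx U2.1 V2.1).
  have -> : dmap (iter k T) (loc x) b x v' =
      dmap id (loc (iter k T x)) b (iter k T x) (Dk k x v').
    exact: (dmap_comp v' (Ck_map_iter k CT) (Ck_map_id A) lx lTx V2.1).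
  apply: (@le_trans _ _ (B * `|Dk k x v'|)).
    by apply: HB; [exact: loc_in|exact: loc_in|exact: locU2|exact: V2].
  by rewrite -!mulrA ler_wpM2l ?(le_trans _ B1) // mulrA; have [] := HC x v k Xx.
have d2 : `|Dk k y w| <= B * C * th ^- k * `|v'| + B * `|v'|.
  have := Hw w; rewrite mul1r => h1.
  have -> : Dk k y w = dmap (iter k T) a b x w + (Dk k y w - dmap (iter k T) a b x w).
    by rewrite addrC subrK.
  apply: le_trans (ler_normD _ _) _; apply: lerD => //.
  exact: le_trans h1 wB.
have [h1 h2 h3 h4] := HC y w k Xy.
have tk0 : 0 <= th ^- k by rewrite invr_ge0 exprn_ge0 // ltW.
have tk1 : th ^- k <= 1 by rewrite invf_le1 ?exprn_gt0 // exprn_ege1 // ltW.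
have d3 : `|Dk k y (Qc y w)| <= `|Dk k y w| + `|Dk k y (Pc y w)|.
  have := linD (Pc y w) (Qc y w) (Dk_linear A M_compact T k y).
  rewrite (PcQc M_compact hd) // => ->; have := ler_normB (Dk k y (Pc y w) + Dk k y (Qc y w)) (Dk k y (Pc y w)).
  by rewrite addrC addKr.
have key : th ^+ k * `|Qc y w| <= C * (B * C + B + C * C * B) * `|v'|.
  apply: le_trans h2 _; rewrite -mulrA; apply: ler_wpM2l; first by rewrite (le_trans _ C1).
  apply: le_trans d3 _.
  have : 0 <= `|v'| by []. have : 0 <= `|w| by []. have : 0 <= `|Pc y w| by [].
  move: (`|v'|) (`|w|) (`|Pc y w|) (`|Dk k y w|) (`|Dk k y (Pc y w)|) (th ^- k) tk0 tk1 wB d2 h1 h3.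
  clear - B1 C1 => v w p dw dp t t0 t1 wB d2 h1 h3 p0 w0 v0.
  have a1 : B * C * t * v <= B * C * v.
    rewrite -!mulrA ler_wpM2l ?(le_trans _ B1) // ler_wpM2l ?(le_trans _ C1) //.
    by rewrite ler_piMl.
  have a2 : dp <= C * p.
    apply: le_trans h1 _; rewrite -mulrA ler_wpM2l ?(le_trans _ C1) // ler_piMl //.
  have a3 : C * p <= C * (C * (B * v)).
    by rewrite ler_wpM2l ?(le_trans _ C1) //; apply: le_trans h3 _; rewrite ler_wpM2l // (le_trans _ C1).
  lra.
have tp : 0 < th ^+ k by rewrite exprn_gt0.
rewrite -(ler_pM2l tp); apply: le_trans key _; rewrite mulrA; apply: ler_wpM2r => //.
by rewrite -ler_pdivrMr.
Qed.

Lemma chart_step (G : M -> M) eta : Ck_map A 1 G -> 0 < eta ->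
  exists2 e, 0 < e & forall x y, dist x y < e ->
   let v := cmap (ch (loc x)) y - cmap (ch (loc x)) x in
   let v1 := cmap (ch (loc (G x))) (G y) - cmap (ch (loc (G x))) (G x) in
   `|v1 - dmap G (loc x) (loc (G x)) x v| <= eta * `|v|.
Proof.
move=> CG eta0; have [d d0 Hd] := C1_map_uniform M_hausdorff M_compact CG eta0.
have [e e0 He] := chart_close A M_hausdorff M_compact d0.
exists e => // x y xy /=.
have [U2 cd] := He x y xy (loc x) (loc_in x) (locU1 _ _ _).
have cd' : `|cmap (ch (loc x)) y - cmap (ch (loc x)) x| < d by rewrite distrC.
have cd0 : `|cmap (ch (loc x)) x - cmap (ch (loc x)) x| < d by rewrite subrr normr0.
have [_ + _] := Hd x (loc x) (loc (G x)) (loc_in _) (loc_in _) (locU2 _ _ _) (locU2 _ _ _) _ _ cd' cd0.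
have lx := loc_dom A M_compact x.
by rewrite /chmap /= (cmapK lx) (cmapK U2.1).
Qed.

(** In charts the difference of the two orbits obeys the derivative up to a small relative error, so
    its stable and unstable parts satisfy the recursion of [cone_sequences]. *)
Lemma expansive_step : exists q : nat, exists C e, [/\ (0 < q)%N, 1 <= C, 0 < e &
  forall x y m, X x -> X y ->
   (forall j, (j <= m)%N -> dist (iter (q * j) T x) (iter (q * j) T y) < e) ->
   forall j, (j <= m)%N ->
    let x' := iter (q * j) T x in let y' := iter (q * j) T y in
    `|cmap (ch (loc x')) y' - cmap (ch (loc x')) x'| <=
       C * (2^-1 ^+ j + 2^-1 ^+ (m - j))].
Proof.
have [C C1 HC] := hyp_coord M_hausdorff M_compact CT TX hd.
have C0 : 0 < C by apply: lt_le_trans C1.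
have [th1 _ _ _ _] := hd; have th0 : 0 < th by apply: lt_trans th1.
(* With [8 * C <= th ^+ q] the map [iter q T] contracts and expands by 8 in charts; the error
   [(8 * C)^-1] costs another eighth after projection. This gives the coefficients of
   [cone_sequences]. *)
have [q0 Hq] := pow_unbounded (8 * C) th1.
pose q := q0.+1; have {}Hq : 8 * C <= th ^+ q by apply: Hq.
have eta0 : 0 < (8 * C)^-1 by rewrite invr_gt0 mulr_gt0.
have [e1 e10 He1] := chart_step (Ck_map_iter q CT) eta0.
have [e2 e20 He2] := chart_close A M_hausdorff M_compact ltr01.
exists q, (2 * C), (Num.min e1 e2); split => //; [lra|by rewrite lt_min e10|].
move=> x y m Xx Xy Hclose.
pose X_ j := iter (q * j) T x; pose Y_ j := iter (q * j) T y.
pose E j := cmap (ch (loc (X_ j))) (Y_ j) - cmap (ch (loc (X_ j))) (X_ j).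
have XX j : X (X_ j) by exact: (iter_stable TX (q * j) Xx).
have XS j : X_ j.+1 = iter q T (X_ j) by rewrite /X_ mulnS iterD.
have YS j : Y_ j.+1 = iter q T (Y_ j) by rewrite /Y_ mulnS iterD.
have Esmall j : (j <= m)%N -> `|E j| <= 1.
  move=> jm; have := Hclose j jm; rewrite lt_min => /andP[_ h2].
  have [_ /ltW] := He2 _ _ h2 (loc (X_ j)) (loc_in _) (locU1 _ _ _).
  by rewrite distrC.
have Estep j : (j < m)%N -> `|E j.+1 - Dk q (X_ j) (E j)| <= (8 * C)^-1 * `|E j|.
  move=> jm; have := Hclose j (ltnW jm); rewrite lt_min => /andP[h1 _].
  have H := He1 (X_ j) (Y_ j) h1.
  by rewrite /E XS YS; exact: H.
have key := @cone_sequences R (fun j => `|Pc (X_ j) (E j)|) (fun j => `|Qc (X_ j) (E j)|) m.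
have {}key : forall j, (j <= m)%N -> `|Pc (X_ j) (E j)| + `|Qc (X_ j) (E j)| <=
   2 * (2^-1 ^+ j * `|Pc (X_ 0%N) (E 0%N)| + 2^-1 ^+ (m - j) * `|Qc (X_ m) (E m)|).
  apply: key => // j jm.
  have hs := Estep j jm; have [h1 h2 _ _] := HC (X_ j) (E j) q (XX j).
  set D := E j.+1 - Dk q (X_ j) (E j) in hs.
  have [_ _ h3 h4] := HC (X_ j.+1) D 0%N (XX j.+1).
  have ED : E j.+1 = Dk q (X_ j) (E j) + D by rewrite /D addrC subrK.
  have EP : Pc (X_ j.+1) (E j.+1) = Dk q (X_ j) (Pc (X_ j) (E j)) + Pc (X_ j.+1) D.
    rewrite {1}ED (linD _ _ (Pc_linear M_compact hd (X_ j.+1))).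
    have EDk := DkP M_compact CT TX hd q (E j) (XX j).
    by rewrite -XS in EDk; rewrite EDk.
  have EQ : Qc (X_ j.+1) (E j.+1) = Dk q (X_ j) (Qc (X_ j) (E j)) + Qc (X_ j.+1) D.
    rewrite {1}ED (linD _ _ (Qc_linear M_compact hd (X_ j.+1))).
    have EDk := DkQ M_compact CT TX hd q (E j) (XX j).
    by rewrite -XS in EDk; rewrite EDk.
  have tE : `|E j| <= `|Pc (X_ j) (E j)| + `|Qc (X_ j) (E j)|.
    by rewrite -{1}(PcQc M_compact hd (E j) (XX j)) ler_normD.
  have n1 : `|Pc (X_ j.+1) (E j.+1)| <= `|Dk q (X_ j) (Pc (X_ j) (E j))| + `|Pc (X_ j.+1) D|.
    by rewrite EP ler_normD.
  have n2 : `|Dk q (X_ j) (Qc (X_ j) (E j))| - `|Qc (X_ j.+1) D| <= `|Qc (X_ j.+1) (E j.+1)|.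
    by rewrite EQ; have := lerB_normD (Dk q (X_ j) (Qc (X_ j) (E j))) (Qc (X_ j.+1) D).
  have iq : C * th ^- q <= 8^-1.
    by rewrite ler_pdivrMr ?exprn_gt0 // mulrC ler_pdivlMr // mulrC.
  have hs' : C * `|D| <= 8^-1 * `|E j|.
    have := ler_wpM2l (ltW C0) hs; rewrite mulrA invfM mulrCA mulfV ?gt_eqF // mulr1.
    by [].
  have h1' : `|Dk q (X_ j) (Pc (X_ j) (E j))| <= 8^-1 * `|Pc (X_ j) (E j)|.
    by apply: le_trans h1 _; apply: ler_wpM2r.
  have h2' : 8 * `|Qc (X_ j) (E j)| <= `|Dk q (X_ j) (Qc (X_ j) (E j))|.
    rewrite -(ler_pM2l C0); apply: le_trans h2; rewrite mulrA (mulrC C).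
    by apply: ler_wpM2r.
  move: n1 n2 h1' h2' hs' h3 h4 tE.
  have : 0 <= `|Pc (X_ j) (E j)| by []. have : 0 <= `|Qc (X_ j) (E j)| by [].
  move: (`|Pc (X_ j.+1) (E j.+1)|) (`|Qc (X_ j.+1) (E j.+1)|) (`|Pc (X_ j) (E j)|)
    (`|Qc (X_ j) (E j)|) (`|Dk q (X_ j) (Pc (X_ j) (E j))|) (`|Dk q (X_ j) (Qc (X_ j) (E j))|)
    (`|Pc (X_ j.+1) D|) (`|Qc (X_ j.+1) D|) (C * `|D|) (`|E j|).
  by clear=> *; split; lra.
move=> j jm /=; rewrite -/(X_ j) -/(Y_ j) -/(E j).
have tE : `|E j| <= `|Pc (X_ j) (E j)| + `|Qc (X_ j) (E j)|.
  by rewrite -{1}(PcQc M_compact hd (E j) (XX j)) ler_normD.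
apply: le_trans tE _; apply: le_trans (key j jm) _.
rewrite -mulrA ler_pM2l // mulrDr; apply: lerD; rewrite mulrC; apply: ler_wpM2r; rewrite ?exprn_ge0 //.
  have [_ _ h3 _] := HC (X_ 0%N) (E 0%N) 0%N (XX 0%N); apply: le_trans h3 _.
  by rewrite ger_pMr //; exact: Esmall.
have [_ _ _ h4] := HC (X_ m) (E m) 0%N (XX m); apply: le_trans h4 _.
by rewrite ger_pMr //; exact: Esmall.
Qed.

End expansivity.

(** * Expansivity and shadowing *)

Lemma fixed_point_ball (R : realType) (V : completeNormedModType R) (f : V -> V) (r : R) :
  0 <= r -> (forall z, `|z| <= r -> `|f z| <= r) ->
  (forall z z', `|z| <= r -> `|z'| <= r -> `|f z - f z'| <= 2^-1 * `|z - z'|) ->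
  exists2 z, `|z| <= r & z = f z.
Proof.
move=> r0 fr fl; pose U := [set z : V | `|z| <= r].
have fU : set_fun U U f by move=> z /= Uz; exact: fr.
pose F : {fun U >-> U} := HB.pack f (isFun.Build V V U U f fU).
have [|||z Uz zE] := @banach_fixed_point R V U F; last by exists z.
- exists (2^-1)%:nng; split; first by rewrite /= invf_lt1 // ltr1n.
  by move=> [z z'] [/= Uz Uz']; exact: fl.
- have -> : U = closed_ball_ Num.norm 0 r.
    by apply/seteqP; split=> w; rewrite /U /closed_ball_ /= sub0r normrN.
  exact: closed_closed_ball_.
- by exists 0; rewrite /U /= normr0.
Qed.

Lemma fixed_point_mx (R : realType) (m n : nat) (f : 'M[R]_(m, n) -> 'M[R]_(m, n)) (r : R) :
  0 <= r -> (forall z, `|z| <= r -> `|f z| <= r) ->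
  (forall z z', `|z| <= r -> `|z'| <= r -> `|f z - f z'| <= 2^-1 * `|z - z'|) ->
  exists2 z, `|z| <= r & z = f z.
Proof.
pose V : completeNormedModType R := HB.pack 'M[R]_(m, n).
exact: (@fixed_point_ball R V).
Qed.

Lemma row_norm_le (R : realType) (m n : nat) (Z : 'M[R]_(m, n)) i : `|row i Z| <= `|Z|.
Proof. by apply: norm_le_coord => // k j; rewrite mxE coord_le_norm. Qed.

Lemma norm_le_row (R : realType) (m n : nat) (Z : 'M[R]_(m, n)) c : 0 <= c ->
  (forall i, `|row i Z| <= c) -> `|Z| <= c.
Proof.
move=> c0 H; apply: norm_le_coord => // i j; apply: le_trans (H i).
by have := coord_le_norm (row i Z) 0 j; rewrite mxE.
Qed.

(** * The linearised equation for a cyclic orbit *)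

Section newton.
Variables (R : realType) (N n : nat) (sg sgi : 'I_N -> 'I_N).
Hypothesis sgK : cancel sgi sg.
Variables (D P Q : 'I_N -> 'rV[R]_n -> 'rV[R]_n) (C : R).
Hypothesis C1 : 1 <= C.
Hypothesis lD : forall i, linear (D i).
Hypothesis lP : forall i, linear (P i).
Hypothesis lQ : forall i, linear (Q i).
Hypothesis PQ : forall i v, P i v + Q i v = v.
Hypothesis bP : forall i v, `|P i v| <= C * `|v|.
Hypothesis bQ : forall i v, `|Q i v| <= C * `|v|.
Hypothesis h1 : forall i v, `|P (sg i) (D i (P i v))| <= 8^-1 * `|P i v|.
Hypothesis h2 : forall i v, `|Q (sg i) (D i (P i v))| <= 8^-1 * `|P i v|.
Hypothesis h3 : forall i v,
  `|P (sg i) (D i (Q i v))| <= 8^-1 * `|Q (sg i) (D i (Q i v))|.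
Hypothesis h4 : forall i v, 8 * `|Q i v| <= `|Q (sg i) (D i (Q i v))|.

Definition defect (Z : 'M[R]_(N, n)) : 'M[R]_(N, n) :=
  \matrix_(i < N, j < n) (row (sg i) Z - D i (row i Z)) 0 j.

Lemma row_defect Z i : row i (defect Z) = row (sg i) Z - D i (row i Z).
Proof. by apply/rowP => j; rewrite !mxE. Qed.

Lemma defect_linear : linear defect.
Proof.
move=> a Z Z'; apply/row_matrixP => i; rewrite row_defect linearP [RHS]linearP /= !row_defect.
by rewrite [row i (_ + _)]linearP lD /= scalerBr opprD addrACA.
Qed.

(** Let [S] and [U] be the largest stable and unstable parts. Expansion, read from [i] to [sg i],
    bounds [U] by [S] and the defect; contraction, read backwards from [i] to [sgi i], bounds [S] by
    [U] and the defect. The coefficients are small enough to solve for both. *)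
Lemma defect_bound Z : `|Z| <= 4 * C * `|defect Z|.
Proof.
pose s i := `|P i (row i Z)|; pose u i := `|Q i (row i Z)|.
pose S := \big[Num.max/0]_i s i; pose U := \big[Num.max/0]_i u i.
pose rho := C * `|defect Z|.
have C0 : 0 <= C by apply: le_trans C1.
have rho0 : 0 <= rho by rewrite mulr_ge0.
have sS i : s i <= S by apply: le_bigmax.
have uU i : u i <= U by apply: le_bigmax.
have S0 : 0 <= S by apply/bigmax_geP; left.
have U0 : 0 <= U by apply/bigmax_geP; left.
pose W i := `|Q (sg i) (D i (Q i (row i Z)))|.
have step i : s (sg i) <= 8^-1 * s i + 8^-1 * W i + rho /\
    W i - 8^-1 * s i - rho <= u (sg i).
  set z := row i Z; set d := row i (defect Z).
  have E : row (sg i) Z = D i (P i z) + D i (Q i z) + d.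
    by rewrite -linD // PQ /d row_defect addrC subrK.
  have dn : C * `|d| <= rho by rewrite ler_wpM2l // row_norm_le.
  rewrite /s /u /W E !(linD _ _ (lP _)) !(linD _ _ (lQ _)) -/z.
  have a1 := h1 i z; have a2 := h2 i z; have a3 := h3 i z.
  have b1 := le_trans (bP (sg i) d) dn; have b2 := le_trans (bQ (sg i) d) dn.
  split.
    apply: le_trans (ler_normD _ _) _; apply: lerD => //.
    by apply: le_trans (ler_normD _ _) _; apply: lerD.
  set x := Q (sg i) (D i (Q i z)).
  have := ler_normD (Q (sg i) (D i (P i z)) + x + Q (sg i) d)
     (- (Q (sg i) (D i (P i z)) + Q (sg i) d)).
  have -> : Q (sg i) (D i (P i z)) + x + Q (sg i) d -
     (Q (sg i) (D i (P i z)) + Q (sg i) d) = x.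
    by rewrite opprD addrACA subrr addr0 addrC addKr.
  have := ler_normD (Q (sg i) (D i (P i z))) (Q (sg i) d).
  rewrite normrN; move: a2 b2; clear.
  move: (`|_ + _ + _|) (`|_ + _|) (`|x|) (`|_|) (`|P i z|) (`|Q (sg i) d|).
  by move=> *; lra.
have Uq : U <= (S / 8 + rho) / 7.
  have bnd i : 8 * u i <= U + S / 8 + rho.
    have := h4 i (row i Z); rewrite -/(W i) -/(u i).
    have [_] := step i; have := uU (sg i); have := sS i; lra.
  have : U <= (U + S / 8 + rho) / 8.
    apply/bigmax_leP; split; first by rewrite divr_ge0 // !addr_ge0 // divr_ge0.
    by move=> i _; have := bnd i; lra.
  lra.
have Sq : S <= 8^-1 * S + 8^-1 * (U + S / 8 + rho) + rho.
  apply/bigmax_leP; split.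
    by rewrite !addr_ge0 // ?mulr_ge0 ?invr_ge0 // !addr_ge0 // divr_ge0.
  move=> i _; have [] := step (sgi i); rewrite sgK.
  have := uU i; have := sS (sgi i); lra.
rewrite -mulrA -/rho; apply: norm_le_row; first by rewrite mulr_ge0.
move=> i; rewrite -(PQ i (row i Z)); apply: le_trans (ler_normD _ _) _.
have := sS i; have := uU i; rewrite /s /u; lra.
Qed.

(** In finite dimension the injectivity from [defect_bound] makes [defect] invertible, with inverse
    bounded by [4 * C]; composed with [r], of Lipschitz constant [1 / (8 * C)], it contracts by a
    half. *)
Lemma newton (r : 'M[R]_(N, n) -> 'M[R]_(N, n)) (rad : R) : 0 <= rad ->
  (forall Z Z', `|Z| <= rad -> `|Z'| <= rad ->
     8 * C * `|r Z - r Z'| <= `|Z - Z'|) ->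
  8 * C * `|r 0| <= rad ->
  exists2 Z, `|Z| <= rad & defect Z = r Z.
Proof.
move=> rad0 rl r0.
pose L : {linear 'M[R]_(N, n) -> 'M[R]_(N, n)} :=
  HB.pack defect (GRing.isLinear.Build _ _ _ _ defect defect_linear).
pose F := linfun L.
have FE Z : F Z = defect Z by rewrite lfunE.
have C0 : 0 < C by apply: lt_le_trans C1.
have kF : lker F == 0%VS.
  apply/lker0P => Z Z' E; apply/eqP; rewrite -subr_eq0 -normr_le0.
  have := defect_bound (Z - Z'); rewrite -FE linearB /= E subrr normr0 mulr0.
  by [].
have K Z : defect (F^-1%VF Z) = Z by rewrite -FE lker0_lfunVK.
have invb Z : `|F^-1%VF Z| <= 4 * C * `|Z|.
  by have := defect_bound (F^-1%VF Z); rewrite K.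
have half Z Z' : `|Z| <= rad -> `|Z'| <= rad ->
    `|F^-1%VF (r Z) - F^-1%VF (r Z')| <= 2^-1 * `|Z - Z'|.
  move=> hZ hZ'; rewrite -linearB /=; apply: le_trans (invb _) _.
  have := rl Z Z' hZ hZ'; lra.
have [Z Zr|Z Z' hZ hZ'|Z Zr ZE] := @fixed_point_mx R N n (fun Z => F^-1%VF (r Z)) rad rad0.
- have := half Z 0 Zr; rewrite normr0 subr0 => /(_ rad0).
  have := invb (r 0).
  have : `|F^-1%VF (r Z)| <= `|F^-1%VF (r Z) - F^-1%VF (r 0)| + `|F^-1%VF (r 0)|.
    by have := ler_normD (F^-1%VF (r Z) - F^-1%VF (r 0)) (F^-1%VF (r 0)); rewrite subrK.
  lra.
- exact: half.
- by exists Z => //; rewrite [in LHS]ZE K.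
Qed.

End newton.

Section shadowing.
Context {R : realType} {n : nat} {M : ptopologicalType}.
Variable A : smoothAtlas R n M.
Hypothesis M_hausdorff : hausdorff_space M.
Hypothesis M_compact : compact [set: M].

Local Notation ch a := (chart_at A a).
Local Notation dist := (dist A M_compact).
Local Notation ats := (ats A M_compact).
Local Notation inU := (inU A).
Local Notation dmap := (dmap A).
Local Notation loc := (idx A M_compact).

Lemma dist_continuous_map (G : M -> M) e : continuous G -> 0 < e ->
  exists2 d, 0 < d & forall x y, dist x y < d -> dist (G x) (G y) < e.
Proof.
move=> cG e0; apply: (@dist_uniform _ _ _ A M_hausdorff M_compact (fun x y => dist (G x) (G y) < e)) => x0.
have e2 : 0 < e / 2 by rewrite divr_gt0.
exists [set y | dist (G x0) (G y) < e / 2].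
  exact: (cG _ _ (dist_near A M_hausdorff M_compact (G x0) e2)).
move=> x y /= hx hy; have := dist_tri A M_compact (G x0) (G x) (G y).
by rewrite (distC A M_compact (G x) (G x0)); lra.
Qed.

Lemma continuous_iter (G : M -> M) k : continuous G -> continuous (iter k G).
Proof.
move=> cG; elim: k => [|k IH] x; first exact: cvg_id.
by apply: (@continuous_comp _ _ _ (iter k G) G); [exact: IH|exact: cG].
Qed.

Lemma pseudo_orbit_iter (G : M -> M) k e : continuous G -> 0 < e ->
  exists2 d, 0 < d & forall w : nat -> M, (forall i, dist (G (w i)) (w i.+1) < d) ->
    forall i r, (r <= k)%N -> dist (iter r G (w i)) (w (r + i)%N) < e.
Proof.
move=> cG; elim: k e => [|k IH] e e0.
  by exists e => // w _ i r; rewrite leqn0 => /eqP -> /=; rewrite distxx.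
have e2 : 0 < e / 2 by rewrite divr_gt0.
have [d1 d10 H1] := dist_continuous_map cG e2.
have [d2 d20 H2] := IH (Num.min d1 e) ltac:(by rewrite lt_min d10).
exists (Num.min d2 (e / 2)); first by rewrite lt_min d20.
move=> w Hw i r; rewrite leq_eqVlt => /orP[/eqP ->|rk]; last first.
  have /H2/(_ i r rk) : forall i, dist (G (w i)) (w i.+1) < d2.
    by move=> j; have := Hw j; rewrite lt_min => /andP[].
  by rewrite lt_min => /andP[].
have /H2/(_ i k (leqnn k)) : forall i, dist (G (w i)) (w i.+1) < d2.
  by move=> j; have := Hw j; rewrite lt_min => /andP[].
rewrite lt_min => /andP[/H1 h1 _].
have := Hw (k + i)%N; rewrite lt_min => /andP[_ h2].
have := dist_tri A M_compact (G (w (k + i)%N)) (iter k.+1 G (w i)) (w (k.+1 + i)%N).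
by rewrite /= addSn; move: h1 h2; rewrite /=; lra.
Qed.

Section splitting.
Variables (T : M -> M) (X : set M) (h : riemannianMetric A) (th : R).
Variables (P Q : M -> 'rV[R]_n -> 'rV[R]_n).
Hypothesis CT : Ck_map A 1 T.
Hypothesis TX : forall x, X x -> X (T x).
Hypothesis hd : hypdata T X h th P Q.

Local Notation Pc := (Pc A M_compact P).
Local Notation Qc := (Qc A M_compact Q).
Local Notation Dk := (Dk A M_compact T).

(** Continuity of the unstable spaces. It is trivial when [P = 0], and for a diffeomorphism it is
    [splitting_continuous] for the inverse. *)
Hypothesis cone : forall tau, 0 < tau -> exists2 e, 0 < e &
  forall x y v, X x -> X y -> dist x y < e ->
    `|Pc y (dmap id (loc x) (loc y) x (Qc x v))| <= tau * `|Qc x v|.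

(** Writing [p i] as [o i + row i Z] in the chart at [w i], the equation for a true cyclic orbit
    becomes [defect Z = r Z] with a small nonlinear remainder [r], which [newton] solves. *)
Lemma shadow_step : exists2 q, (0 < q)%N & forall beta, 0 < beta ->
  exists2 alpha, 0 < alpha & forall N (w : 'I_N -> M), (forall i, X (w i)) ->
   (forall i, dist (iter q T (w i)) (w (ordS i)) < alpha) ->
   exists p : 'I_N -> M, forall i,
     iter q T (p i) = p (ordS i) /\ dist (p i) (w i) < beta.
Proof.
have [C C1 HC] := hyp_coord M_hausdorff M_compact CT TX hd.
have C0 : 0 < C by apply: lt_le_trans C1.
have [th1 _ _ _ _] := hd; have th0 : 0 < th by apply: lt_trans th1.
have [B B1 HB] := dmap_bound M_hausdorff M_compact (Ck_map_id A).
have B0 : 0 < B by apply: lt_le_trans B1.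
(* [B] pays for changing charts between [G (w i)] and [w (ordS i)], [C ^+ 2] for the estimates of
   [hyp_coord], and a factor 2 for the cone condition; the 8 that [newton] requires is left. *)
have [q0 Hq] := pow_unbounded (16 * B * C ^+ 2) th1.
pose q := q0.+1; have {}Hq : 16 * B * C ^+ 2 <= th ^+ q by apply: Hq.
have tq0 : 0 < th ^+ q by rewrite exprn_gt0.
exists q => // beta beta0.
have CG := Ck_map_iter q CT; set G := iter q T in CG *.
have tau0 : 0 < (16 * B)^-1 by rewrite invr_gt0 mulr_gt0.
have [ec ec0 Hc] := cone tau0.
have eta0 : 0 < (8 * C)^-1 by rewrite invr_gt0 mulr_gt0.
have [d1 d10 Hd1] := C1_map_uniform M_hausdorff M_compact CG eta0.
have [d2 d20 Hd2] := chart_inv_close A M_hausdorff M_compact beta0.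
pose rad := Num.min d1 d2 / 2.
have rad0 : 0 < rad by rewrite divr_gt0 // lt_min d10.
have radd1 : rad < d1 by have := ge_min d1 d1 d2; rewrite lexx /rad /=; lra.
have radd2 : rad < d2 by have := ge_min d2 d1 d2; rewrite lexx orbT /rad /=; lra.
have al0 : 0 < rad / (8 * C) by rewrite divr_gt0 // mulr_gt0.
have [e1 e10 He1] := chart_close A M_hausdorff M_compact al0.
exists (Num.min ec e1); first by rewrite lt_min ec0.
move=> N w Xw ps.
have psc i : dist (G (w i)) (w (ordS i)) < ec by have := ps i; rewrite lt_min => /andP[].
have ps1 i : dist (w (ordS i)) (G (w i)) < e1.
  by have := ps i; rewrite lt_min distC => /andP[_]; rewrite distC.
have XG i : X (G (w i)) by apply: iter_stable.
have U2 i : inU (loc (w (ordS i))) 2 (G (w i)).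
  by have [] := He1 _ _ (ps1 i) _ (loc_in A M_compact _) (locU1 A M_compact _).
pose o i := cmap (ch (loc (w i))) (w i).
pose D i := dmap G (loc (w i)) (loc (w (ordS i))) (w i).
pose Th i := dmap id (loc (G (w i))) (loc (w (ordS i))) (G (w i)).
have DE i v : D i v = Th i (Dk q (w i) v).
  have lx := loc_dom A M_compact (w i); have lz := loc_dom A M_compact (G (w i)).
  exact: (dmap_comp v CG (Ck_map_id A) lx lz (U2 i).1).
have ThB i v : `|Th i v| <= B * `|v|.
  by apply: HB; [exact: loc_in|exact: loc_in|exact: locU2|exact: U2].
have ThI i v : `|v| <= B * `|Th i v|.
  have := dmap_idK v (loc_dom A M_compact (G (w i))) (U2 i).1 => E.
  rewrite -{1}E; apply: HB; [exact: loc_in|exact: loc_in|exact: U2|exact: locU2].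
have iq : 16 * (B * C ^+ 2) * th ^- q <= 1 by rewrite ler_pdivrMr // mul1r mulrA.
have lD i : linear (D i) by exact: dmap_linear.
have lP i : linear (Pc (w i)) by exact: (Pc_linear M_compact hd).
have lQ i : linear (Qc (w i)) by exact: (Qc_linear M_compact hd).
have PQ i v : Pc (w i) v + Qc (w i) v = v by exact: (PcQc M_compact hd).
have bP i v : `|Pc (w i) v| <= C * `|v| by have [] := HC (w i) v 0%N (Xw i).
have bQ i v : `|Qc (w i) v| <= C * `|v| by have [] := HC (w i) v 0%N (Xw i).
have DPb i v : `|D i (Pc (w i) v)| <= B * (C * th ^- q * `|Pc (w i) v|).
  rewrite DE; apply: le_trans (ThB _ _) _; apply: ler_wpM2l; first exact: ltW.
  by have [] := HC (w i) v q (Xw i).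
have small i v : C * (B * (C * th ^- q * `|Pc (w i) v|)) <= 8^-1 * `|Pc (w i) v|.
  have -> : C * (B * (C * th ^- q * `|Pc (w i) v|)) =
    (B * C ^+ 2 * th ^- q) * `|Pc (w i) v| by ring.
  by apply: ler_wpM2r => //; lra.
have h1 i v : `|Pc (w (ordS i)) (D i (Pc (w i) v))| <= 8^-1 * `|Pc (w i) v|.
  apply: le_trans (bP _ _) _; apply: le_trans (small i v).
  apply: ler_wpM2l; [exact: ltW|exact: DPb].
have h2 i v : `|Qc (w (ordS i)) (D i (Pc (w i) v))| <= 8^-1 * `|Pc (w i) v|.
  apply: le_trans (bQ _ _) _; apply: le_trans (small i v).
  apply: ler_wpM2l; [exact: ltW|exact: DPb].
(* By the cone condition the stable part of the transported vector [Th i ww] is a small fraction of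
   [ww], so its unstable part keeps at least the share [1 / (2 * B)] of the length of [ww]. *)
have hw i v : `|Pc (w (ordS i)) (D i (Qc (w i) v))| <= (16 * B)^-1 * `|Dk q (w i) (Qc (w i) v)| /\
   `|Dk q (w i) (Qc (w i) v)| <= 2 * B * `|Qc (w (ordS i)) (D i (Qc (w i) v))|.
  have DQ := DkQ M_compact CT TX hd q v (Xw i); rewrite DE.
  set ww := Dk q (w i) (Qc (w i) v) in DQ *.
  have a1 : `|Pc (w (ordS i)) (Th i ww)| <= (16 * B)^-1 * `|ww|.
    by rewrite DQ; apply: Hc; [exact: XG|exact: Xw|exact: psc].
  split => //.
  have a2 := ThI i ww.
  have a3 : `|Th i ww| <= `|Pc (w (ordS i)) (Th i ww)| + `|Qc (w (ordS i)) (Th i ww)|.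
    by rewrite -{1}(PQ (ordS i) (Th i ww)) ler_normD.
  have a4 : B * `|Pc (w (ordS i)) (Th i ww)| <= 16^-1 * `|ww|.
    apply: le_trans (ler_wpM2l (ltW B0) a1) _.
    by rewrite invfM mulrA mulrCA mulfV ?gt_eqF // mulr1.
  have a5 := ler_wpM2l (ltW B0) a3; rewrite mulrDr in a5.
  have : 0 <= `|ww| by [].
  rewrite -mulrA; lra.
have h3 i v : `|Pc (w (ordS i)) (D i (Qc (w i) v))| <=
    8^-1 * `|Qc (w (ordS i)) (D i (Qc (w i) v))|.
  have [a1 a2] := hw i v; apply: le_trans a1 _.
  have := ler_wpM2l (ltW tau0) a2; move=> /le_trans; apply.
  rewrite mulrA; apply: ler_wpM2r => //.
  by rewrite invfM [2 * B]mulrC mulrA mulfVK ?gt_eqF //; lra.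
have h4 i v : 8 * `|Qc (w i) v| <= `|Qc (w (ordS i)) (D i (Qc (w i) v))|.
  have [a1 a2] := hw i v; have [_ a3 _ _] := HC (w i) v q (Xw i).
  have a4 := le_trans a3 (ler_wpM2l (ltW C0) a2).
  have a5 : 16 * B * C ^+ 2 * `|Qc (w i) v| <= th ^+ q * `|Qc (w i) v| by apply: ler_wpM2r.
  have := le_trans a5 a4.
  have -> : 16 * B * C ^+ 2 * `|Qc (w i) v| = (2 * B * C) * (8 * C * `|Qc (w i) v|) by ring.
  have -> : C * (2 * B * `|Qc (w (ordS i)) (D i (Qc (w i) v))|) =
    (2 * B * C) * `|Qc (w (ordS i)) (D i (Qc (w i) v))| by ring.
  rewrite ler_pM2l ?mulr_gt0 //; apply: le_trans.
  by rewrite -mulrA ler_pM2l // ler_peMl.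
pose F i := chmap A G (loc (w i)) (loc (w (ordS i))).
(* Chosen so that [defect Z = r Z] says exactly that [F i] maps [o i + row i Z] to
   [o (ordS i) + row (ordS i) Z]. *)
pose r (Z : 'M[R]_(N, n)) : 'M[R]_(N, n) :=
  \matrix_(i < N, j < n) (F i (o i + row i Z) - o (ordS i) - D i (row i Z)) 0 j.
have rE Z i : row i (r Z) = F i (o i + row i Z) - o (ordS i) - D i (row i Z).
  by apply/rowP => j; rewrite !mxE.
have inrad (Z : 'M[R]_(N, n)) i : `|Z| <= rad -> `|o i + row i Z - o i| <= rad.
  by move=> Zr; rewrite addrC addKr; apply: le_trans (row_norm_le _ _) Zr.
have Fest i u v : `|u - o i| <= rad -> `|v - o i| <= rad ->
    [/\ ccod (ch (loc (w i))) u /\ cdom (ch (loc (w (ordS i)))) (G (cinv (ch (loc (w i))) u)) &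
     `|F i u - F i v - D i (u - v)| <= (8 * C)^-1 * `|u - v| ].
  move=> hu hv.
  by have [] := Hd1 (w i) _ _ (loc_in A M_compact _) (loc_in A M_compact _)
    (locU2 A M_compact _) (U2 i) u v (le_lt_trans hu radd1) (le_lt_trans hv radd1).
have C8 : 0 < 8 * C by rewrite mulr_gt0.
have rl Z Z' : `|Z| <= rad -> `|Z'| <= rad -> 8 * C * `|r Z - r Z'| <= `|Z - Z'|.
  move=> hZ hZ'; rewrite -ler_pdivlMl //; apply: norm_le_row.
    by rewrite mulr_ge0 // ltW.
  move=> i; have -> : row i (r Z - r Z') = row i (r Z) - row i (r Z') by apply/rowP => j; rewrite !mxE.
  rewrite !rE.
  have [_ H] := Fest i _ _ (inrad Z i hZ) (inrad Z' i hZ').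
  have E : o i + row i Z - (o i + row i Z') = row i (Z - Z').
    by apply/rowP => j; rewrite !mxE; ring.
  rewrite E in H.
  have -> : F i (o i + row i Z) - o (ordS i) - D i (row i Z) -
     (F i (o i + row i Z') - o (ordS i) - D i (row i Z')) =
     F i (o i + row i Z) - F i (o i + row i Z') - D i (row i (Z - Z')).
    have -> : row i (Z - Z') = row i Z - row i Z' by apply/rowP => j; rewrite !mxE.
    rewrite (linB _ _ (lD i)); move: (F i (o i + row i Z)) (F i (o i + row i Z')) (D i (row i Z))
      (D i (row i Z')) (o (ordS i)) => a b c d e.
    by apply/rowP => j; rewrite !mxE; ring.
  apply: le_trans H _; apply: ler_wpM2l; [exact: ltW|exact: row_norm_le].
have r0 : 8 * C * `|r 0| <= rad.
  rewrite -ler_pdivlMl // mulrC; apply: norm_le_row; first exact: ltW.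
  move=> i; rewrite rE.
  have -> : row i (0 : 'M[R]_(N, n)) = 0 by apply/rowP => j; rewrite !mxE.
  have -> : D i 0 = 0 by have := linB 0 0 (lD i); rewrite !subrr.
  rewrite subr0 addr0.
  have [_ /ltW] := He1 _ _ (ps1 i) _ (loc_in A M_compact _) (locU1 A M_compact _).
  rewrite distrC /F /o /chmap /= (cmapK (loc_dom A M_compact (w i))).
  by [].
have [Z Zr ZE] := newton (@ord_predK N) C1 lD lP lQ PQ bP bQ h1 h2 h3 h4 (ltW rad0) rl r0.
pose u i := o i + row i Z.
have urad i : `|u i - o i| <= rad by exact: inrad.
exists (fun i => cinv (ch (loc (w i))) (u i)) => i.
have [[cu cGu] _] := Fest i (u i) (u i) (urad i) (urad i).
split; last first.
  by have [] := Hd2 (w i) (loc (w i)) (u i) (loc_in _ _ _) (locU1 _ _ _) (le_lt_trans (urad i) radd2).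
have E : F i (u i) = u (ordS i).
  have := congr1 (row i) ZE; rewrite row_defect rE => /eqP.
  rewrite (inj_eq (addIr _)) => /eqP; rewrite /u => ->.
  by rewrite [RHS]addrC subrK.
by rewrite -E /F /chmap /= cmapK.
Qed.

(** [shadow_step] treats [iter q T]; the times in between follow by continuity. Sampling [w] at
    multiples of [q] keeps the period [N], since [q * N] is also a period of [w]. That the shadowing
    point is periodic places it in the non-wandering set in the Axiom A case. *)
Lemma periodic_shadowing beta : 0 < beta ->
  exists2 alpha, 0 < alpha & forall N (w : nat -> M), (0 < N)%N ->
   (forall i, X (w i)) -> (forall i, w (i + N)%N = w i) ->
   (forall i, dist (T (w i)) (w i.+1) < alpha) ->
   exists2 x, (exists2 k, (0 < k)%N & iter k T x = x) &
     forall i, dist (iter i T x) (w i) < beta.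
Proof.
move=> beta0; have [q q0 Hq] := shadow_step.
have cT : continuous T by case: CT.
have b2 : 0 < beta / 2 by rewrite divr_gt0.
have [d1 d10 Hd1] : exists2 d, 0 < d & forall r, (r <= q)%N -> forall x y,
    dist x y < d -> dist (iter r T x) (iter r T y) < beta / 2.
  elim: (q) => [|k [d d0 IH]].
    exists (beta / 2) => // r; rewrite leqn0 => /eqP -> x y; exact.
  have [d' d'0 H'] := dist_continuous_map (@continuous_iter T k.+1 cT) b2.
  exists (Num.min d d'); first by rewrite lt_min d0.
  move=> r; rewrite leq_eqVlt => /orP[/eqP ->|rk] x y; rewrite lt_min => /andP[h1 h2].
    exact: H'.
  exact: IH.
have [a1 a10 Ha1] := Hq d1 d10.
have [a2 a20 Ha2] := @pseudo_orbit_iter T q (Num.min a1 (beta / 2)) cT ltac:(by rewrite lt_min a10).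
exists a2 => // N w N0 Xw perw psw.
have {}Ha2 := Ha2 w psw.
have perw' i k : w (i + k * N)%N = w i.
  by elim: k => [|k IH]; [rewrite mul0n addn0|rewrite mulSn addnCA addnC perw].
case: N N0 perw perw' => // N _ perw perw'.
pose v (i : 'I_N.+1) := w (q * i)%N.
have vS i : v (ordS i) = w (q * i.+1)%N.
  rewrite /v /= [in RHS](divn_eq i.+1 N.+1) mulnDr addnC mulnA perw'.
  by [].
have [||p Hp] := Ha1 N.+1 v.
- by move=> i; exact: Xw.
- move=> i; rewrite vS mulnS; have := Ha2 (q * i)%N q (leqnn q).
  by rewrite lt_min => /andP[].
pose x := p ord0.
have px k : iter (q * k) T x = p (inord (k %% N.+1)).
  elim: k => [|k IH].
    by rewrite muln0 /= mod0n; congr p; apply/val_inj; rewrite /= inordK.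
  rewrite mulnS iterD IH; have [-> _] := Hp (inord (k %% N.+1)).
  congr p; apply/val_inj; rewrite /= !inordK ?ltn_pmod //.
  by rewrite -[(k %% N.+1).+1]addn1 modnDml addn1.
exists x.
  exists (q * N.+1)%N; first by rewrite muln_gt0 q0.
  by rewrite px modnn /x; congr p; apply/val_inj; rewrite /= inordK.
move=> i; rewrite {1}(divn_eq i q) mulnC addnC iterD px.
have [_ h1] := Hp (inord ((i %/ q) %% N.+1)).
have r_le : (i %% q <= q)%N by rewrite ltnW // ltn_pmod.
have h2 := Hd1 _ r_le _ _ h1.
have E : v (inord ((i %/ q) %% N.+1)) = w (q * (i %/ q))%N.
  rewrite /v inordK ?ltn_pmod // [in RHS](divn_eq (i %/ q) N.+1) mulnDr addnC mulnA perw'.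
  by [].
rewrite E in h2.
have := Ha2 (q * (i %/ q))%N _ r_le; rewrite lt_min => /andP[_].
have -> : (i %% q + q * (i %/ q))%N = i by rewrite addnC mulnC -divn_eq.
have := dist_tri A M_compact (iter (i %% q) T (w (q * (i %/ q))%N))
  (iter (i %% q) T (p (inord ((i %/ q) %% N.+1)))) (w i).
lra.
Qed.

End splitting.
End shadowing.

(** * Repellers and Axiom A diffeomorphisms *)

Section hyperbolic_sets.
Context {R : realType} {n : nat} {M : ptopologicalType}.
Variable A : smoothAtlas R n M.
Hypothesis M_hausdorff : hausdorff_space M.
Hypothesis M_compact : compact [set: M].

Local Notation ch a := (chart_at A a).
Local Notation dist := (dist A M_compact).
Local Notation dmap := (dmap A).
Local Notation loc := (idx A M_compact).

(* Everything that the dynamical part of the proof uses about [T] on [X]. *)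
Definition metric_hyperbolic (T : M -> M) (X : set M) : Prop :=
  [/\ closed X, continuous T, forall x, X x -> X (T x),
    forall y, X y -> exists2 x, X x & T x = y &
   (exists q : nat, exists C e, [/\ (0 < q)%N, 1 <= C, 0 < e &
    forall x y m, X x -> X y ->
     (forall j, (j <= m)%N -> dist (iter (q * j) T x) (iter (q * j) T y) < e) ->
     forall j, (j <= m)%N ->
      let x' := iter (q * j) T x in let y' := iter (q * j) T y in
      `|cmap (ch (loc x')) y' - cmap (ch (loc x')) x'| <=
         C * (2^-1 ^+ j + 2^-1 ^+ (m - j))]) /\
   (forall beta, 0 < beta -> exists2 alpha, 0 < alpha &
     forall N (w : nat -> M), (0 < N)%N ->
      (forall i, X (w i)) -> (forall i, w (i + N)%N = w i) ->
      (forall i, dist (T (w i)) (w i.+1) < alpha) ->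
      exists2 x, X x & forall i, dist (iter i T x) (w i) < beta)].

Section repeller.
Variables (T : M -> M) (X : set M).
Hypothesis rep : repeller A T X.
Hypothesis mix : top_mixing T X.

Lemma repeller_stable x : X x -> X (T x).
Proof.
have [_ _ E _ _] := rep => Xx.
by have : (T @^-1` X) x by rewrite E.
Qed.

(** The image of [X] is compact, so a missed point would have an open neighbourhood that no positive
    iterate of [X] ever meets. *)
Lemma mixing_onto : closed X -> continuous T -> (forall x, X x -> X (T x)) ->
  forall y, X y -> exists2 x, X x & T x = y.
Proof.
move=> cX cT TX y Xy; apply: contrapT => nex.
have cTX : closed (T @` X).
  apply: compact_closed => //; apply: continuous_compact.
    by apply: continuous_subspaceT.
  exact: (subclosed_compact cX M_compact).
have [||N HN] := mix openT (closed_openC cTX).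
- by exists y; split.
- by exists y; split => // -[x Xx Txy]; apply: nex; exists x.
- have [z [[Xz _] nz]] := HN N.+1 (leqnSn N).
  by apply: nz; exists (iter N T z) => //; exact: iter_stable.
Qed.

Lemma riem_norm0 (h : riemannianMetric A) x : riem_norm h x 0 = 0.
Proof. by rewrite /riem_norm /Defs.form !mul0mx mxE sqrtr0. Qed.

Lemma tangent_map_linear (G : M -> M) x : linear (tangent_map A G x).
Proof. exact: dmap_linear. Qed.

Lemma lin0 (f : 'rV[R]_n -> 'rV[R]_n) : linear f -> f 0 = 0.
Proof. by move=> lf; have := linB 0 0 lf; rewrite !subrr. Qed.

Lemma repeller_hyperbolic : metric_hyperbolic T X.
Proof.
have [CT cX TX [h [th th1 Hth]] [V [oV XV XE]]] := rep.
have clX : closed X by apply: compact_closed.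
have stab := repeller_stable.
have hd : hypdata T X h th (fun _ _ => 0) (fun _ v => v).
  split => //.
  - by move=> x; split => // a u v; rewrite scaler0 addr0.
  - by move=> x v _; rewrite add0r.
  - move=> x v k Xx; split; last exact: Hth.
    by rewrite (lin0 (tangent_map_linear _ _)) !riem_norm0 mulr0.
  - by move=> x v Xx; rewrite (lin0 (tangent_map_linear _ _)).
have cone : forall tau, 0 < tau -> exists2 e, 0 < e &
  forall x y v, X x -> X y -> dist x y < e ->
    `|Pc A M_compact (fun _ _ => 0) y (dmap id (loc x) (loc y) x
        (Qc A M_compact (fun _ v => v) x v))| <= tau * `|Qc A M_compact (fun _ v => v) x v|.
  move=> tau tau0; exists 1 => // x y v _ _ _.
  by rewrite /Pc (lin0 (dmap_linear _ _ _ _ _)) normr0 mulr_ge0 // ltW.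
have cT : continuous T by case: CT.
split => //; first exact: mixing_onto.
split; first exact: (expansive_step M_hausdorff M_compact CT stab hd).
move=> beta beta0.
(* Maximality of the repeller: an orbit that stays within [e] of [X] stays in [V], hence lies in
   [X]. *)
have [e e0 He] : exists2 e, 0 < e & forall x, X x -> forall y, dist x y < e -> V y.
  apply: (compact_uniform M_compact (P := fun e x => X x -> forall y, dist x y < e -> V y)).
  move=> x0; have [Xx0|nX] := pselect (X x0); last first.
    exists 1 => //; have : \forall x \near x0, (~` X) x.
      by apply: open_nbhs_nbhs; split => //; exact: closed_openC.
    by apply: filterS => x nXx d _ _ /nXx.
  have nV : nbhs x0 V by apply: open_nbhs_nbhs; split => //; exact: XV.
  have [e1 e10 He1] := nbhs_dist A M_hausdorff M_compact nV.
  have e2 : 0 < e1 / 2 by rewrite divr_gt0.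
  exists (e1 / 2) => //; have := dist_near A M_hausdorff M_compact x0 e2.
  apply: filterS => x hx d d0 dd _ y hy; apply: He1.
  have := dist_tri A M_compact x x0 y; lra.
have [al al0 Hal] := periodic_shadowing M_hausdorff CT stab hd cone
  (ltac:(by rewrite lt_min beta0 e0) : 0 < Num.min beta e).
exists al => // N w N0 Xw per ps; have [x _ Hx] := Hal N w N0 Xw per ps.
have VT i : V (iter i T x).
  have := Hx i; rewrite lt_min => /andP[_ h1]; apply: (He (w i)); first exact: Xw.
  by rewrite distC.
exists x; first by rewrite XE; split => //; exact: (VT 0%N).
by move=> i; have := Hx i; rewrite lt_min => /andP[].
Qed.
End repeller.

Section axiomA.
Variables (X : set M) (h : riemannianMetric A) (th : R).

(** The conditions are symmetric under exchanging [T] with [S] and [W] with [W'], so that statements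
    on stable spaces also apply to the inverse. *)
Definition two_sided (T S : M -> M) (W W' : M -> {vspace 'rV[R]_n}) : Prop :=
  [/\ [/\ cancel T S, cancel S T, Ck_map A 1 T & Ck_map A 1 S],
    (forall x, X x -> X (T x)) /\ (forall x, X x -> X (S x)),
    forall x, X x -> (W x :&: W' x = 0 /\ W x + W' x = fullv)%VS,
    (forall x, X x -> tangent_map A T x @` [set v | v \in W x] = [set v | v \in W (T x)]) /\
    (forall x, X x -> tangent_map A T x @` [set v | v \in W' x] = [set v | v \in W' (T x)]) &
    (forall x v k, X x -> v \in W' x ->
       riem_norm h (iter k S x) (tangent_map A (iter k S) x v) <= th ^- k * riem_norm h x v) /\
    (forall x v k, X x -> v \in W x ->
       riem_norm h (iter k T x) (tangent_map A (iter k T) x v) <= th ^- k * riem_norm h x v) ].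

Lemma tangent_map_inv (T S : M -> M) x v : cancel T S -> Ck_map A 1 T -> Ck_map A 1 S ->
  tangent_map A S (T x) (tangent_map A T x v) = v.
Proof.
move=> TK CT CS; have SE : S (T x) = x by exact: TK.
rewrite /tangent_map SE.
apply: (dmap_inv v CT CS (chart_at_dom A x) (chart_at_dom A (T x)) SE).
by apply/funext => z; exact: TK.
Qed.

Lemma iter_cancel (T S : M -> M) k : cancel T S -> cancel (iter k T) (iter k S).
Proof. by move=> TK; elim: k => // k IH x; rewrite iterSr /= TK IH. Qed.

Lemma two_sided_sym T S W W' : two_sided T S W W' -> two_sided S T W' W.
Proof.
move=> [[TK SK CT CS] [TX SX] dir [iW iW'] [b1 b2]]; split => //.
- by move=> x Xx; have [h1 h2] := dir x Xx; rewrite capvC addvC.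
- have inv (U : M -> {vspace 'rV[R]_n}) :
    (forall x, X x -> tangent_map A T x @` [set v | v \in U x] = [set v | v \in U (T x)]) ->
    (forall x, X x -> tangent_map A S x @` [set v | v \in U x] = [set v | v \in U (S x)]).
    move=> H x Xx; have HS := H (S x) (SX x Xx); rewrite SK in HS.
    have KS v : tangent_map A S x (tangent_map A T (S x) v) = v.
      by have := tangent_map_inv (S x) v TK CT CS; rewrite SK.
    apply/seteqP; split=> [_ [v Uv <-]|v Uv].
      have : [set v | v \in U x] v by [].
      by rewrite -HS => -[u Uu <-]; rewrite KS.
    exists (tangent_map A T (S x) v) => //.
    have : (tangent_map A T (S x) @` [set v | v \in U (S x)]) (tangent_map A T (S x) v) by exists v.
    by rewrite HS.
  by split; exact: inv.
Qed.

Definition pr (W W' : M -> {vspace 'rV[R]_n}) x v := daddv_pi (W x) (W' x) v.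

Lemma two_sided_hypdata T S W W' : 1 < th -> two_sided T S W W' ->
  hypdata T X h th (pr W W') (pr W' W).
Proof.
move=> th1 [[TK SK CT CS] [TX SX] dir [iW iW'] [b1 b2]].
have inv (U : M -> {vspace 'rV[R]_n}) :
    (forall x, X x -> tangent_map A T x @` [set v | v \in U x] = [set v | v \in U (T x)]) ->
    forall x v, X x -> v \in U x -> tangent_map A T x v \in U (T x).
  move=> H x v Xx Uv.
  have : (tangent_map A T x @` [set v | v \in U x]) (tangent_map A T x v) by exists v.
  by rewrite H.
have tmS k x v : tangent_map A (iter k.+1 T) x v =
    tangent_map A T (iter k T x) (tangent_map A (iter k T) x v).
  exact: (dmap_comp v (Ck_map_iter k CT) CT (chart_at_dom A _) (chart_at_dom A _) (chart_at_dom A _)).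
have invk (U : M -> {vspace 'rV[R]_n}) :
    (forall x, X x -> tangent_map A T x @` [set v | v \in U x] = [set v | v \in U (T x)]) ->
    forall k x v, X x -> v \in U x -> tangent_map A (iter k T) x v \in U (iter k T x).
  move=> H; elim=> [|k IH] x v Xx Uv.
    have -> : tangent_map A (iter 0 T) x v = v by exact: (dmap_id v (chart_at_dom A x)).
    by [].
  by rewrite tmS /=; apply: inv => //; [exact: iter_stable|exact: IH].
split => //.
- by move=> x; split => a u v; rewrite /pr linearP.
- move=> x v Xx; have [d1 d2] := dir x Xx; split.
    by rewrite /pr daddv_pi_add // d2 memvf.
  by rewrite /pr daddv_pi_id // memv_pi.
- move=> x v k Xx; split; first by apply: b2 => //; rewrite /pr memv_pi.
  set u := pr W' W x v; have Uu : u \in W' x by rewrite /u /pr memv_pi.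
  (* Expansion along [T] is the contraction of the inverse, applied at the end point
     [iter k T x]. *)
  have := b1 (iter k T x) (tangent_map A (iter k T) x u) k (iter_stable TX k Xx) (invk _ iW' k x u Xx Uu).
  rewrite (tangent_map_inv x u (iter_cancel k TK) (Ck_map_iter k CT) (Ck_map_iter k CS)).
  rewrite (iter_cancel k TK) ler_pdivlMl //.
  by rewrite exprn_gt0 // (lt_trans _ th1).
- move=> x v Xx; have [d1 d2] := dir x Xx; have [d1' d2'] := dir (T x) (TX x Xx).
  have E : v = daddv_pi (W x) (W' x) v + daddv_pi (W' x) (W x) v.
    by rewrite daddv_pi_add // d2 memvf.
  rewrite /pr {2}E (linD _ _ (tangent_map_linear _ _)) linearD /=.
  have m1 : tangent_map A T x (daddv_pi (W x) (W' x) v) \in W (T x).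
    by apply: inv => //; rewrite memv_pi.
  have m2 : tangent_map A T x (daddv_pi (W' x) (W x) v) \in W' (T x).
    by apply: inv => //; rewrite memv_pi.
  rewrite (daddv_pi_id d1' m1).
  have := daddv_pi_add d1' (_ : tangent_map A T x (daddv_pi (W' x) (W x) v) \in _).
  rewrite d2' memvf => /(_ isT); rewrite capvC in d1'.
  by rewrite (daddv_pi_id d1' m2) => /(canRL (addrK _)) ->; rewrite subrr addr0.
Qed.

End axiomA.

Lemma axiomA_hyperbolic (T : M -> M) : axiomA A T -> metric_hyperbolic T (nonwandering T).
Proof.
move=> [S [[TK SK CT CS] [[th th1 [Ws [Wu [dir iWs iWu [h [b1 b2]]]]]] XE]]].
set X := nonwandering T in dir iWs iWu b1 b2 XE *.
have cT : continuous T by case: CT.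
have cS : continuous S by case: CS.
have clX : closed X by rewrite XE; exact: closed_closure.
have stab (G : M -> M) : continuous G ->
    (forall x, periodic_points T x -> periodic_points T (G x)) -> forall x, X x -> X (G x).
  move=> cG pG x; rewrite XE => cx B nB.
  have [y [py By]] := cx _ (cG x _ nB).
  by exists (G y); split => //; exact: pG.
(* Invariance is read off from the periodic points, whose closure is [X]. *)
have TX : forall x, X x -> X (T x).
  apply: stab => // x [k k1 kx]; exists k => //.
  by rewrite -iterSr /= kx.
have SX : forall x, X x -> X (S x).
  apply: stab => // x [k k1 kx]; exists k => //.
  by apply: (can_inj TK); rewrite SK -iterS iterSr SK.
have ts : two_sided X h th T S Ws Wu.
  split => //; first by move=> x Xx; have [/directv_addP h1 h2] := dir x Xx.
have hd := two_sided_hypdata th1 ts.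
have hd' := two_sided_hypdata th1 (two_sided_sym ts).
split => //; first by move=> y Xy; exists (S y); [exact: SX|exact: SK].
split; first exact: (expansive_step M_hausdorff M_compact CT TX hd).
move=> beta beta0.
(* The unstable space of [T] is the stable space of [S], so continuity of the latter is the cone
   condition for [T]. *)
have [al al0 Hal] := periodic_shadowing M_hausdorff CT TX hd
  (splitting_continuous M_hausdorff M_compact CS SX hd') beta0.
exists al => // N w N0 Xw per ps; have [x px Hx] := Hal N w N0 Xw per ps.
exists x => //; rewrite XE; apply: subset_closure.
by have [k k0 kx] := px; exists k.
Qed.

End hyperbolic_sets.

(** * The Riemannian distance *)

(** The integral of a nonnegative function is a supremum over simple functions below it, hence
    monotone without measurability. It is applied to the speed of a curve, which is read in a chart
    that changes from point to point. *)
Lemma ge0_le_integral_nonmeas d (T : measurableType d) (R : realType)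
    (mu : {measure set T -> \bar R}) (D : set T) (f1 f2 : T -> \bar R) :
  (forall x, D x -> (0 <= f1 x)%E) -> (forall x, D x -> (f1 x <= f2 x)%E) ->
  (\int[mu]_(x in D) f1 x <= \int[mu]_(x in D) f2 x)%E.
Proof.
move=> f10 f12.
have f20 x : D x -> (0 <= f2 x)%E by move=> Dx; apply: le_trans (f10 x Dx) (f12 x Dx).
rewrite !ge0_integralE //; apply: ereal_sup_le => _ [h /= hf <-].
exists h => // x; apply: le_trans (hf x) _.
by rewrite /patch; case: ifP => //; rewrite inE; exact: f12.
Qed.

Section riemannian_distance.
Context {R : realType} {n : nat} {M : ptopologicalType}.
Variable A : smoothAtlas R n M.
Hypothesis M_hausdorff : hausdorff_space M.
Hypothesis M_compact : compact [set: M].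
Variable g : riemannianMetric A.

Local Notation ch a := (chart_at A a).
Local Notation dist := (dist A M_compact).
Local Notation ats := (ats A M_compact).
Local Notation inU := (inU A).
Local Notation dmap := (dmap A).
Local Notation loc := (idx A M_compact).

Lemma piecewise_C1_length_ge0 x y l : piecewise_C1_length g x y l -> 0 <= l.
Proof.
elim=> [gamma _|x' y' z l1 l2 _ h1 _ h2]; last exact: addr_ge0.
by apply: Rintegral_ge0 => t _; exact: sqrtr_ge0.
Qed.

Lemma riem_dist_le x y l : piecewise_C1_length g x y l -> riem_dist g x y <= l.
Proof.
move=> h; apply: ge_inf => //; exists 0 => l' /=; exact: piecewise_C1_length_ge0.
Qed.

Lemma riem_dist_ge0 x y : 0 <= riem_dist g x y.
Proof.
have [[l Hl]|ne] := pselect ([set l | piecewise_C1_length g x y l] !=set0).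
  apply: lb_le_inf; first by exists l.
  by move=> l' /piecewise_C1_length_ge0.
rewrite /riem_dist (_ : [set l | _] = set0) ?inf0 //.
by apply/seteqP; split => // l Hl; apply: ne; exists l.
Qed.

(** A [C1_curve] is defined on the whole line. This reparametrization stays between 0 and 1 for all
    [t], so the segment never leaves its chart, and it runs from 0 to 1 on the unit interval. *)
Definition ease (t : R) : R := sin (pi / 2 * t) ^+ 2.
Definition dease (t : R) : R := sin (pi / 2 * t) * cos (pi / 2 * t) * pi.

Lemma is_derive_ease (t : R) : is_derive t (1 : R) ease (dease t).
Proof.
have h1 : is_derive t 1 (fun t : R => pi / 2 * t) (pi / 2).
  by apply: is_derive_eq; rewrite ?mulr1 // /GRing.scale /= mulr1.
have h2 : is_derive t (1 : R) (fun t : R => sin (pi / 2 * t)) (cos (pi / 2 * t) * (pi / 2)).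
  have := is_derive1_comp (is_derive_sin (pi / 2 * t)) h1.
  by rewrite /GRing.scale /=.
have -> : ease = (fun t : R => sin (pi / 2 * t)) * (fun t : R => sin (pi / 2 * t)).
  by apply/funext => s; rewrite /ease expr2.
apply: (is_derive_eq (is_deriveM h2 h2)).
by rewrite /dease /GRing.scale /=; field.
Qed.

Lemma ease01 t : 0 <= ease t <= 1.
Proof.
rewrite /ease sqr_ge0 /=; have := sin_max (pi / 2 * t) => h.
by rewrite -real_normK ?num_real // expr_le1.
Qed.

Lemma dease_bound t : `|dease t| <= pi.
Proof.
rewrite /dease !normrM (ger0_norm (pi_ge0 R)) ger_pMl ?pi_gt0 //.
by rewrite mulr_ile1 // ?sin_max ?cos_max.
Qed.

Section segment.
Variables u dv : 'rV[R]_n.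
Definition sgm (t : R) : 'rV[R]_n := u + ease t *: dv.

Lemma sgm_diff (t : R) : differentiable sgm t /\
  forall w : R, 'd sgm t w = (w * dease t) *: dv.
Proof.
have de := is_derive_ease t.
have dd : derivable ease t 1 by exact: ex_derive.
have d1 : differentiable ease t by apply/derivable1_diffP.
pose aff (e : R) := u + e *: dv.
have gd (e : R) : is_diff e aff (fun h : R => h *: dv).
  have H := @is_diffD R R 'rV[R]_n (cst u) (fun s => s *: dv) _ _ e
     (is_diff_cst _ _) (is_diff_scalel _ _).
  by apply: is_diff_eq; rewrite ?add0r.
have d2 : differentiable aff (ease t) by case: (gd (ease t)).
have [h1 h2] := diff_comp_at (erefl (ease t)) d1 d2.
split; first exact: h1.
move=> w; apply: etrans (h2 w) _; rewrite diff_val deriv1E // derive1E derive_val.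
by [].
Qed.

Lemma sgm_continuous : continuous sgm.
Proof. by move=> t; apply: differentiable_continuous; have [] := sgm_diff t. Qed.

Lemma dsgm_continuous (w : R) : continuous (fun t : R => (w * dease t) *: dv).
Proof.
move=> t; apply: cvgZ; last exact: cvg_cst.
apply: cvgM; first exact: cvg_cst.
have c1 : {for t, continuous (fun t : R => pi / 2 * t)}.
  by apply: cvgM; [exact: cvg_cst|exact: cvg_id].
apply: cvgM; last exact: cvg_cst.
apply: cvgM.
  by apply: (@continuous_comp _ _ _ (fun t : R => pi / 2 * t) sin) => //; exact: continuous_sin.
by apply: (@continuous_comp _ _ _ (fun t : R => pi / 2 * t) cos) => //; exact: continuous_cos.
Qed.

End segment.

(** The chart ball is convex, so the eased segment between the two points stays in it; its speed is
    at most [pi] times its Euclidean length, and [K] compares the norms. *)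
Lemma riem_dist_chart : exists2 C, 0 < C & forall a x y, a \in ats ->
  inU a 2 x -> inU a 2 y -> riem_dist g x y <= C * `|cmap (ch a) x - cmap (ch a) y|.
Proof.
have [K K1 HK] := riem_norm_equiv M_hausdorff M_compact g.
have K0 : 0 < K by apply: lt_le_trans K1.
exists (K * pi); first by rewrite mulr_gt0 // pi_gt0.
move=> a x y aA [cx xr] [cy yr].
set c := ch a; have hc : charts A c by exact: chart_at_charts.
pose u := cmap c x; pose dv := cmap c y - cmap c x.
pose sg := sgm u dv; pose gam t := cinv c (sg t).
have sgr t : `|sg t - cmap c a| < 2 * rad A a.
  have /andP[e0 e1] := ease01 t.
  have -> : sg t - cmap c a = (1 - ease t) *: (cmap c x - cmap c a) + ease t *: (cmap c y - cmap c a).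
    by rewrite /sg /sgm /u /dv; apply/rowP => k; rewrite !mxE; ring.
  apply: le_lt_trans (ler_normD _ _) _.
  rewrite (normrZ (1 - ease t)) (normrZ (ease t)).
  rewrite (ger0_norm e0) ger0_norm ?subr_ge0 //.
  move: (ease t) e0 e1 xr yr => e e0 e1; rewrite -/c.
  move: (`|_|) (`|_|) (2 * rad A a) => p q r pr qr.
  have [e00|e00] := eqVneq e 0; first by rewrite e00; lra.
  have : 0 < e by rewrite lt_def e00.
  nra.
have sgc t : exists2 z, cdom c z & cmap c z = sg t.
  apply: rad_cod; apply: lt_trans (sgr t) _; rewrite ltr_pM2r ?rad_gt0 //.
  by rewrite ltr_nat.
have gd t : cdom c (gam t) by rewrite /gam; have [z cz <-] := sgc t; rewrite cmapK.
have gc t : cmap c (gam t) = sg t by rewrite /gam; have [z cz <-] := sgc t; rewrite cmapK.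
have gU t : inU a 2 (gam t) by split; [exact: gd|rewrite -/c gc].
have gcont : continuous gam.
  move=> t; apply: continuous_comp; first exact: sgm_continuous.
  by apply: cinv_continuous; have [z cz E] := sgc t; exists z.
have CI := Ck_map_id A.
have chain (c' : chart R n M) t : charts A c' -> cdom c' (gam t) ->
    differentiable (cmap c' \o gam) t /\
    forall w, 'd (cmap c' \o gam) t w =
      'd (cmap c' \o id \o cinv c) (sg t) ((w * dease t) *: dv).
  move=> hc' c'g.
  have dF := Ck_map_diff CI hc hc' (gd t) c'g; rewrite gc in dF.
  have [ds dsE] := sgm_diff u dv t.
  have [h1 h2] := diff_comp_at (erefl (sg t)) ds dF.
  split; first exact: h1.
  by move=> w; apply: etrans (h2 w) _; congr ('d _ _ _); exact: dsE.
have C1g : C1_curve A gam.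
  split => // c' hc'; split.
    by move=> t ct; have [] := chain c' t hc' ct.
  move=> w t ct.
  pose F := cmap c' \o id \o cinv c.
  have [DF DFE] : exists D : 'rV[R]_n -> 'rV[R]_n -> 'rV[R]_n,
    D = (fun w z => 'd F w z) by eexists.
  have E : \forall s \near t, DF (sg s) ((w * dease s) *: dv) = 'd (cmap c' \o gam) s w.
    have : \forall s \near t, cdom c' (gam s).
      by apply: (gcont t); apply: open_nbhs_nbhs; split => //; exact: cdom_open.
    apply: filterS => s cs; have [_ cE] := chain c' s hc' cs.
    by rewrite DFE; exact: esym (cE w).
  have lDF : linear (DF (sg t)) by rewrite DFE; exact: diff_is_linear.
  have near_DF eta : 0 < eta -> exists2 r, 0 < r & forall w,
      `|w - sg t| < r -> forall z, `|DF w z - DF (sg t) z| <= eta * `|z|.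
    move=> eta0; have [_ CI1] := CI.
    have oU : open (cmap c @` (cdom c `&` id @^-1` cdom c')).
      by apply: chart_image_open; exact: cdom_open.
    have Up : (cmap c @` (cdom c `&` id @^-1` cdom c')) (sg t).
      by exists (gam t); [split; [exact: gd|exact: ct]|exact: gc].
    have [r r0 Hr] := C1_diff_near oU (CI1 c c' hc hc') Up eta0.
    by exists r => // w'; rewrite DFE => /Hr[_]; exact.
  have cs : {for t, continuous sg} by exact: sgm_continuous.
  have cd : {for t, continuous (fun s => (w * dease s) *: dv)} by exact: dsgm_continuous.
  exact: continuous_near_eq E (cvg_linear_family cs cd lDF near_DF).
have len := C1_piece g C1g.
have g0 : gam 0 = x.
  by rewrite /gam /sg /sgm /ease mulr0 sin0 expr0n /= scale0r addr0 /u cmapK.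
have g1 : gam 1 = y.
  rewrite /gam /sg /sgm /ease mulr1 sin_pihalf expr1n scale1r /u /dv addrC subrK.
  by rewrite cmapK.
rewrite g0 g1 in len.
apply: le_trans (riem_dist_le len) _.
have bnd t : riem_norm g (gam t) (velocity A gam t) <= K * pi * `|cmap c x - cmap c y|.
  have [dd ddE] := chain (ch (gam t)) t (chart_at_charts _ _) (chart_at_dom _ _).
  have -> : velocity A gam t = dmap id a (gam t) (gam t) (dease t *: dv).
    rewrite /velocity derive1E deriveE; last exact: dd.
    apply: etrans (ddE 1) _; rewrite mul1r /dmap /chmap -/c gc.
    by [].
  have [h1 _] := HK (gam t) a (dease t *: dv) aA (gU t).
  apply: le_trans h1 _; rewrite -mulrA ler_pM2l // normrZ (distrC (cmap c x)).
  by apply: ler_wpM2r => //; exact: dease_bound.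
set B := K * pi * _ in bnd *.
have B0 : 0 <= B by rewrite /B !mulr_ge0 // ?pi_ge0 // ltW.
have I1 : (\int[lebesgue_measure]_(t in `[0%R, 1%R]) B%:E = B%:E)%E.
  rewrite integral_cst //= lebesgue_measure_itv /= lte_fin ltr01 -EFinB subr0.
  by rewrite mule1.
have le1 : (\int[lebesgue_measure]_(t in `[0%R, 1%R]) (riem_norm g (gam t) (velocity A gam t))%:E <= B%:E)%E.
  rewrite -I1; apply: ge0_le_integral_nonmeas => t _; first by rewrite lee_fin sqrtr_ge0.
  by rewrite lee_fin.
have ge0 : (0 <= \int[lebesgue_measure]_(t in `[0%R, 1%R]) (riem_norm g (gam t) (velocity A gam t))%:E)%E.
  by apply: integral_ge0 => t _; rewrite lee_fin sqrtr_ge0.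
rewrite /Rintegral -lee_fin fineK //.
by rewrite ge0_fin_numE //; apply: le_lt_trans le1 _; rewrite ltry.
Qed.

End riemannian_distance.

Lemma half_div_sum (R : realType) q N : (0 < q)%N ->
  \sum_(i < N) (2^-1 : R) ^+ (i %/ q) <= 2 * q%:R.
Proof.
move=> q0.
(* The added term is the sum of the series from [N] on: the rest of the current block of [q] equal
   terms and all later blocks. *)
suff : \sum_(i < N) (2^-1 : R) ^+ (i %/ q) + 2^-1 ^+ (N %/ q) * (2 * q%:R - (N %% q)%:R) = 2 * q%:R.
  move=> <-; rewrite lerDl mulr_ge0 ?exprn_ge0 // subr_ge0 -natrM ler_nat.
  by have := ltn_pmod N q0; lia.
elim: N => [|N IH].
  by rewrite big_ord0 div0n mod0n expr0 mul1r add0r subr0.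
rewrite big_ord_recr /= -[RHS]IH -addrA; congr (_ + _).
have [E|E] := leqP q (N %% q).+1.
  have Em : (N %% q = q.-1)%N by have := ltn_pmod N q0; lia.
  have -> : (N.+1 %/ q = (N %/ q).+1)%N.
    rewrite {1}(divn_eq N q) Em -addnS prednK // -mulSnr mulnK //.
  have -> : (N.+1 %% q = 0)%N.
    by rewrite {1}(divn_eq N q) Em -addnS prednK // -mulSnr modnMl.
  rewrite Em subr0 exprS; have -> : (q.-1)%:R = q%:R - 1 :> R.
    by rewrite -subn1 natrB.
  by field.
have -> : (N.+1 %/ q = N %/ q)%N.
  by rewrite {1}(divn_eq N q) -addnS divnMDl // (divn_small E) addn0.
have -> : (N.+1 %% q = (N %% q).+1)%N.
  by rewrite {1}(divn_eq N q) -addnS modnMDl modn_small.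
by rewrite -[in RHS]addn1 in E *; rewrite -addn1 natrD; ring.
Qed.

Lemma le_sum_mem (R : realType) (I : choiceType) (s : seq I) (F : I -> R) a :
  (forall b, 0 <= F b) -> a \in s -> F a <= \sum_(b <- s) F b.
Proof. by move=> F0 aS; rewrite (big_rem a) //= lerDl sumr_ge0. Qed.

Lemma triangle3 (R : realType) (a b c d p q r : R) :
  `|a - b| <= p -> `|b - c| <= q -> `|d - c| <= r -> `|a - d| <= p + q + r.
Proof.
move=> h1 h2 h3; apply: le_trans (ler_distD c _ _) _; rewrite (distrC c).
by apply: lerD => //; apply: le_trans (ler_distD b _ _) _; apply: lerD.
Qed.

(** * Lipschitz functions along close orbits *)

Section lipschitz.
Context {R : realType} {n : nat} {M : ptopologicalType}.
Variable A : smoothAtlas R n M.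
Hypothesis M_hausdorff : hausdorff_space M.
Hypothesis M_compact : compact [set: M].
Variable g : riemannianMetric A.
Variables (T : M -> M) (X : set M).

Local Notation ch a := (chart_at A a).
Local Notation dist := (dist A M_compact).
Local Notation ats := (ats A M_compact).
Local Notation inU := (inU A).
Local Notation loc := (idx A M_compact).

(** Points in different charts are compared through representatives, one in each ball of the finite
    atlas that meets [X]; there are finitely many distances between these. *)
Lemma lipschitz_osc : exists2 D, 0 < D & forall f L, 0 <= L ->
  lipschitz_with g X L f -> forall x y, X x -> X y -> `|f x - f y| <= L * D.
Proof.
have [C C0 HC] := riem_dist_chart M_hausdorff M_compact g.
pose P a z := X z /\ inU a 1 z.
pose rep a := xget a (P a).
pose D1 := \sum_(a <- ats) (C * (4 * rad A a)).
pose D2 := \sum_(a <- ats) \sum_(b <- ats) riem_dist g (rep a) (rep b).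
have r0 a : 0 <= C * (4 * rad A a) by rewrite !mulr_ge0 ?ltW // rad_gt0.
have D10 : 0 <= D1 by apply: sumr_ge0.
have D20 : 0 <= D2 by apply: sumr_ge0 => a _; apply: sumr_ge0 => b _; exact: riem_dist_ge0.
exists (D1 + D2 + D1 + 1); first by rewrite ltr_wpDl // !addr_ge0.
move=> f L L0 lf x y Xx Xy.
have near_rep z : X z -> exists2 a, a \in ats & X (rep a) /\ `|f z - f (rep a)| <= L * D1.
  move=> Xz; exists (loc z); first exact: loc_in.
  have [Xr Ur] : P (loc z) (rep (loc z)).
    by apply: (@xgetPex _ (loc z) (P (loc z))); exists z; split => //; exact: locU1.
  split => //; apply: le_trans (lf z _ Xz Xr) _; apply: ler_wpM2l => //.
  have Ur2 : inU (loc z) 2 (rep (loc z)) by apply: inU_le Ur; rewrite ler1n.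
  apply: le_trans (HC _ _ _ (loc_in _ _ _) (locU2 _ _ z) Ur2) _.
  have : C * `|cmap (ch (loc z)) z - cmap (ch (loc z)) (rep (loc z))| <= C * (4 * rad A (loc z)).
    rewrite ler_pM2l //; have [_ u1] := locU1 A M_compact z; have [_ u2] := Ur.
    have := ler_distD (cmap (ch (loc z)) (loc z)) (cmap (ch (loc z)) z) (cmap (ch (loc z)) (rep (loc z))).
    by rewrite (distrC (cmap _ (loc z))); have := rad_gt0 A (loc z); lra.
  move/le_trans; apply.
  exact: (@le_sum_mem _ _ _ (fun a => C * (4 * rad A a)) _ r0 (loc_in A M_compact z)).
have [a aA [Xa ha]] := near_rep x Xx; have [b bA [Xb hb]] := near_rep y Xy.
have hab : `|f (rep a) - f (rep b)| <= L * D2.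
  apply: le_trans (lf _ _ Xa Xb) _; apply: ler_wpM2l => //.
  have rd0 c e : 0 <= riem_dist g (rep c) (rep e) by exact: riem_dist_ge0.
  apply: le_trans (le_sum_mem (rd0 a) bA) _.
  apply: (@le_sum_mem _ _ _ (fun a => \sum_(b <- ats) riem_dist g (rep a) (rep b)) _ _ aA).
  by move=> c; apply: sumr_ge0.
apply: le_trans (triangle3 ha hab hb) _.
by rewrite -!mulrDr; apply: ler_wpM2l => //; rewrite lerDl.
Qed.

Lemma lipschitz_continuous f L x e : 0 <= L -> lipschitz_with g X L f -> X x -> 0 < e ->
  exists2 d, 0 < d & forall y, X y -> dist x y < d -> `|f x - f y| < e.
Proof.
move=> L0 lf Xx e0; have [C C0 HC] := riem_dist_chart M_hausdorff M_compact g.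
have eta0 : 0 < e / ((L + 1) * C) by rewrite divr_gt0 // mulr_gt0 // ltr_wpDl.
have [d d0 Hd] := chart_close A M_hausdorff M_compact eta0.
exists d => // y Xy xy; have [U2 h] := Hd x y xy (loc x) (loc_in _ _ _) (locU1 _ _ _).
apply: le_lt_trans (lf x y Xx Xy) _.
have h1 := HC (loc x) x y (loc_in _ _ _) (locU2 _ _ _) U2.
rewrite ltr_pdivlMr ?mulr_gt0 // ?ltr_wpDl // in h.
have h2 := ler_wpM2l L0 h1; apply: le_lt_trans h2 _.
by apply: le_lt_trans h; have := normr_ge0 (cmap (ch (loc x)) x - cmap (ch (loc x)) y);
  move: (`|_|) => t t0; nra.
Qed.

Hypothesis hyp : metric_hyperbolic A M_compact T X.

Lemma expansive_close : exists2 e0, 0 < e0 & forall rho, 0 < rho -> exists n0,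
  forall x y, X x -> X y ->
    (forall i, (i <= n0 + n0)%N -> dist (iter i T x) (iter i T y) < e0) ->
    dist (iter n0 T x) (iter n0 T y) < rho.
Proof.
have [_ _ _ _ [[q [C [e [q0 C1 e0 HE]]]] _]] := hyp.
have C0 : 0 < C by apply: lt_le_trans C1.
have [e1 e10 He1] := chart_close A M_hausdorff M_compact ltr01.
exists (Num.min e e1); first by rewrite lt_min e0.
move=> rho rho0; have [eta eta0 Heta] := chart_inv_close A M_hausdorff M_compact rho0.
have two1 : 1 < (2 : R) by rewrite ltr1n.
have [j0 Hj] := pow_unbounded (4 * C / eta) two1.
have {}Hj := Hj j0 (leqnn _).
exists (q * j0)%N => x y Xx Xy Hc.
have := HE x y (j0 + j0)%N Xx Xy _ j0 (leq_addr _ _).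
move=> /(_ _)/= H.
have {}H : `|cmap (ch (loc (iter (q * j0) T x))) (iter (q * j0) T y) -
    cmap (ch (loc (iter (q * j0) T x))) (iter (q * j0) T x)| <=
    C * (2^-1 ^+ j0 + 2^-1 ^+ (j0 + j0 - j0)).
  apply: H => j jm; have := Hc (q * j)%N; rewrite lt_min => H.
  have [|//] := andP (H _); rewrite -mulnDr leq_mul2l jm orbT //.
rewrite addnK in H.
have := Hc (q * j0)%N (leq_addr _ _); rewrite lt_min => /andP[_ h1].
have [U2 _] := He1 _ _ h1 _ (loc_in A M_compact _) (locU1 A M_compact _).
have [|_] := Heta (iter (q * j0) T x) (loc (iter (q * j0) T x))
  (cmap (ch (loc (iter (q * j0) T x))) (iter (q * j0) T y)) (loc_in _ _ _) (locU1 _ _ _).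
  apply: le_lt_trans H _.
  have tp : 0 < (2 : R) ^+ j0 by rewrite exprn_gt0.
  rewrite -mulr2n -[2^-1 ^+ j0 *+ 2]mulr_natl exprVn.
  have : 4 * C <= eta * 2 ^+ j0 by rewrite -ler_pdivrMl // mulrC.
  by rewrite mulrA ltr_pdivrMr //; move: (2 ^+ j0) => t; nra.
by rewrite cmapK; [rewrite distC|case: U2].
Qed.

(** Orbits that stay close up to time [m] are exponentially close away from both ends, so the
    differences are dominated by two geometric series, uniformly in [m]. *)
Lemma orbit_sum : exists2 e0, 0 < e0 & exists2 C, 0 < C & forall f L, 0 <= L ->
  lipschitz_with g X L f -> forall x y m, X x -> X y ->
    (forall i, (i <= m)%N -> dist (iter i T x) (iter i T y) < e0) ->
    \sum_(i < m.+1) `|f (iter i T x) - f (iter i T y)| <= L * C.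
Proof.
have [_ _ TX _ [[q [C [e [q0 C1 e0 HE]]]] _]] := hyp.
have C0 : 0 < C by apply: lt_le_trans C1.
have [K K0 HK] := riem_dist_chart M_hausdorff M_compact g.
have [e1 e10 He1] := chart_close A M_hausdorff M_compact ltr01.
exists (Num.min e e1); first by rewrite lt_min e0.
have qR : 0 < q%:R :> R by rewrite ltr0n.
exists (K * (C * (4 * q%:R))); first by rewrite !mulr_gt0.
move=> f L L0 lf x y m Xx Xy Hc.
have pt i : (i <= m)%N -> `|f (iter i T x) - f (iter i T y)| <=
    L * (K * (C * (2^-1 ^+ (i %/ q) + 2^-1 ^+ ((m - i) %/ q)))).
  move=> im.
  have Xi z k : X z -> X (iter k T z) by move=> Xz; exact: iter_stable.
  apply: le_trans (lf _ _ (Xi x i Xx) (Xi y i Xy)) _; apply: ler_wpM2l => //.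
  have := Hc i im; rewrite lt_min => /andP[_ h1].
  have [U2 _] := He1 _ _ h1 _ (loc_in A M_compact _) (locU1 A M_compact _).
  apply: le_trans (HK _ _ _ (loc_in _ _ _) (locU2 _ _ _) U2) _.
  rewrite ler_pM2l // distrC.
  (* The estimate is available at multiples of [q] only; shifting both orbits by the remainder [r]
     turns time [i] into such a multiple. *)
  pose r := (i %% q)%N; pose j := (i %/ q)%N; pose m' := ((m - r) %/ q)%N.
  have ri : (r <= i)%N by rewrite /r leq_mod.
  have iE : (q * j + r = i)%N by rewrite mulnC -divn_eq.
  have jm : (j <= m')%N.
    by rewrite /m' leq_divRL // mulnC; move: iE im; clear; lia.
  have := HE (iter r T x) (iter r T y) m' (Xi x r Xx) (Xi y r Xy) _ j jm.
  rewrite /= -!iterD iE => H.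
  have -> : ((m - i) %/ q = m' - j)%N.
    have E : (m - r = q * j + (m - i))%N by move: iE im; clear; lia.
    by rewrite /m' E mulnC divnMDl // addKn.
  apply: H => k km; rewrite -!iterD.
  have := Hc (q * k + r)%N; rewrite lt_min => H.
  have [|//] := andP (H _).
  have qk : (q * k <= m - r)%N by rewrite mulnC -leq_divRL.
  by rewrite -(subnK (leq_trans ri im)) leq_add2r.
apply: (@le_trans _ _ (\sum_(i < m.+1) L * (K * (C * (2^-1 ^+ (i %/ q) + 2^-1 ^+ ((m - i) %/ q)))))).
  by apply: ler_sum => i _; apply: pt; rewrite -ltnS.
rewrite -!mulr_sumr ler_wpM2l // ler_pM2l // ler_pM2l // big_split /=.
have -> : 4 * q%:R = 2 * q%:R + 2 * q%:R :> R by ring.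
apply: lerD; first exact: half_div_sum.
rewrite (reindex_inj rev_ord_inj) /=.
apply: le_trans (half_div_sum R m.+1 q0).
apply: ler_sum => i _; rewrite subSS subKn //.
by rewrite -ltnS.
Qed.

End lipschitz.

(** * Shadowing systems *)

(** Charts and derivatives are left behind here: the coding and the entropy estimates see [(X, T)]
    only through these properties of the metric [d]. *)
Record esys (R : realType) (M : ptopologicalType) (d : M -> M -> R) (T : M -> M)
    (X : set M) : Prop := Esys {
  es_ge0 : forall x y, 0 <= d x y;
  es_xx : forall x, d x x = 0;
  es_C : forall x y, d x y = d y x;
  es_tri : forall y x z, d x z <= d x y + d y z;
  es_eq0 : forall x y, d x y = 0 -> x = y;
  es_open : forall x e, open [set y | d x y < e];
  es_nbhs : forall x (U : set M), nbhs x U -> exists2 e, 0 < e & forall y, d x y < e -> U y;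
  es_closed : closed X;
  es_TX : forall x, X x -> X (T x);
  es_onto : forall y, X y -> exists2 x, X x & T x = y;
  es_Tc : continuous T;
  es_cont : forall e, 0 < e -> exists2 e', 0 < e' & forall x y, d x y < e' -> d (T x) (T y) < e;
  es_complete : forall u : nat -> M, (forall k, X (u k)) ->
    (forall e, 0 < e -> exists K, forall k l, (K <= k)%N -> (K <= l)%N -> d (u k) (u l) < e) ->
    exists2 x, X x & forall e, 0 < e -> exists K, forall k, (K <= k)%N -> d x (u k) < e;
  es_net : forall e, 0 < e -> exists2 s : seq M, forall p, p \in s -> X p &
    forall x, X x -> exists2 p, p \in s & d x p < e;
  es_mix : top_mixing T X;
  es_exp : exists2 e0, 0 < e0 & forall rho, 0 < rho -> exists n0, forall x y, X x -> X y ->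
    (forall i, (i <= n0 + n0)%N -> d (iter i T x) (iter i T y) < e0) ->
    d (iter n0 T x) (iter n0 T y) < rho;
  es_shadow : forall beta, 0 < beta -> exists2 alpha, 0 < alpha &
    forall N (w : nat -> M), (0 < N)%N -> (forall i, X (w i)) ->
     (forall i, w (i + N)%N = w i) -> (forall i, d (T (w i)) (w i.+1) < alpha) ->
     exists2 x, X x & forall i, d (iter i T x) (w i) < beta
}.

Lemma hyperbolic_esys (R : realType) (n : nat) (M : ptopologicalType)
    (A : smoothAtlas R n M) (M_hausdorff : hausdorff_space M)
    (M_compact : compact [set: M]) (T : M -> M) (X : set M) :
  metric_hyperbolic A M_compact T X -> top_mixing T X ->
  esys (dist A M_compact) T X.
Proof.
move=> hyp mix; have [cX cT TX onto [_ sh]] := hyp.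
have op x e : open [set y | dist A M_compact x y < e].
  have -> : [set y | dist A M_compact x y < e] = dist A M_compact x @^-1` [set z | z < e] by [].
  apply: open_comp; last exact: open_lt.
  by move=> y _; exact: dist_continuous.
split => //.
- by move=> x y; exact: dist_ge0.
- by move=> x; exact: distxx.
- by move=> x y; exact: distC.
- by move=> y x z; exact: dist_tri.
- by move=> x y; exact: dist0_eq.
- by move=> x U; exact: nbhs_dist.
- by move=> e e0; exact: dist_continuous_map.
- move=> u Xu cau.
  have Xc : compact X by apply: (subclosed_compact cX M_compact).
  have FX : (u @ \oo) X by exists 0%N => // k _; exact: Xu.
  have [x [Xx clx]] := Xc (u @ \oo) _ FX; exists x => // e e0.
  have e2 : 0 < e / 2 by rewrite divr_gt0.
  have [K HK] := cau _ e2; exists K => k Kk.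
  have FA : (u @ \oo) [set z | exists2 l, (K <= l)%N & z = u l].
    by exists K => // l Kl; exists l.
  have [z [[l Kl ->] /= xl]] := clx _ _ FA (dist_near A M_hausdorff M_compact x e2).
  have := HK l k Kl Kk; have := dist_tri A M_compact (u l) x (u k); lra.
- move=> e e0.
  have Xc : compact X by apply: (subclosed_compact cX M_compact).
  move: Xc; rewrite compact_cover => /(_ _ X (fun p => [set y | dist A M_compact p y < e])) [].
  + by move=> p _; exact: op.
  + by move=> x Xx; exists x => //=; rewrite distxx.
  + move=> D DX cov; exists (finmap.enum_fset D).
      by move=> p pD; have := DX p pD; rewrite inE.
    by move=> x Xx; have [p pD /=] := cov x Xx; rewrite distC => h; exists p.
- exact: (expansive_close M_hausdorff hyp).
Qed.

Section shadow.
Context {R : realType} {M : ptopologicalType} (d : M -> M -> R) (T : M -> M) (X : set M).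
Hypothesis E : esys d T X.

(** Two-sided orbits: the point [x 0] of a non-invertible map does not determine its past, and the
    brackets below need one. *)
Definition borbit (x : int -> M) : Prop := forall i, X (x i) /\ T (x i) = x (i + 1).

Lemma es_iter i x : X x -> X (iter i T x).
Proof. by move=> Xx; elim: i => //= i; exact: (es_TX E). Qed.

Lemma borbit_iter (x : int -> M) i (k : nat) : borbit x -> iter k T (x i) = x (i + k%:Z).
Proof.
move=> ox; elim: k => [|k IH]; first by rewrite addr0.
by rewrite iterS IH (ox _).2; congr x; lia.
Qed.

Lemma borbit_shift (x : int -> M) k : borbit x -> borbit (fun i => x (i + k)).
Proof.
by move=> ox i; have [h1 h2] := ox (i + k); split => //; rewrite h2; congr x; lia.
Qed.

Lemma connecting_orbit (x y : M) e n : X x -> X y -> 0 < e -> exists k z,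
  [/\ (n <= k)%N, X z, d x z < e & d y (iter k T z) < e].
Proof.
move=> Xx Xy e0; have [||N HN] := es_mix E (es_open E x e) (es_open E y e).
- by exists x; split => //=; rewrite (es_xx E).
- by exists y; split => //=; rewrite (es_xx E).
- have [z [[Xz xz] yz]] := HN (maxn N n) (leq_maxl _ _).
  by exists (maxn N n), z; split => //; exact: leq_maxr.
Qed.

Lemma borbit_through x : X x -> exists2 y, borbit y & y 0 = x.
Proof.
move=> Xx; have pre z : {z' : M | X z -> X z' /\ T z' = z}.
  apply: cid; have [Xz|nX] := pselect (X z); last by exists z.
  by have [z' Xz' zz'] := es_onto E Xz; exists z'.
pose bk k := iter k (fun z => projT1 (pre z)) x.
have Xbk k : X (bk k).
  by elim: k => //= k IH; have [] := projT2 (pre (bk k)) IH.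
have Tbk k : T (bk k.+1) = bk k by have [] := projT2 (pre (bk k)) (Xbk k).
exists (fun i => match i with Posz k => iter k T x | Negz k => bk k.+1 end) => //.
case=> [k|k].
  split; first exact: es_iter.
  by have -> : k%:Z + 1 = k.+1%:Z by lia.
split; first exact: Xbk.
rewrite Tbk; case: k => [|k]; first by [].
have -> : Negz k.+1 + 1 = Negz k by lia.
by [].
Qed.

(* Finite windows are closed up into periodic pseudo-orbits by mixing; the
   periodic orbits shadowing them converge by expansivity. *)
Lemma biinfinite_shadowing beta : 0 < beta -> exists2 alpha, 0 < alpha &
  forall w : int -> M, (forall i, X (w i)) -> (forall i, d (T (w i)) (w (i + 1)) < alpha) ->
  exists2 x, borbit x & forall i, d (x i) (w i) <= beta.
Proof.
move=> beta0; have [e0 e00 Hexp] := es_exp E.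
(* Two orbits that follow [w] up to [b] are then close enough to each other for expansivity. *)
pose b := Num.min beta (e0 / 2).
have b0 : 0 < b by rewrite lt_min beta0 divr_gt0.
have bb : b <= beta by rewrite ge_min lexx.
have be : b <= e0 / 2 by rewrite ge_min lexx orbT.
have [alpha al0 Hsh] := es_shadow E b0; exists alpha => // w Xw ps.
have per (k : nat) : exists2 x, X x &
    forall i : nat, (i <= k + k)%N -> d (iter i T x) (w (i%:Z - k%:Z)) < b.
  (* An orbit segment from near [T (w k)] to near [w (- k)] closes the window of [2 k + 1] points to
     a pseudo-orbit of period [N]. *)
  have [n [z [n1 Xz h1 h2]]] := connecting_orbit 1 (es_TX E (Xw k%:Z)) (Xw (- k%:Z)) al0.
  pose N := (k + k + n).+1.
  pose v0 (j : nat) := if (j <= k + k)%N then w (j%:Z - k%:Z) else iter (j - (k + k).+1) T z.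
  pose v (j : nat) := v0 (j %% N)%N.
  have Xv i : X (v i) by rewrite /v /v0; case: ifP => _; [exact: Xw|exact: es_iter].
  have vN i : v (i + N)%N = v i by rewrite /v modnDr.
  have psv i : d (T (v i)) (v i.+1) < alpha.
    rewrite /v.
    have [iN|iN] := ltnP (i %% N).+1 N.
      have -> : (i.+1 %% N = (i %% N).+1)%N.
        by rewrite -addn1 -modnDml addn1 modn_small.
      move: (i %% N)%N iN => j jN; rewrite /v0.
      have [j1|j1] := leqP j (k + k).
        have [j2|j2] := leqP j.+1 (k + k).
          have := ps (j%:Z - k%:Z); congr (d _ (w _) < _); lia.
        have -> : (j.+1 - (k + k).+1 = 0)%N by lia.
        have -> : j%:Z - k%:Z = k%:Z by lia.
        exact: h1.
      have -> : (j.+1 <= k + k)%N = false by lia.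
      have -> : (j.+1 - (k + k).+1 = (j - (k + k).+1).+1)%N by lia.
      by rewrite iterS (es_xx E).
    have iE : (i %% N = N.-1)%N by have := ltn_pmod i (ltn0Sn (k + k + n)); rewrite -/N; lia.
    have -> : (i.+1 %% N = 0)%N.
      by rewrite -addn1 -modnDml iE addn1 prednK // modnn.
    rewrite iE /v0 /N /= sub0r.
    have -> : (k + k + n <= k + k)%N = false by lia.
    rewrite -iterS (_ : (k + k + n - (k + k).+1).+1 = n)%N; last by lia.
    by rewrite (es_C E).
  have [x Xx Hx] := Hsh N v (ltn0Sn _) Xv vN psv.
  exists x => // i ik; have := Hx i; rewrite /v /v0 modn_small ?ik //.
  by rewrite /N ltnS (leq_trans ik) // leq_addr.
have [X0 HX0] : exists y : nat -> M, forall k, X (y k) /\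
    forall i : nat, (i <= k + k)%N -> d (iter i T (y k)) (w (i%:Z - k%:Z)) < b.
  have h k : {x | X x /\ forall i : nat, (i <= k + k)%N -> d (iter i T x) (w (i%:Z - k%:Z)) < b}.
    by apply: cid; have [x Xx Hx] := per k; exists x.
  by exists (fun k => projT1 (h k)) => k; exact: (projT2 (h k)).
pose y (k : nat) (i : int) := iter (absz (i + k%:Z)%R) T (X0 k).
have Xy k i : X (y k i) by apply: es_iter; case: (HX0 k).
have yw (k : nat) i : (`|i| <= k)%N -> d (y k i) (w i) < b.
  move=> ik; have [_ H] := HX0 k; have := H (absz (i + k%:Z)%R) ltac:(lia).
  by rewrite /y; congr (d _ (w _) < _); lia.
have yT (k : nat) i : (`|i| <= k)%N -> T (y k i) = y k (i + 1).
  by move=> ik; rewrite /y -iterS; congr (iter _ T _); lia.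
have yiter (k : nat) i (j : nat) : (`|i| <= k)%N -> iter j T (y k i) = y k (i + j%:Z).
  by move=> ik; rewrite /y -iterD; congr (iter _ T _); lia.
have cau i e : 0 < e -> exists K, forall k l, (K <= k)%N -> (K <= l)%N -> d (y k i) (y l i) < e.
  move=> ep; have [n0 Hn] := Hexp e ep; exists (`|i| + n0)%N => k l Kk Kl.
  have ik : (`|(i - n0%:Z)%R| <= k)%N by lia.
  have il : (`|(i - n0%:Z)%R| <= l)%N by lia.
  have := Hn (y k (i - n0%:Z)) (y l (i - n0%:Z)) (Xy _ _) (Xy _ _).
  rewrite !yiter // subrK; apply => j jn; rewrite !yiter //.
  have h1 := yw k (i - n0%:Z + j%:Z) ltac:(lia).
  have h2 := yw l (i - n0%:Z + j%:Z) ltac:(lia).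
  have := es_tri E (w (i - n0%:Z + j%:Z)) (y k (i - n0%:Z + j%:Z)) (y l (i - n0%:Z + j%:Z)).
  by rewrite (es_C E (w _)); lra.
have [x Hx] : exists x : int -> M, forall i, X (x i) /\
    forall e, 0 < e -> exists K, forall k, (K <= k)%N -> d (x i) (y k i) < e.
  have h i : {x | X x /\ forall e, 0 < e -> exists K, forall k, (K <= k)%N -> d x (y k i) < e}.
    apply: cid; have [z Xz Hz] := es_complete E (fun k => Xy k i) (cau i).
    by exists z.
  by exists (fun i => projT1 (h i)) => i; exact: (projT2 (h i)).
have small (r : R) : (forall e, 0 < e -> r <= e) -> r <= 0.
  by move=> h; rewrite leNgt; apply/negP => r0; have := h (r / 2) ltac:(by rewrite divr_gt0); lra.
exists x.
  move=> i; have [Xi Hi] := Hx i; split => //; apply: (es_eq0 E).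
  apply/eqP; rewrite eq_le (es_ge0 E) andbT; apply: small => e ep.
  have e2 : 0 < e / 2 by rewrite divr_gt0.
  have [e' e'0 Hc] := es_cont E e2.
  have [K1 HK1] := Hi e' e'0; have [_ Hi1] := Hx (i + 1).
  have [K2 HK2] := Hi1 _ e2.
  pose k := (K1 + K2 + `|i|)%N.
  have h1 := Hc _ _ (HK1 k (leq_trans (leq_addr _ _) (leq_addr _ _))).
  have h2 := HK2 k (leq_trans (leq_addl _ _) (leq_addr _ _)).
  rewrite yT in h1; last exact: leq_addl.
  have := es_tri E (y k (i + 1)) (T (x i)) (x (i + 1)).
  by rewrite (es_C E (y k (i + 1))); lra.
move=> i; have [_ Hi] := Hx i.
suff : d (x i) (w i) - b <= 0 by rewrite subr_le0 => /le_trans; apply.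
apply: small => e ep; have [K HK] := Hi e ep.
have h1 := HK (K + `|i|)%N ltac:(lia).
have h2 := yw (K + `|i|)%N i ltac:(lia).
have := es_tri E (y (K + `|i|)%N i) (x i) (w i); lra.
Qed.

End shadow.

(** * Markov coding *)

(* Bowen's labels; no topology is involved, only cutting and pasting of
   codes. *)
Section labels.
Context {R : realType} {M : Type} {P : finType} (d : M -> M -> R) (b r : R)
  (O : (int -> M) -> Prop) (code : (int -> P) -> (int -> M) -> Prop).

Definition closef (x y : int -> M) k e := forall i, k <= i -> d (x i) (y i) <= e.
Definition closep (x y : int -> M) k e := forall i, i <= k -> d (x i) (y i) <= e.
(** The orbit [x], seen at time [k], lies in Bowen's rectangle of [p]; since an orbit has many
    codes, it can lie in several rectangles. *)
Definition at_ (x : int -> M) k p := exists2 w, code w x & w k = p.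
(** Bowen's refinement of the rectangles: whether the local stable set of [x] in the rectangle of
    [p] meets that of [q]; [unst] does the same for the unstable set. *)
Definition stab (x : int -> M) k p q := at_ x k p /\
  exists z, [/\ O z, at_ z k p, at_ z k q & closef x z k (2 * b)].
Definition unst (x : int -> M) k p q := at_ x k p /\
  exists z, [/\ O z, at_ z k p, at_ z k q & closep x z k (2 * b)].

Record coding : Prop := Coding {
  cd_ge0 : 0 <= b;
  cd_r0 : 0 <= r;
  cd_xx : forall x, d x x = 0;
  cd_C : forall x y, d x y = d y x;
  cd_tri : forall y x z, d x z <= d x y + d y z;
  cd_close : forall w v x y i, code w x -> code v y -> w i = v i -> d (x i) (y i) <= 2 * b;
  cd_sur : forall x, O x -> exists w, code w x;
  cd_orb : forall w x, code w x -> O x;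
  cd_glue : forall w v x y k, code w x -> code v y -> w k = v k ->
    exists z, code (fun i => if i <= k then v i else w i) z;
  cd_uniq : forall x y, O x -> O y -> (forall i, d (x i) (y i) <= 8 * b + r) -> x = y }.

Definition samelab (x : int -> M) k (y : int -> M) l := forall p q,
  [/\ at_ x k p <-> at_ y l p, stab x k p q <-> stab y l p q
    & unst x k p q <-> unst y l p q].

Hypothesis C : coding.

Lemma closef_tri y x z k e e' : closef x y k e -> closef y z k e' -> closef x z k (e + e').
Proof.
move=> h1 h2 i ki; apply: le_trans (cd_tri C (y i) _ _) _.
by apply: lerD; [exact: h1|exact: h2].
Qed.

Lemma closep_tri y x z k e e' : closep x y k e -> closep y z k e' -> closep x z k (e + e').
Proof.
move=> h1 h2 i ki; apply: le_trans (cd_tri C (y i) _ _) _.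
by apply: lerD; [exact: h1|exact: h2].
Qed.

Lemma closefC x y k e : closef x y k e -> closef y x k e.
Proof. by move=> h i ki; rewrite (cd_C C); exact: h. Qed.

Lemma closepC x y k e : closep x y k e -> closep y x k e.
Proof. by move=> h i ki; rewrite (cd_C C); exact: h. Qed.

Lemma closefW x y k l e : k <= l -> closef x y k e -> closef x y l e.
Proof. by move=> kl h i li; apply: h; exact: le_trans li. Qed.

Lemma close_eq x y k e e' : O x -> O y -> closef x y k e -> closep x y k e' ->
  e <= 8 * b -> e' <= 8 * b -> x = y.
Proof.
move=> Ox Oy h1 h2 e8 e8'; apply: (cd_uniq C) => // i.
apply: (@le_trans _ _ (8 * b)); last by rewrite lerDl (cd_r0 C).
have [ik|ki] := leP i k; first exact: le_trans (h2 _ ik) e8'.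
exact: le_trans (h1 _ (ltW ki)) e8.
Qed.

(** Smale's bracket: [z] has the future of [x] and the past of [y]. *)
Lemma bracket w v x y k : code w x -> code v y -> w k = v k -> exists z,
  [/\ code (fun i => if i <= k then v i else w i) z,
      O z, closef x z k (2 * b) & closep y z k (2 * b)].
Proof.
move=> wx vy e; have [z cz] := cd_glue C wx vy e; exists z; split => //.
- exact: (cd_orb C cz).
- move=> i ki; apply: (cd_close C wx cz); case: ifP => // ik.
  by have -> : i = k by apply/eqP; rewrite eq_le ik ki.
- by move=> i ik; apply: (cd_close C vy cz); rewrite ik.
Qed.

(** [z] is close to the bracket in both time directions, hence equal to it by [cd_uniq], and so it
    has the pasted code. *)
Lemma paste w v x y z k e e' : code w x -> code v y -> w k = v k -> O z ->
  closef x z k e -> closep y z k e' -> e <= 6 * b -> e' <= 6 * b ->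
  code (fun i => if i <= k then v i else w i) z.
Proof.
move=> wx vy wv Oz h1 h2 e6 e6'; have [z' [cz' Oz' h1' h2']] := bracket wx vy wv.
have b0 := cd_ge0 C.
rewrite (_ : z = z') //; apply: (close_eq Oz Oz' (closef_tri (closefC h1) h1')
  (closep_tri (closepC h2) h2')); lra.
Qed.

(** When [x] and [z] share a symbol at time [k], the bracket with the future of [x] and the past of
    [z] is [z] itself; closeness up to [6 * b] thus improves to [2 * b]. *)
Lemma closef_improve x z k p e : at_ x k p -> at_ z k p -> closef x z k e ->
  e <= 6 * b -> closef x z k (2 * b).
Proof.
move=> [w wx wk] [v vz vk] h e6; have b0 := cd_ge0 C.
have [z' [cz' Oz' h1 h2]] := bracket wx vz (etrans wk (esym vk)).
rewrite (_ : z = z') //.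
apply: (close_eq (cd_orb C vz) Oz' (closef_tri (closefC h) h1) h2); lra.
Qed.

Lemma closep_improve x z k p e : at_ x k p -> at_ z k p -> closep x z k e ->
  e <= 6 * b -> closep x z k (2 * b).
Proof.
move=> [w wx wk] [v vz vk] h e6; have b0 := cd_ge0 C.
have [z' [cz' Oz' h1 h2]] := bracket vz wx (etrans vk (esym wk)).
rewrite (_ : z = z') //.
apply: (close_eq (cd_orb C vz) Oz' h1 (closep_tri (closepC h) h2)); lra.
Qed.

Lemma stab_transfer x z k e p q : (forall p, at_ x k p <-> at_ z k p) -> closef x z k e ->
  e <= 4 * b -> stab x k p q -> stab z k p q.
Proof.
move=> h xz e4 [xp [y [Oy yp yq xy]]]; have b0 := cd_ge0 C; split; first exact/h.
exists y; split => //; apply: (@closef_improve _ _ _ p (e + 2 * b)) => //.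
- exact/h.
- exact: closef_tri (closefC xz) xy.
- lra.
Qed.

Lemma unst_transfer x z k e p q : (forall p, at_ x k p <-> at_ z k p) -> closep x z k e ->
  e <= 4 * b -> unst x k p q -> unst z k p q.
Proof.
move=> h xz e4 [xp [y [Oy yp yq xy]]]; have b0 := cd_ge0 C; split; first exact/h.
exists y; split => //; apply: (@closep_improve _ _ _ p (e + 2 * b)) => //.
- exact/h.
- exact: closep_tri (closepC xz) xy.
- lra.
Qed.

Lemma le26 : 2 * b <= 6 * b. Proof. by rewrite ler_wpM2r ?(cd_ge0 C) // ler_nat. Qed.
Lemma le24 : 2 * b <= 4 * b. Proof. by rewrite ler_wpM2r ?(cd_ge0 C) // ler_nat. Qed.
Lemma le06 : 0 <= 6 * b. Proof. by rewrite mulr_ge0 // (cd_ge0 C). Qed.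

Lemma closef_refl x k : closef x x k 0. Proof. by move=> i _; rewrite (cd_xx C). Qed.
Lemma closep_refl x k : closep x x k 0. Proof. by move=> i _; rewrite (cd_xx C). Qed.

Lemma at_future x z k0 k p : O z -> (forall p, at_ x k0 p -> at_ z k0 p) ->
  closef x z k0 (2 * b) -> k0 <= k -> at_ x k p -> at_ z k p.
Proof.
move=> Oz h xz k0k [w wx wk]; have [v vz vk] := h (w k0) (ex_intro2 _ _ w wx erefl).
exists (fun i => if i <= k0 then v i else w i).
  exact: (paste wx vz (esym vk) Oz xz (@closep_refl _ _) le26 le06).
case: ifP => // kk0; have kE : k = k0 by apply/eqP; rewrite eq_le k0k kk0.
by rewrite kE vk -kE.
Qed.

Lemma unst_future x z k0 k p q : O x -> O z ->
  (forall p, at_ z k0 p -> at_ x k0 p) ->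
  (forall p q, unst z k0 p q -> unst x k0 p q) ->
  closef x z k0 (2 * b) -> k0 <= k -> unst z k p q -> unst x k p q.
Proof.
move=> Ox Oz hat hun xz k0k [zp [z1 [Oz1 z1p z1q zz1]]]; have b0 := cd_ge0 C.
have zx := closefC xz.
split; first exact: (at_future Ox hat zx k0k zp).
have [c cz ck] := zp; have [c1 c1z1 c1k] := z1p; have [c2 c2z1 c2k] := z1q.
have cc := paste c1z1 cz (etrans c1k (esym ck)) Oz1 (@closef_refl _ _) zz1 le06 le26.
set c' := (fun i => _) in cc.
have c'k0 : c' k0 = c k0 by rewrite /c' k0k.
have c'k : c' k = p by rewrite /c' lexx.
have zk0 : at_ z k0 (c k0) by exists c.
have [v vx vk0] := hat _ zk0.
have [] : unst x k0 (c k0) (c2 k0).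
  apply: hun; split => //; exists z1; split => //; first by exists c'.
    by exists c2.
  by move=> i ik; apply: zz1; exact: le_trans k0k.
move=> _ [z3 [Oz3 _ [v3 v3z3 v3k0] xz3]].
have [z2 [cz2 Oz2 z12 xz2]] := bracket cc vx (etrans c'k0 (esym vk0)).
have z2p : at_ z2 k p.
  exists (fun i => if i <= k0 then v i else c' i) => //.
  case: ifP => // kk0; have kE : k = k0 by apply/eqP; rewrite eq_le k0k kk0.
  by rewrite -c'k kE vk0.
exists z2; split => //.
- exists (fun i => if i <= k0 then v3 i else c2 i).
    apply: (paste c2z1 v3z3 (esym v3k0) Oz2 z12 (closep_tri (closepC xz3) xz2) le26); lra.
  case: ifP => // kk0; have kE : k = k0 by apply/eqP; rewrite eq_le k0k kk0.
  by rewrite kE v3k0 -kE.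
- have xp := at_future Ox hat zx k0k zp.
  apply: (closep_improve xp z2p _ (lexx _)) => i ik.
  have [ik0|/ltW ik0] := leP i k0; first exact: le_trans (xz2 i ik0) le26.
  have h1 := xz i ik0; have h2 := zz1 i ik; have h3 := z12 i ik0.
  have t1 := cd_tri C (z i) (x i) (z2 i); have t2 := cd_tri C (z1 i) (z i) (z2 i).
  by move: h1 h2 h3 t1 t2; clear; lra.
Qed.

Lemma samelab_future x z k0 k : O x -> O z -> samelab x k0 z k0 ->
  closef x z k0 (2 * b) -> k0 <= k -> samelab x k z k.
Proof.
move=> Ox Oz s xz k0k.
have hat p : at_ x k p <-> at_ z k p.
  split; apply: (@at_future _ _ k0) => //.
  - by move=> p'; have [[h h'] _ _] := s p' p'.
  - by move=> p'; have [[h h'] _ _] := s p' p'.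
  - exact: closefC.
move=> p q; split; first exact: hat.
- split; apply: (@stab_transfer _ _ _ (2 * b)) => //; rewrite ?le24 //.
  + exact: closefW xz.
  + by move=> p'; apply: iff_sym; exact: hat.
  + exact: closefC (closefW k0k xz).
- split; apply: (@unst_future _ _ k0) => //.
  + by move=> p'; have [[h h'] _ _] := s p' p'.
  + by move=> p' q'; have [_ _ [h h']] := s p' q'.
  + exact: closefC.
  + by move=> p'; have [[h h'] _ _] := s p' p'.
  + by move=> p' q'; have [_ _ [h h']] := s p' q'.
Qed.

Lemma samelab_sym x k y l : samelab x k y l -> samelab y l x k.
Proof. by move=> h p q; have [h1 h2 h3] := h p q; split; apply: iff_sym. Qed.

Lemma samelab_trans y l x k z m : samelab x k y l -> samelab y l z m -> samelab x k z m.
Proof.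
move=> h h' p q; have [h1 h2 h3] := h p q; have [h1' h2' h3'] := h' p q.
by split; [apply: (iff_trans h1)|apply: (iff_trans h2)|apply: (iff_trans h3)].
Qed.

(** Symbols common to [x] and [y] pass to [z] by pasting. Conversely, a symbol [q] of [z] shows up
    in the unstable relation of [y], hence in that of [x]; the resulting orbit supplies the past of
    a code of [x] through [q]. *)
Lemma samelab_bracket x y z k : O x -> O y -> O z -> samelab x k y k ->
  closef x z k (2 * b) -> closep y z k (2 * b) -> samelab x k z k.
Proof.
move=> Ox Oy Oz s xz yz; have b0 := cd_ge0 C.
have hat p : at_ x k p -> at_ z k p.
  move=> [w wx wk]; have [v vy vk] : at_ y k p by have [[h _] _ _] := s p p; apply: h; exists w.
  exists (fun i => if i <= k then v i else w i); last by rewrite lexx.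
  by apply: (paste wx vy (etrans wk (esym vk)) Oz xz yz le26 le26).
have hat' q : at_ z k q -> at_ x k q.
  move=> zq; have [w wx] := cd_sur C Ox; have xp : at_ x k (w k) by exists w.
  have yp : at_ y k (w k) by have [[h _] _ _] := s (w k) (w k); apply: h.
  have [] : unst x k (w k) q.
    have [_ _ [_ h]] := s (w k) q; apply: h; split => //; exists z; split => //.
    exact: hat.
  move=> _ [z' [Oz' _ [v' v'z' v'k] xz']]; have [v vz vk] := zq.
  exists (fun i => if i <= k then v' i else v i); last by rewrite lexx.
  exact: (paste vz v'z' (etrans vk (esym v'k)) Ox (closefC xz) (closepC xz') le26 le26).
have hatE p : at_ x k p <-> at_ z k p by split; [exact: hat|exact: hat'].
have hatyE p : at_ y k p <-> at_ z k p by have [h _ _] := s p p; apply: iff_trans (iff_sym h) _.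
move=> p q; split => //.
- split; apply: (@stab_transfer _ _ _ (2 * b)) => //; rewrite ?le24 //.
  + by move=> p'; apply: iff_sym.
  + exact: closefC.
- have [_ _ h] := s p q; apply: (iff_trans h).
  split; apply: (@unst_transfer _ _ _ (2 * b)) => //; rewrite ?le24 //.
  + by move=> p'; apply: iff_sym.
  + exact: closepC.
Qed.

End labels.

Section reversal.
Context {R : realType} {M : Type} {P : finType} (d : M -> M -> R) (b r : R)
  (O : (int -> M) -> Prop) (code : (int -> P) -> (int -> M) -> Prop).
Hypothesis C : coding d b r O code.

Definition mirror (S : Type) (x : int -> S) : int -> S := fun i => x (- i).

Lemma mirrorK S : involutive (@mirror S).
Proof. by move=> x; apply/funext => i; rewrite /mirror opprK. Qed.

Definition mO x := O (mirror x).
Definition mcode w x := code (mirror w) (mirror x).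

(** Reversing time exchanges [stab] with [unst], so statements about the past follow from those
    about the future. In [cd_glue] the cut belongs to the other side after reversal, which is
    harmless because the symbols agree there. *)
Lemma coding_rev : coding d b r mO mcode.
Proof.
split.
- exact: cd_ge0 C.
- exact: cd_r0 C.
- exact: cd_xx C.
- exact: cd_C C.
- exact: cd_tri C.
- move=> w v x y i wx vy e; have := cd_close C (i := - i) wx vy.
  by rewrite /mirror opprK; apply.
- by move=> x /(cd_sur C) [w cw]; exists (mirror w); rewrite /mcode mirrorK.
- by move=> w x; exact: (cd_orb C).
- move=> w v x y k wx vy e; have [|z cz] := cd_glue C (k := - k) vy wx.
    by rewrite /mirror opprK.
  exists (mirror z); rewrite /mcode mirrorK.
  congr (code _ _): cz; apply/funext => i; rewrite /mirror lerNl.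
  case: (ltgtP i (- k)) => [//|//|->]; by rewrite opprK e.
- by move=> x y Ox Oy h; apply: (can_inj (@mirrorK M)); apply: (cd_uniq C) => // i; exact: h.
Qed.

Lemma at_rev x k p : at_ mcode x k p <-> at_ code (mirror x) (- k) p.
Proof.
split=> [[w wx wk]|[w wx wk]]; exists (mirror w) => //.
- by rewrite /mirror opprK.
- by rewrite /mcode mirrorK.
Qed.

Lemma closef_rev x y k e : closef d x y k e <-> closep d (mirror x) (mirror y) (- k) e.
Proof.
split=> h i ki.
  by apply: h; rewrite lerNr.
by have := h (- i); rewrite /mirror opprK lerN2; apply.
Qed.

Lemma closep_rev x y k e : closep d x y k e <-> closef d (mirror x) (mirror y) (- k) e.
Proof.
split=> h i ki.
  by apply: h; rewrite lerNl.
by have := h (- i); rewrite /mirror opprK lerN2; apply.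
Qed.

Lemma stab_rev x k p q : stab d b mO mcode x k p q <-> unst d b O code (mirror x) (- k) p q.
Proof.
split=> [[xp [z [Oz zp zq xz]]]|[xp [z [Oz zp zq xz]]]].
- split; first exact/at_rev.
  by exists (mirror z); split => //; [exact/at_rev|exact/at_rev|exact/closef_rev].
- split; first exact/at_rev.
  exists (mirror z); split.
  + by rewrite /mO mirrorK.
  + by apply/at_rev; rewrite mirrorK.
  + by apply/at_rev; rewrite mirrorK.
  + by apply/closef_rev; rewrite mirrorK.
Qed.

Lemma unst_rev x k p q : unst d b mO mcode x k p q <-> stab d b O code (mirror x) (- k) p q.
Proof.
split=> [[xp [z [Oz zp zq xz]]]|[xp [z [Oz zp zq xz]]]].
- split; first exact/at_rev.
  by exists (mirror z); split => //; [exact/at_rev|exact/at_rev|exact/closep_rev].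
- split; first exact/at_rev.
  exists (mirror z); split.
  + by rewrite /mO mirrorK.
  + by apply/at_rev; rewrite mirrorK.
  + by apply/at_rev; rewrite mirrorK.
  + by apply/closep_rev; rewrite mirrorK.
Qed.

Lemma samelab_rev x k y l : samelab d b mO mcode x k y l <->
  samelab d b O code (mirror x) (- k) (mirror y) (- l).
Proof.
split=> h p q; have [h1 h2 h3] := h p q.
- by split; [rewrite -!at_rev|rewrite -!unst_rev|rewrite -!stab_rev].
- by split; [rewrite !at_rev|rewrite !stab_rev|rewrite !unst_rev].
Qed.

End reversal.

Section gluing.
Context {R : realType} {M : Type} {P : finType} (d : M -> M -> R) (b r : R)
  (O : (int -> M) -> Prop) (code : (int -> P) -> (int -> M) -> Prop).
Hypothesis C : coding d b r O code.
Notation samelab := (samelab d b O code).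

Lemma samelab_past x z k0 k : O x -> O z -> samelab x k0 z k0 ->
  closep d x z k0 (2 * b) -> k <= k0 -> samelab x k z k.
Proof.
move=> Ox Oz s xz kk0.
have := @samelab_future _ _ _ _ _ _ _ _ (coding_rev C) (mirror x) (mirror z) (- k0) (- k).
rewrite /mO !samelab_rev !closef_rev !mirrorK !opprK lerN2; exact.
Qed.

Lemma samelab_bracket_past x y z k : O x -> O y -> O z -> samelab x k y k ->
  closef d x z k (2 * b) -> closep d y z k (2 * b) -> samelab y k z k.
Proof.
move=> Ox Oy Oz s xz yz.
have := @samelab_bracket _ _ _ _ _ _ _ _ (coding_rev C) (mirror y) (mirror x) (mirror z) (- k).
rewrite /mO !samelab_rev !mirrorK !opprK; apply => //.
- exact: samelab_sym.
- by apply/closef_rev; rewrite !mirrorK opprK.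
- by apply/closep_rev; rewrite !mirrorK opprK.
Qed.

Lemma samelab_glue x y k : O x -> O y -> samelab x k y k -> exists z,
  [/\ O z, forall i, k <= i -> samelab x i z i, forall i, i <= k -> samelab y i z i,
      closef d x z k (2 * b) & closep d y z k (2 * b)].
Proof.
move=> Ox Oy s; have [w wx] := cd_sur C Ox; have xp : at_ code x k (w k) by exists w.
have [v vy vk] : at_ code y k (w k) by have [[h _] _ _] := s (w k) (w k); apply: h.
have [z [_ Oz xz yz]] := bracket C wx vy (esym vk).
exists z; split => //.
- by move=> i; apply: (samelab_future C Ox Oz (samelab_bracket C Ox Oy Oz s xz yz) xz).
- by move=> i; apply: (samelab_past Oy Oz (samelab_bracket_past Ox Oy Oz s xz yz) yz).
Qed.

(** Replace the part of [y] between [k] and [l] by that of [x], gluing at both ends where the labels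
    agree. The new orbit has the labels of [x] in between and stays so close to [y] that it equals
    [y]. *)
Lemma samelab_between x y (k l : int) : O x -> O y -> samelab x k y k -> samelab x l y l ->
  (forall i, k <= i <= l -> d (x i) (y i) <= 4 * b + r) ->
  forall i, k <= i <= l -> samelab x i y i.
Proof.
move=> Ox Oy sk sl xy i /andP[ki il]; have b0 := cd_ge0 C.
have kl := le_trans ki il.
have [z [Oz xz yz cxz cyz]] := samelab_glue Ox Oy sk.
have zl : samelab y l z l by apply: samelab_trans (samelab_sym sl) (xz l kl).
have [z' [Oz' yz' zz' cyz' czz']] := samelab_glue Oy Oz zl.
suff -> : y = z' by apply: samelab_trans (xz i ki) (zz' i il).
have r0 := cd_r0 C; apply: (cd_uniq C) => // j; have [jl|lj] := leP j l; last first.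
  by move: (cyz' j (ltW lj)) b0 r0; clear; lra.
have h1 := czz' j jl; have t1 := cd_tri C (z j) (y j) (z' j).
have [jk|kj] := leP j k.
  by have := cyz j jk; move: h1 t1 b0 r0; clear; lra.
have h2 := cxz j (ltW kj); have t2 := cd_tri C (x j) (y j) (z j).
have := xy j; rewrite (ltW kj) jl => /(_ isT); rewrite (cd_C C) => h3.
by move: h1 h2 h3 t1 t2; clear; lra.
Qed.

End gluing.

Section model.
Context {R : realType} {M : ptopologicalType} (d : M -> M -> R) (T : M -> M) (X : set M).
Hypothesis E : esys d T X.
Notation borbit := (borbit T X).

Lemma borbit_expansive : exists2 e0, 0 < e0 & forall x y, borbit x -> borbit y ->
  (forall i, d (x i) (y i) < e0) -> x = y.
Proof.
have [e0 e00 H] := es_exp E; exists e0 => // x y ox oy xy; apply/funext => i.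
apply: (es_eq0 E); apply/eqP; rewrite eq_le (es_ge0 E) andbT leNgt; apply/negP => h.
have [n0 Hn] := H _ h; have := Hn (x (i - n0%:Z)) (y (i - n0%:Z)) (ox _).1 (oy _).1.
rewrite !(borbit_iter _ _ ox) !(borbit_iter _ _ oy) !subrK => hh.
suff : d (x i) (y i) < d (x i) (y i) by rewrite ltxx.
by apply: hh => j _; rewrite (borbit_iter _ _ ox) (borbit_iter _ _ oy); exact: xy.
Qed.

Lemma labelling : exists2 r, 0 < r & forall eps, 0 < eps -> exists2 b, 0 < b <= eps &
  exists (A : finType) (lab : (int -> M) -> int -> A),
  [/\ forall x k i, borbit x -> lab (fun i => x (i + k)) i = lab x (i + k),
      forall x y k, borbit x -> borbit y -> lab x k = lab y k -> exists z,
        [/\ borbit z, forall i, k <= i -> lab z i = lab x i & forall i, i <= k -> lab z i = lab y i],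
      forall x y i j, borbit x -> borbit y -> lab x i = lab y j -> d (x i) (y j) <= 2 * b &
      forall x y (k l : int), borbit x -> borbit y -> lab x k = lab y k -> lab x l = lab y l ->
       (forall i, k <= i <= l -> d (x i) (y i) <= r) ->
       forall i, k <= i <= l -> lab x i = lab y i].
Proof.
have [e0 e00 Hexp] := borbit_expansive.
have r0 : 0 < e0 / 2 by rewrite divr_gt0.
exists (e0 / 2) => // eps eps0.
(* [8 * b + e0 / 2] must stay below [e0], so [b] has to be less than [e0 / 16]. *)
have [b b0 [b1 b2]] : exists2 b, 0 < b & b <= eps /\ b <= e0 / 17.
  by exists (Num.min eps (e0 / 17)); rewrite ?lt_min ?eps0 ?divr_gt0 // !ge_min !lexx orbT.
have [alpha al0 Hsh] := biinfinite_shadowing E b0.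
have al2 : 0 < alpha / 2 by rewrite divr_gt0.
have [e' e'0 Hc] := es_cont E al2.
(* The mesh of the net: net points within [g] of an orbit then form an [alpha]-pseudo-orbit, so
   every orbit has a code. *)
have [g g0 [g1 g2 g3]] : exists2 g, 0 < g & [/\ g <= b, g <= e' & g <= alpha / 2].
  exists (Num.min b (Num.min e' (alpha / 2))); first by rewrite !lt_min b0 e'0 al2.
  by split; rewrite !ge_min lexx ?orbT.
have [s sX snet] := es_net E g0.
pose P := 'I_(size s); pose pt (p : P) := tnth (in_tuple s) p.
have Xpt p : X (pt p) by apply: sX; exact: mem_tnth.
have ptnet x : X x -> exists p, d x (pt p) < g.
  by move=> /snet[p /(tnthP (in_tuple s)) [i ->] h]; exists i.
pose code (w : int -> P) (x : int -> M) := [/\ borbit x,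
  forall i, d (T (pt (w i))) (pt (w (i + 1))) < alpha & forall i, d (x i) (pt (w i)) <= b].
have C : coding d b (e0 / 2) borbit code.
  split.
  - exact: ltW.
  - exact: ltW.
  - exact: es_xx E.
  - exact: es_C E.
  - exact: es_tri E.
  - move=> w v x y i [_ _ h1] [_ _ h2] wv; have := h1 i; have := h2 i; rewrite -wv => h3 h4.
    have := es_tri E (pt (w i)) (x i) (y i); rewrite (es_C E (pt _)).
    by move: h3 h4; clear; lra.
  - move=> x ox; have h i : {p | d (x i) (pt p) < g} by apply: cid; apply: ptnet; exact: (ox i).1.
    exists (fun i => projT1 (h i)); split => // i; last first.
      exact: le_trans (ltW (projT2 (h i))) g1.
    have h1 := projT2 (h i); have h2 := projT2 (h (i + 1)).
    set p := projT1 (h i) in h1 *; set q := projT1 (h (i + 1)) in h2 *.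
    have := Hc _ _ (lt_le_trans h1 g2); rewrite (ox i).2 => h3.
    have := es_tri E (x (i + 1)) (T (pt p)) (pt q); rewrite (es_C E (T _) (x _)).
    by move: h2 h3 g3; clear; lra.
  - by move=> w x [].
  - move=> w v x y k [ox w1 w2] [oy v1 v2] wv.
    pose c (i : int) := if i <= k then v i else w i.
    have cps i : d (T (pt (c i))) (pt (c (i + 1))) < alpha.
      rewrite /c; have [h|h] := leP i k.
        have [h'|h'] := leP (i + 1) k; first exact: v1.
        have -> : i = k by apply/eqP; rewrite eq_le h -ltzD1.
        by rewrite -wv; exact: w1.
      have -> : (i + 1 <= k) = false by apply/negbTE; rewrite -ltNge (lt_trans h) // ltzD1.
      exact: w1.
    have [z oz hz] := Hsh (fun i => pt (c i)) (fun i => Xpt _) cps.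
    by exists z; split.
  - move=> x y ox oy h; apply: Hexp => // i; have := h i; move: b2 b0; clear; lra.
exists b; first by rewrite b0.
(* A label is the table of the three relations, so equality of labels is [samelab]. *)
exists {ffun P * P -> bool * (bool * bool)}.
exists (fun x k => [ffun pq => (`[<at_ code x k pq.1>],
  (`[<stab d b borbit code x k pq.1 pq.2>], `[<unst d b borbit code x k pq.1 pq.2>]))]).
have labP x k y l : [ffun pq => (`[<at_ code x k pq.1>],
  (`[<stab d b borbit code x k pq.1 pq.2>], `[<unst d b borbit code x k pq.1 pq.2>]))] =
  [ffun pq => (`[<at_ code y l pq.1>],
  (`[<stab d b borbit code y l pq.1 pq.2>], `[<unst d b borbit code y l pq.1 pq.2>]))] :> {ffun P * P -> bool * (bool * bool)} <->
  samelab d b borbit code x k y l.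
  split.
    move=> /ffunP h p q; have := h (p, q); rewrite !ffunE /= => -[h1 h2 h3].
    by split; apply: asbool_eq_equiv.
  move=> h; apply/ffunP => -[p q]; rewrite !ffunE /=; have [h1 h2 h3] := h p q.
  by congr (_, (_, _)); exact: asbool_equiv_eq.
have ats x k i p : at_ code (fun i => x (i + k)) i p <-> at_ code x (i + k) p.
  split=> [[w [ow w1 w2] wi]|[w [ow w1 w2] wi]].
    exists (fun i => w (i - k)); last by rewrite addrK.
    split.
    - have := borbit_shift (- k) ow; congr (borbit _).
      by apply/funext => j /=; rewrite subrK.
    - by move=> j; have := w1 (j - k); rewrite addrAC.
    - by move=> j; have := w2 (j - k); rewrite subrK.
  exists (fun i => w (i + k)) => //; split.
  - exact: borbit_shift.
  - by move=> j; have := w1 (j + k); rewrite addrAC.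
  - by move=> j; exact: w2.
have Osh (x : int -> M) k : borbit x -> borbit (fun i => x (i - k)) by exact: borbit_shift.
split.
- move=> x k i ox; apply/labP => p q; split.
  + exact: ats.
  + split=> -[xp [z [Oz zp zq xz]]]; (split; first exact/ats).
      exists (fun i => z (i - k)); split.
      * exact: borbit_shift.
      * by apply/ats; rewrite addrK.
      * by apply/ats; rewrite addrK.
      * by move=> j ij; have := xz (j - k); rewrite subrK; apply; rewrite lerBrDr.
    exists (fun i => z (i + k)); split; [exact: borbit_shift|exact/ats|exact/ats|].
    by move=> j ij; apply: xz; rewrite lerD2r.
  + split=> -[xp [z [Oz zp zq xz]]]; (split; first exact/ats).
      exists (fun i => z (i - k)); split.
      * exact: borbit_shift.
      * by apply/ats; rewrite addrK.
      * by apply/ats; rewrite addrK.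
      * by move=> j ij; have := xz (j - k); rewrite subrK; apply; rewrite lerBlDr.
    exists (fun i => z (i + k)); split; [exact: borbit_shift|exact/ats|exact/ats|].
    by move=> j ij; apply: xz; rewrite lerD2r.
- move=> x y k ox oy /labP s1; have [z [oz h1 h2 _ _]] := samelab_glue C ox oy s1.
  by exists z; split => // i ik; apply/labP; apply: samelab_sym; [exact: h1|exact: h2].
- move=> x y i j ox oy /labP s1.
  have [w wx] := cd_sur C ox; have xp : at_ code x i (w i) by exists w.
  have [[h _] _ _] := s1 (w i) (w i); have [v vy vj] := h xp.
  have [_ _ h1] := wx; have [_ _ h2] := vy; have := h1 i; have := h2 j; rewrite vj => h3 h4.
  have := es_tri E (pt (w i)) (x i) (y j); rewrite (es_C E (pt _)).
  by move: h3 h4; clear; lra.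
- move=> x y k l ox oy /labP s1 /labP s2 xy i ikl; apply/labP.
  apply: (samelab_between C ox oy s1 s2 _ ikl) => j jkl.
  by apply: le_trans (xy j jkl) _; rewrite lerDr mulr_ge0 // ltW.
Qed.

End model.

(* Words are the paths [a :: p] of [e]; [orb a p] is the initial point of an
   orbit segment with the labels [a :: p]. *)
Record smodel (R : realType) (M : Type) (d : M -> M -> R) (T : M -> M) (X : set M)
    (b r : R) (A : finType) (a0 : A) (e : rel A) (orb : A -> seq A -> M) : Prop := Smodel {
  sm_orb : forall a p, path e a p -> X (orb a p);
  sm_close : forall a p a' p' i j, path e a p -> path e a' p' ->
    (i <= size p)%N -> (j <= size p')%N -> nth a (a :: p) i = nth a' (a' :: p') j ->
    d (iter i T (orb a p)) (iter j T (orb a' p')) <= 2 * b;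
  sm_inj : forall a p p', path e a p -> path e a p' -> size p = size p' ->
    last a p = last a p' ->
    (forall i, (i <= size p)%N -> d (iter i T (orb a p)) (iter i T (orb a p')) <= r) ->
    p = p';
  sm_dense : forall x N, X x -> exists a p, [/\ path e a p, size p = N, connect e a0 a,
    connect e (last a p) a0 &
    forall i, (i <= N)%N -> d (iter i T x) (iter i T (orb a p)) <= 3 * b] }.

(** * From labels to a finite graph *)

Section model.
Context {R : realType} {M : ptopologicalType} (d : M -> M -> R) (T : M -> M) (X : set M).
Hypothesis E : esys d T X.
Notation borbit := (borbit T X).

Lemma iter_cont k : continuous (iter k T).
Proof.
elim: k => [|k IH] x; first exact: cvg_id.
apply: (@continuous_comp _ _ _ (iter k T) T); [exact: IH|exact: (es_Tc E)].
Qed.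

Lemma open_bowen x N e : open [set y | forall i, (i <= N)%N -> d (iter i T x) (iter i T y) < e].
Proof.
have o i : open [set y | d (iter i T x) (iter i T y) < e].
  have -> : [set y | d (iter i T x) (iter i T y) < e] =
    iter i T @^-1` [set z | d (iter i T x) z < e] by [].
  by apply: open_comp; [move=> y _; exact: iter_cont|exact: (es_open E)].
elim: N => [|N IH].
  rewrite (_ : [set y | _] = [set y | d (iter 0 T x) (iter 0 T y) < e]) //.
  by apply/seteqP; split=> y /= => [h|h []//]; exact: (h 0%N).
rewrite (_ : [set y | _] = [set y | forall i, (i <= N)%N -> d (iter i T x) (iter i T y) < e]
  `&` [set y | d (iter N.+1 T x) (iter N.+1 T y) < e]); first exact: openI.
apply/seteqP; split=> y /=.
  by move=> h; split => [i iN|]; [exact: h (leqW iN)|exact: (h N.+1)].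
by move=> [h1 h2] i; rewrite leq_eqVlt => /predU1P[->//|]; exact: h1.
Qed.

(** Repeated mixing gives one orbit that follows any finite list of orbit segments in order, with
    gaps exceeding [G]; [f j] holds the initial point and the length of a segment. *)
Lemma visits (G : nat) e J (f : nat -> M * nat) : 0 < e -> (exists x, X x) ->
  (forall j, X (f j).1) -> exists2 W, open W & (exists2 x, X x & W x) /\
  forall y, W y -> exists t : nat -> nat, forall j, (j < J)%N ->
    (t j + G < t j.+1)%N /\
    forall i, (i <= (f j).2)%N -> d (iter i T (f j).1) (iter (i + t j) T y) < e.
Proof.
move=> e0 [x0 Xx0]; elim: J f => [|J IH] f Xf.
  by exists setT; [exact: openT|split; [exists x0|move=> y _; exists id]].
have [W' oW' [[x' Xx' Wx'] HW']] := IH (f \o succn) (fun j => Xf j.+1).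
have oU := open_bowen (f 0%N).1 (f 0%N).2 e.
set U := [set y | _] in oU.
have [||N HN] := es_mix E oU oW'.
- by exists (f 0%N).1; split => // i _; rewrite (es_xx E).
- by exists x'.
pose n := (maxn N G.+1).
have [z [[Xz Uz] Wz]] := HN n (leq_maxl _ _).
exists (U `&` iter n T @^-1` W').
  apply: openI => //; apply: open_comp => // y _; exact: iter_cont.
split; first by exists z.
move=> y [Uy /HW' [t Ht]].
exists (fun j => if j is j'.+1 then (n + t j')%N else 0%N) => -[|j] jJ.
  split; first by rewrite add0n ltn_addr // leq_maxr.
  by move=> i h; rewrite addn0; exact: Uy.
have [h1 h2] := Ht j jJ; split; first by rewrite -addnA ltn_add2l.
by move=> i /h2; rewrite -iterD (addnC n) addnA.
Qed.

(** The graph of labels need not be strongly connected; this finds a component that already follows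
    all of [X]. Otherwise each label [a] has a segment [F a] that no orbit follows between two
    occurrences of [a]. An orbit following all [F a] in turn for [m.+1] rounds shows the same label
    at the start of two rounds, with the forbidden segment between them. *)
Lemma recurrent_label (A : finType) (lab : (int -> M) -> int -> A) e :
  0 < e -> (exists x, X x) ->
  (forall x k i, borbit x -> lab (fun i => x (i + k)) i = lab x (i + k)) ->
  exists a, forall x (N : nat), X x -> exists z (k l : int), [/\ borbit z,
    k <= 0, N%:Z <= l, lab z k = a /\ lab z l = a &
    forall i : nat, (i <= N)%N -> d (iter i T x) (z i) < e].
Proof.
move=> e0 Xne labS; apply: contrapT => /forallNP bad.
have bad' a : {xN : M * nat | X xN.1 /\ forall z (k l : int), borbit z ->
    k <= 0 -> xN.2%:Z <= l -> lab z k = a -> lab z l = a ->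
    ~ forall i : nat, (i <= xN.2)%N -> d (iter i T xN.1) (z i) < e}.
  apply: cid; have /existsNP [x /existsNP [N /not_implyP [Xx h]]] := bad a.
  exists (x, N); split => // z k l oz k0 Nl zk zl hz; apply: h.
  by exists z, k, l; split.
pose F a := projT1 (bad' a).
have HF a : X (F a).1 /\ forall z (k l : int), borbit z ->
    k <= 0 -> (F a).2%:Z <= l -> lab z k = a -> lab z l = a ->
    ~ forall i : nat, (i <= (F a).2)%N -> d (iter i T (F a).1) (z i) < e.
  exact: projT2 (bad' a).
move: bad' {bad} F HF => _ F HF.
have [x0 Xx0] := Xne; have [y0 oy0 _] := borbit_through E Xx0.
pose a0 := lab y0 0; pose m := #|A|.
have m0 : (0 < m)%N by apply/card_gt0P; exists a0.
pose G := (\max_(a : A) (F a).2)%N.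
pose lb j := nth a0 (enum A) (j %% m).
pose J := (m.+1 * m)%N.
have [W oW [[x Xx Wx] HW]] := @visits G e J (fun j => F (lb j)) e0 Xne (fun j => (HF _).1).
have [t Ht] := HW x Wx; have [y oy y0x] := borbit_through E Xx.
have tmono i j : (i <= j)%N -> (j <= J)%N -> (t i <= t j)%N.
  move=> ij; rewrite -(subnKC ij); elim: (j - i)%N => [|k IH]; first by rewrite addn0.
  rewrite addnS => h; apply: leq_trans (IH (ltnW h)) _.
  by have [h1 _] := Ht _ h; apply: leq_trans (leq_addr G _) (ltnW h1).
have [r [r' [rr' labr]]] : exists r r' : 'I_m.+1, (r < r')%N /\
    lab y (t (r * m)%N)%:Z = lab y (t (r' * m)%N)%:Z.
  apply: contrapT => h.
  have inj : injective (fun r : 'I_m.+1 => lab y (t (r * m)%N)%:Z).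
    move=> r r' rr'; apply/val_inj; case: (ltngtP r r') => // lt.
      by case: h; exists r, r'.
    by case: h; exists r', r.
  by have := leq_card _ inj; rewrite card_ord ltnn.
pose a := lab y (t (r * m)%N)%:Z.
have ia : (index a (enum A) < m)%N by rewrite /m cardE index_mem mem_enum.
pose j := (r * m + index a (enum A))%N.
have lbj : lb j = a by rewrite /lb /j modnMDl modn_small // nth_index // mem_enum.
have jr' : (j.+1 <= r' * m)%N.
  by apply: leq_trans (_ : r.+1 * m <= _)%N; [rewrite /j -addnS mulSn addnC leq_add2r|rewrite leq_mul2r rr' orbT].
have r'J : (r' * m <= J)%N by rewrite /J leq_mul2r ltnW ?orbT.
have jJ : (j < J)%N := leq_trans jr' r'J.
have [h1 h2] := Ht j jJ; rewrite lbj in h2.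
have := (HF a).2 (fun i => y (i + (t j)%:Z)) ((t (r * m)%N)%:Z - (t j)%:Z)
  ((t (r' * m)%N)%:Z - (t j)%:Z).
rewrite !labS // !subrK; apply => //.
- exact: borbit_shift.
- by rewrite subr_le0 lez_nat; apply: tmono; [exact: leq_addr|exact: ltnW].
- have h3 := tmono _ _ jr' r'J.
  have h4 : ((F a).2 <= G)%N by rewrite /G (leq_bigmax a).
  by rewrite lerBrDr -PoszD lez_nat; move: h1 h3 h4; clear; lia.
- by move=> i /h2; rewrite -y0x (borbit_iter _ _ oy) add0r PoszD.
Qed.

Theorem symbolic_model : (exists x, X x) -> exists2 r, 0 < r &
  forall eps, 0 < eps -> exists2 b, 0 < b <= eps &
  exists (A : finType) (a0 : A) (e : rel A) (orb : A -> seq A -> M),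
    smodel d T X b r a0 e orb.
Proof.
move=> Xne; have [r r0 Hlab] := labelling E; exists r => // eps eps0.
have [b /andP[b0 beps] [A [lab [L1 L2 L3 L4]]]] := Hlab eps eps0.
have [a0 Ha0] := recurrent_label b0 Xne L1.
exists b; first by rewrite b0.
pose e : rel A := fun a a' => `[<exists x, [/\ borbit x, lab x 0 = a & lab x 1 = a']>].
have edge x k : borbit x -> e (lab x k) (lab x (k + 1)).
  move=> ox; apply/asboolP; exists (fun i => x (i + k)); split; first exact: borbit_shift.
    by rewrite L1 // add0r.
  by rewrite L1 // addrC.
have [x0 Xx0] := Xne; have [y0 oy0 _] := borbit_through E Xx0.
pose onl a := exists2 x, borbit x & lab x 0 = a.
have onE x i : borbit x -> onl (lab x i).
  by move=> ox; exists (fun j => x (j + i)); [exact: borbit_shift|rewrite L1 // add0r].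
(* Each edge comes from an orbit; gluing these at the common labels realises the whole path. *)
have real a p : path e a p -> onl a -> exists2 x, borbit x &
    forall i : nat, (i <= size p)%N -> lab x i = nth a (a :: p) i.
  elim/last_ind: p => [_ [x ox xa]|p c IH].
    by exists x => // -[|i].
  rewrite rcons_path => /andP[pp /asboolP [y [oy ya yb]]] ha.
  have [x ox hx] := IH pp ha.
  have oy' := borbit_shift (- (size p)%:Z) oy.
  have [|z [oz z1 z2]] := L2 _ _ (size p)%:Z oy' ox.
    by rewrite L1 // subrr ya hx // (last_nth a).
  exists z => // i; rewrite size_rcons leq_eqVlt => /predU1P[->|].
    rewrite z1 ?lez_nat // L1 // -addn1 PoszD addrAC subrr add0r yb.
    by rewrite addn1 /= nth_rcons ltnn eqxx.
  rewrite ltnS => ip; rewrite z2 ?lez_nat // hx //.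
  by case: i ip => //= i ip; rewrite nth_rcons ip.
(* A label carried by no orbit starts only the empty path. It gets the default orbit [y0], the same
   for all such labels, so that [sm_close] still holds. *)
have ch a p : {x : int -> M | borbit x /\ (path e a p -> onl a ->
    forall i : nat, (i <= size p)%N -> lab x i = nth a (a :: p) i) /\ (~ onl a -> x = y0)}.
  apply: cid; have [[h1 h2]|h] := pselect (path e a p /\ onl a).
    by have [x ox hx] := real a p h1 h2; exists x.
  by exists y0; split => //; split => // h1 h2; case: h.
pose orb a p := projT1 (ch a p).
have oorb a p : borbit (orb a p) by have [] := projT2 (ch a p).
have orbP a p : path e a p -> onl a ->
    forall i : nat, (i <= size p)%N -> lab (orb a p) i = nth a (a :: p) i.
  by have [_ []] := projT2 (ch a p).
have orbN a p : ~ onl a -> orb a p = y0 by have [_ []] := projT2 (ch a p).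
have nilP a p : path e a p -> ~ onl a -> p = [::].
  case: p => //= b' p /andP[/asboolP[x [ox xa _]] _] []; by exists x.
have orbi a p (i : nat) : iter i T (orb a p 0) = orb a p i.
  by rewrite (borbit_iter _ _ (oorb a p)) add0r.
exists A, a0, e, (fun a p => orb a p 0); split.
- by move=> a p _; exact: (oorb a p 0).1.
- move=> a p a' p' i j pp pp' ip jp' h; rewrite !orbi.
  have [ha|ha] := pselect (onl a); have [ha'|ha'] := pselect (onl a').
  + by apply: L3 => //; rewrite !orbP.
  + have p0 := nilP _ _ pp' ha'; move: h jp'; rewrite p0; case: j => //= h _.
    by case: ha'; rewrite -h -orbP //; exact: onE.
  + have p0 := nilP _ _ pp ha; move: h ip; rewrite p0; case: i => //= h _.
    by case: ha; rewrite h -(orbP a' p') //; exact: onE.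
  + have p0 := nilP _ _ pp ha; have p0' := nilP _ _ pp' ha'.
    move: ip jp'; rewrite !orbN // p0 p0'; case: i {h} => //; case: j => // _ _.
    by rewrite (es_xx E) mulr_ge0 // ltW.
- move=> a p p' pp pp' sp lp h.
  have [ha|ha] := pselect (onl a); last by rewrite (nilP _ _ pp ha) (nilP _ _ pp' ha).
  have lE := orbP _ _ pp ha; have lE' := orbP _ _ pp' ha.
  have same := @L4 (orb a p) (orb a p') 0 (size p) (oorb _ _) (oorb _ _).
  apply: (@eq_from_nth _ a) => // i ip.
  suff : lab (orb a p) i.+1 = lab (orb a p') i.+1 by rewrite lE // lE' -?sp.
  apply: same.
  + by rewrite (lE 0%N) // (lE' 0%N).
  + by move: lp; rewrite !(last_nth a) lE // sp lE'.
  + by case=> // k /andP[_ kp]; have := h k; rewrite !orbi; apply.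
  + by rewrite lez_nat.
- move=> x N Xx; have [z [k [l [oz k0 Nl [zk zl] hz]]]] := Ha0 x N Xx.
  have zpath (i : int) n : path e (lab z i) [seq lab z (i + j.+1%:Z) | j <- iota 0 n].
    elim: n i => //= n IH i; rewrite edge //=.
    have := IH (i + 1); congr (path _ _ _).
    have -> : iota 1 n = map (addn 1) (iota 0 n) by rewrite -iotaDl.
    rewrite -map_comp; apply: eq_map => j /=; congr (lab z _).
    by rewrite add1n -[j.+2]addn1 PoszD addrA addrAC.
  have zlast (i : int) n : last (lab z i) [seq lab z (i + j.+1%:Z) | j <- iota 0 n] = lab z (i + n%:Z).
    case: n => [|n]; first by rewrite addr0.
    by rewrite -addn1 iotaD map_cat last_cat /= add0n addn1.
  have zcon (i : int) (n : nat) : connect e (lab z i) (lab z (i + n%:Z)).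
    by apply/connectP; exists [seq lab z (i + j.+1%:Z) | j <- iota 0 n]; rewrite ?zlast.
  exists (lab z 0), [seq lab z (0 + j.+1%:Z) | j <- iota 0 N]; split.
  + exact: zpath.
  + by rewrite size_map size_iota.
  + have := zcon k `|k|%N; rewrite zk; congr (connect _ _ (lab z _)); lia.
  + rewrite zlast; have := zcon (0 + N%:Z) `|l - N%:Z|%N; rewrite -zl; congr (connect _ _ (lab z _)); lia.
  + move=> i iN; rewrite orbi.
    have h1 : d (z i) (orb (lab z 0) [seq lab z (0 + j.+1%:Z) | j <- iota 0 N] i) <= 2 * b.
      apply: L3 => //; rewrite orbP ?zpath ?size_map ?size_iota //; last exact: onE.
      case: i iN => [//|i iN]; rewrite [RHS]/= (nth_map 0%N) ?size_iota // nth_iota //.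
    have := es_tri E (z i) (iter i T x) (orb (lab z 0) [seq lab z (0 + j.+1%:Z) | j <- iota 0 N] i).
    by have := hz i iN; move: h1; clear; lra.
Qed.

End model.

(** * Path counting *)

Section paths.
Context {S : finType} (e : rel S) (s : S).

Fixpoint paths n v : seq (seq S) :=
  if n is n'.+1 then flatten [seq map (cons x) (paths n' x) | x <- enum S & e v x]
  else if v == s then [:: [::]] else [::].

Lemma mem_paths n v p : (p \in paths n v) = [&& size p == n, path e v p & last v p == s].
Proof.
elim: n v p => [|n IH] v p /=.
  by case: p => [|x p] /=; case: eqP; rewrite ?inE.
apply/flatten_mapP/idP => [[x]|].
  rewrite mem_filter => /andP[vx _] /mapP[q]; rewrite IH => /and3P[sq pq lq] ->.
  by rewrite /= eqSS sq vx pq.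
case: p => [|x p] //=; rewrite eqSS => /and3P[sp /andP[vx pp] lp].
exists x; first by rewrite mem_filter vx mem_enum.
by apply/mapP; exists p => //; rewrite IH sp pp.
Qed.

Lemma uniq_paths n v : uniq (paths n v).
Proof.
elim: n v => [|n IH] v /=; first by case: eqP.
have : uniq [seq x <- enum S | e v x] by rewrite filter_uniq ?enum_uniq.
elim: [seq x <- enum S | e v x] => //= x l IHl /andP[xl ul].
rewrite cat_uniq IHl // map_inj_uniq ?IH /=; last by move=> p q [].
rewrite andbT; apply/hasPn => p /flatten_mapP[y yl /mapP[q _ ->]].
by apply/mapP => -[q' _ [yx _]]; move: xl; rewrite -yx yl.
Qed.

Lemma big_paths (R : nmodType) n v (F : seq S -> R) :
  \sum_(p <- paths n.+1 v) F p = \sum_(x | e v x) \sum_(p <- paths n x) F (x :: p).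
Proof.
rewrite /= big_flatten big_map big_filter big_enum_cond /=.
by apply: eq_bigr => x _; rewrite big_map.
Qed.

Lemma perm_paths (f : seq S -> seq S) n v : {in paths n v, forall p, f p \in paths n v} ->
  {in paths n v, cancel f f} -> perm_eq (map f (paths n v)) (paths n v).
Proof.
move=> h1 h2; have u : uniq (map f (paths n v)).
  rewrite map_inj_in_uniq ?uniq_paths // => p q pp qq pq.
  by rewrite -(h2 p pp) pq h2.
apply: uniq_perm => //; first exact: uniq_paths.
move=> p; apply/mapP/idP => [[q qq ->]|pp]; first exact: h1.
by exists (f p); [exact: h1|rewrite h2].
Qed.

(* [hit m v] counts the paths from [v] that reach [s] for the first time
   after [m] steps, [m > 0]. *)
Fixpoint hit m v : nat :=
  if m is m'.+1 then \sum_(x | e v x) (if x == s then (m' == 0)%N : nat else hit m' x) else 0%N.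

Definition cnt n v := size (paths n v).

Lemma cntS n v : cnt n.+1 v = (\sum_(x | e v x) cnt n x)%N.
Proof.
by rewrite /cnt -!sum1_size big_paths; apply: eq_bigr => x _; rewrite -sum1_size.
Qed.

Section weights.
Context {R : realType} (c : nat -> R).

(* [c (l + 1)] is the weight of a return to [s] after [l] steps. *)
Fixpoint wt g p : R :=
  if p is x :: p' then (if x == s then c g.+2 * wt 0 p' else wt g.+1 p') else 1.

Definition wsum n v g : R := \sum_(p <- paths n v) wt g p.

Lemma wsum0 v g : wsum 0 v g = (v == s)%:R.
Proof. by rewrite /wsum /=; case: eqP => _; rewrite ?big_nil // big_seq1. Qed.

Lemma wsumS n v g : wsum n.+1 v g =
  \sum_(x | e v x) (if x == s then c g.+2 * wsum n s 0 else wsum n x g.+1).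
Proof.
rewrite /wsum big_paths; apply: eq_bigr => x _ /=.
by case: eqP => // ->; rewrite big_distrr.
Qed.

(** The sum is split at the first visit to [s], which comes [g + m + 1] steps after the previous
    one; [c] takes this number plus one. *)
Lemma wsum_renewal n v g : wsum n.+1 v g =
  \sum_(m < n.+1) (hit m.+1 v)%:R * c (g + m).+2 * wsum (n - m) s 0.
Proof.
elim: n v g => [|n IH] v g.
  rewrite wsumS big_ord1 /= addn0 wsum0 eqxx !mulr1 natr_sum big_distrl /=.
  by apply: eq_bigr => x _; case: eqP => [_|/eqP/negbTE xs]; rewrite ?mulr1 ?mul1r // wsum0 xs mul0r.
rewrite wsumS big_ord_recl /= subn0 addn0.
under [X in _ + X]eq_bigr => m _ do rewrite natr_sum -mulrA big_distrl /=.
rewrite exchange_big /= natr_sum -mulrA big_distrl -big_split /=.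
apply: eq_bigr => x _; case: eqP => [_|_].
  by rewrite mul1r [X in _ + X]big1 ?addr0 // => m _; rewrite mul0r.
by rewrite mul0r add0r IH; apply: eq_bigr => m _; rewrite addSnnS subSS mulrA.
Qed.

End weights.

Lemma wsum1 (R : realType) n v g : wsum (fun=> 1 : R) n v g = (cnt n v)%:R.
Proof.
rewrite /wsum /cnt -sum1_size natr_sum; apply: eq_bigr => p _.
by elim: p g => //= x p IH g; case: eqP; rewrite ?IH ?mulr1.
Qed.

Section growth.
Context {R : realType} (La : R).
Hypothesis La0 : 0 < La.
Hypothesis cntL : forall n, (cnt n s)%:R <= La ^+ n.

(** By the renewal equation a sum [Sg > 1] would make the partial sums [u k] grow like [Sg ^+ k],
    while [t n <= 1] bounds them by [k * M + 1]. *)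
Lemma hit_sum M : \sum_(m < M) (hit m.+1 s)%:R / La ^+ m.+1 <= 1.
Proof.
rewrite leNgt; apply/negP => h; set Sg := \sum_(m < M) _ in h.
pose t n := (cnt n s)%:R / La ^+ n; pose u k := \sum_(n < (k * M).+1) t n.
have t0 n : 0 <= t n by rewrite divr_ge0 // exprn_ge0 // ltW.
have t1 n : t n <= 1 by rewrite ler_pdivrMr ?mul1r ?exprn_gt0.
have tS n : t n.+1 = \sum_(m < n.+1) (hit m.+1 s)%:R / La ^+ m.+1 * t (n - m)%N.
  rewrite /t -(@wsum1 R _ _ 0) wsum_renewal big_distrl /=; apply: eq_bigr => m _.
  rewrite mulr1 wsum1; have -> : La ^+ n.+1 = La ^+ m.+1 * La ^+ (n - m).
    by rewrite -exprD addSn subnKC // -ltnS.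
  by rewrite invfM; ring.
have uS k : Sg * u k <= u k.+1.
  rewrite /u [X in _ <= X]big_ord_recl /= mulSn.
  apply: le_trans (_ : \sum_(n < M + k * M) t n.+1 <= _); last by rewrite ler_wpDl.
  under [X in _ <= X]eq_bigr => n _ do rewrite tS.
  pose f m := (hit m.+1 s)%:R / La ^+ m.+1.
  have f0 m : 0 <= f m by rewrite divr_ge0 // exprn_ge0 // ltW.
  rewrite (_ : Sg * _ = \sum_(m < M) \sum_(n < (k * M).+1) f m * t n); last first.
    by rewrite /Sg big_distrl; apply: eq_bigr => m _; rewrite big_distrr.
  have -> : \sum_(n < M + k * M) \sum_(m < n.+1) f m * t (n - m)%N =
    \sum_(m < M + k * M) \sum_(n < M + k * M | (m <= n)%N) f m * t (n - m)%N.
    rewrite (exchange_big_dep xpredT) //=; apply: eq_bigr => n _.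
    rewrite (@big_ord_widen_cond _ _ _ n.+1 (M + k * M) xpredT (fun m => f m * t (n - m)%N)) //=.
  rewrite big_split_ord /= ler_wpDr //.
    by apply: sumr_ge0 => m _; apply: sumr_ge0 => n _; rewrite mulr_ge0.
  apply: ler_sum => m _.
  have hm : (m <= M + k * M)%N by rewrite (leq_trans (ltnW (ltn_ord m))) // leq_addr.
  rewrite -(big_mkord (fun n => (m <= n)%N) (fun n => f m * t (n - m)%N)).
  rewrite (big_cat_nat (leq0n m) hm) //= [X in _ <= X + _]big_nat_cond [X in _ <= X + _]big1 ?add0r; last first.
    by move=> i; rewrite ltnNge; case: (m <= i)%N; rewrite ?andbF.
  have -> : \sum_(m <= i < M + k * M | (m <= i)%N) f m * t (i - m)%N =
      \sum_(0 <= i < M + k * M - m) f m * t i.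
    rewrite -{1}[m : nat]add0n big_addn; apply: eq_big => i; first by rewrite leq_addl.
    by rewrite addnK.
  have hk : ((k * M).+1 <= M + k * M - m)%N.
    by rewrite -addnBAC ?(ltnW (ltn_ord m)) // -add1n leq_add2r subn_gt0.
  rewrite (big_cat_nat (leq0n _) hk) //= -(big_mkord xpredT (fun n => f m * t n)).
  by rewrite ler_wpDr // sumr_ge0 // => i _; rewrite mulr_ge0.
have uk k : Sg ^+ k <= u k.
  elim: k => [|k IH]; first by rewrite /u mul0n big_ord1 /t /cnt /= eqxx expr0 divr1.
  rewrite exprS; apply: le_trans (uS k); rewrite ler_wpM2l //.
  by apply: le_trans (ltW h); exact: ler01.
have ub k : u k <= (k * M).+1%:R.
  rewrite -[X in X%:R](card_ord (k * M).+1) -sum1_card natr_sum.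
  by apply: ler_sum => i _; exact: t1.
have a0 : 0 < Sg - 1 by rewrite subr_gt0.
have a2 : 0 < (Sg - 1) ^+ 2 by rewrite exprn_gt0.
(* Bernoulli's inequality, squared, gives [(k (Sg - 1)) ^ 2 <= Sg ^ (2 k) <= 2 k M + 1], which fails
   for this [k]. *)
pose k := (Num.truncn ((2 * M%:R + 1) / (Sg - 1) ^+ 2)).+1.
have kb : (2 * M%:R + 1) < k%:R * (Sg - 1) ^+ 2.
  by rewrite -ltr_pdivrMr // truncnS_gt.
have h1 := le_trans (uk (k + k)%N) (ub _).
have h2 : k%:R * (Sg - 1) <= Sg ^+ k.
  have := @bernoulli_le R (Sg - 1) k (ltW a0); rewrite [1 + (Sg - 1)]addrC subrK -mulr_natl; lra.
have k1 : 1 <= k%:R :> R by rewrite ler1n.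
have h3 : (k%:R * (Sg - 1)) ^+ 2 <= Sg ^+ (k + k).
  by rewrite exprD expr2 ler_pM // mulr_ge0 // ltW.
have := le_trans h3 h1; rewrite mulnDl -natr1 natrD natrM exprMn => h4.
have : k%:R * (2 * M%:R + 1) < k%:R * (k%:R * (Sg - 1) ^+ 2) by rewrite ltr_pM2l // ltr0n.
by move: h4 k1; rewrite (expr2 k%:R); clear; nra.
Qed.

End growth.

Definition pathn n v x := exists p, [/\ size p = n, path e v p & last v p = x].

Lemma pathnD m n v x y : pathn m v x -> pathn n x y -> pathn (m + n) v y.
Proof.
move=> [p [sp pp lp]] [q [sq pq lq]]; exists (p ++ q).
by rewrite size_cat sp sq cat_path pp lp last_cat lp.
Qed.

Lemma cnt_gt0 n v : (0 < cnt n v)%N <-> pathn n v s.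
Proof.
rewrite /cnt -has_predT; split=> [/hasP[p]|[p [h1 h2 h3]]].
  by rewrite mem_paths => /and3P[/eqP h1 h2 /eqP h3] _; exists p.
by apply/hasP; exists p => //; rewrite mem_paths h1 h2 h3 !eqxx.
Qed.

Fixpoint nall n v x : nat := if n is n'.+1 then \sum_(y | e v y) nall n' y x else (v == x).
Fixpoint navoid n v x : nat :=
  if n is n'.+1 then \sum_(y | e v y && (y != s)) navoid n' y x else (v == x).

Lemma nall_path n v x p : size p = n -> path e v p -> last v p = x -> (0 < nall n v x)%N.
Proof.
elim: n v p => [|n IH] v [|y p] //= => [_ _ ->|[sp] /andP[vy pp] lp]; first by rewrite eqxx.
by rewrite (bigD1 y) //= addn_gt0 (IH y p).
Qed.

Lemma navoid_le n v x : (navoid n v x <= nall n v x)%N.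
Proof.
elim: n v => //= n IH v; rewrite [leqRHS](bigID (fun y => y != s)) /=.
by rewrite (leq_trans _ (leq_addr _ _)) // leq_sum.
Qed.

Lemma navoid_lt n v x p : size p = n -> path e v p -> last v p = x -> s \in p ->
  (navoid n v x < nall n v x)%N.
Proof.
elim: n v p => [|n IH] v [|y p] //= [sp] /andP[vy pp] lp.
rewrite inE => /orP[/eqP sy|sp'].
  rewrite [ltnRHS](bigID (fun y => y != s)) /= -addn1 leq_add //.
    by apply: leq_sum => z _; exact: navoid_le.
  rewrite (bigD1 y) /=; last by rewrite vy -sy eqxx.
  by rewrite addn_gt0 (nall_path sp pp lp).
rewrite [ltnRHS](bigD1 y) //=.
have h : (\sum_(z | e v z && (z != s)) navoid n z x <=
  (if y != s then navoid n y x else 0) + \sum_(z | e v z && (z != y)) nall n z x)%N.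
  have [ys|ys] := boolP (y != s).
    rewrite (bigD1 y) /= ?vy // leq_add2l.
    apply: (@leq_trans (\sum_(z | e v z && (z != s) && (z != y)) nall n z x)%N).
      by apply: leq_sum => z _; exact: navoid_le.
    by rewrite [leqRHS](bigID (fun z => z != s)) /= (leq_trans _ (leq_addr _ _)) // leq_eqVlt;
      apply/orP; left; apply/eqP; apply: eq_bigl => z; rewrite andbAC.
  rewrite add0n; rewrite negbK in ys; rewrite (eqP ys).
  by apply: leq_sum => z _; exact: navoid_le.
apply: leq_ltn_trans h _; rewrite ltn_add2r; case: ifP => _; first exact: (IH y p).
exact: (nall_path sp pp lp).
Qed.

Lemma hitD K m v : (0 < m)%N -> hit (K + m) v = (\sum_x navoid K v x * hit m x)%N.
Proof.
move=> m0; elim: K v => [|K IH] v /=.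
  rewrite (bigD1 v) //= eqxx mul1n big1 ?addn0 // => x; rewrite eq_sym => /negbTE ->.
  by rewrite mul0n.
under [RHS]eq_bigr => x _ do rewrite big_distrl /=.
rewrite exchange_big /= big_mkcond [RHS]big_mkcond /=; apply: eq_bigr => y _.
case: (e v y) => //=; case: eqP => _ /=; first by rewrite addn_eq0 (gtn_eqF m0) andbF.
exact: IH.
Qed.

Lemma cntD K m v : cnt (K + m) v = (\sum_x nall K v x * cnt m x)%N.
Proof.
elim: K v => [|K IH] v /=.
  rewrite (bigD1 v) //= eqxx mul1n big1 ?addn0 // => x; rewrite eq_sym => /negbTE ->.
  by rewrite mul0n.
under [RHS]eq_bigr => x _ do rewrite big_distrl /=.
by rewrite exchange_big /= addSn cntS; apply: eq_bigr => y _; exact: IH.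
Qed.

Lemma hit_cnt m v : (hit m v <= cnt m v)%N.
Proof.
elim: m v => // m IH v; rewrite cntS; apply: leq_sum => x _; case: eqP => // ->.
by case: m {IH} => //=; rewrite /cnt /= eqxx.
Qed.

Lemma navoid_pathn n v x : (0 < navoid n v x)%N -> pathn n v x.
Proof.
elim: n v => [|n IH] v /=; first by case: eqP => // <- _; exists [::].
rewrite lt0n sum_nat_eq0 negb_forall => /existsP[y].
rewrite negb_imply -lt0n => /andP[/andP[vy _] /IH[p [sp pp lp]]].
by exists (y :: p); rewrite /= sp vy.
Qed.

End paths.

(** The period is found as the least positive difference [g] of two elements [t] and [t + g]: a
    nonzero remainder modulo [g] would be a smaller difference. Large multiples of [g] are
    combinations of [t] and [t + g]. *)
Lemma semigroup_period (L : nat -> Prop) r : L 0%N -> (forall m n, L m -> L n -> L (m + n)%N) ->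
  (0 < r)%N -> L r -> exists per M0, [/\ (0 < per)%N, forall n, L n -> (per %| n)%N &
    forall n, (M0 <= n)%N -> (per %| n)%N -> L n].
Proof.
move=> L0 LD r0 Lr.
have LM k n : L n -> L (k * n)%N.
  by move=> Ln; elim: k => // k IH; rewrite mulSn; exact: (LD).
pose D g := (0 < g)%N && `[<exists2 t, L t & L (t + g)%N>].
have Dr : exists g, D g.
  by exists r; rewrite /D r0; apply/asboolP; exists r => //; exact: (LD).
have [g /andP[g0 /asboolP[t Lt Ltg]] gmin] := ex_minnP Dr.
have dv n : L n -> (g %| n)%N.
  move=> Ln; rewrite /dvdn; case: posnP => // h; have := ltn_pmod n g0.
  rewrite ltnNge gmin // /D h; apply/asboolP; exists (n %/ g * (t + g) + n)%N.
    by apply: (LD) => //; exact: LM.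
  have -> : (n %/ g * (t + g) + n + n %% g = n %/ g * t + n + n)%N.
    by rewrite {5}(divn_eq n g); ring.
  by apply: (LD) => //; apply: (LD) => //; exact: LM.
have [sg tE] := dvdnP (dv t Lt).
exists g, (g * (sg * sg))%N; split => // n Mn /dvdnP[k nE].
have [s0|s0] := posnP sg.
  by rewrite nE; apply: LM; move: Ltg; rewrite tE s0.
have ks : (sg * sg <= k)%N by move: Mn; rewrite nE mulnC leq_pmul2r.
have qj : (k %% sg <= k %/ sg)%N.
  by apply: leq_trans (ltnW (ltn_pmod k s0)) _; rewrite leq_divRL.
have -> : n = ((k %/ sg - k %% sg) * t + (k %% sg) * (t + g))%N.
  rewrite nE {1}(divn_eq k sg) tE -{1}(subnK qj); ring.
by apply: (LD); exact: LM.
Qed.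

(** * Exponential tail of the first return *)

Section tail.
Context {S : finType} (e : rel S) (s : S) {R : realType} (La : R).
Hypothesis La0 : 0 < La.
Hypothesis cntL : forall n, (cnt e s n s)%:R <= La ^+ n.
Notation pathn := (pathn e).

(** A stretch of [K] steps can be rerouted: from [v] to [s], loops at [s], then from [s] to [x]. The
    length left for the loops is a multiple of the period, because [j] and [l] embed the stretch in
    a loop at [s], and [K] makes it exceed [M0]. *)
Lemma avoid_gap r : (0 < r)%N -> pathn r s s -> exists K, (0 < K)%N /\
  forall j v x, pathn j s v -> (exists l, pathn l x s) ->
    (0 < navoid e s K v x)%N -> (navoid e s K v x < nall e K v x)%N.
Proof.
move=> r0 pr.
have [per [M0 [per0 dv big]]] := @semigroup_period (fun n => pathn n s s) r
  (ex_intro _ [::] (And3 erefl isT erefl)) (fun m n => @pathnD _ e m n s s s) r0 pr.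
have tos v : {n : nat | (exists n, pathn n v s) -> pathn n v s}.
  apply: cid; have [[n pn]|h] := pselect (exists n, pathn n v s); first by exists n.
  by exists 0%N => h'; case: h.
have froms v : {n : nat | (exists n, pathn n s v) -> pathn n s v}.
  apply: cid; have [[n pn]|h] := pselect (exists n, pathn n s v); first by exists n.
  by exists 0%N => h'; case: h.
pose q v := projT1 (tos v); pose n2 v := projT1 (froms v).
have qP v : (exists n, pathn n v s) -> pathn (q v) v s := projT2 (tos v).
have n2P v : (exists n, pathn n s v) -> pathn (n2 v) s v := projT2 (froms v).
pose Q := (\max_v q v + \max_v n2 v)%N.
have [K KE] : exists K, K = (Q + M0 + r)%N by exists (Q + M0 + r)%N.
exists K; split; first by rewrite KE addn_gt0 r0 orbT.
move=> j v x pv [l pl] nv.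
have pvx := navoid_pathn nv.
have pq : pathn (q v) v s by apply: qP; exists (K + l)%N; exact: pathnD pl.
have pn : pathn (n2 x) s x by apply: n2P; exists (j + K)%N; exact: pathnD pvx.
have d1 := dv _ (pathnD pv pq).
have d2 := dv _ (pathnD pn pl).
have d3 := dv _ (pathnD pv (pathnD pvx pl)).
have hq : (q v <= \max_v q v)%N by exact: leq_bigmax.
have hn : (n2 x <= \max_v n2 v)%N by exact: leq_bigmax.
have qn : (q v + n2 x + M0 + r <= K)%N by rewrite KE /Q !leq_add.
pose rr := (K - q v - n2 x)%N.
have drr : (per %| rr)%N.
  have h : (j + (K + l) = (j + q v) + (n2 x + l) + rr)%N by rewrite /rr; move: qn; clear; lia.
  by rewrite -(dvdn_addr _ (dvdn_add d1 d2)) -h.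
have prr : pathn rr s s by apply: big => //; rewrite /rr; move: qn; clear; lia.
have rr0 : (0 < rr)%N by rewrite /rr; move: qn r0; clear; lia.
have [p1 [s1 p1p l1]] := pq; have [p2 [s2 p2p l2]] := pn; have [p3 [s3 p3p l3]] := prr.
have p3s : s \in p3.
  by move: s3 l3; case: p3 {p3p} => [|y p3] /= h l3; [move: rr0; rewrite -h|rewrite -[in X in X \in _]l3 mem_last].
apply: (@navoid_lt _ e s K v x (p1 ++ p3 ++ p2)) => //.
- by rewrite !size_cat s1 s2 s3 /rr; move: qn; clear; lia.
- by rewrite !cat_path p1p l1 p3p l3.
- by rewrite !last_cat l1 l3.
- by rewrite !mem_cat p3s orbT.
Qed.

(* In every stretch of [K] steps an avoiding path has at least one competitor
   through [s], so avoiding paths lose a constant factor per stretch. *)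
Lemma hit_gap K (dl : R) : 0 < dl ->
  (forall j v x, pathn j s v -> (exists l, pathn l x s) ->
    (1 + dl) * (navoid e s K v x)%:R <= (nall e K v x)%:R) ->
  forall k m j v, (0 < m)%N -> pathn j s v ->
    (1 + dl) ^+ k * (hit e s (k * K + m) v)%:R <= (cnt e s (k * K + m) v)%:R.
Proof.
move=> dl0 H k m j v m0; elim: k j v => [|k IH] j v jv.
  by rewrite expr0 mul1r ler_nat hit_cnt.
rewrite mulSn -addnA hitD ?addn_gt0 ?m0 ?orbT // cntD !natr_sum mulr_sumr.
apply: ler_sum => x _; rewrite !natrM exprS.
have [->|h0] := posnP (navoid e s K v x); first by rewrite mul0r mulr0 mulr_ge0.
have [->|h1] := posnP (hit e s (k * K + m) x); first by rewrite !mulr0 mulr_ge0.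
have jx := pathnD jv (navoid_pathn h0).
have xs : pathn (k * K + m) x s by apply/cnt_gt0; apply: leq_trans h1 _; exact: hit_cnt.
have h2 := H j v x jv (ex_intro (fun l => pathn l x s) _ xs); have h3 := IH (j + K)%N x jx.
rewrite mulrACA; apply: ler_pM => //.
  by rewrite mulr_ge0 // addr_ge0 // ltW.
by rewrite mulr_ge0 // exprn_ge0 // addr_ge0 // ltW.
Qed.

Lemma hit_tail : exists rho C : R, [/\ 0 < rho, rho < 1, 0 < C &
  forall m, (hit e s m s)%:R <= C * (rho * La) ^+ m].
Proof.
have [[r r0 pr]|nr] := pselect (exists2 r, (0 < r)%N & pathn r s s); last first.
  exists (1 / 2), 1; split; rewrite ?divr_gt0 ?ltr_pdivrMr ?mul1r ?ltr1n // => m.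
  rewrite mul1r; suff -> : hit e s m s = 0%N.
    by rewrite exprn_ge0 // mulr_ge0 // ?divr_ge0 // ltW.
  apply/eqP; rewrite -leqn0 leqNgt; apply/negP => h; apply: nr; exists m; last first.
    by apply/cnt_gt0; apply: leq_trans h _; exact: hit_cnt.
  by case: m h.
have [K [K0 HK]] := avoid_gap r0 pr.
(* Every count [navoid] is below [Mb], so one competing path adds at least the proportion [dl]. *)
pose Mb := (\max_v \max_x navoid e s K v x).+1.
pose dl : R := Mb%:R^-1.
have Mb0 : 0 < Mb%:R :> R by rewrite ltr0n.
have dl0 : 0 < dl by rewrite invr_gt0.
have H j v x : pathn j s v -> (exists l, pathn l x s) ->
    (1 + dl) * (navoid e s K v x)%:R <= (nall e K v x)%:R.
  move=> jv xl; have [->|h0] := posnP (navoid e s K v x); first by rewrite mulr0.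
  have := HK j v x jv xl h0; rewrite -addn1 -(ler_nat R) natrD => h.
  rewrite mulrDl mul1r; apply: le_trans h; rewrite lerD2l.
  rewrite /dl mulrC ler_pdivrMr // mul1r ler_nat /Mb ltnW // ltnS.
  by apply: leq_trans (leq_bigmax v); exact: (leq_bigmax x).
have hg := hit_gap dl0 H.
have K0R : 0 < K%:R :> R by rewrite ltr0n.
have dl1 : 0 < 1 + dl by rewrite addr_gt0.
(* Chosen so that [1 - K * eta = 1 / (1 + dl)]; Bernoulli's inequality then gives
   [(1 + dl) * rho ^+ K >= 1]. *)
pose eta := dl / (1 + dl) / K%:R.
have eta0 : 0 < eta by rewrite !divr_gt0.
have eta1 : eta < 1.
  rewrite /eta ltr_pdivrMr // ltr_pdivrMr // mul1r.
  by have : 1 <= K%:R :> R by [rewrite ler1n]; move: dl0; clear; nra.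
pose rho := 1 - eta.
have rho0 : 0 < rho by rewrite subr_gt0.
have rho1 : rho < 1 by rewrite /rho; move: eta0; clear; lra.
have rhoK : 1 <= (1 + dl) * rho ^+ K.
  have : 1 - K%:R * eta <= rho ^+ K.
    have geom k : 1 - k%:R * eta <= rho ^+ k.
      elim: k => [|k IH]; first by rewrite mul0r subr0 expr0.
      have k0 : 0 <= k%:R :> R by [].
      have : rho * (1 - k%:R * eta) <= rho ^+ k.+1 by rewrite exprS ler_pM2l.
      apply: le_trans; rewrite -natr1 /rho; move: k0 eta0; clear; nra.
    exact: geom.
  have -> : 1 - K%:R * eta = (1 + dl)^-1.
    by rewrite /eta; field; rewrite (gt_eqF K0R) (gt_eqF dl1).
  by rewrite -(@ler_pM2l _ _ dl1 (1 + dl)^-1) mulfV ?gt_eqF.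
exists rho, (rho ^- K); split => //; first by rewrite invr_gt0 exprn_gt0.
case=> [|m]; first by rewrite /= mulr_ge0 // ?invr_ge0 ?exprn_ge0 // ?ltW // mulr_gt0.
have := hg (m %/ K)%N (m %% K).+1 0%N s isT (ex_intro _ [::] (And3 erefl isT erefl)).
rewrite addnS -divn_eq => h; have {}h := le_trans h (cntL m.+1).
have k1 : 1 <= ((1 + dl) * rho ^+ K) ^+ (m %/ K) by exact: exprn_ege1.
have r1 : rho ^+ (K * (m %/ K).+1) <= rho ^+ m.+1.
  by apply: ler_wiXn2l; rewrite ?ltW // mulnC ltn_ceil.
have L1 : 0 <= La ^+ m.+1 by rewrite exprn_ge0 // ltW.
set hm := (hit e s m.+1 s)%:R in h *; set k := (m %/ K)%N in h k1 r1.
have hm0 : 0 <= hm by [].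
have rK : 0 < rho ^+ K by rewrite exprn_gt0.
move: k1; rewrite exprMn -exprM => k1.
move: r1; rewrite mulnS exprD => r1.
have rk0 : 0 < rho ^+ (K * k) by rewrite exprn_gt0.
rewrite exprMn mulrA; apply: le_trans (_ : rho ^+ (K * k) * La ^+ m.+1 <= _).
  apply: le_trans (_ : (1 + dl) ^+ k * rho ^+ (K * k) * hm <= _).
    by rewrite -[X in X <= _]mul1r ler_wpM2r.
  by rewrite mulrAC mulrC ler_pM2l.
by rewrite ler_wpM2r // ler_pdivlMl.
Qed.

End tail.

(** * Hyperbolic cosines of return times *)

Definition coshr (R : realType) (x : R) : R := (expR x + expR (- x)) / 2.

Lemma coshr_ge1 (R : realType) (x : R) : 1 <= coshr x.
Proof.
have h := expR_gt0 x; have : expR x * expR (- x) = 1 by rewrite -expRD subrr expR0.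
have h' := expR_gt0 (- x); rewrite /coshr; move: (expR x) (expR (- x)) h h' => a b a0 b0 ab.
have : 0 <= (a - 1) ^+ 2 * b by rewrite mulr_ge0 ?sqr_ge0 // ltW.
have -> : (a - 1) ^+ 2 * b = a * (a * b) - 2 * (a * b) + b by ring.
by rewrite ab; clear; lra.
Qed.

Lemma coshr_mono (R : realType) (x y : R) : `|x| <= y -> coshr x <= coshr y.
Proof.
have chN (z : R) : coshr (- z) = coshr z by rewrite /coshr opprK addrC.
have mono (u v : R) : 0 <= u -> u <= v -> coshr u <= coshr v.
  move=> u0 uv; rewrite /coshr ler_pM2r ?invr_gt0 //.
  have h1 := expR_gt0 u; have h2 : expR u <= expR v by rewrite ler_expR.
  have h3 : 1 <= expR u by rewrite -expR0 ler_expR.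
  have e1 : expR u * expR (- u) = 1 by rewrite -expRD subrr expR0.
  have e2 : expR v * expR (- v) = 1 by rewrite -expRD subrr expR0.
  have -> : expR (- u) = (expR u)^-1 by rewrite expRN.
  have -> : expR (- v) = (expR v)^-1 by rewrite expRN.
  move: (expR u) (expR v) h1 h2 h3 => a b a0 ab a1.
  have b0 : 0 < b by exact: lt_le_trans ab.
  have -> : b + b^-1 = a + a^-1 + (b - a) * (1 - (a * b)^-1).
    by field; rewrite !gt_eqF.
  rewrite lerDl mulr_ge0 // subr_ge0 // invf_le1 ?mulr_gt0 //.
  by move: a1 ab; clear; nra.
case: (leP 0 x) => [x0|x0].
  by rewrite ger0_norm // => h; exact: mono.
by rewrite ltr0_norm // => h; rewrite -chN; apply: mono => //; rewrite oppr_ge0 ltW.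
Qed.

(** [coshr x - 1] equals [(expR x - 1) ^+ 2 * expR (- x) / 2], and [expR x - 1 <= x * expR x]. The
    absence of a linear term is the source of the quadratic gain. *)
Lemma coshr_le (R : realType) (x : R) : 0 <= x -> coshr x <= 1 + x ^+ 2 * expR x.
Proof.
move=> x0; have h := expR_gt0 (- x); have e1 : expR x * expR (- x) = 1 by rewrite -expRD subrr expR0.
have h1 : 1 - x <= expR (- x) by have := expR_ge1Dx (- x).
have h0 := expR_gt0 x; have h2 : 1 <= expR x by rewrite -expR0 ler_expR.
rewrite /coshr; move: (expR x) (expR (- x)) h0 h h1 e1 h2 => a b a0 b0 h1 ab a1.
have ax : a - 1 <= x * a by move: (ler_wpM2l (ltW a0) h1); rewrite ab; clear; lra.
have h2 : (a - 1) ^+ 2 <= (x * a) ^+ 2 by rewrite !expr2 ler_pM // subr_ge0.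
have -> : (a + b) / 2 = 1 + (a - 1) ^+ 2 * b / 2.
  have -> : (a - 1) ^+ 2 * b = a * (a * b) - 2 * (a * b) + b by ring.
  by rewrite ab; field.
have : (a - 1) ^+ 2 * b <= (x * a) ^+ 2 * b by rewrite ler_wpM2r // ltW.
have -> : (x * a) ^+ 2 * b = x ^+ 2 * a * (a * b) by ring.
rewrite ab mulr1.
have : 0 <= x ^+ 2 * a by rewrite mulr_ge0 ?sqr_ge0 // ltW.
by clear; lra.
Qed.

Lemma sqr_le_expR (R : realType) (y : R) : 0 <= y -> y ^+ 2 / 4 <= expR y.
Proof.
move=> y0; have -> : expR y = expR (y / 2) * expR (y / 2) by rewrite -expRD -splitr.
have := expR_ge1Dx (y / 2); move: (expR (y / 2)) => a h; nra.
Qed.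

Section renewal.
Context {S : finType} (e : rel S) (s : S) {R : realType} (La : R).
Hypothesis La0 : 0 < La.
Hypothesis cntL : forall n, (cnt e s n s)%:R <= La ^+ n.

(** The weights have total mass at most 1 by [hit_sum], so only [coshr - 1] needs an estimate; it is
    of order [k ^+ 2], and its sum converges by the exponential tail. *)
Lemma hit_moment : exists k0 C : R, [/\ 0 < k0, 0 <= C & forall k n, 0 <= k -> k <= k0 ->
  \sum_(m < n) (hit e s m.+1 s)%:R / La ^+ m.+1 * coshr (k * m.+2%:R) <= 1 + C * k ^+ 2].
Proof.
have [rho [C [rho0 rho1 C0 tail]]] := hit_tail La0 cntL.
pose sg := (1 + rho) / 2.
have sg1 : sg < 1 by rewrite /sg; lra.
have sgr : rho < sg by rewrite /sg; lra.
have sg0 : 0 < sg by exact: lt_trans sgr.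
(* Then [expR (2 * k0) * rho = sg < 1]: one factor [expR k0] per step absorbs the exponential in
   [coshr_le], the other the square of the gap. *)
pose k0 := ln (sg / rho) / 2.
have k00 : 0 < k0 by rewrite divr_gt0 // ln_gt0 // ltr_pdivlMr ?mul1r.
have ek0 : expR (2 * k0) * rho = sg.
  have h : 2 * k0 = ln (sg / rho) by rewrite /k0; field.
  have h2 : 0 < sg / rho by exact: divr_gt0.
  by rewrite h lnK ?posrE // -mulrA mulVf ?mulr1 ?gt_eqF.
pose C1 := C * (4 / k0 ^+ 2 * expR (2 * k0)) / (1 - sg).
have C10 : 0 <= C1.
  by rewrite /C1 divr_ge0 ?subr_ge0 ?(ltW sg1) // mulr_ge0 ?(ltW C0) // mulr_ge0 ?expR_ge0 // divr_ge0 // sqr_ge0.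
exists k0, C1; split => // k n kge kle.
pose f m := (hit e s m.+1 s)%:R / La ^+ m.+1.
have f0 m : 0 <= f m by rewrite divr_ge0 // exprn_ge0 // ltW.
have ft m : f m <= C * rho ^+ m.+1.
  by rewrite /f ler_pdivrMr ?exprn_gt0 // -mulrA -exprMn; exact: tail.
have key m (x : R) : 0 <= x -> x <= C * rho ^+ m.+1 ->
    x * coshr (k * m.+2%:R) <= x + k ^+ 2 * (C * (4 / k0 ^+ 2 * expR (2 * k0)) * sg ^+ m.+1).
  move=> x0 xt; have km : 0 <= k * m.+2%:R by rewrite mulr_ge0.
  apply: le_trans (ler_wpM2l x0 (coshr_le km)) _.
  have -> : x * (1 + (k * m.+2%:R) ^+ 2 * expR (k * m.+2%:R)) =
    x + k ^+ 2 * (x * (m.+2%:R ^+ 2 * expR (k * m.+2%:R))) by ring.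
  rewrite lerD2l ler_wpM2l ?sqr_ge0 //.
  have h2 : m.+2%:R ^+ 2 * expR (k * m.+2%:R) <= 4 / k0 ^+ 2 * expR (2 * k0 * m.+2%:R).
    have e1 : expR (k * m.+2%:R) <= expR (k0 * m.+2%:R) by rewrite ler_expR ler_wpM2r.
    have e2 : (k0 * m.+2%:R) ^+ 2 / 4 <= expR (k0 * m.+2%:R).
      by apply: sqr_le_expR; rewrite mulr_ge0 // ltW.
    have -> : 2 * k0 * m.+2%:R = k0 * m.+2%:R + k0 * m.+2%:R by ring.
    rewrite expRD mulrA; apply: ler_pM => //; rewrite ?expR_ge0 ?sqr_ge0 //.
    rewrite mulrAC ler_pdivlMr ?exprn_gt0 // mulrC -exprMn.
    by move: e2; rewrite ler_pdivrMr // (mulrC (expR _)).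
  apply: le_trans (ler_wpM2l x0 h2) _.
  have e3 : expR (2 * k0 * m.+2%:R) = expR (2 * k0) * expR (2 * k0) ^+ m.+1.
    by rewrite -expRM_natr -expRD -natr1; congr expR; ring.
  have -> : sg ^+ m.+1 = expR (2 * k0) ^+ m.+1 * rho ^+ m.+1 by rewrite -ek0 exprMn.
  rewrite e3.
  have h3 : 0 <= 4 / k0 ^+ 2 * (expR (2 * k0) * expR (2 * k0) ^+ m.+1).
    by rewrite mulr_ge0 ?divr_ge0 ?sqr_ge0 // mulr_ge0 ?exprn_ge0 ?expR_ge0.
  apply: le_trans (ler_wpM2r h3 xt) _; rewrite le_eqVlt; apply/orP; left; apply/eqP; ring.
apply: le_trans (ler_sum _ (fun (m : 'I_n) _ => key m (f m) (f0 m) (ft m))) _.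
rewrite big_split /= lerD ?(hit_sum La0 cntL) //.
rewrite -mulr_sumr mulrC ler_wpM2r ?sqr_ge0 // -mulr_sumr /C1 ler_wpM2l //.
  by rewrite mulr_ge0 ?(ltW C0) // mulr_ge0 ?expR_ge0 // divr_ge0 // sqr_ge0.
rewrite -[X in _ <= X]div1r ler_pdivlMr ?subr_gt0 //.
have -> : (\sum_(i < n) sg ^+ i.+1) * (1 - sg) = sg - sg ^+ n.+1.
  elim: n => [|n IH]; first by rewrite big_ord0 mul0r expr1 subrr.
  by rewrite big_ord_recr /= mulrDl IH [in RHS]exprS; ring.
by rewrite lerBlDr (le_trans (ltW sg1)) // lerDl exprn_ge0 // ltW.
Qed.

(** Each return costs at most a factor [expR (C * k ^+ 2)], and [n] steps contain at most [n]
    returns. *)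
Lemma wsum_bound : exists k0 C : R, [/\ 0 < k0, 0 <= C & forall k n, 0 <= k -> k <= k0 ->
  wsum e s (fun l => coshr (k * l%:R)) n s 0 <= (La * expR (C * k ^+ 2)) ^+ n].
Proof.
have [k0 [C [k00 C0 H]]] := hit_moment; exists k0, C; split => // k n kge kle.
elim/ltn_ind: n => -[|n] IH; first by rewrite wsum0 eqxx expr0.
rewrite wsum_renewal.
have h2 : 1 <= expR (C * k ^+ 2) by rewrite -expR0 ler_expR mulr_ge0 // sqr_ge0.
have t (m : 'I_n.+1) : (hit e s m.+1 s)%:R * coshr (k * (0 + m).+2%:R) *
    wsum e s (fun l => coshr (k * l%:R)) (n - m) s 0 <=
  (La ^+ n.+1 * expR (C * k ^+ 2) ^+ n) * ((hit e s m.+1 s)%:R / La ^+ m.+1 * coshr (k * m.+2%:R)).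
  have cg := coshr_ge1 (k * m.+2%:R).
  have a0 : 0 <= (hit e s m.+1 s)%:R * coshr (k * (0 + m).+2%:R).
    by rewrite add0n mulr_ge0 // (le_trans ler01).
  have nm : (n - m < n.+1)%N by rewrite ltnS leq_subr.
  apply: le_trans (ler_wpM2l a0 (IH _ nm)) _.
  rewrite exprMn add0n (_ : La ^+ n.+1 = La ^+ m.+1 * La ^+ (n - m)); last first.
    by rewrite -exprD addSn subnKC // -ltnS.
  rewrite [X in _ <= X](_ : _ = (hit e s m.+1 s)%:R * coshr (k * m.+2%:R) * (La ^+ (n - m) * expR (C * k ^+ 2) ^+ n)); last first.
    by field; rewrite gt_eqF // exprn_gt0.
  rewrite add0n in a0; rewrite !ler_wpM2l // ?exprn_ge0 ?(ltW La0) // ler_weXn2l // leq_subr.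
apply: le_trans (ler_sum _ (fun m _ => t m)) _; rewrite -mulr_sumr.
have -> : (La * expR (C * k ^+ 2)) ^+ n.+1 = La ^+ n.+1 * expR (C * k ^+ 2) ^+ n * expR (C * k ^+ 2).
  by rewrite exprMn [X in _ * X = _]exprSr mulrA.
rewrite ler_wpM2l ?mulr_ge0 ?exprn_ge0 ?expR_ge0 ?(ltW La0) //.
by apply: le_trans (H k n.+1 kge kle) _; rewrite expR_ge1Dx.
Qed.

End renewal.

(** * Exponential moments of functions on paths *)

Section swap.
Context {A : finType} (e : rel A) (a0 : A).
Notation s := (a0, a0).

Definition e2 : rel (A * A) := fun x y => e x.1 y.1 && e x.2 y.2.
Definition sw (x : A * A) := (x.2, x.1).

Implicit Types (u : seq (A * A)) (D : nat -> bool).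

(* The last visit to the diagonal state before time [i]. *)
Fixpoint lv u i : nat := if i is i'.+1 then (if nth s u i' == s then i else lv u i') else 0.

(** [D j] decides whether the stretch that starts with a visit at time [j] is exchanged. Times are
    positions in [s :: u], hence the shift in [lv u i.+1]; at a visit itself the choice is
    immaterial, as [sw] fixes [s]. *)
Definition swap D u := mkseq (fun i => if D (lv u i.+1) then sw (nth s u i) else nth s u i) (size u).

Lemma swK : involutive sw. Proof. by case. Qed.

Lemma size_swap D u : size (swap D u) = size u. Proof. by rewrite size_mkseq. Qed.

Lemma nth_swap D u i : nth s (swap D u) i = if D (lv u i.+1) then sw (nth s u i) else nth s u i.
Proof.
have [iu|ui] := ltnP i (size u); first by rewrite nth_mkseq.
by rewrite !nth_default ?size_swap //; case: ifP.
Qed.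

Lemma swap_visit D u i : (nth s (swap D u) i == s) = (nth s u i == s).
Proof.
by rewrite nth_swap; case: ifP => // _; case: (nth s u i) => x y; rewrite /sw !xpair_eqE andbC.
Qed.

Lemma lv_swap D u i : lv (swap D u) i = lv u i.
Proof. by elim: i => //= i IH; rewrite swap_visit IH. Qed.

Lemma lv_le u i : (lv u i <= i)%N.
Proof. by elim: i => //= i IH; case: ifP => // _; exact: leqW. Qed.

Lemma lv_visit u i : nth s (s :: u) (lv u i) = s.
Proof. by elim: i => //= i IH; case: eqP. Qed.

Lemma lv_ge u i k : nth s (s :: u) i = s -> (i <= k)%N -> (i <= lv u k)%N.
Proof.
elim: k => [|k IH] us; first by rewrite leqn0 => /eqP ->.
by rewrite leq_eqVlt => /predU1P[ik|ik] /=; [move: us; rewrite ik /= => ->; rewrite eqxx|case: ifP => // _; [exact: ltnW|exact: IH]].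
Qed.

Lemma swap_comp D D' u : swap D (swap D' u) = swap (fun j => D j (+) D' j) u.
Proof.
apply: (@eq_from_nth _ s) => [|i _]; first by rewrite !size_swap.
by rewrite !nth_swap lv_swap; case: (D _); case: (D' _) => //=; rewrite swK.
Qed.

Lemma eq_swap D D' u : (forall i, (i < size u)%N -> D (lv u i.+1) = D' (lv u i.+1) \/ nth s u i = s) ->
  swap D u = swap D' u.
Proof.
move=> h; apply: (@eq_from_nth _ s) => [|i]; rewrite !size_swap // => iu.
rewrite !nth_swap; case: (h i iu) => [->//|->]; by case: ifP; case: ifP.
Qed.

Lemma swap0 u : swap (fun=> false) u = u.
Proof. by apply: (@eq_from_nth _ s) => [|i _]; rewrite ?size_swap // nth_swap. Qed.

Lemma swapT u : swap (fun=> true) u = map sw u.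
Proof.
apply: (@eq_from_nth _ s) => [|i]; rewrite ?size_swap ?size_map // => iu.
by rewrite nth_swap (nth_map s).
Qed.

Lemma swap_paths D n u : u \in paths e2 s n s -> swap D u \in paths e2 s n s.
Proof.
rewrite !mem_paths size_swap => /and3P[-> /(pathP s) pu lu] /=; apply/andP; split; last first.
  by move: lu; rewrite !(last_nth s) size_swap; case: (size u) => //= k; rewrite swap_visit.
apply/(pathP s) => i; rewrite size_swap => iu; have := pu i iu.
rewrite [nth s (swap D u) i]nth_swap /=.
have [us|us] := eqVneq (nth s u i) s.
  rewrite us (_ : (if _ then sw s else s) = s); last by case: ifP.
  case: i iu us => [|i] iu us //=; rewrite nth_swap; case: ifP => // _.
  by rewrite /e2 /= andbC.
case: i iu us => [|i] iu us /=.
  by case: ifP => // _; rewrite /e2 /= andbC.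
rewrite nth_swap /=; case: (D _) => //.
by rewrite /e2 /= andbC.
Qed.

Lemma swap_perm D n : perm_eq (map (swap D) (paths e2 s n s)) (paths e2 s n s).
Proof.
apply: perm_paths => u uu; first exact: swap_paths.
rewrite swap_comp -[RHS]swap0; apply: eq_swap => i _; left; exact: addbb.
Qed.

Lemma index_swap D j u : index s (drop j (swap D u)) = index s (drop j u).
Proof.
have gen v v' : size v = size v' -> (forall i, (nth s v i == s) = (nth s v' i == s)) ->
    index s v = index s v'.
  elim: v v' => [|x v IH] [|y v'] //= [sv] h; have /= -> := h 0%N; case: ifP => // _.
  by congr S; apply: IH => // i; have := h i.+1.
apply: gen => [|i]; first by rewrite !size_drop size_swap.
by rewrite !nth_drop swap_visit.
Qed.

Section average.
Context {R : realType} (k : R) (n : nat) (G : seq A -> R).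
Hypothesis k0 : 0 <= k.
Hypothesis Gosc : forall w w' i j, w \in paths e a0 n a0 -> w' \in paths e a0 n a0 ->
  (i <= j <= n)%N -> (forall l, (l <= i)%N || (j <= l <= n)%N ->
     nth a0 (a0 :: w) l = nth a0 (a0 :: w') l) -> `|G w - G w'| <= k * (j - i).+1%:R.

Definition phi u := G (unzip1 u) - G (unzip2 u).
(** [index s (drop j u)] is one less than the number of steps to the next visit, and [Gosc] adds one
    to the gap, hence [.+2]. *)
Definition osc j u : R :=
  if nth s (s :: u) j == s then k * (index s (drop j u)).+2%:R else 0.

(** The conditional expectation of [phi] when the stretches starting before time [m] are exchanged
    by independent fair coins. The differences of successive averages are martingale increments. *)
Fixpoint avg m u : R :=
  if m is m'.+1 then (avg m' u + avg m' (swap (pred1 m') u)) / 2 else phi u.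

Lemma osc_swap D j u : osc j (swap D u) = osc j u.
Proof. by rewrite /osc index_swap; case: j => //= j; rewrite swap_visit. Qed.

Lemma unzip_paths u : u \in paths e2 s n s ->
  unzip1 u \in paths e a0 n a0 /\ unzip2 u \in paths e a0 n a0.
Proof.
rewrite !mem_paths !size_map => /and3P[-> pu /eqP lu].
have gen v x : path e2 x v -> path e x.1 (unzip1 v) /\ path e x.2 (unzip2 v).
  elim: v x => //= y v IH x /andP[/andP[xy1 xy2] /IH[-> ->]].
  by rewrite xy1 xy2.
have [/= -> ->] := gen _ _ pu.
by split; rewrite (last_map _ _ s) lu eqxx.
Qed.

Lemma phi_osc j u : u \in paths e2 s n s -> (j < n)%N ->
  `|phi u - phi (swap (pred1 j) u)| <= 2 * osc j u.
Proof.
move=> uu jn; rewrite /osc; case: eqP => us; last first.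
  rewrite (_ : swap _ u = u) ?subrr ?normr0 ?mulr0 //.
  rewrite -[RHS]swap0; apply: eq_swap => i _; left; apply/eqP => h.
  by apply: us; rewrite -h lv_visit.
have [h1 h2] := unzip_paths uu; have [h3 h4] := unzip_paths (swap_paths (pred1 j) uu).
move: (uu); rewrite mem_paths => /and3P[/eqP su _ /eqP lu].
(* The next visit is at time [j + l.+1]; the exchange changes nothing up to [j] and nothing from
   that visit on. Both components of the pair contribute, hence the factor 2 in the claim. *)
set l := index s (drop j u).
have hl : (l < size (drop j u))%N.
  rewrite index_mem; move: lu; rewrite -{1}(cat_take_drop j u) last_cat.
  case: (drop j u) (size_drop j u) => [|y v] /=.
    by rewrite su => /eqP; rewrite eq_sym subn_eq0 leqNgt jn.
  by move=> _ <-; exact: mem_last.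
have hn : (j + l.+1 <= n)%N by move: hl; rewrite size_drop su; lia.
have vis : nth s (s :: u) (j + l.+1) = s.
  by rewrite addnS /= -nth_drop nth_index // -index_mem.
have same i : (i <= j)%N || (j + l.+1 <= i <= n)%N ->
    nth s (s :: swap (pred1 j) u) i = nth s (s :: u) i.
  case: i => // i hi; rewrite [LHS]nth_swap; have [hlv|hlv] := eqVneq (lv u i.+1) j; last by rewrite -[pred1 _ _]/(_ == _) (negbTE hlv).
  rewrite -[pred1 _ _]/(_ == _) hlv eqxx.
  case/orP: hi => [ij|/andP[ij _]].
    have : i.+1 = j by apply/eqP; rewrite eqn_leq ij -[X in (X <= _)%N]hlv lv_le.
    by move=> ijE; move: us; rewrite -ijE /= => ->.
  by have := lv_ge vis ij; rewrite hlv; lia.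
have bd : (j <= j + l.+1 <= n)%N by rewrite leq_addr.
have len : (j + l.+1 - j).+1 = l.+2 by rewrite addKn.
have o1 := Gosc h1 h3 bd; have o2 := Gosc h2 h4 bd; rewrite len in o1 o2.
have nthz i v : nth a0 (a0 :: unzip1 v) i = (nth s (s :: v) i).1 /\
    nth a0 (a0 :: unzip2 v) i = (nth s (s :: v) i).2.
  split; case: i => //= i; have [iv|vi] := ltnP i (size v);
    first [by rewrite (nth_map s) | by rewrite !nth_default ?size_map].
have {}o1 : `|G (unzip1 u) - G (unzip1 (swap (pred1 j) u))| <= k * l.+2%:R.
  by apply: o1 => i /same h; rewrite (nthz _ _).1 (nthz i _).1 h.
have {}o2 : `|G (unzip2 u) - G (unzip2 (swap (pred1 j) u))| <= k * l.+2%:R.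
  by apply: o2 => i /same h; rewrite (nthz _ _).2 (nthz i _).2 h.
rewrite /phi (_ : _ - _ - (_ - _) = (G (unzip1 u) - G (unzip1 (swap (pred1 j) u))) -
  (G (unzip2 u) - G (unzip2 (swap (pred1 j) u)))); last by ring.
apply: le_trans (ler_normB _ _) _; lra.
Qed.

Lemma swap_swapC D D' u : swap D (swap D' u) = swap D' (swap D u).
Proof. by rewrite !swap_comp; apply: eq_swap => i _; left; exact: addbC. Qed.

Lemma avg_osc m j u : u \in paths e2 s n s -> (j < n)%N ->
  `|avg m u - avg m (swap (pred1 j) u)| <= 2 * osc j u.
Proof.
move=> + jn; elim: m u => [|m IH] u uu /=; first exact: phi_osc.
have h1 := IH u uu; have := IH _ (swap_paths (pred1 m) uu).
rewrite osc_swap (swap_swapC (pred1 j)) => h2.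
rewrite -mulrBl normrM (ger0_norm (_ : 0 <= 2^-1)) ?invr_ge0 // ler_pdivrMr //.
rewrite (_ : _ + _ - (_ + _) = (avg m u - avg m (swap (pred1 j) u)) +
  (avg m (swap (pred1 m) u) - avg m (swap (pred1 m) (swap (pred1 j) u)))); last by ring.
apply: le_trans (ler_normD _ _) _; lra.
Qed.

Lemma avg_anti m u : avg m (swap (fun=> true) u) = - avg m u.
Proof.
elim: m u => [|m IH] u /=; last by rewrite swap_swapC !IH -mulNr opprD.
rewrite swapT /phi opprB; congr (G _ - G _); by rewrite /unzip1 /unzip2 -map_comp.
Qed.

(** Averaging over the exchanges below [m] forgets whether they were made beforehand. *)
Lemma avg_agree m D D' u : (forall j, (m <= j)%N -> D j = D' j) ->
  avg m (swap D u) = avg m (swap D' u).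
Proof.
elim: m D D' => [|m IH] D D' h /=.
  by congr (phi _); apply: eq_swap => i _; left; exact: h.
rewrite !swap_comp; congr (_ / 2); have [DD'|DD'] := eqVneq (D m) (D' m).
  by congr (_ + _); apply: IH => j; rewrite leq_eqVlt => /predU1P[<-|mj]; rewrite ?DD' ?h.
have hh j : (m <= j)%N -> D j = (j == m) (+) D' j.
  rewrite leq_eqVlt => /predU1P[<-|mj]; last by rewrite h // gtn_eqF.
  by rewrite eqxx /=; move: DD'; case: (D m); case: (D' m).
rewrite addrC; congr (_ + _); apply: IH => j mj /=; last by rewrite hh.
by rewrite hh // addbA addbb.
Qed.

(** Exchanging every stretch that starts before [n] exchanges the two paths, which changes the sign
    of the average; but the average over these exchanges is also invariant under them. *)
Lemma avg_end u : u \in paths e2 s n s -> avg n u = 0.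
Proof.
move=> uu; move: (uu); rewrite mem_paths => /and3P[/eqP su _ /eqP lu].
have h1 : avg n u = avg n (swap (fun j => (j < n)%N) u).
  by rewrite -{1}[u]swap0; apply: avg_agree => j nj; rewrite ltnNge nj.
have h2 : swap (fun j => (j < n)%N) u = swap (fun=> true) u.
  apply: eq_swap => i iu; have [ln|ln] := ltnP (lv u i.+1) n; first by left.
  right; have := lv_visit u i.+1; have : lv u i.+1 = i.+1; last by move=> ->.
  by apply/eqP; rewrite eqn_leq lv_le; apply: leq_trans ln; rewrite -su.
by move: h1; rewrite h2 avg_anti; lra.
Qed.

(** The method of bounded differences. Since [swap] permutes the paths, each sum may be averaged
    over one exchange at a time; this replaces [avg m] by [avg m.+1] and costs one hyperbolic
    cosine, whose other factors do not change. *)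
Lemma mcdiarmid : \sum_(u <- paths e2 s n s) expR (phi u) <=
  \sum_(u <- paths e2 s n s) \prod_(j < n) coshr (osc j u).
Proof.
have step m : (m <= n)%N -> \sum_(u <- paths e2 s n s) expR (phi u) <=
    \sum_(u <- paths e2 s n s) (\prod_(j < m) coshr (osc j u)) * expR (avg m u).
  elim: m => [_|m IH mn].
    by rewrite le_eqVlt; apply/orP; left; apply/eqP; apply: eq_bigr => u _; rewrite big_ord0 mul1r.
  apply: le_trans (IH (ltnW mn)) _.
  pose F u := (\prod_(j < m) coshr (osc j u)) * expR (avg m u).
  have FS : \sum_(u <- paths e2 s n s) F u = \sum_(u <- paths e2 s n s) F (swap (pred1 m) u).
    by rewrite -(perm_big _ (swap_perm (pred1 m) n)) big_map.
  rewrite (_ : \sum_(u <- _) _ = \sum_(u <- paths e2 s n s) (F u + F (swap (pred1 m) u)) / 2); last first.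
    by rewrite -mulr_suml big_split /= -FS; field.
  rewrite big_seq [X in _ <= X]big_seq; apply: ler_sum => u uu.
  have W : \prod_(j < m) coshr (osc j (swap (pred1 m) u)) = \prod_(j < m) coshr (osc j u).
    by apply: eq_bigr => j _; rewrite osc_swap.
  rewrite /F W -mulrDr big_ord_recr /= -[leLHS]mulrA -[leRHS]mulrA ler_wpM2l //.
    by apply: prodr_ge0 => j _; apply: le_trans (coshr_ge1 _); exact: ler01.
  set x := avg m u; set y := avg m (swap (pred1 m) u).
  have -> : (expR x + expR y) / 2 = coshr ((x - y) / 2) * expR ((x + y) / 2).
    have -> : expR x = expR ((x - y) / 2) * expR ((x + y) / 2) by rewrite -expRD; congr expR; field.
    have -> : expR y = expR (- ((x - y) / 2)) * expR ((x + y) / 2) by rewrite -expRD; congr expR; field.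
    by rewrite /coshr; field.
  rewrite ler_wpM2r ?expR_ge0 // coshr_mono // normrM (ger0_norm (_ : 0 <= 2^-1)) ?invr_ge0 //.
  by rewrite ler_pdivrMr // mulrC; exact: avg_osc.
apply: le_trans (step n (leqnn _)) _; rewrite big_seq [X in _ <= X]big_seq.
by apply: ler_sum => u uu; rewrite avg_end // expR0 mulr1.
Qed.

(** The factor attached to the visit that starts a stretch is the one that [wt] charges at its end;
    all other times contribute [coshr 0 = 1]. *)
Lemma prod_osc u : u \in paths e2 s n s ->
  \prod_(j < n) coshr (osc j u) = wt s (fun l => coshr (k * l%:R)) 0 u.
Proof.
rewrite mem_paths => /and3P[/eqP <- _ /eqP lu].
pose c l := coshr (k * l%:R).
pose pr v u := \prod_(j < size u) (if nth s (v :: u) j == s then c (index s (drop j u)).+2 else 1).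
have prS v x w : pr v (x :: w) = (if v == s then c (index s (x :: w)).+2 else 1) * pr x w.
  by rewrite /pr /= big_ord_recl /=.
have key w : (last s w = s -> wt s c 0 w = pr s w) /\
    forall v g, v != s -> last v w = s -> wt s c g w = c (g + index s w).+2 * pr v w.
  elim: w => [|x w [IH1 IH2]].
    by split=> [_|v g vs /= vE]; [rewrite /pr big_ord0|rewrite vE eqxx in vs].
  split=> [|v g /negbTE vs] /= lw; rewrite prS ?vs ?eqxx ?mul1r /=; have [xs|xs] := eqVneq x s.
  - by rewrite IH1 ?xs // -[in LHS]xs.
  - by rewrite (IH2 x).
  - by rewrite addn0 IH1 ?xs // -[in LHS]xs.
  - by rewrite (IH2 x) // addSnnS.
rewrite (key u).1 // /pr; apply: eq_bigr => j _; rewrite /osc /c; case: ifP => // _.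
by rewrite /coshr oppr0 expR0; field.
Qed.

End average.

Lemma sum_pairs (R : nmodType) n x (F : seq A -> seq A -> R) :
  \sum_(w <- paths e a0 n x.1) \sum_(w' <- paths e a0 n x.2) F w w' =
  \sum_(u <- paths e2 s n x) F (unzip1 u) (unzip2 u).
Proof.
elim: n x F => [|n IH] [x y] F /=.
  by rewrite xpair_eqE; case: eqP => _; case: eqP => _; rewrite ?big_nil ?big_seq1 ?big_nil // big_seq1.
rewrite -![flatten _]/(paths _ _ n.+1 _) !big_paths /=.
under [LHS]eq_bigr => z _ do (under eq_bigr => w _ do rewrite big_paths; rewrite exchange_big /=).
rewrite pair_big /=; apply: eq_bigr => z _; exact: (IH z (fun w w' => F (z.1 :: w) (z.2 :: w'))).
Qed.

End swap.

(** Loops of the pair graph at [(a0, a0)] are pairs of loops at [a0], hence the square in the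
    hypothesis. *)
Theorem pair_bound (A : finType) (e : rel A) (a0 : A) (R : realType) (La : R) : 0 < La ->
  (forall n, (cnt e a0 n a0)%:R ^+ 2 <= La ^+ n) ->
  exists k0 C : R, [/\ 0 < k0, 0 <= C & forall k n (G : seq A -> R), 0 <= k -> k <= k0 ->
    (forall w w' i j, w \in paths e a0 n a0 -> w' \in paths e a0 n a0 ->
      (i <= j <= n)%N -> (forall l, (l <= i)%N || (j <= l <= n)%N ->
         nth a0 (a0 :: w) l = nth a0 (a0 :: w') l) -> `|G w - G w'| <= k * (j - i).+1%:R) ->
    (\sum_(w <- paths e a0 n a0) expR (G w)) * (\sum_(w <- paths e a0 n a0) expR (- G w)) <=
      (La * expR (C * k ^+ 2)) ^+ n].
Proof.
move=> La0 cntL.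
have cnt2 n : (cnt (e2 e) (a0, a0) n (a0, a0))%:R <= La ^+ n.
  apply: le_trans (cntL n); rewrite /cnt -!sum1_size !natr_sum -(sum_pairs e a0 n (a0, a0) (fun _ _ => 1%:R : R)) /=.
  by rewrite expr2 big_distrl /=; apply: ler_sum => w _; rewrite mul1r.
have [k0 [C [k00 C0 H]]] := wsum_bound La0 cnt2.
exists k0, C; split => // k n G kge kle Gosc.
rewrite big_distrl /=; under eq_bigr => w _ do rewrite big_distrr /=.
rewrite (sum_pairs e a0 n (a0, a0) (fun w w' => expR (G w) * expR (- G w'))).
under eq_bigr => u _ do rewrite -expRD.
apply: le_trans (mcdiarmid kge Gosc) _; apply: le_trans (H k n kge kle).
rewrite /wsum big_seq [X in _ <= X]big_seq.
by apply: ler_sum => u uu; rewrite (prod_osc k uu).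
Qed.

(** * Entropy *)

Lemma xlogx_le (R : realType) (p q : R) : 0 <= p -> 0 <= q -> (0 < p -> 0 < q) ->
  p * (ln q - ln p) <= q - p.
Proof.
rewrite le_eqVlt => /predU1P[<- q0 _|p0 _ /(_ p0) q0]; first by rewrite mul0r subr0.
have h : ln (q / p) <= q / p - 1.
  have := @le_ln1Dx R (q / p - 1); rewrite [1 + _]addrC subrK; apply.
  by rewrite ltrBrDl subrr divr_gt0.
rewrite -ln_div ?posrE //; apply: le_trans (ler_wpM2l (ltW p0) h) _.
by rewrite mulrBr mulr1 mulrC divfK ?gt_eqF.
Qed.

Section finite_entropy.
Context {R : realType}.

Definition ent (I : finType) (p : I -> R) : R := - \sum_i p i * ln (p i).

Lemma ent_push (I J : finType) (f : I -> J) (p : I -> R) (q : J -> R) :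
  (forall i, 0 <= p i) -> (forall j, q j = \sum_(i | f i == j) p i) -> ent q <= ent p.
Proof.
move=> p0 qE; rewrite lerN2 [leLHS](partition_big f xpredT) //=.
apply: ler_sum => j _; rewrite qE mulr_suml; apply: ler_sum => i /eqP fi.
have := p0 i; rewrite le_eqVlt => /predU1P[<-|pi]; first by rewrite !mul0r.
have h : p i <= \sum_(i | f i == j) p i.
  by rewrite (bigD1 i) ?fi //= lerDl sumr_ge0.
by rewrite ler_wpM2l // ler_ln ?posrE //; exact: lt_le_trans h.
Qed.

(** Nonnegativity of the relative entropy with respect to the weights [expR (a i) / Z]. *)
Lemma gibbs (I : finType) (p a : I -> R) : (forall i, 0 <= p i) -> \sum_i p i = 1 ->
  ent p + \sum_i p i * a i <= ln (\sum_i expR (a i)).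
Proof.
move=> p0 p1; set Z := \sum_i expR _.
have Z0 : 0 < Z.
  have [i0 _|I0] := pickP (fun i : I => true).
    by rewrite /Z (bigD1 i0) //= ltr_wpDr ?expR_gt0 // sumr_ge0 // => i _; exact: expR_ge0.
  by move: p1; rewrite big_pred0 // => /eqP; rewrite eq_sym oner_eq0.
pose r i := expR (a i) / Z.
have r1 : \sum_i r i = 1 by rewrite /r -mulr_suml divff ?gt_eqF.
have key : \sum_i p i * (ln (r i) - ln (p i)) <= 0.
  apply: (@le_trans _ _ (\sum_i (r i - p i))); last by rewrite sumrB r1 p1 subrr.
  apply: ler_sum => i _; by apply: xlogx_le => // [|_]; rewrite ?divr_ge0 ?divr_gt0 ?expR_ge0 ?expR_gt0 ?(ltW Z0).
rewrite -subr_le0; apply: le_trans key; rewrite le_eqVlt; apply/orP; left; apply/eqP.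
have -> : ln Z = \sum_i p i * ln Z by rewrite -mulr_suml p1 mul1r.
rewrite /ent -!sumrN -!big_split /=.
by apply: eq_bigr => i _; rewrite /r ln_div ?posrE ?expR_gt0 // expRK; ring.
Qed.

Lemma ent_ge0 (I : finType) (p : I -> R) : (forall i, 0 <= p i) -> \sum_i p i = 1 -> 0 <= ent p.
Proof.
move=> p0 p1; rewrite oppr_ge0; apply: sumr_le0 => i _; apply: mulr_ge0_le0 => //.
by apply: ln_le0; rewrite -p1 (bigD1 i) //= lerDl sumr_ge0.
Qed.

Lemma ent_le_card (I : finType) (p : I -> R) : (forall i, 0 <= p i) -> \sum_i p i = 1 ->
  ent p <= ln #|I|%:R.
Proof.
move=> p0 p1; have := gibbs (fun=> 0) p0 p1; rewrite expR0 sumr_const.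
by rewrite big1 ?addr0 // => i _; rewrite mulr0.
Qed.

Lemma ent_ge (I : finType) (p : I -> R) b : (forall i, 0 <= p i) -> \sum_i p i = 1 ->
  (forall i, p i <= b) -> - ln b <= ent p.
Proof.
move=> p0 p1 pb; rewrite lerN2 -[leRHS]mul1r -p1 mulr_suml; apply: ler_sum => i _.
have := p0 i; rewrite le_eqVlt => /predU1P[<-|pi]; first by rewrite !mul0r.
by rewrite ler_wpM2l // ler_ln ?posrE //; exact: lt_le_trans (pb i).
Qed.

Lemma sum_pair (V : nmodType) (I J : finType) (F : I * J -> V) :
  \sum_x F x = \sum_i \sum_j F (i, j).
Proof. by rewrite pair_big; apply: eq_bigr => -[]. Qed.

Lemma ent_pair (I J : finType) (p : I * J -> R) (q : I -> R) (r : J -> R) :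
  (forall x, 0 <= p x) -> \sum_x p x = 1 ->
  (forall i, q i = \sum_j p (i, j)) -> (forall j, r j = \sum_i p (i, j)) ->
  ent p <= ent q + ent r.
Proof.
move=> p0 p1 qE rE; have q0 i : 0 <= q i by rewrite qE sumr_ge0.
have r0 j : 0 <= r j by rewrite rE sumr_ge0.
have eq_ : ent q = - \sum_x p x * ln (q x.1).
  rewrite /ent sum_pair; congr (- _); apply: eq_bigr => i _; by rewrite {1}qE mulr_suml.
have er : ent r = - \sum_x p x * ln (r x.2).
  rewrite /ent sum_pair exchange_big; congr (- _); apply: eq_bigr => i _; by rewrite {1}rE mulr_suml.
have q1 : \sum_i q i = 1 by rewrite -p1 sum_pair; apply: eq_bigr.
have r1 : \sum_i r i = 1 by rewrite -p1 sum_pair exchange_big; apply: eq_bigr.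
have sum1 : \sum_x q x.1 * r x.2 = 1.
  rewrite sum_pair /=; under eq_bigr => i _ do rewrite -mulr_sumr r1 mulr1.
  exact: q1.
rewrite eq_ er -subr_le0 -[leRHS](subrr 1) -{1}sum1 -p1 /ent -!sumrN -!big_split /= -sumrB.
apply: ler_sum => -[i j] _ /=.
have [-> |pij] := eqVneq (p (i, j)) 0; first by rewrite !mul0r ?oppr0 ?addr0 ?subr0 ?oppr0 ?addr0 mulr_ge0.
have pp : 0 < p (i, j) by rewrite lt_def pij p0.
have qi : 0 < q i by apply: lt_le_trans pp _; rewrite qE (bigD1 j) //= lerDl sumr_ge0.
have rj : 0 < r j by apply: lt_le_trans pp _; rewrite rE (bigD1 i) //= lerDl sumr_ge0.
have h := @xlogx_le R (p (i, j)) (q i * r j) (ltW pp) (mulr_ge0 (ltW qi) (ltW rj)) (fun _ => mulr_gt0 qi rj).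
rewrite lnM ?posrE // in h.
by move: h; clear; lra.
Qed.

End finite_entropy.

Section random_variables.
Context {R : realType} (d : measure_display) (T : measurableType d).
Context (mu : probability T R) (X : set T).
Hypothesis mX : measurable X.
Hypothesis muX : mu X = 1%E.

Definition mfib (I : finType) (Z : T -> I) := forall i, measurable (X `&` Z @^-1` [set i]).
Definition pm (I : finType) (Z : T -> I) i : R := fine (mu (X `&` Z @^-1` [set i])).

Lemma mfib_preimage (I : finType) (Z : T -> I) (P : pred I) : mfib Z ->
  measurable (X `&` Z @^-1` [set i | P i]).
Proof.
move=> mZ; rewrite (_ : _ `&` _ = \bigcup_(i in [set i | P i]) (X `&` Z @^-1` [set i])).
  by apply: fin_bigcup_measurable => // i _; exact: mZ.
apply/seteqP; split=> x /=; first by move=> [Xx Px]; exists (Z x).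
by move=> [i Pi [Xx /= ->]].
Qed.

Lemma mfib_det (I J : finType) (Z : T -> I) (Z' : T -> J) : mfib Z ->
  (forall x y, X x -> X y -> Z x = Z y -> Z' x = Z' y) -> mfib Z'.
Proof.
move=> mZ h j.
rewrite (_ : _ `&` _ = X `&` Z @^-1` [set i | `[<exists x, [/\ X x, Z x = i & Z' x = j]>]]).
  exact: mfib_preimage.
apply/seteqP; split=> x /=.
  by move=> [Xx /= Zx]; split => //; apply/asboolP; exists x.
by move=> [Xx /asboolP[y [Xy Zy <-]]]; split => //=; apply: h.
Qed.

Lemma pm_ge0 (I : finType) (Z : T -> I) i : 0 <= pm Z i.
Proof. exact: fine_ge0. Qed.

Lemma pm_seq (I : finType) (Z : T -> I) (l : seq I) : mfib Z -> uniq l ->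
  fine (mu (X `&` Z @^-1` [set i | i \in l])) = \sum_(i <- l) pm Z i.
Proof.
move=> mZ; elim: l => [_|i l IH /= /andP[il ul]].
  by rewrite big_nil (_ : _ `&` _ = set0) ?measure0 //; apply/seteqP; split=> x //= [].
rewrite big_cons -IH // (_ : _ `&` _ = (X `&` Z @^-1` [set i]) `|` (X `&` Z @^-1` [set i | i \in l])).
  have mP := @mfib_preimage _ _ (fun i => i \in l) mZ.
  rewrite measureU //; last first.
    by apply/seteqP; split=> x //= [[_ /= ->] [_]]; rewrite /= (negbTE il).
  by rewrite fineD // fin_num_measure.
apply/seteqP; split=> x /=.
  by move=> [Xx]; rewrite inE => /orP[/eqP h|h]; [left|right].
by move=> [[Xx ->]|[Xx h]]; split => //; rewrite inE ?eqxx // h orbT.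
Qed.

Lemma pm_preimage (I : finType) (Z : T -> I) (P : pred I) : mfib Z ->
  fine (mu (X `&` Z @^-1` [set i | P i])) = \sum_(i | P i) pm Z i.
Proof.
move=> mZ; rewrite -big_enum -pm_seq ?enum_uniq //; congr (fine (mu _)).
by apply/seteqP; split=> x /=; rewrite mem_enum.
Qed.

Lemma pm_det (I J : finType) (Z : T -> I) (Z' : T -> J) (f : I -> J) : mfib Z ->
  (forall x, X x -> Z' x = f (Z x)) -> forall j, pm Z' j = \sum_(i | f i == j) pm Z i.
Proof.
move=> mZ h j; rewrite -pm_preimage // /pm; congr (fine (mu _)).
by apply/seteqP; split=> x /= [Xx]; rewrite /= h // => /eqP.
Qed.

Lemma pm_sum (I : finType) (Z : T -> I) : mfib Z -> \sum_i pm Z i = 1.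
Proof.
move=> mZ; rewrite -(@pm_preimage _ _ xpredT) //.
by rewrite (_ : _ `&` _ = X) ?muX //; apply/seteqP; split=> x //= [].
Qed.

Lemma det_fun (I J : finType) (Z : T -> I) (Z' : T -> J) :
  (forall x y, X x -> X y -> Z x = Z y -> Z' x = Z' y) ->
  exists f : I -> J, forall x, X x -> Z' x = f (Z x).
Proof.
move=> h; have [[x0 Xx0]|nX] := pselect (exists x, X x); last first.
  have : mu X = 0%E.
    rewrite (_ : X = set0) ?measure0 //; apply/seteqP; split=> x // Xx.
    by case: nX; exists x.
  by rewrite muX => /eqP; rewrite onee_eq0.
have ch i : {j | forall x, X x -> Z x = i -> Z' x = j}.
  apply: cid; have [[x [Xx Zx]]|nx] := pselect (exists x, X x /\ Z x = i).
    by exists (Z' x) => y Xy Zy; apply: h => //; rewrite Zy.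
  by exists (Z' x0) => x Xx Zx; case: nx; exists x.
by exists (fun i => projT1 (ch i)) => x Xx; exact: (projT2 (ch (Z x))).
Qed.

Definition Hrv (I : finType) (Z : T -> I) : R := ent (pm Z).

Lemma Hrv_det (I J : finType) (Z : T -> I) (Z' : T -> J) : mfib Z ->
  (forall x y, X x -> X y -> Z x = Z y -> Z' x = Z' y) -> Hrv Z' <= Hrv Z.
Proof.
move=> mZ /det_fun[f fE]; apply: (@ent_push _ _ _ f); first by move=> i; exact: pm_ge0.
exact: pm_det.
Qed.

Lemma mfib_pair (I J : finType) (Z1 : T -> I) (Z2 : T -> J) : mfib Z1 -> mfib Z2 ->
  mfib (fun x => (Z1 x, Z2 x)).
Proof.
move=> m1 m2 [i j]; rewrite (_ : _ `&` _ = (X `&` Z1 @^-1` [set i]) `&` (X `&` Z2 @^-1` [set j])).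
  exact: measurableI.
apply/seteqP; split=> x /=; first by move=> [Xx [-> ->]].
by move=> [[Xx /= ->] [_ /= ->]].
Qed.

Lemma Hrv_pair (I J K : finType) (Z1 : T -> I) (Z2 : T -> J) (Z' : T -> K) :
  mfib Z1 -> mfib Z2 ->
  (forall x y, X x -> X y -> Z1 x = Z1 y -> Z2 x = Z2 y -> Z' x = Z' y) ->
  Hrv Z' <= Hrv Z1 + Hrv Z2.
Proof.
move=> m1 m2 h; have m12 := mfib_pair m1 m2.
apply: (@le_trans _ _ (Hrv (fun x => (Z1 x, Z2 x)))).
  by apply: Hrv_det => // x y Xx Xy [h1 h2]; exact: h.
apply: ent_pair.
- by move=> x; exact: pm_ge0.
- exact: pm_sum.
- move=> i; rewrite (@pm_det _ _ (fun x => (Z1 x, Z2 x)) Z1 fst) // big_mkcond sum_pair.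
  rewrite (bigD1 i) //= [X in _ + X]big1 ?addr0; first by apply: eq_bigr => j _; rewrite eqxx.
  by move=> i' /negbTE ii; rewrite big1 // => j _; rewrite ii.
- move=> j; rewrite (@pm_det _ _ (fun x => (Z1 x, Z2 x)) Z2 snd) // big_mkcond sum_pair.
  apply: eq_bigr => i _; rewrite (bigD1 j) //= eqxx big1 ?addr0 // => j' /negbTE jj.
  by rewrite jj.
Qed.

Lemma Hrv_ge0 (I : finType) (Z : T -> I) : mfib Z -> 0 <= Hrv Z.
Proof. by move=> mZ; apply: ent_ge0; [move=> i; exact: pm_ge0|exact: pm_sum]. Qed.

End random_variables.

Lemma Rintegral_fib (R : realType) (d : measure_display) (T : measurableType d)
    (mu : probability T R) (X : set T) (I : finType) (Z : T -> I) (h : T -> R) (a : I -> R) :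
  measurable X -> mfib X Z -> mu.-integrable X (EFin \o h) -> (forall x, X x -> h x <= a (Z x)) ->
  (\int[mu]_(x in X) h x <= \sum_i pm mu X Z i * a i)%R.
Proof.
move=> mX mZ ih ha.
have gen (l : seq I) : uniq l -> \int[mu]_(x in X `&` Z @^-1` [set i | i \in l]) h x <=
    \sum_(i <- l) pm mu X Z i * a i.
  elim: l => [_|i l IH /= /andP[il ul]].
    rewrite big_nil (_ : _ `&` _ = set0) ?Rintegral_set0 //.
    by apply/seteqP; split=> x //= [].
  have mP := mfib_preimage (fun i => i \in l) mZ.
  rewrite big_cons (_ : _ `&` _ = (X `&` Z @^-1` [set i]) `|` (X `&` Z @^-1` [set i | i \in l])); last first.
    apply/seteqP; split=> x /=.
      by move=> [Xx]; rewrite inE => /orP[/eqP H|H]; [left|right].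
    by move=> [[Xx ->]|[Xx H]]; split => //; rewrite inE ?eqxx // H orbT.
  rewrite Rintegral_setU //; last 2 first.
  - apply: (integrableS mX _ _ ih).
      exact: measurableU.
    by move=> x [[]|[]].
  - by apply/disj_setPS => x /= [[_ /= ->] [_]]; rewrite /= (negbTE il).
  apply: lerD; last exact: IH.
  apply: le_trans (_ : \int[mu]_(x in X `&` Z @^-1` [set i]) (cst (a i) x) <= _).
    apply: le_Rintegral => //.
    - by apply: (integrableS mX _ _ ih) => // x [].
    - by apply: finite_measure_integrable_cst.
    - by move=> x [Xx /= <-]; exact: ha.
  by rewrite Rintegral_cst // mulrC.
have := gen (enum I) (enum_uniq _); rewrite big_enum /=.
rewrite (_ : _ `&` _ = X) //; apply/seteqP; split=> x //= => [[]//|Xx].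
by split => //; rewrite mem_enum.
Qed.

(** * Borel sets seen at small scales *)

Section borel_sets.
Context {R : realType} {M : ptopologicalType}.

Lemma borel_ind (C : set (set M)) : (forall U, open U -> C U) -> sigma_algebra setT C ->
  forall B : set (borel M), measurable B -> C B.
Proof. by move=> Co Cs B mB; apply: (smallest_sub Cs Co). Qed.

Lemma open_borel (U : set M) : open U -> measurable (U : set (borel M)).
Proof. by move=> oU; apply: sub_sigma_algebra. Qed.

Lemma closed_borel (U : set M) : closed U -> measurable (U : set (borel M)).
Proof.
move=> cU; rewrite -[U]setCK; apply: measurableC; apply: open_borel.
exact: closed_openC.
Qed.

Lemma continuous_borel (f : M -> M) : continuous f ->
  forall B : set (borel M), measurable B -> measurable (f @^-1` B : set (borel M)).
Proof.
move=> cf; apply: borel_ind => [U oU|].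
  by apply: open_borel; apply: open_comp => // x _; exact: cf.
split.
- by rewrite preimage_set0; exact: measurable0.
- by move=> A mA; rewrite setTD preimage_setC; exact: measurableC.
- by move=> F mF; rewrite preimage_bigcup; exact: bigcupT_measurable.
Qed.

Lemma small_tail (mu : probability (borel M) R) (F : nat -> set (borel M)) (eps : R) : 0 < eps ->
  (forall n, measurable (F n)) -> (forall n, F n.+1 `<=` F n) ->
  (forall x, exists n, ~ F n x) -> exists n, (mu (F n) <= eps%:E)%E.
Proof.
move=> eps0 mF dF nF.
have F0 : \bigcap_n F n = set0.
  by apply/seteqP; split=> x // h; have [n []] := nF x; exact: h.
have := @nonincreasing_cvg_mu _ _ R mu F.
rewrite F0 measure0 => /(_ _ mF measurable0) h.
have {}h : mu \o F @ \oo --> 0%E.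
  apply: h; first by rewrite (le_lt_trans (probability_le1 _ _)) ?ltry.
  by apply/nonincreasing_seqP => n; apply/subsetPset; exact: dF.
have := cvgP _ h.
have : \forall n \near \oo, (mu (F n) < eps%:E)%E.
  have nb : nbhs (0 : \bar R)%E [set x | (x < eps%:E)%E].
    by apply: open_ereal_lt'; rewrite lte_fin.
  exact: (h _ nb).
by case=> n _ hn _; exists n; apply: ltW; exact: (hn n (leqnn _)).
Qed.

End borel_sets.

Section separation.
Context {R : realType} {M : ptopologicalType} (d : M -> M -> R) (T : M -> M) (X : set M).
Hypothesis E : esys d T X.
Context (mu : probability (borel M) R).

(** A property in the spirit of Lusin's theorem: off a set of small measure, membership in [B] is
    constant at scale [rho]. It passes to complements and countable unions, so partitions into
    arbitrary Borel sets can be treated without regard to their boundaries. *)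
Definition separated (B : set M) := forall eps : R, 0 < eps ->
  exists2 rho, 0 < rho & exists G : set (borel M), [/\ measurable G, (mu (~` G) <= eps%:E)%E &
    forall x y, G x -> G y -> d x y < rho -> B x -> B y].

Lemma open_separated U : open U -> separated U.
Proof.
move=> oU eps eps0.
pose V n := [set x | exists2 y, ~ U y & d y x < n.+1%:R^-1].
have oV n : open (V n).
  rewrite (_ : V n = \bigcup_(y in ~` U) [set x | d y x < n.+1%:R^-1]); last first.
    by apply/seteqP; split=> x; [move=> [y]; exists y|move=> [y Uy h]; exists y].
  by apply: bigcup_open => y _; exact: (es_open E).
have [||x|n hn] := @small_tail R M mu (fun n => U `&` V n) eps eps0.
- by move=> n; apply: measurableI; apply: open_borel.
- move=> n x [Ux [y Uy h]]; split => //; exists y => //; apply: lt_trans h _.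
  by rewrite ltf_pV2 ?posrE ?ltr0n // ltr_nat.
- have [Ux|Ux] := pselect (U x); last by exists 0%N => -[].
  have [e e0 he] := es_nbhs E (open_nbhs_nbhs (conj oU Ux)).
  pose n := Num.truncn e^-1; exists n => -[_ [y nUy]]; apply/negP; rewrite -leNgt.
  apply: (@le_trans _ _ e).
    by rewrite invf_ple ?posrE ?ltr0n // ltW // truncnS_gt.
  by rewrite leNgt; apply/negP => h; apply: nUy; apply: he; rewrite (es_C E).
exists n.+1%:R^-1; first by rewrite invr_gt0 ltr0n.
exists (~` (U `&` V n)); split.
- by apply: measurableC; apply: measurableI; apply: open_borel.
- by rewrite setCK.
- move=> x y nx _ xy Ux; apply: contrapT => nUy; apply: nx; split => //.
  by exists y => //; rewrite (es_C E).
Qed.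

Lemma borel_separated (B : set (borel M)) : measurable B -> separated B.
Proof.
move=> mB; suff [] : measurable B /\ separated B by [].
move: B mB; apply: borel_ind => [U oU|].
  by split; [exact: open_borel|exact: open_separated].
split.
- split; first exact: measurable0.
  by move=> eps eps0; exists 1 => //; exists setT; split => //; rewrite setCT measure0 lee_fin ltW.
- move=> A [mA sA]; rewrite setTD; split; first exact: measurableC.
  move=> eps /sA[rho rho0 [G [mG Ge hG]]]; exists rho => //; exists G; split => //.
  by move=> x y Gx Gy xy nAx Ay; apply: nAx; apply: (hG y x) => //; rewrite (es_C E).
(* A countable union differs from a finite one by a set of small measure, which is removed from [G];
   finite unions are handled by induction. *)
- move=> F hF; have mF n : measurable (F n : set (borel M)) by case: (hF n).
  have sF n : separated (F n) by case: (hF n).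
  split; first exact: bigcupT_measurable.
  move=> eps eps0.
  pose U n : set (borel M) := \bigcup_(i in [set i | (i < n)%N]) F i.
  have mU n : measurable (U n) by apply: bigcup_measurable => i _; exact: mF.
  have mUU : measurable (\bigcup_n F n : set (borel M)) by exact: bigcupT_measurable.
  have e2 : 0 < eps / 2 by rewrite divr_gt0.
  have [||x|n hn] := @small_tail R M mu (fun n => \bigcup_n F n `\` U n) (eps / 2) e2.
  + by move=> n; apply: measurableD.
  + by move=> n x [Fx nU]; split => // -[i /= ik Fi]; apply: nU; exists i => //=; exact: ltn_trans ik _.
  + have [[i _ Fi]|nF] := pselect ((\bigcup_n F n) x); last by exists 0%N => -[].
    by exists i.+1 => -[_]; apply; exists i => /=.
  have sepU m e : 0 < e -> exists2 rho, 0 < rho & exists G : set (borel M),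
     [/\ measurable G, (mu (~` G) <= e%:E)%E &
      forall x y, G x -> G y -> d x y < rho -> U m x -> U m y].
    elim: m e => [|m IH] e e0.
      by exists 1 => //; exists setT; split => //; [rewrite setCT measure0 lee_fin ltW|move=> x y _ _ _ []].
    have e20 : 0 < e / 2 by rewrite divr_gt0.
    have [r1 r10 [G1 [mG1 G1e hG1]]] := IH _ e20.
    have [r2 r20 [G2 [mG2 G2e hG2]]] := sF m _ e20.
    exists (Num.min r1 r2); first by rewrite lt_min r10.
    exists (G1 `&` G2); split; first exact: measurableI.
      rewrite setCI; apply: le_trans (measureU2 _ _ _) _; [exact: measurableC|exact: measurableC|].
      by rewrite [e]splitr EFinD; exact: leeD.
    move=> x y [x1 x2] [y1 y2]; rewrite lt_min => /andP[d1 d2] [i /=].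
    rewrite ltnS leq_eqVlt => /predU1P[->|ik] Fx.
      by exists m => //=; apply: (hG2 x y).
    have [j /= jn Fj] := hG1 x y x1 y1 d1 (ex_intro2 _ _ i ik Fx).
    by exists j => //=; exact: ltnW.
  have [rho rho0 [G [mG Ge hG]]] := sepU n _ e2.
  exists rho => //; exists (G `&` ~` (\bigcup_n F n `\` U n)); split.
  + by apply: measurableI => //; apply: measurableC; apply: measurableD.
  + rewrite setCI setCK; apply: le_trans (measureU2 _ _ _) _; [exact: measurableC|exact: measurableD|].
    by rewrite [eps]splitr EFinD; exact: leeD.
  + move=> x y [Gx nx] [Gy ny] xy Fx.
    have Ux : U n x by apply: contrapT => h; apply: nx; split.
    have [i /= ik Fi] := hG x y Gx Gy xy Ux.
    by exists i.
Qed.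

Lemma partition_separated k (P : 'I_k -> set (borel M)) (eps : R) : (forall i, measurable (P i)) ->
  0 < eps -> exists2 rho, 0 < rho & exists G : set (borel M),
    [/\ measurable G, (mu (~` G) <= eps%:E)%E &
    forall x y, G x -> G y -> d x y < rho -> forall i, P i x -> P i y].
Proof.
move=> mP; suff gen (l : seq 'I_k) : forall eps : R, 0 < eps -> exists2 rho, 0 < rho & exists G : set (borel M),
    [/\ measurable G, (mu (~` G) <= eps%:E)%E &
    forall x y, G x -> G y -> d x y < rho -> forall i, i \in l -> P i x -> P i y].
  move=> /(gen (enum 'I_k))[rho rho0 [G [mG Ge hG]]]; exists rho => //; exists G; split => //.
  by move=> x y Gx Gy xy i; apply: (hG x y) => //; rewrite mem_enum.
elim: l => [|i l IH] e e0.
  by exists 1 => //; exists setT; split => //; rewrite setCT measure0 lee_fin ltW.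
have e20 : 0 < e / 2 by rewrite divr_gt0.
have [r1 r10 [G1 [mG1 G1e hG1]]] := IH _ e20.
have [r2 r20 [G2 [mG2 G2e hG2]]] := borel_separated (mP i) e20.
exists (Num.min r1 r2); first by rewrite lt_min r10.
exists (G1 `&` G2); split; first exact: measurableI.
  rewrite setCI; apply: le_trans (measureU2 _ _ _) _; [exact: measurableC|exact: measurableC|].
  by rewrite [e]splitr EFinD; exact: leeD.
move=> x y [x1 x2] [y1 y2]; rewrite lt_min => /andP[d1 d2] j.
by rewrite inE => /predU1P[->|jl]; [exact: (hG2 x y)|exact: (hG1 x y)].
Qed.

End separation.

Section itineraries.
Context {R : realType} {M : ptopologicalType} (d : M -> M -> R) (T : M -> M) (X : set M).
Hypothesis E : esys d T X.
Context (mu : probability (borel M) R).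
Hypothesis inv : invariant_on T X mu.

Lemma esys_measurable : measurable (X : set (borel M)).
Proof. exact: closed_borel (es_closed E). Qed.
Let mX := esys_measurable.

Lemma iter_measurable i (B : set (borel M)) : measurable B -> measurable (iter i T @^-1` B : set (borel M)).
Proof. apply: continuous_borel; exact: (iter_cont E). Qed.

Lemma mu_iter i (B : set (borel M)) : measurable B -> mu (iter i T @^-1` B) = mu B.
Proof.
elim: i B => [|i IH] B mB //.
have -> : iter i.+1 T @^-1` B = iter i T @^-1` (T @^-1` B) by [].
by rewrite IH ?inv.2 //; exact: (@iter_measurable 1).
Qed.

Lemma muCX : mu (~` X) = 0%E.
Proof. by rewrite probability_setC // inv.1 subee. Qed.

Lemma muXI (B : set (borel M)) : measurable B -> mu (X `&` B) = mu B.
Proof.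
move=> mB; apply/eqP; rewrite eq_le measureIr //=.
apply: (@le_trans _ _ (mu ((X `&` B) `|` ~` X))).
  rewrite le_measure ?inE //.
  - by apply: measurableU; [exact: measurableI|exact: measurableC].
  - by move=> x Bx; have [Xx|nX] := pselect (X x); [left|right].
apply: le_trans (measureU2 _ _ _) _; [exact: measurableI|exact: measurableC|].
by rewrite -[leRHS]adde0; apply: leeD => //; rewrite le_eqVlt; apply/orP; left; apply/eqP; exact: muCX.
Qed.

Lemma Rintegral_iter (f : M -> R) (b : R) i : measurable_fun (X : set (borel M)) f ->
  (forall x, X x -> `|f x| <= b) ->
  \int[mu]_(x in X) f (iter i T x) = \int[mu]_(x in X) f x.
Proof.
move=> mf fb; set g : borel M -> R := f \_ X.
have mg : measurable_fun setT g by apply/(measurable_restrictT _ mX).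
have gb x : `|g x| <= b.
  rewrite /g patchE; case: ifPn => [/set_mem/fb//|_].
  have [x0 Xx0] : exists x, X x.
    apply: contrapT => h; have : mu X = 0%E.
      by rewrite (_ : X = set0) ?measure0 //; apply/seteqP; split=> y // Xy; case: h; exists y.
    by rewrite inv.1 => /eqP; rewrite onee_eq0.
  by rewrite normr0; apply: le_trans (fb _ Xx0).
have mTi : measurable_fun setT (iter i T : borel M -> borel M).
  by move=> _ B mB; rewrite setTI; exact: iter_measurable.
have mgT : measurable_fun setT (g \o (iter i T : borel M -> borel M)) by apply: measurableT_comp.
have fin : (mu setT < +oo)%E by rewrite probability_setT ltry.
have intb (h : borel M -> R) : measurable_fun setT h -> (forall x, `|h x| <= b) ->
    mu.-integrable setT (EFin \o h).
  move=> mh hb; apply: measurable_bounded_integrable => //.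
  by exists b; split; [exact: num_real|move=> c bc x _ /=; apply: le_trans (hb x) (ltW bc)].
rewrite [RHS]Rintegral_mkcond -/g.
transitivity (\int[mu]_(x in X) (g \o iter i T) x).
  apply: eq_Rintegral => x /set_mem Xx /=.
  by rewrite /g patchE mem_set //; exact: (es_iter E).
transitivity (\int[mu]_x (g \o iter i T) x).
  rewrite /Rintegral; congr fine; apply/esym.
  rewrite (@negligible_integral _ _ _ mu setT (~` X)) //.
  - by rewrite setTD setCK.
  - exact: measurableC.
  - by apply: (intb _ mgT) => x; exact: gb.
  - exact: muCX.
rewrite /Rintegral; congr fine.
have := @integral_pushforward _ _ _ _ R _ mTi mu setT (EFin \o g).
move=> /(_ _ _ measurableT) <-.
- apply: eq_measure_integral => A mA _; rewrite /pushforward.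
  exact: mu_iter.
- by apply/measurable_realfun.measurable_EFinP.
- by apply: (intb _ mgT) => x; exact: gb.
Qed.

Lemma partition_index k (P : 'I_k -> set (borel M)) : fin_partition P ->
  exists p : M -> 'I_k, forall x i, P i x <-> p x = i.
Proof.
move=> [_ tP uP].
have h x : {i | P i x}.
  by apply: cid; have : (\bigcup_i P i) x by [rewrite uP]; case=> i _ Pi; exists i.
exists (fun x => projT1 (h x)) => x i; split=> [Pi|<-]; last exact: (projT2 (h x)).
apply: (@tP _ _ I I); exists x; split => //; exact: (projT2 (h x)).
Qed.

Lemma join_entropy_Hrv k (P : 'I_k -> set (borel M)) (p : M -> 'I_k) N :
  (forall x i, P i x <-> p x = i) -> (forall i, measurable (P i)) ->
  join_entropy T mu P N = Hrv mu X (fun x => [ffun i : 'I_N => p (iter i T x)]).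
Proof.
move=> pP mP; rewrite /join_entropy /Hrv /ent; congr (- _); apply: eq_bigr => w _.
suff -> : fine (mu (join_cell T P w)) = pm mu X (fun x => [ffun i : 'I_N => p (iter i T x)]) w by [].
have -> : join_cell T P w = (fun x => [ffun i : 'I_N => p (iter i T x)]) @^-1` [set w].
  apply/seteqP; split=> x /=.
    by move=> h; apply/ffunP => i; rewrite ffunE; apply/pP; exact: h.
  by move=> <- i _ /=; rewrite ffunE; apply/pP.
rewrite /pm muXI //.
rewrite (_ : _ @^-1` _ = join_cell T P w).
  apply: fin_bigcap_measurable => // i _; exact: iter_measurable.
apply/seteqP; split=> x /=.
  by move=> <- i _ /=; rewrite ffunE; apply/pP.
by move=> h; apply/ffunP => i; rewrite ffunE; apply/pP; exact: h.
Qed.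

Lemma mfib_iter k (P : 'I_k -> set (borel M)) (p : M -> 'I_k) i :
  (forall x i, P i x <-> p x = i) -> (forall i, measurable (P i)) ->
  mfib (X : set (borel M)) (fun x => p (iter i T x)).
Proof.
move=> pP mP j; apply: measurableI => //.
rewrite (_ : _ @^-1` _ = iter i T @^-1` (P j)); first exact: iter_measurable.
by apply/seteqP; split=> x /=; rewrite pP.
Qed.

(** Where [G] holds, the symbol will be known from elsewhere and is erased; what remains is
    concentrated on [None] and has little entropy. *)
Lemma erased_entropy k (P : 'I_k -> set (borel M)) (p : M -> 'I_k) (G : set (borel M)) i (eta : R) :
  (forall x i, P i x <-> p x = i) -> (forall i, measurable (P i)) -> measurable G ->
  0 < eta -> eta <= 1 -> (mu (~` G) <= (eta ^+ 2)%:E)%E ->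
  let C x := if `[<G (iter i T x)>] then None else Some (p (iter i T x)) in
  mfib (X : set (borel M)) C /\ Hrv mu X C <= (1 + 3 * k%:R) * eta.
Proof.
move=> pP mP mG eta0 eta1 Ge C.
have CE o : X `&` C @^-1` [set o] = X `&` iter i T @^-1` (if o is Some j then P j `&` ~` G else G).
  case: o => [j|]; apply/seteqP; split=> x [Xx] /=; rewrite /C.
  - by case: asboolP => // nG [pj]; split => //=; split => //; apply/pP.
  - by case=> /pP pj nG; rewrite asboolF // pj.
  - by case: asboolP.
  - by move=> h; rewrite asboolT.
have mo o : measurable ((if o is Some j then P j `&` ~` G else G) : set (borel M)).
  by case: o => [j|] //; apply: measurableI => //; exact: measurableC.
have mC : mfib (X : set (borel M)) C.
  by move=> o; rewrite CE; apply: measurableI => //; exact: iter_measurable.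
split => //.
have pmE o : pm mu X C o = fine (mu (if o is Some j then P j `&` ~` G else G)).
  by rewrite /pm CE muXI ?mu_iter //; exact: iter_measurable.
have p0 := pm_ge0 mu X C.
have psum := pm_sum inv.1 mC.
rewrite -/(pm mu X C) in p0.
have pS j : pm mu X C (Some j) <= eta ^+ 2.
  rewrite pmE -lee_fin fineK ?fin_num_measure //; last by apply: (mo (Some j)).
  by apply: le_trans Ge; rewrite measureIr //; exact: measurableC.
have pN : 1 - pm mu X C None <= eta ^+ 2.
  have h : 1 = fine (mu G) + fine (mu (~` G)).
    by rewrite probability_setC // fineB ?fin_num_measure // addrC subrK.
  rewrite pmE h addrC addKr -lee_fin fineK ?fin_num_measure //; exact: measurableC.
have pN1 : pm mu X C None <= 1.
  by rewrite -psum (bigD1 None) //= lerDl sumr_ge0.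
have tN : - (pm mu X C None * ln (pm mu X C None)) <= eta ^+ 2.
  have := xlogx_le (p0 None) ler01 (fun _ => ltr01); rewrite ln1 sub0r mulrN => h.
  exact: le_trans h pN.
(* With a mass [q <= eta ^+ 2], comparison with [eta ^+ 2] reduces [- q * ln q] to
   [- 2 * q * ln eta], and [- ln eta <= eta^-1]; this is why the measure of the complement is
   bounded by a square. *)
have tS j : - (pm mu X C (Some j) * ln (pm mu X C (Some j))) <= 3 * eta.
  have q0 : 0 < eta ^+ 2 by rewrite exprn_gt0.
  have h1 := xlogx_le (p0 (Some j)) (ltW q0) (fun _ => q0).
  have h2 : ln eta >= - eta^-1.
    have : ln eta^-1 <= eta^-1 by apply/ltW/ln_sublinear; rewrite invr_gt0.
    by rewrite lnV ?posrE // lerNl.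
  move: h1 (pS j) (p0 (Some j)); rewrite lnXn // mulr2n.
  move: (pm mu X C (Some j)) (ln (pm mu X C (Some j))) => q lq h1 h3 h4.
  have h5 : - (q * ln eta) <= eta.
    rewrite -mulrN; apply: le_trans (_ : eta ^+ 2 * eta^-1 <= _); last first.
      by rewrite expr2 mulfK ?gt_eqF.
    apply: le_trans (_ : q * eta^-1 <= _); first by rewrite ler_wpM2l // lerNl.
    by rewrite ler_wpM2r // invr_ge0 ltW.
  have h6 : eta ^+ 2 <= eta by rewrite expr2 ler_piMl // ltW.
  have h7 : q * (ln eta + ln eta) = q * ln eta + q * ln eta by rewrite mulrDr.
  rewrite mulrBr h7 in h1; lra.
rewrite /Hrv /ent -sumrN (bigD1 None) //= mulrDl mul1r lerD //.
  by apply: le_trans tN _; rewrite expr2 ler_piMl // ltW.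
apply: (@le_trans _ _ (\sum_(o : option 'I_k | o != None) 3 * eta)).
  by apply: ler_sum => -[j _|//]; exact: tS.
rewrite sumr_const (_ : #|_| = k); first by rewrite -[leLHS]mulr_natr mulrAC.
have h := cardC1 (None : option 'I_k); rewrite card_option card_ord /= in h.
by rewrite -[RHS]h; apply: eq_card => o; rewrite !inE.
Qed.

Lemma Hrv_itinerary (I : finType) (C : nat -> M -> I) (b : nat -> R) N :
  (forall i, mfib (X : set (borel M)) (C i)) -> (forall i, (i < N)%N -> Hrv mu X (C i) <= b i) ->
  mfib (X : set (borel M)) (fun x => [ffun i : 'I_N => C i x]) /\
  Hrv mu X (fun x => [ffun i : 'I_N => C i x]) <= \sum_(i < N) b i.
Proof.
move=> mC; elim: N => [_|N IH hb].
  have m0 : mfib (X : set (borel M)) (fun x => [ffun i : 'I_0 => C i x]).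
    apply: (mfib_det (mC 0%N)) => x y _ _ _; by apply/ffunP => -[].
  split => //; rewrite big_ord0.
  apply: le_trans (ent_le_card (pm_ge0 mu X _) (pm_sum inv.1 m0)) _.
  by rewrite card_ffun card_ord expn0 ln1.
have [m h] := IH (fun i iN => hb i (ltnW iN)).
have det x y : [ffun i : 'I_N => C i x] = [ffun i : 'I_N => C i y] -> C N x = C N y ->
    [ffun i : 'I_N.+1 => C i x] = [ffun i : 'I_N.+1 => C i y].
  move=> /ffunP h1 h2; apply/ffunP => i; rewrite !ffunE.
  have := ltn_ord i; rewrite ltnS leq_eqVlt => /predU1P[-> //|iN].
  by have := h1 (Ordinal iN); rewrite !ffunE.
split.
  by apply: (mfib_det (mfib_pair m (mC N))) => x y _ _ [h1 h2]; exact: det.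
rewrite big_ord_recr /=; apply: le_trans (lerD h (hb N (ltnSn _))).
by apply: Hrv_pair => //; [exact: inv.1|move=> x y _ _; exact: det].
Qed.

End itineraries.

Lemma sum_boundary (R : realType) N n0 (b : nat -> R) (dl l : R) : 0 <= l ->
  (forall i, (n0 <= i)%N -> (i + n0 <= N)%N -> b i <= dl) -> (forall i, b i <= dl + l) ->
  \sum_(i < N) b i <= N%:R * dl + (n0 + n0)%:R * l.
Proof.
move=> l0 hb hl.
have h i : b i <= dl + ((i < n0)%:R + (N < i + n0)%N%:R) * l.
  case: (ltnP i n0) => h1; case: (ltnP N (i + n0)) => h2; rewrite ?addr0 ?add0r ?mul1r ?mul0r //.
  - by apply: le_trans (hl i) _; rewrite lerD2l mulrDl mul1r lerDl.
  - by rewrite addr0 hb.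
have c1 m : \sum_(i < m) ((i < n0)%:R : R) <= n0%:R.
  have : (\sum_(i < m) (i < n0) = minn m n0)%N.
    elim: m => [|m IH]; first by rewrite big_ord0 min0n.
    rewrite big_ord_recr /= IH; have [h1|h1] := ltnP m n0; rewrite /= ?addn1 ?addn0.
      by rewrite (minn_idPl h1).
    by rewrite (minn_idPr (leqW h1)).
  by move=> e; rewrite -natr_sum e ler_nat geq_minr.
have c2 : \sum_(i < N) ((N < i + n0)%N%:R : R) <= n0%:R.
  apply: le_trans (c1 N); rewrite (reindex_inj rev_ord_inj) /=; apply: ler_sum => i _.
  by rewrite ler_nat; have := ltn_ord i; case: (ltnP i n0) => //; case: ltnP => //; lia.
apply: le_trans (ler_sum _ (fun (i : 'I_N) _ => h i)) _.
rewrite big_split /= (_ : \sum_(i < N) dl = N%:R * dl); last by rewrite sumr_const card_ord mulr_natl.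
rewrite lerD2l -mulr_suml ler_wpM2r //.
by rewrite big_split natrD; apply: lerD; [exact: c1|exact: c2].
Qed.

(** * The variational inequality *)

Section upper.
Context {R : realType} {M : ptopologicalType} (d : M -> M -> R) (T : M -> M) (X : set M).
Hypothesis E : esys d T X.
Context (mu : probability (borel M) R).
Hypothesis inv : invariant_on T X mu.

Lemma bounded_integrable (h : M -> R) (b : R) : measurable_fun (X : set (borel M)) h ->
  (forall x, X x -> `|h x| <= b) -> mu.-integrable X (EFin \o h).
Proof.
move=> mh hb; apply: measurable_bounded_integrable => //.
- exact: (esys_measurable E).
- by rewrite (le_lt_trans (probability_le1 _ _)) ?ltry //; exact: (esys_measurable E).
- by exists b; split; [exact: num_real|move=> c bc x Xx /=; apply: le_trans (hb x Xx) (ltW bc)].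
Qed.

Lemma Rintegral_birkhoff (f : M -> R) (b : R) N : measurable_fun (X : set (borel M)) f ->
  (forall x, X x -> `|f x| <= b) ->
  mu.-integrable X (EFin \o (fun x => \sum_(j < N) f (iter j T x))) /\
  \int[mu]_(x in X) (\sum_(j < N) f (iter j T x)) = N%:R * \int[mu]_(x in X) f x.
Proof.
move=> mf fb; have mX := esys_measurable E.
have ij j : mu.-integrable X (EFin \o (fun x => f (iter j T x))).
  apply: (@bounded_integrable _ b) => [|x Xx]; last by apply: fb; exact: (es_iter E).
  apply: (@measurable_comp _ _ _ _ _ _ (X : set (borel M)) f _ (iter j T : borel M -> borel M)) => //.
    by move=> y [x Xx <-]; exact: (es_iter E).
  by apply: measurable_funTS => _ B mB; rewrite setTI; exact: (iter_measurable E).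
elim: N => [|N [IH1 IH2]].
  have e : (fun x : M => \sum_(j < 0) f (iter j T x)) = cst 0 by apply/funext => x; rewrite big_ord0.
  split; first by rewrite e; exact: integrable0.
  by under eq_Rintegral => x _ do rewrite big_ord0; rewrite Rintegral_cst // !mul0r.
have e : (fun x : M => \sum_(j < N.+1) f (iter j T x)) =
    (fun x => \sum_(j < N) f (iter j T x) + f (iter N T x)).
  by apply/funext => x; rewrite big_ord_recr.
split; first by rewrite e; exact: (integrableD mX IH1 (ij N)).
rewrite (@eq_Rintegral _ _ _ mu X (fun x => \sum_(j < N) f (iter j T x) + f (iter N T x))); last first.
  by move=> x _; rewrite big_ord_recr.
by rewrite RintegralD // IH2 (Rintegral_iter E inv N mf fb) -natr1 mulrDl mul1r.
Qed.

(** Two points followed by the same [y i] are within [e0] of each other, so by expansivity within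
    [rho] at all times away from the ends; there they have the same symbol of [P] if both lie in
    [G]. The itinerary is thus determined by the index [i] and the symbols not erased, and [gibbs]
    bounds entropy plus integral over the indices. [C0] is chosen before [N] and [f]. *)
Lemma entropy_upper (e0 c0 dl : R) k (P : 'I_k -> set (borel M)) :
  (forall rho, 0 < rho -> exists n0, forall x y, X x -> X y ->
    (forall i, (i <= n0 + n0)%N -> d (iter i T x) (iter i T y) < e0) ->
    d (iter n0 T x) (iter n0 T y) < rho) ->
  2 * c0 <= e0 -> fin_partition P -> 0 < dl -> exists C0, forall N (f : M -> R) (b K : R) (I : finType) (y : I -> M),
    measurable_fun (X : set (borel M)) f -> (forall x, X x -> `|f x| <= b) ->
    (forall x, X x -> exists i, forall j, (j <= N)%N -> d (iter j T x) (iter j T (y i)) < c0) ->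
    (forall x i, X x -> (forall j, (j <= N)%N -> d (iter j T x) (iter j T (y i)) < c0) ->
       \sum_(j < N) f (iter j T x) <= \sum_(j < N) f (iter j T (y i)) + K) ->
    join_entropy T mu P N + N%:R * \int[mu]_(x in X) f x <=
      ln (\sum_i expR (\sum_(j < N) f (iter j T (y i)))) + N%:R * dl + C0 + K.
Proof.
move=> Hexp c0e0 fP dl0; have [mP _ _] := fP; have mX := esys_measurable E.
have [p pP] := partition_index fP.
have [eta [eta0 eta1 etadl]] : exists eta, [/\ 0 < eta, eta <= 1 & (1 + 3 * k%:R) * eta <= dl].
  have k3 : 0 < 1 + 3 * k%:R :> R by rewrite ltr_wpDr.
  exists (Num.min 1 (dl / (1 + 3 * k%:R))); split.
  - by rewrite lt_min ltr01 divr_gt0.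
  - by rewrite ge_min lexx.
  - by rewrite mulrC -ler_pdivlMr // ge_min lexx orbT.
have eta20 : 0 < eta ^+ 2 by rewrite exprn_gt0.
have [rho rho0 [G [mG Ge hG]]] := partition_separated E mu mP eta20.
have [n0 Hn0] := Hexp rho rho0.
pose l : R := ln k.+1%:R.
have l0 : 0 <= l by rewrite ln_ge0 // ler1n.
exists ((n0 + n0)%:R * l) => N f b K I y mf fb cov var.
pose mid i := (n0 <= i)%N && (i + n0 <= N)%N.
(* Near the two ends nothing is erased; these at most [n0 + n0] symbols cost [l] each, which makes
   up [C0]. *)
pose C i x := if mid i && `[<G (iter i T x)>] then None else Some (p (iter i T x)).
pose bd i := if mid i then dl else l.
have mps i : mfib (X : set (borel M)) (fun x => Some (p (iter i T x))).
  by apply: (mfib_det (mfib_iter E i pP mP)) => x z _ _ ->.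
have hC i : mfib (X : set (borel M)) (C i) /\ Hrv mu X (C i) <= bd i.
  rewrite /C /bd; case: (mid i) => /=.
    have [h1 h2] := erased_entropy E inv i pP mP mG eta0 eta1 Ge.
    by split => //; exact: le_trans h2 etadl.
  split; first exact: mps.
  apply: le_trans (ent_le_card (pm_ge0 mu X _) (pm_sum inv.1 (mps i))) _.
  by rewrite card_option card_ord.
have [mV hV] := @Hrv_itinerary _ _ _ _ _ inv _ C bd N (fun i => (hC i).1) (fun i _ => (hC i).2).
pose near i x := `[<forall j, (j <= N)%N -> d (iter j T x) (iter j T (y i)) < c0>].
have [x0 Xx0] : exists x, X x.
  apply: contrapT => h; have : mu X = 0%E.
    by rewrite (_ : X = set0) ?measure0 //; apply/seteqP; split=> z // Xz; case: h; exists z.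
  by rewrite inv.1 => /eqP; rewrite onee_eq0.
have [i0 _] := cov x0 Xx0.
pose Z x := odflt i0 [pick i | near i x].
have ZP x : X x -> near (Z x) x.
  move=> Xx; rewrite /Z; case: pickP => //= h; have [i hi] := cov x Xx.
  by have := h i; rewrite /near; move/asboolP: hi => ->.
have near_of x : X x -> forall j, (j <= N)%N -> d (iter j T x) (iter j T (y (Z x))) < c0.
  by move=> /ZP/asboolP.
have mnear : mfib (X : set (borel M)) (fun x => [ffun i => near i x]).
  move=> w; apply: measurableI => //.
  have mU i : measurable ([set x | near i x] : set (borel M)).
    apply: open_borel; rewrite (_ : [set x | _] = [set x | forall j, (j <= N)%N -> d (iter j T (y i)) (iter j T x) < c0]).
      exact: (open_bowen E).
    by apply/seteqP; split=> x /=; [move/asboolP => h j jN; rewrite (es_C E); exact: h|move=> h; apply/asboolP => j jN; rewrite (es_C E); exact: h].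
  rewrite (_ : _ @^-1` _ = \bigcap_(i in [set: I]) (if w i then [set x | near i x] else ~` [set x | near i x])).
    apply: fin_bigcap_measurable => // i _; case: (w i) => //; exact: measurableC.
  apply/seteqP; split=> x /=.
    by move=> <- i _; rewrite ffunE; case: ifPn => //= /negP.
  move=> h; apply/ffunP => i; rewrite ffunE; have := h i Logic.I; case: (w i) => //=.
  by move/negP/negbTE.
have mZ : mfib (X : set (borel M)) Z.
  apply: (mfib_det mnear) => x z _ _ /ffunP h; rewrite /Z; congr odflt; apply: eq_pick => i.
  by have := h i; rewrite !ffunE.
have h1 : join_entropy T mu P N <= Hrv mu X Z + \sum_(i < N) bd i.
  rewrite (join_entropy_Hrv E inv N pP mP); apply: le_trans (lerD (lexx _) hV).
  apply: Hrv_pair => //; first exact: inv.1.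
  move=> x z Xx Xz Zxz /ffunP hc; apply/ffunP => i; rewrite !ffunE.
  have := hc i; rewrite !ffunE /C; have [/andP[m1 m2]|_] /= := boolP (mid i); last by case.
  case: asboolP => Gx; case: asboolP => Gz //=; last by case.
  move=> _; apply/esym/pP; apply: (hG _ _ Gx Gz); last exact/pP.
  have -> : (i = (i - n0) + n0 :> nat)%N by rewrite subnK.
  rewrite addnC !iterD; apply: Hn0; [exact: (es_iter E)|exact: (es_iter E)|].
  move=> j jn; rewrite -!iterD.
  have jN : (j + (i - n0) <= N)%N by move: m1 m2 jn; clear; lia.
  have /asboolP/(_ _ jN) d1 := ZP x Xx; have /asboolP/(_ _ jN) d2 := ZP z Xz.
  rewrite Zxz in d1; rewrite (es_C E) in d2.
  have := es_tri E (iter (j + (i - n0)) T (y (Z z))) (iter (j + (i - n0)) T x) (iter (j + (i - n0)) T z).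
  by move: d1 d2 c0e0; clear; lra.
have h2 : \sum_(i < N) bd i <= N%:R * dl + (n0 + n0)%:R * l.
  apply: sum_boundary => // i; rewrite /bd.
    by move=> i1 i2; rewrite /mid i1 i2.
  by case: ifP => _; rewrite ?lerDl ?lerDr // ltW.
have [intS intSE] := Rintegral_birkhoff N mf fb.
have h3 := @Rintegral_fib _ _ _ mu X I Z _ (fun i => \sum_(j < N) f (iter j T (y i)) + K) mX mZ intS (fun x Xx => var x (Z x) Xx (near_of x Xx)).
rewrite intSE in h3.
have pm1 := pm_sum inv.1 mZ.
have h4 : \sum_i pm mu X Z i * (\sum_(j < N) f (iter j T (y i)) + K) =
    \sum_i pm mu X Z i * (\sum_(j < N) f (iter j T (y i))) + K.
  by under eq_bigr => i _ do rewrite mulrDr; rewrite big_split /= -mulr_suml pm1 mul1r.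
have h5 := gibbs (fun i => \sum_(j < N) f (iter j T (y i))) (pm_ge0 mu X Z) pm1.
rewrite -/(Hrv mu X Z) in h5.
by move: h1 h2 h3 h5; rewrite h4; clear; lra.
Qed.

End upper.

(** * Measures carried by separated segments *)

Lemma mnormalize1E (R : realType) (d : measure_display) (T : measurableType d)
  (m : {measure set T -> \bar R}) (P : probability T R) A : m setT = 1%E -> mnormalize m P A = m A.
Proof. by move=> m1; rewrite /mnormalize m1 onee_eq0 /= invr1 mule1. Qed.

Section digits.
Context {R : realType} (s : nat).
Hypothesis s0 : (0 < s)%N.
Notation Om := (measurableTypeR R).

Definition unit_itv : set Om := `[0, 1[%classic.
Lemma measurable_unit_itv : measurable unit_itv. Proof. exact: measurable_itv. Qed.

Definition unif : probability Om R :=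
  mnormalize (mrestr lebesgue_measure measurable_unit_itv) (dirac ((0 : R) : Om)).

Lemma unifE (A : set Om) : unif A = lebesgue_measure (A `&` unit_itv).
Proof.
have e : mrestr lebesgue_measure measurable_unit_itv (setT : set Om) = 1%E :> \bar R.
  by rewrite /mrestr setTI /unit_itv lebesgue_measure_itv /= lte_fin ltr01 oppr0 adde0.
exact: mnormalize1E.
Qed.

(** Independent uniform symbols with [s] values are realised as base-[s] digits of a uniform point
    of the unit interval. *)
Definition digit k (x : R) : nat := (Num.truncn (s%:R ^+ k.+1 * x) %% s)%N.

Lemma truncn_divn (y : R) q : (0 < q)%N -> 0 <= y -> (Num.truncn (q%:R * y) %/ q = Num.truncn y)%N.
Proof.
move=> q0 y0; have /andP[h1 h2] := truncn_itv y0.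
have q0R : 0 < q%:R :> R by rewrite ltr0n.
have qy0 : 0 <= q%:R * y by rewrite mulr_ge0.
apply/eqP; rewrite eqn_leq; apply/andP; split.
  rewrite -ltnS ltn_divLR // -(ltr_nat R).
  apply: le_lt_trans (_ : _ <= q%:R * y) _; first by have /andP[] := truncn_itv qy0.
  by rewrite natrM mulrC ltr_pM2r.
rewrite leq_divRL //; have /andP[_ h3] := truncn_itv qy0.
rewrite -ltnS -(ltr_nat R); apply: le_lt_trans h3.
by rewrite natrM mulrC ler_pM2l.
Qed.

Lemma digitE K k (x : R) : (k < K)%N -> 0 <= x ->
  digit k x = ((Num.truncn (s%:R ^+ K * x) %/ s ^ (K - k.+1)) %% s)%N.
Proof.
move=> kK x0; rewrite /digit; congr (_ %% _)%N.
have -> : s%:R ^+ K * x = (s ^ (K - k.+1))%:R * (s%:R ^+ k.+1 * x).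
  by rewrite natrX mulrA -exprD subnK.
by rewrite truncn_divn ?expn_gt0 ?s0 // mulr_ge0 // exprn_ge0.
Qed.

Definition dig (K : nat) (v : 'I_(s ^ K)) : {ffun 'I_K -> 'I_s} :=
  [ffun k : 'I_K => Ordinal (ltn_pmod (v %/ s ^ (K - k.+1)) s0)].

Lemma dig_inj K : injective (@dig K).
Proof.
move=> u v /ffunP h; apply/val_inj => /=.
suff gen m : (m <= K)%N -> (u %/ s ^ (K - m) = v %/ s ^ (K - m))%N.
  by have := gen K (leqnn K); rewrite subnn expn0 !divn1.
elim: m => [|m IH] mK; first by rewrite subn0 !divn_small.
have := h (Ordinal mK); rewrite !ffunE => /(congr1 val) /= hm.
rewrite (divn_eq (u %/ s ^ (K - m.+1)) s) (divn_eq (v %/ s ^ (K - m.+1)) s) hm.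
congr (_ * _ + _)%N; rewrite -!divnMA -expnSr.
have -> : (K - m.+1).+1 = (K - m)%N by rewrite -subSn.
exact: IH (ltnW mK).
Qed.

Definition trv K (x : R) : 'I_(s ^ K) :=
  odflt (Ordinal (ltac:(by rewrite expn_gt0 s0) : (0 < s ^ K)%N)) (insub (Num.truncn (s%:R ^+ K * x))).

Lemma trvE K (x : R) : unit_itv x -> val (trv K x) = Num.truncn (s%:R ^+ K * x).
Proof.
rewrite /unit_itv /= in_itv /= => /andP[x0 x1]; rewrite /trv insubT //.
have y0 : 0 <= s%:R ^+ K * x by rewrite mulr_ge0 // exprn_ge0.
rewrite -(ltr_nat R) natrX; have /andP[h _] := truncn_itv y0; apply: le_lt_trans h _.
by rewrite -[ltRHS]mulr1 ltr_pM2l // exprn_gt0 // ltr0n.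
Qed.

Lemma trv_fib K v : unit_itv `&` trv K @^-1` [set v] =
  `[v%:R / s%:R ^+ K, v.+1%:R / s%:R ^+ K[%classic :> set R.
Proof.
have sK : 0 < s%:R ^+ K :> R by rewrite exprn_gt0 // ltr0n.
apply/seteqP; split=> x /=; rewrite in_itv /=.
  move=> [ux <-]; rewrite trvE //; move: ux; rewrite /unit_itv /= in_itv /= => /andP[x0 x1].
  have y0 : 0 <= s%:R ^+ K * x by rewrite mulr_ge0 // ltW.
  by rewrite ler_pdivrMr // ltr_pdivlMr // (mulrC x) truncn_itv.
move=> /andP[h1 h2].
have ux : unit_itv x.
  rewrite /unit_itv /= in_itv /=; apply/andP; split.
    by apply: le_trans h1; rewrite divr_ge0 // ltW.
  apply: lt_le_trans h2 _; rewrite ler_pdivrMr // mul1r -natrX ler_nat.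
  exact: ltn_ord.
split => //; apply/val_inj; rewrite trvE //; apply: truncn_def.
by rewrite mulrC -ler_pdivrMr // h1 -ltr_pdivlMr.
Qed.

Lemma mfib_trv K : mfib unit_itv (trv K).
Proof. by move=> v; rewrite trv_fib; exact: measurable_itv. Qed.

Lemma pm_trv K v : pm unif unit_itv (trv K) v = s%:R ^- K.
Proof.
have sK : 0 < s%:R ^+ K :> R by rewrite exprn_gt0 // ltr0n.
rewrite /pm unifE setIAC setIid trv_fib lebesgue_measure_itv /=.
rewrite lte_fin ltr_pM2r ?invr_gt0 // ltr_nat ltnSn /= -mulrBl -natr1 addrAC subrr add0r mul1r.
by [].
Qed.

Definition digs m (io : 'I_m -> nat) (x : R) : {ffun 'I_m -> 'I_s} :=
  [ffun j => Ordinal (ltn_pmod (Num.truncn (s%:R ^+ (io j).+1 * x)) s0)].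

Lemma digs_det m (io : 'I_m -> nat) K (ioK : forall j, (io j < K)%N) x : unit_itv x ->
  digs io x = [ffun j => dig (trv K x) (Ordinal (ioK j))].
Proof.
move=> ux; apply/ffunP => j; rewrite !ffunE; apply/val_inj => /=; rewrite trvE //.
move: ux; rewrite /unit_itv /= in_itv /= => /andP[x0 _].
exact: (digitE (ioK j)).
Qed.

(** All the places lie among the first [K] digits, which are uniform on words of length [K]; exactly
    [s ^ (K - m)] of these words have prescribed digits at [m] distinct places. *)
Lemma digs_law m (io : 'I_m -> nat) : injective io -> mfib unit_itv (digs io) /\
  forall w, pm unif unit_itv (digs io) w = s%:R ^- m.
Proof.
move=> ioI; pose K := (\max_j io j).+1.
have ioK j : (io j < K)%N by rewrite ltnS /K (leq_bigmax j).
pose f (v : 'I_(s ^ K)) : {ffun 'I_m -> 'I_s} := [ffun j => dig v (Ordinal (ioK j))].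
have fE x : unit_itv x -> digs io x = f (trv K x) by exact: digs_det.
split.
  apply: (@mfib_det _ Om unit_itv _ _ (trv K)) (@mfib_trv K) _ => x y ux uy h.
  by rewrite !fE // h.
move=> w; rewrite (pm_det unif (@mfib_trv K) fE).
under eq_bigr => v _ do rewrite pm_trv.
rewrite sumr_const.
suff -> : #|[pred v | f v == w]| = (s ^ (K - m))%N.
  have sR : s%:R != 0 :> R by rewrite pnatr_eq0 -lt0n.
  have mK : (m <= K)%N.
    rewrite -[m]card_ord -[K]card_ord; apply: (@leq_card _ _ (fun j => Ordinal (ioK j))) => i j [].
    exact: ioI.
  rewrite -[LHS]mulr_natl natrX -{2}(subnK mK) exprD invfM mulrA mulfV ?mul1r // expf_neq0 //.
pose F (k : 'I_K) := [pred a : 'I_s | [forall j, (io j == k) ==> (a == w j)]].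
have bd : bijective (@dig K).
  by apply: inj_card_bij; [exact: dig_inj|rewrite card_ffun !card_ord].
have [g gd dg] := bd.
transitivity #|[pred u : {ffun 'I_K -> 'I_s} | u \in family F]|.
  rewrite -(fintype.card_image (@dig_inj K)); apply: eq_card => u.
  rewrite [RHS]inE; apply/fintype.imageP/familyP => [[v /eqP fv ->] k|h].
    apply/forallP => j; apply/implyP => /eqP jk; rewrite -fv (_ : f v j = dig v (Ordinal (ioK j))); last by rewrite [LHS]ffunE.
    have kE : k = Ordinal (ioK j) by apply: val_inj; rewrite /= -jk.
    by rewrite kE.
  exists (g u); last by rewrite dg.
  rewrite inE; apply/eqP/ffunP => j; rewrite ffunE dg.
  by have := h (Ordinal (ioK j)) => /forallP /(_ j); rewrite eqxx => /eqP.
rewrite (eq_card (B := family F)); last by move=> u; rewrite inE.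
rewrite card_family foldrE big_image /=.
pose io' j := Ordinal (ioK j).
have io'I : injective io' by move=> i j [] /ioI.
rewrite (bigID (fun k => k \in codom io')) /= big1 ?mul1n => [|k /codomP[j ->]]; last first.
  apply/eqP; rewrite -(card1 (w j)); apply/eqP/eq_card => a; rewrite !inE.
  apply/forallP/eqP => [/(_ j)|-> j']; first by rewrite eqxx => /eqP.
  by apply/implyP => /eqP jj; apply/eqP; congr (w _); apply: ioI; rewrite [RHS]jj.
rewrite (eq_bigr (fun=> s)) => [|k kn].
  rewrite prod_nat_const; congr (s ^ _)%N; rewrite -[in RHS](card_ord K) -[in RHS](card_ord m).
  rewrite -(card_codom io'I) -(cardC [in codom io']) addKn.
  by apply: eq_card => k; rewrite !inE.
rewrite -[RHS](card_ord s); apply: eq_card => a; rewrite !inE; apply/forallP => j.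
apply/implyP => /eqP jk; case/negP: kn; apply/codomP; exists j; exact/val_inj.
Qed.

End digits.

(* Free concatenations of the [s] orbit segments of length [N] starting at the
   points [y a] are shadowed by orbits. *)
Section concatenation.
Context {R : realType} {M : ptopologicalType} (d : M -> M -> R) (T : M -> M) (X : set M).
Hypothesis E : esys d T X.
Notation borbit := (borbit T X).
Context (N s : nat) (y : 'I_s -> M) (beta alpha e0 : R).
Hypothesis N0 : (0 < N)%N.
Hypothesis Xy : forall a, X (y a).
Hypothesis shadow : forall w : int -> M, (forall i, X (w i)) ->
  (forall i, d (T (w i)) (w (i + 1)) < alpha) ->
  exists2 x, borbit x & forall i, d (x i) (w i) <= beta.
Hypothesis al0 : 0 < alpha.
Hypothesis jump : forall a b, d (iter N T (y a)) (y b) < alpha.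
Hypothesis expan : forall x z, borbit x -> borbit z -> (forall i, d (x i) (z i) < e0) -> x = z.
Hypothesis be0 : 2 * beta < e0.
Hypothesis Hexp : forall rho, 0 < rho -> exists n0, forall x z, X x -> X z ->
    (forall i, (i <= n0 + n0)%N -> d (iter i T x) (iter i T z) < e0) ->
    d (iter n0 T x) (iter n0 T z) < rho.

Definition concat (c : int -> 'I_s) (t : int) : M :=
  iter (absz (t %% N%:Z)%Z) T (y (c (t %/ N%:Z)%Z)).

Lemma concatE c (q : int) (l : nat) : (l < N)%N -> concat c (q * N%:Z + l%:Z) = iter l T (y (c q)).
Proof.
move=> lN; have N0' : N%:Z != 0 by rewrite -lt0n.
have ll : (l%:Z %/ N%:Z)%Z = 0 by apply: divz_small; rewrite lez_nat leq0n ltz_nat.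
by rewrite /concat divzMDl // ll addr0 modzMDl modz_small.
Qed.

Lemma int_block (t : int) : exists (q : int) (l : nat), (l < N)%N /\ t = q * N%:Z + l%:Z.
Proof.
have N0' : N%:Z != 0 by rewrite -lt0n.
exists (t %/ N%:Z)%Z, (absz (t %% N%:Z)%Z); have h := modz_ge0 t N0'.
have h2 : (t %% N%:Z)%Z < N%:Z by have := ltz_pmod t (_ : 0 < N%:Z); apply; rewrite ltz_nat.
split; last by rewrite gez0_abs // -divz_eq.
by rewrite -ltz_nat gez0_abs.
Qed.

Lemma Pi_ex (c : int -> 'I_s) : {z : int -> M | borbit z /\ forall t, d (z t) (concat c t) <= beta}.
Proof.
apply: cid; have [||z oz hz] := shadow (w := concat c); last by exists z.
- by move=> t; apply: (es_iter E).
- move=> t; have [q [l [lN ->]]] := int_block t; rewrite concatE // -iterS.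
  have [lN1|lN1] := ltnP l.+1 N.
    rewrite -addrA -PoszD addn1 concatE // (es_xx E) //.
  have -> : l.+1 = N by apply/eqP; rewrite eqn_leq lN lN1.
  have -> : q * N%:Z + l%:Z + 1 = (q + 1) * N%:Z + 0%:Z.
    rewrite -addrA -PoszD addn1 mulrDl mul1r addr0; congr (_ + _).
    by congr Posz; apply/eqP; rewrite eqn_leq lN lN1.
  by rewrite concatE //; exact: jump.
Qed.

Definition Pi c := projT1 (Pi_ex c).
Lemma Pi_orbit c : borbit (Pi c). Proof. by have [] := projT2 (Pi_ex c). Qed.
Lemma Pi_close c t : d (Pi c t) (concat c t) <= beta.
Proof. by have [_ h] := projT2 (Pi_ex c); exact: h. Qed.

(** Expansivity makes the shadowing orbit unique, so the choice made in [Pi_ex] commutes with the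
    shift. *)
Lemma Pi_shift c : Pi (fun i => c (i + 1)) = fun t => Pi c (t + N%:Z).
Proof.
apply: expan; [exact: Pi_orbit|exact: borbit_shift (Pi_orbit c)|].
move=> t; have h1 := Pi_close (fun i => c (i + 1)) t; have h2 := Pi_close c (t + N%:Z).
have e : concat (fun i => c (i + 1)) t = concat c (t + N%:Z).
  have [q [l [lN ->]]] := int_block t; rewrite concatE //.
  by rewrite addrAC -{2}[N%:Z]mul1r -mulrDl concatE.
rewrite e in h1.
have := es_tri E (concat c (t + N%:Z)) (Pi (fun i => c (i + 1)) t) (Pi c (t + N%:Z)).
by rewrite (es_C E (concat _ _)); move: h1 h2 be0; lra.
Qed.

(** Equal symbols near 0 make both orbits follow the same concatenation for [n0] steps in both
    directions, and expansivity brings them close at time 0. *)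
Lemma Pi_continuous c (U : set M) : open U -> U (Pi c 0) -> exists n : nat, forall c',
  (forall i : int, (`|i| <= n)%N -> c i = c' i) -> U (Pi c' 0).
Proof.
move=> oU Uc; have [rho rho0 hU] := es_nbhs E (open_nbhs_nbhs (conj oU Uc)).
have [n0 Hn0] := Hexp rho0; exists n0.+1 => c' cc'; apply: hU.
have := Hn0 (Pi c (- n0%:Z)) (Pi c' (- n0%:Z)) (Pi_orbit _ _).1 (Pi_orbit _ _).1.
rewrite !(borbit_iter _ _ (Pi_orbit _)) addNr; apply => i iN.
rewrite !(borbit_iter _ _ (Pi_orbit _)).
(* Since [N >= 1], a time of absolute value at most [n0] lies in a block whose index is at most
   [n0 + 1] in absolute value. *)
have e : concat c (- n0%:Z + i%:Z) = concat c' (- n0%:Z + i%:Z).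
  have [q [l [lN tE]]] := int_block (- n0%:Z + i%:Z); rewrite tE !concatE // cc' //.
  have hN : 1 <= N%:Z by rewrite lez_nat.
  have hl : l%:Z < N%:Z by rewrite ltz_nat.
  have hl0 : 0 <= l%:Z by [].
  have hi : i%:Z <= n0%:Z + n0%:Z by rewrite -PoszD lez_nat.
  have hi0 : 0 <= i%:Z by [].
  have hq1 : q < n0%:Z + 1.
    rewrite ltNge; apply/negP => h.
    have : (n0%:Z + 1) * 1 <= q * N%:Z by apply: ler_pM.
    by move: tE hl0 hi; clear; lia.
  have hq2 : - (n0%:Z + 1) <= q.
    rewrite leNgt; apply/negP => h; have h' : q + 1 <= - (n0%:Z + 1) by rewrite lezD1.
    have : (n0%:Z + 1) * 1 <= - (q + 1) * N%:Z by apply: ler_pM => //; rewrite lerNr.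
    by move: tE hl hi0; clear; lia.
  by move: hq1 hq2; clear; lia.
have h1 := Pi_close c (- n0%:Z + i%:Z); have h2 := Pi_close c' (- n0%:Z + i%:Z).
rewrite e in h1.
have := es_tri E (concat c' (- n0%:Z + i%:Z)) (Pi c (- n0%:Z + i%:Z)) (Pi c' (- n0%:Z + i%:Z)).
by rewrite (es_C E (concat _ _)); move: h1 h2 be0; lra.
Qed.

Lemma Pi_separates (r : R) c c' (q : int) :
  (forall a b, a != b -> exists2 l, (l < N)%N & r < d (iter l T (y a)) (iter l T (y b))) ->
  4 * beta <= r ->
  (forall l : nat, (l < N)%N -> d (Pi c (q * N%:Z + l%:Z)) (Pi c' (q * N%:Z + l%:Z)) < r / 2) ->
  c q = c' q.
Proof.
move=> sep br h; apply/eqP; apply/negPn/negP => cc; have [l lN rl] := sep _ _ cc.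
have h1 := Pi_close c (q * N%:Z + l%:Z); have h2 := Pi_close c' (q * N%:Z + l%:Z).
rewrite !concatE // in h1 h2; have h3 := h l lN.
have t1 := es_tri E (Pi c (q * N%:Z + l%:Z)) (iter l T (y (c q))) (iter l T (y (c' q))).
have t2 := es_tri E (Pi c' (q * N%:Z + l%:Z)) (Pi c (q * N%:Z + l%:Z)) (iter l T (y (c' q))).
rewrite (es_C E (iter _ _ _) (Pi c _)) in t1.
by move: rl h1 h2 h3 t1 t2 br; lra.
Qed.

End concatenation.

Definition int_code (i : int) : nat := match i with Posz n => n.*2 | Negz n => n.*2.+1 end.

Lemma int_code_inj : injective int_code.
Proof.
case=> [m|m] [n|n] /= h.
- by congr Posz; apply: double_inj.
- by have := congr1 odd h; rewrite /= !odd_double.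
- by have := congr1 odd h; rewrite /= !odd_double.
- by congr Negz; apply: double_inj; case: h.
Qed.

Lemma mnormalizeE (R : realType) (d : measure_display) (T : measurableType d)
  (m : {measure set T -> \bar R}) (P : probability T R) A (r : R) : m setT = r%:E -> 0 < r ->
  mnormalize m P A = (m A * (r^-1)%:E)%E.
Proof. by move=> m1 r0; rewrite /mnormalize m1 eqe (gt_eqF r0). Qed.

(** * Bernoulli measures on concatenated orbits *)

Section bernoulli.
Context {R : realType} {M : ptopologicalType} (d : M -> M -> R) (T : M -> M) (X : set M).
Hypothesis E : esys d T X.
Context (N s : nat) (Pi : (int -> 'I_s) -> int -> M) (r : R).
Hypothesis N0 : (0 < N)%N.
Hypothesis s0 : (0 < s)%N.
Hypothesis PiX : forall c t, X (Pi c t).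
Hypothesis PiT : forall c (t : int) (j : nat), iter j T (Pi c t) = Pi c (t + j%:Z).
Hypothesis PiS : forall c, Pi (fun i => c (i + 1)) = fun t => Pi c (t + N%:Z).
Hypothesis Pic : forall c (U : set M), open U -> U (Pi c 0) -> exists n : nat, forall c',
  (forall i : int, (`|i| <= n)%N -> c i = c' i) -> U (Pi c' 0).
Hypothesis Pisep : forall c c' (q : int),
  (forall l : nat, (l < N)%N -> d (Pi c (q * N%:Z + l%:Z)) (Pi c' (q * N%:Z + l%:Z)) < r) -> c q = c' q.
Notation Om := (measurableTypeR R).
Notation unif := (@unif R).
Notation unit_itv := (@unit_itv R).

(** Off the unit interval all symbols are those of 0, so [rv k] is measurable on the whole line;
    [unif] gives no mass to that part. *)
Definition clamp (x : R) : R := if x \in unit_itv then x else 0.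
Definition sym (x : R) (i : int) : 'I_s :=
  Ordinal (ltn_pmod (Num.truncn (s%:R ^+ (int_code i).+1 * clamp x)) s0).

Definition windowP (U : set M) n (w : {ffun 'I_(n.*2.+1) -> 'I_s}) : bool :=
  `[<forall c, (forall k : 'I_(n.*2.+1), c (k%:Z - n%:Z) = w k) -> U (Pi c 0)>].

Lemma in_unit x : unit_itv x -> clamp x = x.
Proof. by move=> ux; rewrite /clamp mem_set. Qed.

Definition io n (k : int) (j : 'I_(n.*2.+1)) : nat := int_code (j%:Z - n%:Z + k).

Lemma io_inj n k : injective (@io n k).
Proof. by move=> i j /int_code_inj /addIr /addIr [] /val_inj. Qed.

(** By [Pic], an open condition on [Pi c 0] that holds is already forced by finitely many symbols,
    so the event is an increasing union of cylinders. *)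
Lemma window_union (U : set M) k : open U ->
  unit_itv `&` [set x | U (Pi (fun i => sym x (i + k)) 0)] =
  \bigcup_n (unit_itv `&` digs s0 (@io n k) @^-1` [set w | windowP U w]).
Proof.
move=> oU; apply/seteqP; split=> x /=.
  move=> [ux Ux]; have [n hn] := Pic oU Ux; exists n => //; split => //=.
  apply/asboolP => c hc; apply: hn => i inn.
  have jn : (absz (i + n%:Z)%R < n.*2.+1)%N by rewrite -addnn; move: inn; clear; lia.
  have := hc (Ordinal jn); rewrite /= ffunE /io /=.
  have -> : (absz (i + n%:Z))%:Z - n%:Z = i by move: inn; clear; lia.
  by move=> ->; apply/val_inj; rewrite /= in_unit.
move=> [n _ [ux /asboolP h]]; split => //; apply: h => j.
by apply/val_inj; rewrite /= !ffunE /= in_unit.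
Qed.

Lemma window_mono (U : set M) k n :
  unit_itv `&` digs s0 (@io n k) @^-1` [set w | windowP U w] `<=`
  unit_itv `&` digs s0 (@io n.+1 k) @^-1` [set w | windowP U w].
Proof.
move=> x [ux /asboolP h]; split => //=; apply/asboolP => c hc; apply: h => j.
have jn : (j.+1 < n.+1.*2.+1)%N by rewrite doubleS !ltnS (leq_trans (ltnW (ltn_ord j))) //.
have := hc (Ordinal jn); rewrite !ffunE /io /=.
by have -> : j.+1%:Z - n.+1%:Z = j%:Z - n%:Z by clear; lia.
Qed.

Lemma window_prob (U : set M) n k :
  unif (unit_itv `&` digs s0 (@io n k) @^-1` [set w | windowP U w]) =
  (s%:R ^- (n.*2.+1) *+ #|[pred w | @windowP U n w]|)%:E.
Proof.
have [mf law] := @digs_law R s s0 _ _ (@io_inj n k).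
have mm := mfib_preimage (@windowP U n) mf.
have := pm_preimage unif (@windowP U n) mf => /=.
under eq_bigr => w _ do rewrite law.
by rewrite sumr_const => h; rewrite -[LHS]fineK ?fin_num_measure // h.
Qed.

Lemma measurable_window (U : set M) n k :
  measurable (unit_itv `&` digs s0 (@io n k) @^-1` [set w | windowP U w]).
Proof. exact: mfib_preimage (digs_law s0 (@io_inj n k)).1. Qed.

Lemma sym_const x i : ~ unit_itv x -> sym x i = sym 0 i.
Proof.
have u0 : unit_itv 0 by rewrite /unit_itv /= in_itv /= lexx ltr01.
by move=> nx; apply/val_inj; rewrite /= /clamp memNset // mem_set.
Qed.

Definition rv (k : int) (x : Om) : borel M := Pi (fun i => sym x (i + k)) 0.

Lemma rv_measurable k : measurable_fun setT (rv k).
Proof.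
move=> _ B; rewrite setTI; move: B; apply: borel_ind => [U oU|].
  rewrite (_ : _ @^-1` _ = (unit_itv `&` [set x | U (Pi (fun i => sym x (i + k)) 0)]) `|`
    (~` unit_itv `&` [set _ | U (Pi (fun i => sym 0 (i + k)) 0)])).
    apply: measurableU.
      by rewrite window_union //; apply: bigcupT_measurable => n; exact: measurable_window.
    apply: measurableI; first by apply: measurableC; exact: measurable_unit_itv.
    have [h|h] := pselect (U (Pi (fun i => sym 0 (i + k)) 0)).
      by rewrite (_ : [set _ | _] = setT) //; apply/seteqP; split.
    by rewrite (_ : [set _ | _] = set0) //; apply/seteqP; split.
  have e x : ~ unit_itv x -> (fun i => sym x (i + k)) = (fun i => sym 0 (i + k)).
    by move=> nx; apply/funext => i; exact: sym_const.
  apply/seteqP; split=> x /=; rewrite /rv.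
    by have [ux|nx] := pselect (unit_itv x); [left|rewrite e //; right].
  by move=> [[_ h]|[nx h]] //; rewrite (e x nx).
split.
- by rewrite preimage_set0; exact: measurable0.
- by move=> A mA; rewrite setTD preimage_setC; exact: measurableC.
- by move=> F mF; rewrite preimage_bigcup; exact: bigcupT_measurable.
Qed.

Lemma unif_unitI (B : set Om) : measurable B -> unif (unit_itv `&` B) = unif B.
Proof. by move=> mB; rewrite !unifE setIAC setIid setIC. Qed.

(** Stationarity of the symbols: the probability of the [n]-th cylinder event counts words and does
    not involve [k], so the limits agree. *)
Lemma rv_open k (U : set M) : open U -> unif (rv k @^-1` U) = unif (rv 0 @^-1` U).
Proof.
move=> oU; have mU : measurable (U : set (borel M)) by exact: open_borel.
have mk j : measurable (rv j @^-1` U) by rewrite -[X in measurable X]setTI; exact: rv_measurable.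
have lim j : (fun n => (s%:R ^- (n.*2.+1) *+ #|[pred w | @windowP U n w]|)%:E : \bar R) @ \oo
    --> unif (rv j @^-1` U).
  rewrite -unif_unitI // (_ : unit_itv `&` _ = unit_itv `&` [set x | U (Pi (fun i => sym x (i + j)) 0)]) //.
  rewrite window_union //.
  pose F n := unit_itv `&` digs s0 (@io n j) @^-1` [set w | windowP U w].
  rewrite (_ : (fun n => _) = unif \o F); last first.
    by apply/funext => n; rewrite /= window_prob.
  apply: nondecreasing_cvg_mu.
  - by move=> n; exact: measurable_window.
  - by apply: bigcupT_measurable => n; exact: measurable_window.
  - by apply/nondecreasing_seqP => n; apply/subsetPset; exact: window_mono.
exact: cvg_unique (lim k) (lim 0).
Qed.

Lemma rv_mfun k : rv k \in @mfun _ _ Om (borel M).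
Proof. by rewrite inE; exact: rv_measurable. Qed.

Lemma rv_borel k (B : set (borel M)) : measurable B -> unif (rv k @^-1` B) = unif (rv 0 @^-1` B).
Proof.
move=> mB.
apply: (@g_sigma_algebra_measure_unique _ R (borel M) open (@open_borel M) (fun=> setT)
  (fun=> openT) _ (distribution unif (mfun_Sub (rv_mfun k))) (distribution unif (mfun_Sub (rv_mfun 0)))) => //.
- by rewrite bigcup_const //; exists 0%N.
- by move=> A B' oA oB; exact: openI.
- by move=> A oA; exact: rv_open.
- by move=> n; rewrite (le_lt_trans (probability_le1 _ _)) ?ltry.
Qed.

Definition rvj (j : nat) (x : Om) : borel M := Pi (sym x) j%:Z.

Lemma rvjE j x : rvj j x = iter j T (rv 0 x).
Proof.
rewrite /rvj /rv PiT add0r; congr (Pi _ _).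
by apply/funext => i; rewrite addr0.
Qed.

Lemma rvj_measurable j : measurable_fun setT (rvj j).
Proof.
move=> _ B mB; rewrite setTI.
rewrite (_ : _ @^-1` _ = rv 0 @^-1` (iter j T @^-1` B)); last first.
  by apply/seteqP; split=> x /=; rewrite rvjE.
rewrite -[X in measurable X]setTI; apply: rv_measurable => //.
exact: (iter_measurable E).
Qed.

Lemma rvj_mfun j : rvj j \in @mfun _ _ Om (borel M).
Proof. by rewrite inE; exact: rvj_measurable. Qed.

Lemma rvj_period (B : set (borel M)) : measurable B -> unif (rvj N @^-1` B) = unif (rvj 0 @^-1` B).
Proof.
move=> mB; have e1 : rvj N = rv 1.
  by apply/funext => x; rewrite /rvj /rv PiS add0r.
have e0 : rvj 0 = rv 0.
  by apply/funext => x; rewrite rvjE.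
by rewrite e1 e0; exact: rv_borel.
Qed.

(** A shift of the symbols corresponds to [N] steps of [T], so the law of [rvj 0] is only invariant
    under [iter N T]; averaging over [N] successive times makes it invariant under [T]. *)
Definition avg_law : probability (borel M) R :=
  mnormalize (msum (fun j => distribution unif (mfun_Sub (rvj_mfun j))) N) (dirac (point : borel M)).

Lemma avg_lawE (B : set (borel M)) : avg_law B = ((\sum_(j < N) unif (rvj j @^-1` B)) * (N%:R^-1)%:E)%E.
Proof.
apply: mnormalizeE; last by rewrite ltr0n.
transitivity (\sum_(j < N) distribution unif (mfun_Sub (rvj_mfun j)) setT)%E; first by [].
rewrite (eq_bigr (fun=> 1%E)); last by move=> j _; exact: probability_setT.
by rewrite sumEFin sumr_const card_ord.
Qed.

Lemma avg_law_invariant : invariant_on T X avg_law.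
Proof.
have N0R : N%:R != 0 :> R by rewrite pnatr_eq0 -lt0n.
split.
  rewrite avg_lawE (eq_bigr (fun=> 1%E)); last first.
    move=> j _; rewrite (_ : _ @^-1` _ = setT) ?probability_setT //.
    by apply/seteqP; split=> x // _; exact: PiX.
  by rewrite sumEFin sumr_const card_ord -EFinM divff.
move=> B mB; rewrite !avg_lawE; congr (_ * _)%E.
rewrite (eq_bigr (fun j : 'I_N => unif (rvj j.+1 @^-1` B))); last first.
  by move=> j _; congr (unif _); apply/seteqP; split=> x /=; rewrite !rvjE.
move: (rvj_period mB); case: N N0 => // N' _ h.
rewrite big_ord_recr big_ord_recl /= h addeC; congr (_ + _)%E.
Qed.

(** Whatever the phase [j], a stretch of [q.+1 * N] steps contains [q] whole blocks, so by [Pisep]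
    the points of [A] determine [q] symbols. *)
Lemma avg_law_cell q (A : set (borel M)) : measurable A ->
  (forall x z, X x -> X z -> A x -> A z -> forall i, (i < q.+1 * N)%N -> d (iter i T x) (iter i T z) < r) ->
  (avg_law A <= (s%:R ^- q)%:E)%E.
Proof.
move=> mA hA; have N0R : N%:R != 0 :> R by rewrite pnatr_eq0 -lt0n.
have key (j : 'I_N) : (unif (rvj j @^-1` A) <= (s%:R ^- q)%:E)%E.
  have mj : measurable (rvj j @^-1` A).
    by rewrite -[X in measurable X]setTI; exact: rvj_measurable.
  rewrite -unif_unitI //.
  have [[x0 [ux0 Ax0]]|nx] := pselect (exists x, unit_itv x /\ A (rvj j x)); last first.
    rewrite (_ : _ `&` _ = set0) ?measure0 ?lee_fin ?invr_ge0 ?exprn_ge0 //.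
    by apply/seteqP; split=> x // [ux Ax]; case: nx; exists x.
  pose iq (k : 'I_q) := int_code (k%:Z + 1).
  have iqI : injective iq by move=> a b /int_code_inj /addIr [] /val_inj.
  have [mf law] := @digs_law R s s0 _ _ iqI.
  have mw := mf (digs s0 iq x0).
  rewrite -(law (digs s0 iq x0)) /pm fineK ?fin_num_measure //.
  rewrite le_measure ?inE //.
  - by apply: measurableI => //; exact: measurable_unit_itv.
  - move=> x [ux Ax]; split => //=; apply/ffunP => k; rewrite !ffunE; apply/val_inj => /=.
    suff : sym x (k%:Z + 1) = sym x0 (k%:Z + 1) by move/(congr1 val); rewrite /= !in_unit.
    apply: Pisep => l lN.
    have tE : (k%:Z + 1) * N%:Z + l%:Z = j%:Z + (k.+1 * N + l - j)%N%:Z.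
      rewrite -subzn; last by rewrite mulSn -addnA (leq_trans (ltnW (ltn_ord j))) // leq_addr.
      by rewrite addrCA subrr addr0 PoszD PoszM -addn1 PoszD.
    rewrite tE -!PiT; apply: hA => //.
    + have kq := ltn_ord k; rewrite mulSn.
      have : (k.+1 * N <= q * N)%N by rewrite leq_mul2r kq orbT.
      by move: lN; lia.
rewrite avg_lawE; apply: (@le_trans _ _ ((\sum_(j < N) (s%:R ^- q)%:E) * (N%:R^-1)%:E)%E).
  by apply: lee_wpmul2r; [rewrite lee_fin invr_ge0|exact: lee_sum].
by rewrite sumEFin sumr_const card_ord -EFinM lee_fin -[X in X * _ <= _]mulr_natr mulfK.
Qed.

End bernoulli.

(** * Entropy as a limit, and its lower bound *)

Lemma fekete (R : realType) (a : nat -> R) : (forall n, 0 <= a n) ->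
  (forall m n, a (m + n)%N <= a m + a n) -> cvgn (fun n => a n / n%:R).
Proof.
move=> a0 aD; pose S := [set x | exists2 n, (0 < n)%N & x = a n / n%:R].
have Sinf : has_inf S.
  split; first by exists (a 1%N / 1%:R), 1%N.
  by exists 0 => x [n _ ->]; rewrite divr_ge0.
apply/cvg_ex; exists (inf S); apply/cvgrPdist_le => e e0.
have e2 : 0 < e / 2 by rewrite divr_gt0.
have [_ [k k0 ->] hk] := inf_adherent e2 Sinf.
pose B := \sum_(i < k) a i.
have aB i : (i < k)%N -> a i <= B.
  by move=> ik; rewrite /B (bigD1 (Ordinal ik)) //= lerDl sumr_ge0.
have kR : 0 < k%:R :> R by rewrite ltr0n.
have aq q i : a (q * k + i)%N <= q%:R * a k + a i.
  elim: q => [|q IH]; first by rewrite mul0n mul0r add0r add0n.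
  by rewrite mulSn -addnA -natr1 mulrDl mul1r [_ + a k]addrC -addrA; apply: le_trans (aD _ _) _; rewrite lerD2l.
near=> n.
have n0 : (0 < n)%N by near: n; exists 1%N.
have nR : 0 < n%:R :> R by rewrite ltr0n.
have h1 : inf S <= a n / n%:R by apply: ge_inf; [exact: Sinf.2|exists n].
have h2 : B <= e / 2 * n%:R.
  rewrite mulrC -ler_pdivrMr //; near: n.
  exists (Num.truncn (B / (e / 2))).+1 => // m /= hm; apply: ltW.
  by apply: lt_le_trans (truncnS_gt _) _; rewrite ler_nat.
have h3 : a n <= (n %/ k)%:R * a k + B.
  rewrite {1}(divn_eq n k); apply: le_trans (aq _ _) _.
  by rewrite lerD2l; apply: aB; exact: ltn_pmod.
have h4 : (n %/ k)%:R * a k <= n%:R * (a k / k%:R).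
  have : (n %/ k)%:R * k%:R <= n%:R :> R by rewrite -natrM ler_nat leq_divM.
  rewrite -ler_pdivlMr // => h; apply: le_trans (ler_wpM2r (a0 k) h) _.
  by rewrite mulrAC mulrA.
rewrite distrC ger0_norm ?subr_ge0 // lerBlDr ler_pdivrMr // mulrDl.
have h5 : n%:R * (a k / k%:R) <= n%:R * (inf S + e / 2) by rewrite ler_pM2l // ltW.
apply: le_trans h3 _.
have : n%:R * (inf S + e / 2) = inf S * n%:R + e / 2 * n%:R by ring.
have : e * n%:R = e / 2 * n%:R + e / 2 * n%:R by field.
by move: h2 h4 h5; lra.
Unshelve. all: by end_near.
Qed.

Lemma lim_lower (R : realType) (a : nat -> R) (l : R) N : (0 < N)%N ->
  cvgn (fun n => a n / n%:R) -> (forall q, q%:R * l <= a (q.+1 * N)%N) ->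
  l / N%:R <= limn (fun n => a n / n%:R).
Proof.
move=> N0 ca al; set L := limn _; rewrite leNgt; apply/negP => h.
have NR : 0 < N%:R :> R by rewrite ltr0n.
pose e := (l / N%:R - L) / 2.
have e0 : 0 < e by rewrite divr_gt0 // subr_gt0.
have /cvgrPdist_le /(_ _ e0) [n1 _ hn] := ca.
have lN : L * N%:R < l by rewrite -ltr_pdivlMr.
pose g := l - (L + e) * N%:R.
have gE : g = e * N%:R by rewrite /g /e; field; rewrite gt_eqF.
have g0 : 0 < g by rewrite gE mulr_gt0.
pose u : R := `|(L + e) * N%:R| / g.
pose q := (n1 + (Num.truncn u).+1)%N.
have qn : (n1 <= q.+1 * N)%N.
  apply: leq_trans (_ : q.+1 * 1 <= _)%N; last by rewrite leq_mul2l N0 orbT.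
  by rewrite muln1 /q ltnW // ltnS leq_addr.
have := hn _ qn; rewrite ler_norml => /andP[h1 _].
have qR : 0 < (q.+1 * N)%:R :> R by rewrite ltr0n muln_gt0.
have h2 : a (q.+1 * N)%N / (q.+1 * N)%:R <= L + e 
  by move: h1; rewrite -/L lerBrDr (addrC (- e)) lerBlDr.
rewrite ler_pdivrMr // in h2.
have := le_trans (al q) h2; rewrite natrM -natr1 => h3.
have h4 : q%:R * g <= (L + e) * N%:R.
  have e3 : (L + e) * ((q%:R + 1) * N%:R) = q%:R * ((L + e) * N%:R) + (L + e) * N%:R by ring.
  by move: h3; rewrite e3 /g mulrBr lerBlDl.
have : (L + e) * N%:R < q%:R * g.
  apply: le_lt_trans (ler_norm _) _; rewrite -ltr_pdivrMr //.
  apply: lt_le_trans (truncnS_gt _) _; rewrite ler_nat /q.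
  exact: leq_addl.
by rewrite ltNge h4.
Qed.

Section lower.
Context {R : realType} {M : ptopologicalType} (d : M -> M -> R) (T : M -> M) (X : set M).
Hypothesis E : esys d T X.

Lemma mfib_itinerary (mu : probability (borel M) R) k (P : 'I_k -> set (borel M)) (p : M -> 'I_k) n :
  invariant_on T X mu -> (forall x i, P i x <-> p x = i) -> (forall i, measurable (P i)) ->
  mfib (X : set (borel M)) (fun x => [ffun i : 'I_n => p (iter i T x)]).
Proof.
move=> inv pP mP.
by have [] := @Hrv_itinerary _ _ _ _ _ inv _ (fun i x => p (iter i T x))
  (fun i => Hrv mu X (fun x => p (iter i T x))) n (fun i => mfib_iter E i pP mP) (fun i _ => lexx _).
Qed.

Lemma join_entropy_ge0 (mu : probability (borel M) R) k (P : 'I_k -> set (borel M)) n :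
  invariant_on T X mu -> fin_partition P -> 0 <= join_entropy T mu P n.
Proof.
move=> inv fP; have [p pP] := partition_index fP; have [mP _ _] := fP.
rewrite (join_entropy_Hrv E inv n pP mP); apply: Hrv_ge0; first exact: inv.1.
exact: (mfib_itinerary inv pP mP).
Qed.

Lemma join_entropy_cvg (mu : probability (borel M) R) k (P : 'I_k -> set (borel M)) :
  invariant_on T X mu -> fin_partition P -> cvgn (fun n => join_entropy T mu P n / n%:R).
Proof.
move=> inv fP; have [p pP] := partition_index fP; have [mP _ _] := fP.
apply: fekete => [n|m n]; first exact: join_entropy_ge0.
pose it m x := [ffun i : 'I_m => p (iter i T x)].
have mit m' : mfib (X : set (borel M)) (it m').
  exact: (mfib_itinerary inv pP mP).
have fibE m' w : it m' @^-1` [set w] = join_cell T P w.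
  apply/seteqP; split=> x /=.
    by move=> <- i _ /=; rewrite ffunE; apply/pP.
  by move=> h; apply/ffunP => i; rewrite ffunE; apply/pP; exact: h.
have mcell m' (w : {ffun 'I_m' -> 'I_k}) : measurable (join_cell T P w).
  by apply: fin_bigcap_measurable => // i _; exact: (iter_measurable E).
have mitT : mfib (X : set (borel M)) (fun x => it n (iter m T x)).
  move=> w; rewrite (_ : _ @^-1` _ = iter m T @^-1` (it n @^-1` [set w])) // fibE.
  by apply: measurableI; [exact: (esys_measurable E)|exact: (iter_measurable E)].
have eH : Hrv mu X (fun x => it n (iter m T x)) = Hrv mu X (it n).
  rewrite /Hrv /ent; congr (- _); apply: eq_bigr => w _.
  suff -> : pm mu X (fun x => it n (iter m T x)) w = pm mu X (it n) w by [].
  rewrite /pm (_ : _ @^-1` _ = iter m T @^-1` (it n @^-1` [set w])) // fibE.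
  by rewrite !(muXI E inv) ?(mu_iter E inv) //; exact: (iter_measurable E).
rewrite !(join_entropy_Hrv E inv _ pP mP) -/(it n) -eH; apply: Hrv_pair => //; first exact: inv.1.
move=> x z _ _ /ffunP h1 /ffunP h2; apply/ffunP => i; rewrite !ffunE.
have [im|mi] := ltnP i m; first by have := h1 (Ordinal im); rewrite !ffunE.
have imn : (i - m < n)%N by rewrite ltn_subLR.
by have := h2 (Ordinal imn); rewrite !ffunE /= -!iterD subnK.
Qed.

Lemma small_partition r : 0 < r -> exists k (P : 'I_k -> set (borel M)), fin_partition P /\
  forall i x z, X x -> X z -> P i x -> P i z -> d x z < r.
Proof.
move=> r0; have r2 : 0 < r / 2 by rewrite divr_gt0.
have [s sX net] := es_net E r2.
pose near (j : 'I_(size s)) x := `[<d (tnth (in_tuple s) j) x < r / 2>].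
pose p x : option 'I_(size s) := [pick j | near j x].
have mv : mfib (setT : set (borel M)) (fun x => [ffun j => near j x]).
  move=> w; rewrite setTI.
  have mU j : measurable ([set x | near j x] : set (borel M)).
    apply: open_borel; rewrite (_ : [set x | _] = [set x | d (tnth (in_tuple s) j) x < r / 2]).
      exact: (es_open E).
    by apply/seteqP; split=> x /=; [move/asboolP|move=> h; apply/asboolP].
  rewrite (_ : _ @^-1` _ = \bigcap_(j in setT) (if w j then [set x | near j x] else ~` [set x | near j x])).
    apply: fin_bigcap_measurable => [|j _]; first exact: finite_finset.
    by case: (w j) => //; exact: measurableC.
  apply/seteqP; split=> x /=.
    by move=> <- j _; rewrite ffunE; case: ifPn => //= /negP.
  move=> h; apply/ffunP => j; rewrite ffunE; have := h j Logic.I; case: (w j) => //=.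
  by move/negP/negbTE.
have mp : mfib (setT : set (borel M)) p.
  apply: (mfib_det mv) => x z _ _ /ffunP h; apply: eq_pick => j.
  by have := h j; rewrite !ffunE.
exists #|{: option 'I_(size s)}|, (fun i => p @^-1` [set enum_val i]); split.
  split.
  - by move=> i; have := mp (enum_val i); rewrite setTI.
  - by move=> i j _ _ [x [/= -> /enum_val_inj]].
  - apply/seteqP; split=> x // _; exists (enum_rank (p x)) => //=.
    by rewrite enum_rankK.
move=> i x z Xx Xz /= hx hz.
have : p x = p z by rewrite hx hz.
rewrite /p; case: pickP => [j hj|h]; last first.
  by have [c /(tnthP (in_tuple s)) [j ->] hc] := net x Xx; have := h j; rewrite /near (es_C E) asboolT.
case: pickP => // j' hj' [jj]; rewrite -jj in hj'.
have /asboolP h1 := hj; have /asboolP h2 := hj'.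
have := es_tri E (tnth (in_tuple s) j) x z; rewrite (es_C E x (tnth _ _)) => t.
by move: h1 h2 t; lra.
Qed.

(** For a partition with cells of diameter below [r / 2], the joins over [q.+1 * N] steps have cells
    of measure at most [s ^- q] under [avg_law], so the entropy is at least [ln s / N]. The
    tolerance [alpha] depends only on [r], not on [N] or the points. *)
Lemma entropy_lower (r : R) : 0 < r -> exists2 alpha, 0 < alpha &
  forall N s (y : 'I_s -> M), (0 < N)%N -> (0 < s)%N -> (forall a, X (y a)) ->
    (forall a b, d (iter N T (y a)) (y b) < alpha) ->
    (forall a b, a != b -> exists2 l, (l < N)%N & r < d (iter l T (y a)) (iter l T (y b))) ->
    exists2 nu : probability (borel M) R, invariant_on T X nu &
      ((ln s%:R / N%:R)%:E <= ks_entropy T nu)%E.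
Proof.
move=> r0; have [e1 e10 Hexp] := es_exp E; have [e2 e20 Huniq] := borbit_expansive E.
pose e0 := Num.min e1 e2.
have e00 : 0 < e0 by rewrite lt_min e10.
have uniq x z : borbit T X x -> borbit T X z -> (forall i, d (x i) (z i) < e0) -> x = z.
  by move=> ox oz h; apply: Huniq => // i; apply: lt_le_trans (h i) _; rewrite ge_min lexx orbT.
have exp0 rho : 0 < rho -> exists n0, forall x z, X x -> X z ->
    (forall i, (i <= n0 + n0)%N -> d (iter i T x) (iter i T z) < e0) ->
    d (iter n0 T x) (iter n0 T z) < rho.
  move=> /Hexp [n0 h]; exists n0 => x z Xx Xz hh; apply: h => // i iN.
  by apply: lt_le_trans (hh i iN) _; rewrite ge_min lexx.
(* [2 * beta < e0] makes shadowing orbits unique, and [4 * beta <= r] keeps the orbits of different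
   symbols [r / 2] apart at some time. *)
have [beta be0 [be1 be2]] : exists2 beta, 0 < beta & 2 * beta < e0 /\ 4 * beta <= r.
  exists (Num.min (e0 / 3) (r / 4)); first by rewrite lt_min !divr_gt0.
  have h1 : Num.min (e0 / 3) (r / 4) <= e0 / 3 by rewrite ge_min lexx.
  have h2 : Num.min (e0 / 3) (r / 4) <= r / 4 by rewrite ge_min lexx orbT.
  by move: h1 h2; move: (Num.min _ _) => m h1 h2; split; lra.
have [alpha al0 Hsh] := biinfinite_shadowing E be0; exists alpha => // N s y N0 s0 Xy jump sep.
pose PI := Pi E N0 Xy Hsh al0 jump.
have PX c t : X (PI c t) by have [] := Pi_orbit E N0 Xy Hsh al0 jump c t.
have PT c (t : int) j : iter j T (PI c t) = PI c (t + j%:Z).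
  by rewrite (borbit_iter _ _ (Pi_orbit E N0 Xy Hsh al0 jump c)).
have PS := Pi_shift E N0 Xy Hsh al0 jump uniq be1.
have PC c U := @Pi_continuous _ _ _ _ _ E _ _ _ _ _ _ N0 Xy Hsh al0 jump be1 exp0 c U.
have Psep c c' q := @Pi_separates _ _ _ _ _ E _ _ _ _ _ N0 Xy Hsh al0 jump r c c' q sep be2.
pose nu := avg_law E N s0 PT PC.
have inv : invariant_on T X nu by exact: (avg_law_invariant E N0 s0 PX PT PS PC).
exists nu => //.
have r2 : 0 < r / 2 by rewrite divr_gt0.
have [k [P [fP small]]] := small_partition r2.
apply: (@le_trans _ _ (partition_entropy T nu P)%:E); last first.
  by apply: ereal_sup_ubound; exists k, P.
rewrite lee_fin; apply: lim_lower => //; first exact: join_entropy_cvg.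
move=> q; have [p pP] := partition_index fP; have [mP _ _] := fP.
rewrite (join_entropy_Hrv E inv _ pP mP).
have mit := @mfib_itinerary nu k P p (q.+1 * N)%N inv pP mP.
have sR : 0 < s%:R :> R by rewrite ltr0n.
have -> : q%:R * ln s%:R = - ln (s%:R ^- q) :> R.
  by rewrite lnV ?posrE ?exprn_gt0 // lnXn // opprK mulr_natl.
apply: ent_ge => [w||w]; [exact: pm_ge0|exact: (pm_sum inv.1 mit)|].
rewrite -lee_fin /pm fineK ?fin_num_measure //.
apply: (@avg_law_cell _ _ _ _ _ E N s PI (r / 2) N0 s0 PX PT PC Psep q) => //.
move=> x z _ _ [Xx /= /ffunP hx] [Xz /= /ffunP hz] i iN.
have := hx (Ordinal iN); have := hz (Ordinal iN); rewrite !ffunE /= => h1 h2.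
apply: (small (w (Ordinal iN))); [exact: (es_iter E)|exact: (es_iter E)| |]; exact/pP.
Qed.

End lower.

(** * The entropy gap *)

Lemma lim_upper (R : realType) (a b : nat -> R) (ta U C0 : R) per : (0 < per)%N ->
  cvgn (fun n => a n / n%:R) -> cvgn (fun n => b n / n%:R) ->
  (forall k, let n := (k.+1 * per)%N in a n + b n + n%:R * ta <= n%:R * U + C0) ->
  limn (fun n => a n / n%:R) + limn (fun n => b n / n%:R) + ta <= U.
Proof.
move=> per0 ca cb h; rewrite leNgt; apply/negP => hlt.
have [La LaE] : exists La : R, La = limn (fun n => a n / n%:R) by eexists.
have [Lb LbE] : exists Lb : R, Lb = limn (fun n => b n / n%:R) by eexists.
rewrite -LaE -LbE in hlt.
pose e := (La + Lb + ta - U) / 4.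
have e0 : 0 < e by rewrite divr_gt0 // subr_gt0.
have /cvgrPdist_le /(_ _ e0) [n1 _ h1] := ca; rewrite -LaE in h1.
have /cvgrPdist_le /(_ _ e0) [n2 _ h2] := cb; rewrite -LbE in h2.
pose u : R := `|C0| / e.
pose k := (n1 + n2 + (Num.truncn u).+1)%N; pose n := (k.+1 * per)%N.
have kn : (k <= n)%N.
  by apply: leq_trans (leqnSn k) _; rewrite /n -{1}[k.+1]muln1 leq_mul2l per0 orbT.
have nR : 0 < n%:R :> R by rewrite ltr0n /n muln_gt0.
have n1n : (n1 <= n)%N by apply: leq_trans kn; rewrite /k -addnA leq_addr.
have n2n : (n2 <= n)%N by apply: leq_trans kn; rewrite /k addnAC leq_addl.
have := h1 n n1n; rewrite ler_norml => /andP[_ g1].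
have := h2 n n2n; rewrite ler_norml => /andP[_ g2].
have {}g1 : (La - e) * n%:R <= a n.
  by rewrite -ler_pdivlMr // lerBlDr -lerBlDl; exact: g1.
have {}g2 : (Lb - e) * n%:R <= b n.
  by rewrite -ler_pdivlMr // lerBlDr -lerBlDl; exact: g2.
have g3 : C0 < n%:R * e.
  apply: le_lt_trans (ler_norm _) _; rewrite -ltr_pdivrMr //.
  apply: lt_le_trans (truncnS_gt _) _; rewrite ler_nat; apply: leq_trans kn.
  exact: leq_addl.
have g4 : a n + b n + n%:R * ta <= n%:R * U + C0 := h k.
have ne0 : 0 < n%:R * e by rewrite mulr_gt0.
have e4 : e * 4 = La + Lb + ta - U by rewrite /e divfK.
have e5 : La * n%:R + Lb * n%:R + n%:R * ta - n%:R * U = 4 * (n%:R * e).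
  have -> : 4 * (n%:R * e) = n%:R * (e * 4) by ring.
  by rewrite e4; ring.
rewrite mulrBl in g1; rewrite mulrBl in g2; rewrite (mulrC e) in g1 g2.
move: e5 g1 g2 g3 g4 ne0; clear.
move: (La * n%:R : R) (Lb * n%:R : R) (n%:R * e) (n%:R * ta) (n%:R * U) (a n) (b n) => x y z w v p q.
by lra.
Qed.

Section regular_functions.
Context {R : realType} {M : ptopologicalType} (d : M -> M -> R) (T : M -> M) (X : set M).
Hypothesis E : esys d T X.
Context (m : probability (borel M) R).
Hypothesis maxm : maximal_entropy T X m.
Context (D C1 e1 : R).
Hypothesis D0 : 0 < D.
Hypothesis C10 : 0 < C1.
Hypothesis e10 : 0 < e1.

(** Lipschitz functions enter the entropy estimates only through these bounds. They are homogeneous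
    in [L], so a multiple [t * f] is covered with constant [|t| * L]. *)
Record regular (f : M -> R) (L : R) : Prop := Regular {
  rg_ge0 : 0 <= L;
  rg_meas : measurable_fun (X : set (borel M)) f;
  rg_osc : forall x y, X x -> X y -> `|f x - f y| <= L * D;
  rg_sum : forall x y k, X x -> X y ->
    (forall i, (i <= k)%N -> d (iter i T x) (iter i T y) < e1) ->
    \sum_(i < k.+1) `|f (iter i T x) - f (iter i T y)| <= L * C1 }.

Lemma X_nonempty (mu : probability (borel M) R) : invariant_on T X mu -> exists x, X x.
Proof.
move=> inv; apply: contrapT => h; have : mu X = 0%E.
  by rewrite (_ : X = set0) ?measure0 //; apply/seteqP; split=> y // Xy; case: h; exists y.
by rewrite inv.1 => /eqP; rewrite onee_eq0.
Qed.

Lemma regular_sum f L x y k : regular f L -> X x -> X y ->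
  (forall i, (i < k)%N -> d (iter i T x) (iter i T y) < e1) ->
  \sum_(i < k) `|f (iter i T x) - f (iter i T y)| <= L * C1.
Proof.
move=> rf Xx Xy; case: k => [_|k h].
  by rewrite big_ord0 mulr_ge0 // ?(rg_ge0 rf) // ltW.
by apply: (rg_sum rf).
Qed.

Lemma regularZ f L t : regular f L -> regular (fun x => t * f x) (`|t| * L).
Proof.
move=> rf; split.
- by rewrite mulr_ge0 // (rg_ge0 rf).
- by apply: measurable_realfun.measurable_funM; [exact: measurable_cst|exact: (rg_meas rf)].
- by move=> x y Xx Xy; rewrite -mulrBr normrM -mulrA ler_wpM2l // (rg_osc rf).
- move=> x y k Xx Xy h; under eq_bigr => i _ do rewrite -mulrBr normrM.
  by rewrite -mulr_sumr -mulrA ler_wpM2l // (rg_sum rf).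
Qed.

(** This is the oscillation condition of [pair_bound] for Birkhoff sums: each of the two close
    stretches costs [L * C1], and each time in between at most [L * D]. *)
Lemma regular_window f L x y i j n : regular f L -> X x -> X y -> (i <= j <= n)%N ->
  (forall l, (l <= i)%N || (j <= l <= n)%N -> d (iter l T x) (iter l T y) < e1) ->
  `|\sum_(l < n) f (iter l T x) - \sum_(l < n) f (iter l T y)| <= L * (2 * C1 + D) * (j - i).+1%:R.
Proof.
move=> rf Xx Xy /andP[ij jn] h; have L0 := rg_ge0 rf.
rewrite -sumrB; apply: le_trans (ler_norm_sum _ _ _) _.
rewrite -(big_mkord xpredT (fun l => `|f (iter l T x) - f (iter l T y)|)).
rewrite (big_cat_nat (leq0n j) jn) /= (big_cat_nat (leq0n i) ij) /=.
have s1 : \sum_(0 <= l < i) `|f (iter l T x) - f (iter l T y)| <= L * C1.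
  rewrite big_mkord; apply: regular_sum => // l li; apply: h; by rewrite (ltnW li).
have s2 : \sum_(i <= l < j) `|f (iter l T x) - f (iter l T y)| <= L * D * (j - i)%:R.
  apply: le_trans (_ : \sum_(i <= l < j) L * D <= _).
    by apply: ler_sum => l _; apply: (rg_osc rf); exact: (es_iter E).
  by rewrite sumr_const_nat mulr_natr.
have s3 : \sum_(j <= l < n) `|f (iter l T x) - f (iter l T y)| <= L * C1.
  rewrite -{1}[j]add0n big_addn big_mkord.
  under eq_bigr => l _ do rewrite !iterD.
  apply: regular_sum => //; [exact: (es_iter E)|exact: (es_iter E)|move=> l lnj].
  rewrite -!iterD; apply: h; rewrite leq_addl /= orbC.
  by have -> : (l + j <= n)%N by move: lnj jn; clear; lia.
have jr : 0 <= (j - i)%:R :> R by [].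
have LC : 0 <= L * C1 by rewrite mulr_ge0 // ltW.
have LD : 0 <= L * D by rewrite mulr_ge0 // ltW.
have LCj : 0 <= L * C1 * (j - i)%:R by rewrite mulr_ge0.
have -> : L * (2 * C1 + D) * (j - i).+1%:R = 2 * (L * C1 * (j - i)%:R) + L * D * (j - i)%:R + 2 * (L * C1) + L * D.
  by rewrite -natr1; ring.
by move: s1 s2 s3 LC LD LCj; lra.
Qed.

(** Taking [f = 0] in [entropy_upper] bounds the entropy of every partition through the number of
    words, so the supremum is finite and can be handled as a real number. *)
Lemma entropy_finite (mu : probability (borel M) R) : invariant_on T X mu -> exists h : R,
  ks_entropy T mu = h%:E /\
  (forall k (P : 'I_k -> set (borel M)), fin_partition P -> partition_entropy T mu P <= h) /\
  (forall U : R, (forall k (P : 'I_k -> set (borel M)), fin_partition P -> partition_entropy T mu P <= U) -> h <= U).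
Proof.
move=> inv; have [x0 Xx0] := X_nonempty inv.
have [ea ea0 Hexp] := es_exp E; have [r r0 Hmod] := symbolic_model E (ex_intro _ x0 Xx0).
have c00 : 0 < ea / 2 by rewrite divr_gt0.
have eps0 : 0 < ea / 8 by rewrite divr_gt0.
have [b /andP[b0 be] [A [a0 [e [orb mod]]]]] := Hmod _ eps0.
have bound k (P : 'I_k -> set (borel M)) : fin_partition P -> partition_entropy T mu P <= ln #|A|%:R + 1.
  move=> fP; have h2 : 2 * (ea / 2) <= ea by rewrite mulrC divfK.
  have [C0 HC0] := entropy_upper E inv Hexp h2 fP ltr01.
  have cv := join_entropy_cvg E inv fP.
  have A0 : (0 < #|A|)%N by apply/card_gt0P; exists a0.
  have lnA : 0 <= ln #|A|%:R :> R by rewrite ln_ge0 // ler1n.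
  have key n : join_entropy T mu P n <= n%:R * (ln #|A|%:R + 1) + (ln #|A|%:R + C0).
    have mX := esys_measurable E.
    pose y (w : A * n.-tuple A) := orb w.1 w.2.
    have := HC0 n (fun=> 0) 0 0 _ y.
    have -> : \sum_i expR (\sum_(j < n) (fun=> 0 : R) (iter j T (y i))) = (#|A| ^ n.+1)%:R :> R.
      rewrite (eq_bigr (fun=> 1)); last by move=> i _; rewrite big1 // expR0.
      by rewrite sumr_const card_prod card_tuple expnS.
    rewrite Rintegral_cst // mul0r mulr0 !addr0 mulr1.
    rewrite natrX lnXn ?ltr0n // -[_ *+ n.+1]mulr_natl -[n.+1%:R]natr1 => h.
    have : join_entropy T mu P n <= (n%:R + 1) * ln #|A|%:R + n%:R + C0.
      apply: h.
      - exact: measurable_cst.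
      - by move=> x _; rewrite normr0.
      - move=> x Xx; have [a [p [pp sp _ _ hp]]] := sm_dense mod n Xx.
        have sp' : size p == n by rewrite sp.
        exists (a, Tuple sp') => j jn; apply: le_lt_trans (hp j jn) _.
        by move: b0 be ea0; lra.
      - by move=> x i _ _; rewrite !big1 // addr0.
    by rewrite mulrDl mul1r mulrDr mulr1; lra.
  have h2' : partition_entropy T mu P + partition_entropy T mu P + 0 <= 2 * (ln #|A|%:R + 1).
    apply: (@lim_upper _ _ _ 0 _ (2 * (ln #|A|%:R + C0)) 1) => // k'.
    by cbv zeta; have h3 := key (k'.+1 * 1)%N; rewrite mulr0 addr0 mulrCA; lra.
  by move: h2'; lra.
have nonneg k (P : 'I_k -> set (borel M)) : fin_partition P -> 0 <= partition_entropy T mu P.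
  move=> fP; have := @lim_lower R (join_entropy T mu P) 0 1 isT (join_entropy_cvg E inv fP).
  by rewrite mul0r; apply => q; rewrite mulr0; exact: (join_entropy_ge0 E).
pose S := [set h | exists (k : nat) (P : 'I_k -> set (borel M)),
    fin_partition P /\ h = (partition_entropy T mu P)%:E].
have triv : fin_partition (fun _ : 'I_1 => setT : set (borel M)).
  split => //; first by move=> i j _ _ _; rewrite (ord1 i) (ord1 j).
  by apply/seteqP; split=> x // _; exists ord0.
have up : (ereal_sup S <= (ln #|A|%:R + 1)%:E)%E.
  by apply: ge_ereal_sup => _ [k [P [fP ->]]]; rewrite lee_fin; exact: bound.
have lo : (0 <= ereal_sup S)%E.
  apply: (@le_trans _ _ (partition_entropy T mu (fun _ : 'I_1 => setT : set (borel M)))%:E).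
    by rewrite lee_fin; exact: nonneg.
  by apply: ereal_sup_ubound; exists 1%N, (fun _ : 'I_1 => setT).
have fin : ereal_sup S \is a fin_num.
  by rewrite fin_numE; apply/andP; split; [move: lo|move: up]; case: (ereal_sup S).
exists (fine (ereal_sup S)); split; first by rewrite fineK.
split=> [k P fP|U hU].
  by rewrite -lee_fin fineK //; apply: ereal_sup_ubound; exists k, P.
rewrite -lee_fin fineK //; apply: ge_ereal_sup => _ [k [P [fP ->]]]; rewrite lee_fin.
exact: hU.
Qed.

End regular_functions.

Lemma sum_subset_le (R : realType) (I : eqType) (s1 s2 : seq I) (F : I -> R) :
  uniq s1 -> uniq s2 -> {subset s1 <= s2} -> (forall i, 0 <= F i) ->
  \sum_(i <- s1) F i <= \sum_(i <- s2) F i.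
Proof.
move=> u1 u2 s12 F0; have p : perm_eq s1 [seq x <- s2 | x \in s1].
  apply: uniq_perm => //; first exact: filter_uniq.
  by move=> x; rewrite mem_filter; case: (boolP (x \in s1)) => // /s12 ->.
rewrite (perm_big _ p) big_filter [leRHS](bigID (fun x => x \in s1)) /= lerDl.
by apply: sumr_ge0.
Qed.

Lemma nth_shift (A : Type) (x a : A) pre s j :
  nth x (a :: pre ++ s) (size pre + j) = nth x (last a pre :: s) j.
Proof. by elim: pre a => [|b pre IH] a //=; rewrite addSn /= IH. Qed.

Lemma connect_path (A : finType) (e : rel A) a b : connect e a b -> exists n, pathn e n a b.
Proof. by move/connectP => [p pp ->]; exists (size p), p. Qed.

(* Paths between states of the component of [a0] are completed to loops at
   [a0] by a fixed number of steps. *)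
Lemma loop_completion (A : finType) (e : rel A) (a0 : A) r : (0 < r)%N -> pathn e r a0 a0 ->
  exists per Q, (0 < per)%N /\ exists (pre suf : A -> nat -> seq A), forall N a p,
    (per %| N)%N -> path e a p -> size p = N -> connect e a0 a -> connect e (last a p) a0 ->
    [/\ path e a0 (pre a N), last a0 (pre a N) = a &
      pre a N ++ p ++ suf (last a p) (size (pre a N)) \in paths e a0 (N + Q) a0].
Proof.
move=> r0 pr.
have [per [M0 [per0 dv big]]] := @semigroup_period (fun n => pathn e n a0 a0) r
  (ex_intro _ [::] (And3 erefl isT erefl)) (fun m n => @pathnD _ e m n a0 a0 a0) r0 pr.
have hpre a : {p | connect e a0 a -> path e a0 p /\ last a0 p = a}.
  apply: cid; have [c|c] := boolP (connect e a0 a); last by exists [::].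
  by have [n [p [_ pp lp]]] := connect_path c; exists p.
have hsuf a : {p | connect e a a0 -> path e a p /\ last a p = a0}.
  apply: cid; have [c|c] := boolP (connect e a a0); last by exists [::].
  by have [n [p [_ pp lp]]] := connect_path c; exists p.
have hpad n : {p | pathn e n a0 a0 -> [/\ size p = n, path e a0 p & last a0 p = a0]}.
  apply: cid; have [[p h]|c] := pselect (pathn e n a0 a0); first by exists p.
  by exists [::].
pose pre a := projT1 (hpre a); pose suf a := projT1 (hsuf a); pose pad n := projT1 (hpad n).
have preP a : connect e a0 a -> path e a0 (pre a) /\ last a0 (pre a) = a := projT2 (hpre a).
have sufP a : connect e a a0 -> path e a (suf a) /\ last a (suf a) = a0 := projT2 (hsuf a).
have padP n : pathn e n a0 a0 -> [/\ size (pad n) = n, path e a0 (pad n) & last a0 (pad n) = a0] := projT2 (hpad n).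
(* As a multiple of [per] this leaves a padding that is again a multiple of [per], and the padding
   is at least [M0]. *)
pose Q := (per * (\max_a size (pre a) + \max_a size (suf a) + M0))%N.
exists per, Q; split => //.
exists (fun a _ => pre a), (fun b k => suf b ++ pad (Q - k - size (suf b))%N).
move=> N a p pN pp sp ca cb; have [p1 l1] := preP a ca; have [p2 l2] := sufP _ cb.
split => //.
have hq : (size (pre a) + size (suf (last a p)) + M0 <= Q)%N.
  apply: leq_trans (leq_pmull _ per0); rewrite !leq_add //.
    exact: (leq_bigmax a).
  exact: (leq_bigmax (last a p)).
have dl : (per %| size (pre a) + (N + size (suf (last a p))))%N.
  apply: dv; exists (pre a ++ p ++ suf (last a p)).
  by rewrite !size_cat sp !cat_path p1 l1 pp p2 !last_cat l1 l2.
have dQ : (per %| Q)%N by exact: dvdn_mulr.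
set k := (Q - size (pre a) - size (suf (last a p)))%N.
have dk : (per %| k)%N.
  have e1 : (k + (size (pre a) + (N + size (suf (last a p)))) = Q + N)%N.
    by rewrite /k; move: hq; clear; lia.
  by rewrite -(dvdn_addl _ dl) e1 dvdn_add.
have [s3 p3 l3] : [/\ size (pad k) = k, path e a0 (pad k) & last a0 (pad k) = a0].
  by apply: padP; apply: big => //; rewrite /k; move: hq; clear; lia.
rewrite mem_paths !size_cat sp s3 !cat_path p1 l1 pp p2 l2 p3 !last_cat l1 l2 l3 eqxx /= andbT.
by apply/eqP; rewrite /k; move: hq; clear; lia.
Qed.

(** * Partition sums over words and over loops *)

Section partition_sums.
Context {R : realType} {M : ptopologicalType} (d : M -> M -> R) (T : M -> M) (X : set M).
Hypothesis E : esys d T X.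
Context (D C1 e1 : R).
Hypothesis D0 : 0 < D.
Hypothesis C10 : 0 < C1.
Hypothesis e10 : 0 < e1.
Notation regular := (regular d T X D C1 e1).

Section coded.
Context (b r : R) (A : finType) (a0 : A) (e : rel A) (orb : A -> seq A -> M).
Hypothesis mod : smodel d T X b r a0 e orb.
Hypothesis be1 : 2 * b < e1.

Definition wsumf (f : M -> R) n (w : seq A) := \sum_(l < n) f (iter l T (orb a0 w)).

Lemma paths_orb n w : w \in paths e a0 n a0 -> X (orb a0 w).
Proof. by rewrite mem_paths => /and3P[_ pw _]; exact: (sm_orb mod). Qed.

Lemma wsumf_osc f L n w w' i j : regular f L -> w \in paths e a0 n a0 -> w' \in paths e a0 n a0 ->
  (i <= j <= n)%N -> (forall l, (l <= i)%N || (j <= l <= n)%N ->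
     nth a0 (a0 :: w) l = nth a0 (a0 :: w') l) ->
  `|wsumf f n w - wsumf f n w'| <= L * (2 * C1 + D) * (j - i).+1%:R.
Proof.
move=> rf pw pw' ijn h; have [ij jn] := andP ijn.
apply: (regular_window E D0 C10 rf (paths_orb pw) (paths_orb pw') ijn) => l hl.
have ln : (l <= n)%N by case/orP: hl => [li|/andP[]//]; rewrite (leq_trans li) // (leq_trans ij).
move: pw pw'; rewrite !mem_paths => /and3P[/eqP sw pw _] /and3P[/eqP sw' pw' _].
by apply: le_lt_trans be1; apply: (sm_close mod) => //; rewrite ?sw ?sw' ?h.
Qed.

Definition word N := {x : A * N.-tuple A | [&& path e x.1 x.2, connect e a0 x.1 & connect e (last x.1 x.2) a0]}.

Definition partition_sum (f : M -> R) N : R :=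
  \sum_(x : word N) expR (\sum_(j < N) f (iter j T (orb (val x).1 (val x).2))).

(** Completing a word to a loop adds [Q] steps, each worth at most [L * D]; on the common [N] steps
    the labels agree, which costs [L * C1]. *)
Lemma partition_sum_le : (exists x, X x) -> exists per Q, (0 < per)%N /\
  forall N f L, (per %| N)%N -> regular f L -> (forall x, X x -> `|f x| <= L * D) ->
  partition_sum f N <= #|A|%:R * expR (L * (Q%:R * D + C1)) *
    \sum_(w <- paths e a0 (N + Q) a0) expR (wsumf f (N + Q) w).
Proof.
move=> [x0 Xx0].
have [r1 r10 pr1] : exists2 r1, (0 < r1)%N & pathn e r1 a0 a0.
  have [a [p [pp sp ca cl _]]] := sm_dense mod 1 Xx0.
  have [n1 h1] := connect_path ca; have [n2 h2] := connect_path cl.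
  exists (n1 + (1 + n2))%N; first by rewrite addn_gt0 orbT.
  by apply: pathnD h1 _; apply: pathnD h2; exists p.
have [per [Q [per0 [pre [suf comp]]]]] := loop_completion r10 pr1.
exists per, Q; split => // N f L pN rf fb; have L0 := rg_ge0 rf.
pose w (x : word N) := pre (val x).1 N ++ val (val x).2 ++ suf (last (val x).1 (val x).2) (size (pre (val x).1 N)).
have wP (x : word N) : [/\ path e a0 (pre (val x).1 N), last a0 (pre (val x).1 N) = (val x).1 &
    w x \in paths e a0 (N + Q) a0].
  have /and3P[h1 h2 h3] := valP x.
  by apply: comp => //; rewrite size_tuple.
have close (x : word N) : \sum_(j < N) f (iter j T (orb (val x).1 (val x).2)) <=
    L * (Q%:R * D + C1) + wsumf f (N + Q) (w x).
  have [p1 l1 pw] := wP x; have /and3P[h1 _ _] := valP x.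
  have Xo := sm_orb mod h1; have Xw := paths_orb pw.
  set k := size (pre (val x).1 N).
  move: (pw); rewrite mem_paths => /and3P[/eqP sw pw' _].
  have kQ : (k <= Q)%N.
    by move: sw; rewrite /w !size_cat size_tuple -/k; clear; lia.
  rewrite /wsumf -(big_mkord xpredT (fun l => f (iter l T (orb a0 (w x))))).
  have kN : (k <= N + Q)%N by rewrite (leq_trans kQ) // leq_addl.
  have kN2 : (k + N <= N + Q)%N by rewrite addnC leq_add2l.
  rewrite (big_cat_nat (leq0n k) kN) /= (big_cat_nat (leq_addr N k) kN2) /=.
  have s1 : - (k%:R * (L * D)) <= \sum_(0 <= l < k) f (iter l T (orb a0 (w x))).
    rewrite -{1}[k]subn0 mulr_natl -sumr_const_nat -sumrN; apply: ler_sum => l _.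
    by have := fb _ (es_iter E l Xw); rewrite ler_norml => /andP[].
  have s3 : - ((N + Q - (k + N))%N%:R * (L * D)) <= \sum_(k + N <= l < N + Q) f (iter l T (orb a0 (w x))).
    rewrite mulr_natl -sumr_const_nat -sumrN; apply: ler_sum => l _.
    by have := fb _ (es_iter E l Xw); rewrite ler_norml => /andP[].
  have s2 : \sum_(j < N) f (iter j T (orb (val x).1 (val x).2)) - L * C1 <= \sum_(k <= l < k + N) f (iter l T (orb a0 (w x))).
    rewrite -{1}[k]add0n big_addn addKn big_mkord lerBlDr -lerBlDl -sumrB.
    apply: le_trans (ler_norm _) _; apply: le_trans (ler_norm_sum _ _ _) _.
    under eq_bigr => j _ do rewrite iterD.
    apply: (regular_sum C10 rf Xo (es_iter E k Xw)) => j jN.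
    rewrite -iterD; apply: le_lt_trans be1.
    have hjk : (j + k <= size (w x))%N by rewrite sw addnC (leq_trans _ kN2) // leq_add2l ltnW.
    have hj : (j <= size (val (val x).2))%N by rewrite size_tuple ltnW.
    apply: (sm_close mod h1 pw' hj hjk).
    rewrite addnC nth_shift l1 -cat_cons nth_cat /= ltnS hj.
    exact: set_nth_default.
  have e2 : (N + Q - (k + N) = Q - k)%N by clear; lia.
  rewrite e2 in s3.
  have e3 : k%:R * (L * D) + (Q - k)%N%:R * (L * D) = L * (Q%:R * D).
    by rewrite -mulrDl -natrD subnKC // mulrCA.
  rewrite mulrDr; move: s1 s2 s3 e3; lra.
pose F u := expR (wsumf f (N + Q) u).
have F0 u : 0 <= F u by exact: expR_ge0.
apply: le_trans (_ : \sum_x (expR (L * (Q%:R * D + C1)) * F (w x)) <= _).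
  by apply: ler_sum => x _; rewrite -expRD ler_expR close.
rewrite -mulr_sumr [#|A|%:R * _]mulrC -[leRHS]mulrA ler_wpM2l ?expR_ge0 //.
pose s2 := [seq (a, u) | a <- enum A, u <- paths e a0 (N + Q) a0].
(* A completed loop and the initial state determine the word, since the prefix depends only on that
   state once [N] is fixed; hence the factor [#|A|]. *)
pose g (x : word N) := ((val x).1, w x).
have ig : injective g.
  move=> [[a p] hx] [[a' p'] hy] [/= ea ew]; apply: val_inj => /=.
  move: ew; rewrite /w /= -ea => /eqP; rewrite eqseq_cat // => /andP[_].
  by rewrite eqseq_cat ?size_tuple // => /andP[/eqP/val_inj ->].
have -> : \sum_x F (w x) = \sum_(z <- [seq g x | x <- index_enum (word N)]) F z.2.
  by rewrite big_map.
have -> : #|A|%:R * (\sum_(u <- paths e a0 (N + Q) a0) F u) = \sum_(z <- s2) F z.2.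
  by rewrite big_allpairs /= big_enum /= sumr_const mulr_natl.
apply: sum_subset_le => //.
- by rewrite map_inj_uniq // index_enum_uniq.
- by rewrite allpairs_uniq ?enum_uniq ?uniq_paths // => -[? ?] [? ?] _ _ [-> ->].
- move=> z /mapP[x _ ->]; apply/allpairsP; exists ((val x).1, w x); split=> //=.
    by rewrite mem_enum.
  by have [] := wP x.
Qed.

End coded.
End partition_sums.

Section partition_sum_pairs.
Context {R : realType} {M : ptopologicalType} (d : M -> M -> R) (T : M -> M) (X : set M).
Hypothesis E : esys d T X.

(** Distinct loops of length [N] are separated by [sm_inj], and all begin and end near each other,
    so [low] applies to them. The entropy of the resulting measure is at most [hm], which yields the
    count without a constant factor. *)
Lemma cnt_bound (m : probability (borel M) R) (hm b r alpha : R) (A : finType) (a0 : A) (e : rel A)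
    (orb : A -> seq A -> M) :
  maximal_entropy T X m -> ks_entropy T m = hm%:E -> 0 <= hm ->
  smodel d T X b r a0 e orb -> 2 * b <= r -> 2 * b < alpha ->
  (forall N s (y : 'I_s -> M), (0 < N)%N -> (0 < s)%N -> (forall a, X (y a)) ->
    (forall a b, d (iter N T (y a)) (y b) < alpha) ->
    (forall a b, a != b -> exists2 l, (l < N)%N & r < d (iter l T (y a)) (iter l T (y b))) ->
    exists2 nu : probability (borel M) R, invariant_on T X nu &
      ((ln s%:R / N%:R)%:E <= ks_entropy T nu)%E) ->
  forall n, (cnt e a0 n a0)%:R ^+ 2 <= expR (2 * hm) ^+ n.
Proof.
move=> maxm hmE hm0 mod br balpha low [|n].
  by rewrite /cnt /= eqxx /= expr1n expr0.
set N := n.+1; set s := cnt e a0 N a0.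
have [->|s0] := posnP s; first by rewrite expr0n exprn_ge0 // expR_ge0.
pose w (i : 'I_s) := nth [::] (paths e a0 N a0) i.
have wP i : w i \in paths e a0 N a0 by rewrite mem_nth.
have w3 i : [/\ size (w i) = N, path e a0 (w i) & last a0 (w i) = a0].
  by have := wP i; rewrite mem_paths => /and3P[/eqP -> -> /eqP ->].
have [nu inv h] : exists2 nu : probability (borel M) R, invariant_on T X nu &
      ((ln s%:R / N%:R)%:E <= ks_entropy T nu)%E.
  apply: (low N s (fun i => orb a0 (w i))) => //.
  - by move=> i; have [_ pw _] := w3 i; exact: (sm_orb mod).
  - move=> i j; have [si pi li] := w3 i; have [sj pj lj] := w3 j.
    apply: le_lt_trans balpha; apply: (sm_close mod (j := 0%N) pi pj) => //; first by rewrite si.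
    by rewrite -si -last_nth.
  move=> i j ij; have [si pi li] := w3 i; have [sj pj lj] := w3 j.
  apply: contrapT => h; move/eqP: ij; apply.
  apply: val_inj; apply/eqP.
  rewrite -(@nth_uniq _ [::] (paths e a0 N a0) i j (ltn_ord i) (ltn_ord j) (uniq_paths _ _ _ _)).
  apply/eqP.
  apply: (sm_inj mod pi pj); rewrite ?si ?sj ?li ?lj //.
  (* At time [N] both loops are back at [a0], so the separation has to occur earlier, as [low]
     demands. *)
  move=> l; rewrite leq_eqVlt => /orP[/eqP ->|lN].
    apply: le_trans br; apply: (sm_close mod pi pj); rewrite ?si ?sj //.
    by rewrite -[in LHS]si -[in RHS]sj -!last_nth li lj.
  by rewrite leNgt; apply/negP => hl; apply: h; exists l.
have := le_trans h (maxm.2 nu inv).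
rewrite hmE lee_fin ler_pdivrMr ?ltr0n // => h2.
rewrite expRM_natl exprAC ler_sqr ?nnegrE ?exprn_ge0 ?expR_ge0 // -expRM_natl.
by rewrite -ler_ln ?posrE ?expR_gt0 ?ltr0n // expRK mulrC.
Qed.

Context (D C1 e1 : R).
Hypothesis D0 : 0 < D.
Hypothesis C10 : 0 < C1.
Hypothesis e10 : 0 < e1.
Notation regular := (regular d T X D C1 e1).

Lemma regularN f L : regular f L -> regular (fun x => - f x) L.
Proof.
move=> /(regularZ (-1)); rewrite normrN1 mul1r.
by congr regular; apply/funext => x; rewrite mulN1r.
Qed.

Lemma regular_cst f L c : regular f L -> regular (fun x => f x - c) L.
Proof.
have cancel a b : a - c - (b - c) = a - b by ring.
move=> rf; split; first exact: (rg_ge0 rf).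
- by apply: measurable_realfun.measurable_funB; [exact: (rg_meas rf)|exact: measurable_cst].
- by move=> x y Xx Xy; rewrite cancel (rg_osc rf).
- move=> x y k Xx Xy h; under eq_bigr => i _ do rewrite cancel.
  exact: (rg_sum rf).
Qed.

Lemma partition_sum_pair (hm b r : R) (A : finType) (a0 : A) (e : rel A) (orb : A -> seq A -> M) :
  smodel d T X b r a0 e orb -> 2 * b < e1 -> (exists x, X x) ->
  (forall n, (cnt e a0 n a0)%:R ^+ 2 <= expR (2 * hm) ^+ n) ->
  exists k0 Cp per Q, [/\ 0 < k0, 0 <= Cp, (0 < per)%N & forall N f L, (per %| N)%N ->
    regular f L -> (forall x, X x -> `|f x| <= L * D) -> L * (2 * C1 + D) <= k0 ->
    ln (partition_sum T a0 e orb f N) + ln (partition_sum T a0 e orb (fun x => - f x) N) <=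
      2 * (ln #|A|%:R + L * (Q%:R * D + C1)) + (N + Q)%:R * (2 * hm + Cp * (L * (2 * C1 + D)) ^+ 2)].
Proof.
move=> mod be1 Xn cntle.
have [k0 [Cp [k00 Cp0 pb]]] := pair_bound (expR_gt0 (2 * hm)) cntle.
have [per [Q [per0 psle]]] := partition_sum_le E D C10 mod be1 Xn.
exists k0, Cp, per, Q; split => // N f L pN rf fb Lk.
have L0 := rg_ge0 rf.
have fbN x : X x -> `|- f x| <= L * D by move=> Xx; rewrite normrN fb.
have h1 := psle N f L pN rf fb; have h2 := psle N _ L pN (regularN rf) fbN.
have CD : 0 <= L * (2 * C1 + D) by rewrite mulr_ge0 // addr_ge0 ?mulr_ge0 // ltW.
have h3 := pb (L * (2 * C1 + D)) (N + Q)%N (wsumf T a0 orb f (N + Q)) CD Lk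
  (fun w w' i j pw pw' ij h => wsumf_osc E D0 C10 mod be1 rf pw pw' ij h).
have pos (g : M -> R) : 0 < partition_sum T a0 e orb g N.
  have [x0 Xx0] := Xn.
  have [a [p [pp sp ca cb _]]] := sm_dense mod N Xx0.
  have sp' : size p == N by rewrite sp.
  have ok : [&& path e (a, Tuple sp').1 (a, Tuple sp').2, connect e a0 (a, Tuple sp').1 &
      connect e (last (a, Tuple sp').1 (a, Tuple sp').2) a0] by apply/and3P.
  rewrite /partition_sum (bigD1 (Sub (a, Tuple sp') ok : word a0 e N)) //=.
  by rewrite ltr_pwDl ?expR_gt0 // sumr_ge0 // => *; exact: expR_ge0.
rewrite -lnM ?posrE ?pos //.
have A0 : (0 < #|A|)%N by apply/card_gt0P; exists a0.
have A0R : 0 < #|A|%:R :> R by rewrite ltr0n.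
have -> : 2 * (ln #|A|%:R + L * (Q%:R * D + C1)) + (N + Q)%:R * (2 * hm + Cp * (L * (2 * C1 + D)) ^+ 2) =
  ln ((#|A|%:R * expR (L * (Q%:R * D + C1))) ^+ 2 * (expR (2 * hm) * expR (Cp * (L * (2 * C1 + D)) ^+ 2)) ^+ (N + Q)).
  have q0 : 0 < #|A|%:R * expR (L * (Q%:R * D + C1)) by rewrite mulr_gt0 // expR_gt0.
  rewrite -expRD -expRM_natl lnM ?posrE ?expR_gt0 ?exprn_gt0 //.
  by rewrite lnXn // lnM ?posrE ?expR_gt0 // !expRK mulr_natl.
rewrite ler_ln ?posrE ?mulr_gt0 ?pos ?exprn_gt0 ?mulr_gt0 ?expR_gt0 //.
have h12 := ler_pM (ltW (pos f)) (ltW (pos (fun x => - f x))) h1 h2.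
apply: (le_trans h12).
rewrite mulrACA -expr2 ler_wpM2l ?exprn_ge0 ?mulr_ge0 ?expR_ge0 ?ler0n //.
apply: le_trans h3; rewrite le_eqVlt; apply/orP; left; apply/eqP; congr (_ * _).
by apply: eq_bigr => w _; rewrite /wsumf sumrN.
Qed.

End partition_sum_pairs.

Section entropy_gap.
Context {R : realType} {M : ptopologicalType} (d : M -> M -> R) (T : M -> M) (X : set M).
Hypothesis E : esys d T X.
Lemma entropy_ge0 (mu : probability (borel M) R) (h : R) :
  invariant_on T X mu -> ks_entropy T mu = h%:E -> 0 <= h.
Proof.
move=> inv hE; rewrite -lee_fin -hE; have [h' [hE' [hP _]]] := entropy_finite E inv.
have fP : fin_partition (fun _ : 'I_1 => setT : set (borel M)).
  split => //; first by move=> i j _ _ _; rewrite (ord1 i) (ord1 j).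
  by apply/seteqP; split=> x // _; exists ord0.
have ge0 n : 0 <= join_entropy T mu (fun _ : 'I_1 => setT : set (borel M)) n.
  exact: (join_entropy_ge0 E n inv fP).
have := @lim_lower R (join_entropy T mu (fun _ : 'I_1 => setT : set (borel M))) 0 1 isT (join_entropy_cvg E inv fP).
rewrite mul0r hE' lee_fin => /(_ _)/le_trans; apply; last exact: (hP _ _ fP).
by move=> k; rewrite mulr0.
Qed.

Context (D C1 e1 : R).
Hypothesis D0 : 0 < D.
Hypothesis C10 : 0 < C1.
Hypothesis e10 : 0 < e1.
Notation regular := (regular d T X D C1 e1).

(** The entropy of [m], which enters on the left through the inequality for [- f], cancels one of
    the two [hm] in the rate of [partition_sum_pair]. The quadratic term comes from that rate. *)
Lemma entropy_integral_gap (m : probability (borel M) R) (hm : R) :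
  maximal_entropy T X m -> ks_entropy T m = hm%:E ->
  exists2 t0, 0 < t0 & exists2 C, 0 <= C &
    forall (mu : probability (borel M) R) (hmu : R) f L, invariant_on T X mu -> ks_entropy T mu = hmu%:E ->
      regular f L -> L <= t0 ->
      hmu + \int[mu]_(x in X) f x - \int[m]_(x in X) f x <= hm + C * L ^+ 2.
Proof.
move=> maxm hmE; have [x0 Xx0] := X_nonempty maxm.1.
have Xn : exists x, X x by exists x0.
have hm0 := entropy_ge0 maxm.1 hmE.
have [ea ea0 Hexp] := es_exp E; have [r r0 Hmod] := symbolic_model E Xn.
have [alpha al0 low] := entropy_lower E r0.
(* The four bounds serve the covering radius [c0], the summation of [f] along close orbits, the
   jumps in [entropy_lower], and the separation of loops. *)
pose eps := Num.min (Num.min (ea / 8) (e1 / 4)) (Num.min (alpha / 4) (r / 2)).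
have eps0 : 0 < eps by rewrite !lt_min !divr_gt0.
have [b /andP[b0 be] [A [a0 [e [orb mod]]]]] := Hmod _ eps0.
have {be} [b1 b2 b3 b4] : [/\ b <= ea / 8, b <= e1 / 4, b <= alpha / 4 & b <= r / 2].
  by move: be; rewrite !le_min => /andP[/andP[? ?] /andP[? ?]].
have br : 2 * b <= r by lra.
have bal : 2 * b < alpha by lra.
have be1 : 2 * b < e1 by lra.
have cntle := cnt_bound maxm hmE hm0 mod br bal low.
have [k0 [Cp [per [Q [k00 Cp0 per0 pair]]]]] := partition_sum_pair E D0 C10 mod be1 Xn cntle.
pose cc := 2 * C1 + D.
have cc0 : 0 < cc by rewrite addr_gt0 ?mulr_gt0.
exists (k0 / cc); first exact: divr_gt0.
exists (Cp * cc ^+ 2); first by rewrite mulr_ge0 // exprn_ge0 // ltW.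
have main (mu : probability (borel M) R) (hmu : R) f L : invariant_on T X mu -> ks_entropy T mu = hmu%:E ->
    regular f L -> (forall x, X x -> `|f x| <= L * D) -> L <= k0 / cc ->
    hmu + \int[mu]_(x in X) f x - \int[m]_(x in X) f x <= hm + Cp * cc ^+ 2 * L ^+ 2.
  move=> inv hmuE rf fb Lk.
  have L0 := rg_ge0 rf.
  have {}Lk : L * cc <= k0 by rewrite -ler_pdivlMr.
  pose c0 := Num.min (ea / 2) e1.
  have c0ea : 2 * c0 <= ea by rewrite mulrC -ler_pdivlMr // ge_min lexx.
  have bc0 : 3 * b < c0 by rewrite lt_min; apply/andP; split; lra.
  have c0e1 : c0 <= e1 by rewrite ge_min lexx orbT.
  pose I1 := \int[mu]_(x in X) f x; pose I2 := \int[m]_(x in X) f x.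
  have I2N : \int[m]_(x in X) (- f x) = - I2.
    have := @RintegralZl _ _ R m X f (-1) (esys_measurable E) (bounded_integrable E m (rg_meas rf) fb).
    by rewrite mulN1r => <-; apply: eq_Rintegral => x _; rewrite mulN1r.
  pose y N (x : word a0 e N) := orb (val x).1 (val x).2.
  have yX N x : X (y N x) by have /and3P[h _ _] := valP x; exact: (sm_orb mod).
  have cover N x : X x -> exists i, forall j, (j <= N)%N -> d (iter j T x) (iter j T (y N i)) < c0.
    move=> Xx; have [a [p [pp sp ca cb h]]] := sm_dense mod N Xx.
    have sp' : size p == N by rewrite sp.
    have ok : [&& path e (a, Tuple sp').1 (a, Tuple sp').2, connect e a0 (a, Tuple sp').1 &
      connect e (last (a, Tuple sp').1 (a, Tuple sp').2) a0] by apply/and3P.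
    by exists (Sub (a, Tuple sp') ok) => j jN; apply: le_lt_trans (h j jN) bc0.
  have var g N x i : regular g L -> X x -> (forall j, (j <= N)%N -> d (iter j T x) (iter j T (y N i)) < c0) ->
      \sum_(j < N) g (iter j T x) <= \sum_(j < N) g (iter j T (y N i)) + L * C1.
    move=> rg Xx h; rewrite -lerBlDl -sumrB; apply: le_trans (ler_norm _) _.
    apply: le_trans (ler_norm_sum _ _ _) _.
    apply: (regular_sum C10 rg Xx (yX N i)) => j jN; apply: lt_le_trans c0e1.
    by apply: h; rewrite ltnW.
  have parts k (P : 'I_k -> set (borel M)) k' (P' : 'I_k' -> set (borel M)) dl :
      fin_partition P -> fin_partition P' -> 0 < dl ->
      partition_entropy T mu P + partition_entropy T m P' + (I1 - I2) <= 2 * hm + Cp * (L * cc) ^+ 2 + 2 * dl.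
    move=> fP fP' dl0.
    have [Ca HCa] := entropy_upper E inv Hexp c0ea fP dl0.
    have [Cb HCb] := entropy_upper E maxm.1 Hexp c0ea fP' dl0.
    pose K := Q%:R * (2 * hm + Cp * (L * cc) ^+ 2) + 2 * (ln #|A|%:R + L * (Q%:R * D + C1)) + Ca + Cb + 2 * (L * C1).
    apply: (@lim_upper _ _ _ _ _ K per per0 (join_entropy_cvg E inv fP) (join_entropy_cvg E maxm.1 fP')) => q.
    cbv zeta; set N := (q.+1 * per)%N.
    have u1 := HCa N f (L * D) (L * C1) (word a0 e N) (y N) (rg_meas rf) fb (cover N) (fun x i => @var f N x i rf).
    have u2 := HCb N (fun x => - f x) (L * D) (L * C1) (word a0 e N) (y N) (rg_meas (regularN rf))
      (fun x Xx => eq_ind_r (fun z => z <= L * D) (fb x Xx) (normrN (f x))) (cover N)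
      (fun x i => @var _ N x i (regularN rf)).
    have u3 := pair N f L (dvdn_mull _ (dvdnn per)) rf fb Lk.
    rewrite I2N in u2.
    have u4 : N%:R * (2 * hm + Cp * (L * cc) ^+ 2 + 2 * dl) + K =
      2 * (ln #|A|%:R + L * (Q%:R * D + C1)) + (N + Q)%:R * (2 * hm + Cp * (L * cc) ^+ 2)
      + 2 * (N%:R * dl) + Ca + Cb + 2 * (L * C1).
      by rewrite natrD /K; ring.
    have u5 : N%:R * (I1 - I2) = N%:R * I1 + N%:R * - I2 by rewrite mulrDr.
    rewrite u4 u5.
    have [Z1 Z1E] : exists z, z = ln (partition_sum T a0 e orb f N) by eexists.
    have [Z2 Z2E] : exists z, z = ln (partition_sum T a0 e orb (fun x => - f x) N) by eexists.
    have v1 : join_entropy T mu P N + N%:R * I1 <= Z1 + N%:R * dl + Ca + L * C1 by rewrite Z1E.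
    have v2 : join_entropy T m P' N + N%:R * - I2 <= Z2 + N%:R * dl + Cb + L * C1 by rewrite Z2E.
    rewrite -Z1E -Z2E -/cc in u3; move: u3 v1 v2.
    by move: (join_entropy T mu P N) (join_entropy T m P' N) (N%:R * I1) (N%:R * - I2) (N%:R * dl)
      ((N + Q)%:R * _) (L * C1) (ln #|A|%:R + _) => *; lra.
  have [h' [hE' [_ hU]]] := entropy_finite E inv.
  have [h'' [hE'' [_ hU']]] := entropy_finite E maxm.1.
  have e1' : h' = hmu by apply: EFin_inj; rewrite -hE' -hmuE.
  have e2' : h'' = hm by apply: EFin_inj; rewrite -hE'' -hmE.
  rewrite {}e1' in hU; rewrite {}e2' in hU'.
  have : hmu + hm + (I1 - I2) <= 2 * hm + Cp * (L * cc) ^+ 2.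
    apply/ler_addgt0Pr => dl dl0.
    have dl2 : 0 < dl / 2 by rewrite divr_gt0.
    rewrite -addrA -lerBrDr; apply: hU => k P fP.
    rewrite lerBrDr -lerBrDl -lerBrDr; apply: hU' => k' P' fP'.
    rewrite lerBrDr lerBrDl addrA; have := parts k P k' P' _ fP fP' dl2.
    by have -> : 2 * (dl / 2) = dl by rewrite mulrC divfK.
  have -> : Cp * cc ^+ 2 * L ^+ 2 = Cp * (L * cc) ^+ 2 by ring.
  by rewrite -/I1 -/I2; lra.
(* Only differences of values of [f] are bounded by [L * D]; subtracting [f x0] bounds the values
   themselves and shifts both integrals equally. *)
move=> mu hmu f L inv hmuE rf Lk.
have L0 := rg_ge0 rf.
have fb x : X x -> `|f x - f x0| <= L * D by move=> Xx; exact: (rg_osc rf).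
have := main mu hmu _ L inv hmuE (regular_cst (f x0) rf) fb Lk.
have shift (nu : probability (borel M) R) : invariant_on T X nu ->
    \int[nu]_(x in X) (f x - f x0) = \int[nu]_(x in X) f x - f x0.
  move=> inu; have mX := esys_measurable E.
  have b1' x : X x -> `|f x| <= L * D + `|f x0|.
    move=> Xx; rewrite -{1}[f x](subrK (f x0)); apply: le_trans (ler_normD _ _) _.
    by rewrite lerD2r fb.
  have b2' x : X x -> `|f x0| <= `|f x0| by [].
  rewrite RintegralB //.
  - by rewrite Rintegral_cst // (congr1 fine inu.1) mulr1.
  - exact: (bounded_integrable E nu (rg_meas rf) b1').
  - by apply: (bounded_integrable E nu _ b2'); exact: measurable_cst.
rewrite (shift mu inv) (shift m maxm.1).
by have -> : forall u v w : R, hmu + (u - w) - (v - w) = hmu + u - v by move=> *; ring.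
Qed.

End entropy_gap.

(** Both signs of [s] give the absolute value. With [s = v / L] the best [v] is [sqrt Dl], or [t0]
    if that is smaller, when [Dl <= B] takes over. For [L = 0] an arbitrarily large [s] forces
    [dl = 0]; for [Dl = 0] an arbitrarily small [v] does. *)
Lemma quadratic_sqrt_bound (R : realType) (Dl dl L t0 C B : R) :
  0 <= Dl <= B -> 0 <= L -> 0 < t0 -> 0 <= C ->
  (forall s, `|s| * L <= t0 -> s * dl <= Dl + C * (`|s| * L) ^+ 2) ->
  `|dl| <= (1 + C + Num.sqrt B / t0) * L * Num.sqrt Dl.
Proof.
move=> /andP[Dl0 DlB] L0 t00 C0 h.
have {}h s : 0 <= s -> s * L <= t0 -> s * `|dl| <= Dl + C * (s * L) ^+ 2.
  move=> s0 sL; case: (ger0P dl) => _.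
    by have := h s; rewrite ger0_norm //; apply.
  by have := h (- s); rewrite normrN ger0_norm // mulNr mulrN; apply.
have [u [u0 uE]] : exists u, 0 <= u /\ Dl = u ^+ 2.
  by exists (Num.sqrt Dl); rewrite sqrtr_ge0 sqr_sqrtr.
have [w [w0 wE]] : exists w, 0 <= w /\ B = w ^+ 2.
  by exists (Num.sqrt B); rewrite sqrtr_ge0 sqr_sqrtr // (le_trans Dl0).
rewrite wE uE !sqrtr_sqr (ger0_norm u0) (ger0_norm w0).
have uw : u <= w by rewrite -(@ler_pXn2r _ 2) ?nnegrE // -uE -wE.
have ww : 0 <= w / t0 by rewrite divr_ge0 // ltW.
have rhs0 : 0 <= (1 + C + w / t0) * L * u by rewrite !mulr_ge0 ?addr_ge0.
move: L0; rewrite le_eqVlt => /orP[/eqP L0|L0].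
  rewrite -L0 mulr0 mul0r; rewrite leNgt; apply/negP => dl0.
  have := h ((Dl + 1) / `|dl|); rewrite -L0 !mulr0 divfK ?gt_eqF // expr0n /= mulr0 addr0.
  by move=> /(_ (divr_ge0 (addr_ge0 Dl0 ler01) (ltW dl0)) (ltW t00)); lra.
have {}h v : 0 < v -> v <= t0 -> `|dl| <= L * (u ^+ 2 / v + C * v).
  move=> v0 vt; have := h (v / L); rewrite divr_ge0 ?(ltW v0) ?(ltW L0) // divfK ?gt_eqF // vt.
  move=> /(_ isT isT); rewrite mulrAC ler_pdivrMr // => h1.
  rewrite -(ler_pM2l v0); apply: le_trans h1 _; rewrite uE le_eqVlt; apply/orP; left; apply/eqP.
  by field; rewrite gt_eqF.
move: u0; rewrite le_eqVlt => /orP[/eqP u0|u0].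
  apply/ler_addgt0Pr => e e0; rewrite -u0 mulr0 add0r.
  pose v := Num.min t0 (e / (L * C + 1)).
  have q0 : 0 < L * C + 1 by rewrite ltr_wpDl // mulr_ge0 // ltW.
  have v0 : 0 < v by rewrite lt_min t00 divr_gt0.
  apply: le_trans (h v v0 _) _; first by rewrite ge_min lexx.
  rewrite -u0 expr0n /= mul0r add0r mulrA.
  apply: le_trans (_ : (L * C + 1) * v <= _).
    by rewrite mulrDl mul1r lerDl ltW.
  by rewrite mulrC -ler_pdivlMr // ge_min lexx orbT.
have [ut|tu] := leP u t0.
  apply: le_trans (h u u0 ut) _.
  have -> : u ^+ 2 / u = u by rewrite expr2 mulfK // gt_eqF.
  have -> : L * (u + C * u) = (1 + C) * L * u by ring.
  by rewrite ler_pM2r // ler_pM2r // lerDl.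
apply: le_trans (h t0 t00 (lexx _)) _.
rewrite [_ * L]mulrC -[leRHS]mulrA ler_pM2l //.
have h1 : u ^+ 2 / t0 <= w / t0 * u.
  by rewrite [leRHS]mulrAC ler_pM2r ?invr_gt0 // expr2 ler_pM2r.
have h2 : C * t0 <= C * u by rewrite ler_wpM2l // ltW.
by rewrite !mulrDl mul1r; lra.
Qed.

Lemma lipschitz_measurable (R : realType) (M : ptopologicalType) (d : M -> M -> R) T X (f : M -> R) :
  esys d T X ->
  (forall x e, X x -> 0 < e -> exists2 r, 0 < r & forall y, X y -> d x y < r -> `|f x - f y| < e) ->
  measurable_fun (X : set (borel M)) f.
Proof.
move=> E fc mX; apply: (measurability _ (measurable_realfun.RGenOInfty.measurableE R)) => // _ [_ [a ->] <-].
pose O := \bigcup_(p in [set p : M * R | X p.1 /\ forall y, X y -> d p.1 y < p.2 -> a < f y]) [set y | d p.1 y < p.2].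
have -> : X `&` f @^-1` `]a, +oo[ = X `&` O.
  apply/seteqP; split=> x [Xx h]; split=> //.
    move: h; rewrite /= in_itv /= andbT -subr_gt0 => h.
    have [r r0 hr] := fc x _ Xx h.
    exists (x, r) => /=; last by rewrite (es_xx E).
    split=> // y Xy dxy; have := hr y Xy dxy; rewrite ltr_norml => /andP[_]; lra.
  by case: h => -[z r] /= [Xz hz] dzx; rewrite /= in_itv /= andbT; exact: hz.
apply: measurableI; first exact: closed_borel (es_closed E).
by apply: open_borel; apply: bigcup_open => p _; exact: (es_open E).
Qed.

Theorem theorem1p2 (R : realType) (n : nat) (M : ptopologicalType)
    (A : smoothAtlas R n M) (g : riemannianMetric A)
    (M_hausdorff : hausdorff_space M)
    (M_compact : compact [set: M]) (M_connected : connected [set: M])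
    (T : M -> M) (X : set M)
    (hX : (repeller A T X /\ top_mixing T X) \/
          [/\ axiomA A T, X = nonwandering T & top_mixing T X])
    (m : probability (borel M) R) (hm : unique_maximal_entropy T X m) :
  exists2 c : R, 0 < c &
    forall mu : probability (borel M) R, invariant_on T X mu ->
    forall (f : M -> R) (L : R), 0 <= L -> lipschitz_with g X L f ->
      (`| \int[mu]_(x in X) f x - \int[m]_(x in X) f x |%:E
        <= (c * L)%:E * (ks_entropy T m - ks_entropy T mu) `^ (2^-1))%E.
Proof.
have [hyp mix] : metric_hyperbolic A M_compact T X /\ top_mixing T X.
  case: hX => [[rep mix]|[ax -> mix]]; split => //.
    exact: repeller_hyperbolic.
  exact: axiomA_hyperbolic.
have E := hyperbolic_esys M_hausdorff hyp mix.
have [D D0 HD] := lipschitz_osc M_hausdorff M_compact g X.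
have [e1 e10 [C1 C10 HC]] := orbit_sum M_hausdorff g hyp.
have [[invm maxm] _] := hm.
have [h [hE _]] := entropy_finite E invm.
have [t0 t00 [C C0 gap]] := entropy_integral_gap E D0 C10 e10 (conj invm maxm) hE.
(* The constant of [quadratic_sqrt_bound] with [B = h]: the gap is at most the entropy of [m],
   because entropies are nonnegative. *)
exists (1 + C + Num.sqrt h / t0).
  by rewrite ltr_wpDr ?divr_ge0 ?sqrtr_ge0 ?ltr_wpDr // ltW.
move=> mu inv f L L0 lf; have [h' [hE' _]] := entropy_finite E inv.
have hh : h' <= h by rewrite -lee_fin -hE -hE'; exact: maxm.
have h'0 := entropy_ge0 E inv hE'.
have Dl : 0 <= h - h' <= h by rewrite subr_ge0 hh gerBl.
rewrite hE hE' -EFinB poweR_EFin -EFinM lee_fin.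
have -> : (h - h') `^ 2^-1 = Num.sqrt (h - h').
  by rewrite powR12_sqrt //; case/andP: Dl.
apply: quadratic_sqrt_bound => // s sL.
have rf : regular (dist A M_compact) T X D C1 e1 f L.
  split => //.
  - apply: (lipschitz_measurable E) => x e Xx e0; exact: (lipschitz_continuous M_hausdorff M_compact L0 lf).
  - exact: HD.
  - by move=> x y k; exact: HC.
have := gap mu h' _ _ inv hE' (regularZ s rf) sL.
have intf (nu : probability (borel M) R) : \int[nu]_(x in X) (s * f x) = s * \int[nu]_(x in X) f x.
  have [Xe|[x0 Xx0]] : X = set0 \/ exists x, X x.
    by case: (eqVneq X set0) => [|/set0P[x]]; [left|right; exists x].
    by rewrite Xe !Rintegral_set0 mulr0.
  apply: RintegralZl; first exact: (esys_measurable E).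
  apply: (bounded_integrable E nu (rg_meas rf) (b := L * D + `|f x0|)) => x Xx.
  rewrite -{1}[f x](subrK (f x0)); apply: le_trans (ler_normD _ _) _.
  by rewrite lerD2r HD.
rewrite !intf mulrBr => ?; lra.
Qed.
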